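(* Let $m\ge1$ and let $u\in\dot H^{1/2}(\mathbb{R},S^{m-1})$ be a weak $1/2$-harmonic map. Then $u\in H^s_{loc}(\mathbb{R},S^{m-1})$ for every $s\in\mathbb{R}$, and thus $u$ is $C^\infty$.
   Context: $\Delta^{1/4}$ is the Fourier multiplier with symbol $|\xi|^{1/2}$ on $\mathbb{R}$. $\dot H^{1/2}(\mathbb{R},\mathbb{R}^m)$ is the homogeneous Sobolev space with seminorm $\|u\|_{\dot H^{1/2}}=\|\Delta^{1/4}u\|_{L^2}$ (equivalent to $(\int\int|u(x)-u(y)|^2/|x-y|^2\,dx\,dy)^{1/2}$), and $\dot H^{1/2}(\mathbb{R},S^{m-1})=\{u\in\dot H^{1/2}(\mathbb{R},\mathbb{R}^m):u(x)\in S^{m-1}\text{ a.e.}\}$, with $S^{m-1}$ the unit sphere of $\mathbb{R}^m$. $L(u)=\int_{\mathbb{R}}|\Delta^{1/4}u|^2dx$, and $\pi(y)=y/|y|$ is the orthogonal projection onto $S^{m-1}$. A map $u\in\dot H^{1/2}(\mathbb{R},S^{m-1})$ is a weak $1/2$-harmonic map if $\frac{d}{dt}L(\pi(u+t\phi))\big|_{t=0}=0$ for every $\phi\in C_0^\infty(\mathbb{R},\mathbb{R}^m)$. *)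

(* Defs.v *)
From HB Require Import structures.
From mathcomp Require Import all_boot all_order all_algebra.
From mathcomp Require Import all_classical all_reals all_analysis.
From mathcomp Require Import complex.

Set Implicit Arguments.
Unset Strict Implicit.
Unset Printing Implicit Defensive.

Import Order.TTheory GRing.Theory Num.Theory.
Import numFieldNormedType.Exports.

Local Open Scope classical_set_scope.
Local Open Scope complex_scope.
Local Open Scope ring_scope.

Section Smooth.
Context {R : realType}.

Definition smooth (f : R -> R) : Prop :=
  forall (n : nat) (x : R), derivable (derive1n n f) x 1.

Definition test_function (f : R -> R) : Prop :=
  smooth f /\ compact (closure [set x | f x != 0]).

Definition schwartz (f : R -> R) : Prop :=
  smooth f /\
  forall k n : nat, exists M : R, forall x, `|x ^+ k * derive1n n f x| <= M.

End Smooth.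

Section Fourier.
Context {R : realType}.
Notation mu := (@lebesgue_measure R).

Definition cintegral (h : R -> R[i]) : R[i] :=
  (\int[mu]_(x in setT) complex.Re (h x)) +i*
  (\int[mu]_(x in setT) complex.Im (h x)).

Definition expi (t : R) : R[i] := cos t +i* sin t.

Definition fourier (f : R -> R) (xi : R) : R[i] :=
  cintegral (fun x => (f x)%:C * expi (- (x * xi))).

Definition inv_fourier (h : R -> R[i]) (x : R) : R[i] :=
  ((2 * pi)^-1)%:C * cintegral (fun xi => h xi * expi (x * xi)).

(* The symbol is real and even, so the inverse transform is already real. *)
Definition quarter_laplacian_schwartz (phi : R -> R) (x : R) : R :=
  complex.Re (inv_fourier (fun xi => (Num.sqrt `|xi|)%:C * fourier phi xi) x).

(* [g] is the L^2 function representing the tempered distribution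
   Delta^(1/4) f, defined by duality (the multiplier |xi|^(1/2) is symmetric).
   For a Schwartz function phi, Delta^(1/4) phi is only O(|x|^(-3/2)) at
   infinity, because |xi|^(1/2) is not smooth at 0; the weighted integrability
   of [f] makes the pairing converge. It holds for every bounded measurable
   [f], and for every function of bounded mean oscillation. *)
Definition is_quarter_laplacian (f g : R -> R) : Prop :=
  [/\ mu.-integrable setT
        (fun x => (f x * (1 + `|x|) `^ (- (3 / 2)))%:E),
      g \in Lfun mu 2%:E &
      forall phi : R -> R, schwartz phi ->
        \int[mu]_(x in setT) (g x * phi x) =
        \int[mu]_(x in setT) (f x * quarter_laplacian_schwartz phi x)].

(* Meaningful only when Delta^(1/4) f is in L^2; it is then unique up to
   almost everywhere equality. *)
Definition quarter_laplacian (f : R -> R) : R -> R :=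
  get [set g | is_quarter_laplacian f g].

Definition Hs_loc_scalar (s : R) (f : R -> R) : Prop :=
  locally_integrable setT f /\
  forall chi : R -> R, test_function chi ->
    (\int[mu]_(xi in setT)
       ((1 + xi ^+ 2) `^ s * ComplexField.Normc.normc (fourier (chi \* f) xi) ^+ 2)%:E < +oo)%E.

End Fourier.

Section Maps.
Context {R : realType} {m : nat}.
Notation mu := (@lebesgue_measure R).
Implicit Types u v phi : R -> 'rV[R]_m.

(* The library norm on ['rV[R]_m] is the sup norm. *)
Definition enorm (y : 'rV[R]_m) : R := Num.sqrt (\sum_(i < m) y 0 i ^+ 2).

Definition coord u (i : 'I_m) : R -> R := fun x => u x 0 i.

Definition sphere_valued u : Prop := {ae mu, forall x, enorm (u x) = 1}.

Definition Hhalf u : Prop :=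
  forall i, exists g : R -> R, is_quarter_laplacian (coord u i) g.

Definition Hhalf_sphere u : Prop := Hhalf u /\ sphere_valued u.

Definition energy u : R :=
  \int[mu]_(x in setT)
    \sum_(i < m) quarter_laplacian (coord u i) x ^+ 2.

(* The value at the origin is 0. *)
Definition sphere_proj (y : 'rV[R]_m) : 'rV[R]_m := (enorm y)^-1 *: y.

Definition smooth_map u : Prop := forall i, smooth (coord u i).

Definition test_map phi : Prop := forall i, test_function (coord phi i).

(* When u has values in the sphere and |t| sup|phi| < 1, the argument of
   [sphere_proj] stays away from the origin and the composite is again in
   H^(1/2), so that [energy] is meaningful for all t near 0. *)
Definition weak_half_harmonic u : Prop :=
  forall phi, test_map phi ->
    is_derive (0 : R) (1 : R)
      (fun t : R => energy (fun x => sphere_proj (u x + t *: phi x))) 0.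

Definition Hs_loc_sphere (s : R) u : Prop :=
  (forall i, Hs_loc_scalar s (coord u i)) /\ sphere_valued u.

(* Elements of Sobolev spaces are classes modulo almost everywhere equality. *)
Definition ae_smooth u : Prop :=
  exists v, smooth_map v /\ {ae mu, forall x, u x = v x}.

End Maps.

(* Main.v *)
From HB Require Import structures.
From mathcomp Require Import all_boot all_order all_algebra.
From mathcomp Require Import all_classical all_reals all_analysis.
From mathcomp Require Import measurable_realfun complex ring lra zify.
Require Import Defs.

(** Why a weak half-harmonic map into the sphere is smooth.

    The angle [th x = 2 atan x] maps the line to the circle, with
    [|e^(i th x) - e^(i th y)|^2 = th'(x) th'(y) (x - y)^2] (lemma [chord]).
    Hence the Gagliardo energy, the double integral of
    [((f x - f y) / (x - y))^2], is conformally invariant: for bounded [f] it is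
    [4 pi^2] times the sum of [|n| (al f n ^2 + be f n ^2)] over the Fourier
    coefficients of [f] on the circle ([cvg_ecoef]). On Schwartz functions the
    multiplier [|xi|^(1/2)] is a singular integral [halfD]
    ([multiplier_halfD]). The circle harmonics are Laplace-type
    integrals whose index [halfD] raises by one ([CS_expand], [halfD_lapc]), so
    applying [halfD] twice to a harmonic multiplies it by [|n| th']
    ([half_CS]). It follows that a bounded function has a half Laplacian in
    [L^2] exactly when its Gagliardo energy is finite, and that the two energies
    are proportional ([quarter_laplacian_energy], [sqn_quarter_laplacian]).

    The energy can therefore be differentiated in Gagliardo form
    ([energy_expand]). Criticality says that [energy_form (w i) eta] is the
    integral of [w i * eta] against a density that does not depend on [i], first
    for test functions and, by scale-invariant cutoffs and Fejer means, for all
    bounded [eta] of finite energy. As [w i * (w j * h)] is symmetric in [i] and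
    [j], so is [energy_form (w i) (w j * h)] ([harmonic_EL]).

    Let [v i] be the half derivative of [w i] on the circle. Since [|w| = 1],
    [v i = w i * U + sum_j w j * W j i] with [U = sum_j w j * v j] and
    [W i j = w i * v j - v i * w j] ([decomposition]). In frequency, [U] and [W]
    are bilinear in [w] with kernels [sqrt|k| + sqrt|n|] and
    [sqrt|n| - sqrt|k|]. The constraint subtracts [sqrt|k + n|] from the first,
    the equation subtracts [(|n| - |k|) / sqrt|k + n|] from the second, and both
    become at most [2 min (sqrt|k|, sqrt|n|)] ([kernel_U], [kernel_W]). So [U]
    and [W] are dominated by a quadratic form in [v] with the kernel
    [1 / sqrt (max (1, |k|, |n|))] ([U_bound], [W_bound]).

    That form maps [l^2 x l^2] to [l^2] ([sconv_bound]) and, with one factor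
    fixed, is arbitrarily small modulo low frequencies ([sconv_small]). The
    commutator of a polynomial weight with multiplication by [w] is of the same
    kind ([tweight_comm]), and the remaining multiplication by [w] costs nothing
    because [|w| <= 1]. With [T] the weight of degree [K] truncated at height
    [L], this gives [|T v|^2 <= |T v|^2 / 2 + C] with [C] independent of [L]
    ([absorb]), hence rapid decay of all coefficients ([rapid_decay]). The
    Fourier series of [w] then converges to a smooth function of the angle
    ([smooth_representative]); its product with a cutoff is a Schwartz function,
    whose Fourier transform decays rapidly ([Hs_loc_smooth]). *)

Set Implicit Arguments.
Unset Strict Implicit.
Unset Printing Implicit Defensive.

Import Order.TTheory GRing.Theory Num.Theory.
Import numFieldNormedType.Exports.

Local Open Scope classical_set_scope.
Local Open Scope ring_scope.

Ltac meas := repeat first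
  [ assumption
  | exact: measurable_cst | exact: measurable_id
  | exact: measurable_fst | exact: measurable_snd
  | apply: measurable_funD | apply: measurable_funB | apply: measurable_funN
  | apply: measurable_funM | apply: measurable_funX
  | apply: (measurableT_comp (@normr_measurable _ setT))
  | apply: (measurableT_comp (@oppr_measurable _ setT)) ].

Lemma le_of_eq d (T : porderType d) (x y : T) : x = y -> (x <= y)%O.
Proof. by move=> ->. Qed.

Local Notation leb R := (@lebesgue_measure R).
(* The measurable structure of the plane is the product of the one that carries Lebesgue measure. *)
Local Notation plane R := (measurableTypeR R * measurableTypeR R)%type.

(** * Real-valued Lebesgue integration *)
Section RealIntegral.
Context {R : realType} d {T : measurableType d} (mu : {measure set T -> \bar R}).
Implicit Types f g h : T -> R.

(** Real-valued integrals over the whole space keep all estimates in the ordered field [R];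
    [EFin_ii] links them to the extended-real ones. *)
Definition intg f := mu.-integrable setT (EFin \o f).
Definition ii f : R := \int[mu]_(x in setT) f x.

Lemma intg_meas f : intg f -> measurable_fun setT f.
Proof. by move=> /integrableP[/measurable_EFinP]. Qed.

Lemma eq_intg f g : f =1 g -> intg f -> intg g.
Proof. by move=> /funext ->. Qed.

Lemma eq_ii f g : f =1 g -> ii f = ii g.
Proof. by move=> /funext ->. Qed.

Lemma EFin_ii f : intg f -> (ii f)%:E = (\int[mu]_x (f x)%:E)%E.
Proof. by move=> fi; rewrite /ii /Rintegral fineK//; exact: integrable_fin_num. Qed.

Lemma intg_le f g : measurable_fun setT f -> (forall x, `|f x| <= g x) -> intg g -> intg f.
Proof.
move=> mf fg gi; apply: (le_integrable measurableT _ _ gi); first exact/measurable_EFinP.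
by move=> x _ /=; rewrite lee_fin (le_trans (fg x))// ler_norm.
Qed.

Lemma intg0 : intg (fun=> 0).
Proof. exact: integrable0. Qed.

Lemma intgD f g : intg f -> intg g -> intg (fun x => f x + g x).
Proof. by move=> fi gi; have := integrableD measurableT fi gi. Qed.

Lemma intgN f : intg f -> intg (fun x => - f x).
Proof. by move=> fi; have := integrableN fi. Qed.

Lemma intgB f g : intg f -> intg g -> intg (fun x => f x - g x).
Proof. by move=> fi gi; apply: intgD => //; exact: intgN. Qed.

Lemma intgZ k f : intg f -> intg (fun x => k * f x).
Proof. by move=> fi; have := integrableZl measurableT k fi. Qed.

Lemma intgZr k f : intg f -> intg (fun x => f x * k).
Proof. by move=> fi; apply: (@eq_intg (fun x => k * f x)); [move=> x; rewrite mulrC|exact: intgZ]. Qed.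

Lemma intg_norm f : intg f -> intg (fun x => `|f x|).
Proof.
by move=> fi; apply: (@intg_le _ (fun x => `|f x|)) => [|x|]; rewrite ?normr_id//; [
  apply: measurableT_comp => //; exact: intg_meas|exact: (integrable_norm fi)].
Qed.

Lemma intg_sum I (s : seq I) (P : pred I) (F : I -> T -> R) :
  (forall i, P i -> intg (F i)) -> intg (fun x => \sum_(i <- s | P i) F i x).
Proof.
move=> h; elim: s => [|i s ih].
  by apply: eq_intg intg0 => x; rewrite big_nil.
case: (boolP (P i)) => Pi; last by apply: eq_intg ih => x; rewrite big_cons (negbTE Pi).
by apply: eq_intg (intgD (h i Pi) ih) => x; rewrite big_cons Pi.
Qed.

Lemma iiD f g : intg f -> intg g -> ii (fun x => f x + g x) = ii f + ii g.
Proof. by move=> fi gi; rewrite /ii RintegralD. Qed.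

Lemma iiZ k f : intg f -> ii (fun x => k * f x) = k * ii f.
Proof. by move=> fi; rewrite /ii RintegralZl. Qed.

Lemma iiN f : intg f -> ii (fun x => - f x) = - ii f.
Proof. by move=> fi; rewrite -mulN1r -iiZ//; apply: eq_ii => x; rewrite mulN1r. Qed.

Lemma iiZr k f : intg f -> ii (fun x => f x * k) = ii f * k.
Proof. by move=> fi; rewrite mulrC -iiZ//; apply: eq_ii => x; rewrite mulrC. Qed.

Lemma iiB f g : intg f -> intg g -> ii (fun x => f x - g x) = ii f - ii g.
Proof. by move=> fi gi; rewrite iiD//; [rewrite iiN|exact: intgN]. Qed.

Lemma ii0 : ii (fun=> 0) = 0.
Proof. by rewrite /ii /Rintegral integral0. Qed.

Lemma ii_sum I (s : seq I) (P : pred I) (F : I -> T -> R) :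
  (forall i, P i -> intg (F i)) ->
  ii (fun x => \sum_(i <- s | P i) F i x) = \sum_(i <- s | P i) ii (F i).
Proof.
move=> h; elim: s => [|i s ih].
  by rewrite big_nil -[RHS]ii0; apply: eq_ii => x; rewrite big_nil.
rewrite big_cons; case: (boolP (P i)) => Pi; last first.
  by rewrite -ih; apply: eq_ii => x; rewrite big_cons (negbTE Pi).
rewrite -ih -iiD//; [|exact: h|exact: intg_sum].
by apply: eq_ii => x; rewrite big_cons Pi.
Qed.

Lemma le_ii f g : intg f -> intg g -> (forall x, f x <= g x) -> ii f <= ii g.
Proof. by move=> fi gi fg; apply: le_Rintegral. Qed.

Lemma ii_ge0 f : (forall x, 0 <= f x) -> 0 <= ii f.
Proof. by move=> f0; apply: Rintegral_ge0. Qed.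

Lemma ler_norm_ii f : intg f -> `|ii f| <= ii (fun x => `|f x|).
Proof. by move=> fi; apply: le_normr_Rintegral. Qed.

Lemma norm_ii_le f g : measurable_fun setT f -> (forall x, `|f x| <= g x) -> intg g ->
  `|ii f| <= ii g.
Proof.
move=> mf fg gi; have fi := intg_le mf fg gi.
by apply: (le_trans (ler_norm_ii fi)); apply: le_ii => //; exact: intg_norm.
Qed.

Lemma ae_eq_ii f g : measurable_fun setT f -> measurable_fun setT g ->
  {ae mu, forall x, f x = g x} -> ii f = ii g.
Proof.
move=> mf mg fg; rewrite /ii /Rintegral; congr fine.
apply: ae_eq_integral => //; [exact/measurable_EFinP|exact/measurable_EFinP|].
by apply: filterS fg => x -> _.
Qed.

Lemma ae_intg f g : measurable_fun setT g ->
  {ae mu, forall x, f x = g x} -> intg f -> intg g.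
Proof.
move=> mg fg fi; have mf := intg_meas fi; apply/integrableP; split; first exact/measurable_EFinP.
case/integrableP: fi => _; apply: le_lt_trans; apply: le_of_eq.
apply: ae_eq_integral => //.
- by apply: measurableT_comp => //; exact/measurable_EFinP.
- by apply: measurableT_comp => //; exact/measurable_EFinP.
- by apply: filterS fg => x /= -> _.
Qed.

Lemma ii_eq0_ae f : (forall x, 0 <= f x) -> intg f -> ii f = 0 -> {ae mu, forall x, f x = 0}.
Proof.
move=> f0 fi if0; have := EFin_ii fi; rewrite if0 => /esym h.
have mf : measurable_fun setT (EFin \o f) by exact/measurable_EFinP/intg_meas.
have /= := (ae_eq_integral_abs mu measurableT mf).1.
have -> : (\int[mu]_x `|(EFin \o f) x| = 0)%E.
  by apply: etrans h; apply: eq_integral => x _ /=; rewrite ger0_norm.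
by move=> /(_ erefl); apply: filterS => x /(_ I)[].
Qed.

Lemma ii_dct (F : nat -> T -> R) f g :
  (forall n, measurable_fun setT (F n)) -> measurable_fun setT f ->
  {ae mu, forall x, F n x @[n --> \oo] --> f x} ->
  intg g -> (forall n x, `|F n x| <= g x) ->
  intg f /\ (ii (F n) @[n --> \oo] --> ii f).
Proof.
move=> mF mf Ff gi Fg.
have mF' n : measurable_fun setT (EFin \o F n) by exact/measurable_EFinP.
have mf' : measurable_fun setT (EFin \o f) by exact/measurable_EFinP.
have h1 : {ae mu, forall x, setT x -> (fun n => (EFin \o F n) x) @ \oo --> (EFin \o f) x}.
  by apply: filterS Ff => x h _; apply/fine_cvgP; split; [exact: nearW|exact: h].
have h2 : {ae mu, forall x n, setT x -> (`|(EFin \o F n) x| <= (EFin \o g) x)%E}.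
  by apply: aeW => x n _; rewrite /= lee_fin; exact: Fg.
have [fi _ hc] := dominated_convergence measurableT mF' mf' h1 gi h2.
have Fi n : intg (F n) by exact: intg_le (Fg n) gi.
split => //; move: hc; rewrite -EFin_ii// => /fine_cvgP[_]; exact.
Qed.

(** Only a bound on the integrals is available for finite energies, so integrability of the
    limit is part of the conclusion. *)
Lemma intg_fatou (F : nat -> T -> R) f C :
  (forall n, intg (F n)) -> (forall n x, 0 <= F n x) -> measurable_fun setT f ->
  {ae mu, forall x, F n x @[n --> \oo] --> f x} -> (forall x, 0 <= f x) ->
  (forall n, ii (F n) <= C) -> intg f /\ ii f <= C.
Proof.
move=> Fi F0 mf Ff f0 FC.
have mF n : measurable_fun setT (fun x => (F n x)%:E) by exact/measurable_EFinP/intg_meas.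
have e1 : (\int[mu]_x (f x)%:E = \int[mu]_x (limn_einf (fun n => (F n x)%:E)))%E.
  apply: ae_eq_integral => //; first exact/measurable_EFinP.
    rewrite (_ : (fun _ => _) = (fun x => - limn_esup (fun n => - (F n x)%:E))%E).
      apply: (measurableT_comp (@oppe_measurable _ setT)).
      apply: (@measurable_fun_limn_esup _ _ _ setT (fun n x => (- (F n x)%:E)%E)) => n.
      by apply: (measurableT_comp (@oppe_measurable _ setT)).
    by [].
  apply: filterS Ff => x h _; rewrite is_cvg_limn_einfE.
    apply/esym/cvg_lim => //; apply/fine_cvgP; split; [exact: nearW|exact: h].
  by apply/cvg_ex; exists (f x)%:E; apply/fine_cvgP; split; [exact: nearW|exact: h].
have key : (\int[mu]_x (f x)%:E <= C%:E)%E.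
  rewrite e1; apply: le_trans (fatou mu measurableT mF _) _; first by move=> n x _; rewrite lee_fin.
  rewrite limn_einf_lim; apply: lime_le; first exact: is_cvg_einfs.
  apply: nearW => n; apply: ereal_inf_le; exists (\int[mu]_x (F n x)%:E)%E; first by exists n => /=.
  by rewrite -EFin_ii// lee_fin.
have fi : intg f.
  apply/integrableP; split; first exact/measurable_EFinP.
  apply: le_lt_trans (ltry C); apply: le_trans key; apply: le_of_eq.
  by apply: eq_integral => x _ /=; rewrite ger0_norm.
by split => //; rewrite -lee_fin EFin_ii.
Qed.

Lemma intg_monotone (F : nat -> T -> R) f C :
  (forall n, intg (F n)) -> (forall n x, 0 <= F n x) ->
  (forall x n m, (n <= m)%N -> F n x <= F m x) ->
  (forall x, F n x @[n --> \oo] --> f x) -> (forall n, ii (F n) <= C) ->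
  intg f /\ (ii (F n) @[n --> \oo] --> ii f).
Proof.
move=> Fi F0 Fnd Ff FC.
have mf : measurable_fun setT f.
  apply: (@measurable_fun_cvg _ _ _ setT F) => [n|x _]; [exact: intg_meas|exact: Ff].
have Fle n x : F n x <= f x.
  rewrite -(cvg_lim _ (Ff x))//; apply: nondecreasing_cvgn_le.
    by move=> a b ab; apply: Fnd.
  by apply/cvg_ex; exists (f x); exact: Ff.
have [fi _] : intg f /\ ii f <= C.
  apply: (@intg_fatou F) => //; first exact: aeW.
  by move=> x; apply: le_trans (F0 0%N x) (Fle 0%N x).
split => //.
have [] // := @ii_dct F f f; first by move=> n; exact: intg_meas.
- exact: aeW.
- by move=> n x; rewrite ger0_norm.
Qed.

End RealIntegral.

(** * Square-integrable functions *)
Section L2theory.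
Context {R : realType} d {T : measurableType d} (mu : {measure set T -> \bar R}).
Implicit Types f g h : T -> R.
Local Notation intg := (intg mu).
Local Notation ii := (ii mu).

Definition L2 f := measurable_fun setT f /\ intg (fun x => f x ^+ 2).
Definition ip f g : R := ii (fun x => f x * g x).
Definition sqn f : R := ii (fun x => f x ^+ 2).

Lemma eq_L2 f g : f =1 g -> L2 f -> L2 g.
Proof. by move=> /funext ->. Qed.

Lemma eq_sqn f g : f =1 g -> sqn f = sqn g.
Proof. by move=> /funext ->. Qed.

Lemma eq_ip f g f' g' : f =1 f' -> g =1 g' -> ip f g = ip f' g'.
Proof. by move=> /funext -> /funext ->. Qed.

Lemma L2_le f g C : measurable_fun setT f -> (forall x, `|f x| <= C * `|g x|) -> L2 g -> L2 f.
Proof.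
move=> mf fg [mg gi]; split => //.
apply: (@intg_le _ _ _ _ _ (fun x => C ^+ 2 * g x ^+ 2)); [by meas| |exact: intgZ].
move=> x; rewrite ger0_norm ?sqr_ge0// -exprMn -(real_normK (num_real (f x))).
by rewrite -(real_normK (num_real (C * _))) lerXn2r ?nnegrE// normrM (le_trans (fg x))// ler_wpM2r// ler_norm.
Qed.

Lemma L2_intgM f g : L2 f -> L2 g -> intg (fun x => f x * g x).
Proof.
move=> [mf fi] [mg gi]; apply: (intg_le _ _ (intgD fi gi)); first by meas.
by move=> x; rewrite ler_norml; have := sqr_ge0 (f x + g x); have := sqr_ge0 (f x - g x); nra.
Qed.

Lemma L2_0 : L2 (fun=> 0).
Proof. by split; [meas|apply: eq_intg (intg0 mu) => x; rewrite expr0n]. Qed.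

Lemma L2Z k f : L2 f -> L2 (fun x => k * f x).
Proof. by move=> Lf; apply: (@L2_le _ f `|k|) => // [|x]; [case: Lf => *; meas|rewrite normrM]. Qed.

Lemma L2D f g : L2 f -> L2 g -> L2 (fun x => f x + g x).
Proof.
move=> Lf Lg; have [mf fi] := Lf; have [mg gi] := Lg; split; first by meas.
have := intgD (intgD fi gi) (intgZ 2 (L2_intgM Lf Lg)).
by apply: eq_intg => x; ring.
Qed.

Lemma L2N f : L2 f -> L2 (fun x => - f x).
Proof. by move=> /(L2Z (-1)); apply: eq_L2 => x; rewrite mulN1r. Qed.

Lemma L2B f g : L2 f -> L2 g -> L2 (fun x => f x - g x).
Proof. by move=> Lf Lg; apply: L2D => //; exact: L2N. Qed.

Lemma L2_sum I (s : seq I) (P : pred I) (F : I -> T -> R) :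
  (forall i, P i -> L2 (F i)) -> L2 (fun x => \sum_(i <- s | P i) F i x).
Proof.
move=> h; elim: s => [|i s ih].
  by apply: eq_L2 L2_0 => x; rewrite big_nil.
case: (boolP (P i)) => Pi; last by apply: eq_L2 ih => x; rewrite big_cons (negbTE Pi).
by apply: eq_L2 (L2D (h i Pi) ih) => x; rewrite big_cons Pi.
Qed.

Lemma L2_bddM (b : T -> R) f C : measurable_fun setT b -> (forall x, `|b x| <= C) -> L2 f ->
  L2 (fun x => b x * f x).
Proof.
move=> mb bC Lf; apply: (@L2_le _ f C) => //; first by case: Lf => *; meas.
by move=> x; rewrite normrM ler_wpM2r.
Qed.

Lemma sqn_ge0 f : 0 <= sqn f.
Proof. by apply: ii_ge0 => x; exact: sqr_ge0. Qed.

Lemma ipC f g : ip f g = ip g f.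
Proof. by apply: eq_ii => x; rewrite mulrC. Qed.

Lemma ipff f : ip f f = sqn f.
Proof. by apply: eq_ii => x; rewrite expr2. Qed.

Lemma ipBl f g h : L2 f -> L2 g -> L2 h -> ip (fun x => f x - g x) h = ip f h - ip g h.
Proof.
move=> Lf Lg Lh; rewrite /ip -iiB; [|exact: L2_intgM|exact: L2_intgM].
by apply: eq_ii => x; rewrite mulrBl.
Qed.

Lemma ipBr f g h : L2 f -> L2 g -> L2 h -> ip h (fun x => f x - g x) = ip h f - ip h g.
Proof. by move=> *; rewrite ipC ipBl// ipC [ip g _]ipC. Qed.

Lemma ipZl k f g : L2 f -> L2 g -> ip (fun x => k * f x) g = k * ip f g.
Proof.
move=> Lf Lg; rewrite /ip -iiZ; last exact: L2_intgM.
by apply: eq_ii => x; rewrite mulrA.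
Qed.

Lemma sqnD f g : L2 f -> L2 g -> sqn (fun x => f x + g x) = sqn f + 2 * ip f g + sqn g.
Proof.
move=> Lf Lg; have [_ fi] := Lf; have [_ gi] := Lg; have fg := L2_intgM Lf Lg.
rewrite /sqn /ip -iiZ// -!iiD//; [|exact: intgD (intgZ _ _)|exact: intgZ].
by apply: eq_ii => x; ring.
Qed.

Lemma sqnZ k f : L2 f -> sqn (fun x => k * f x) = k ^+ 2 * sqn f.
Proof. by move=> [_ fi]; rewrite /sqn -iiZ//; apply: eq_ii => x; rewrite exprMn. Qed.

Lemma sqnN f : sqn (fun x => - f x) = sqn f.
Proof. by apply: eq_ii => x; rewrite sqrrN. Qed.

Lemma sqnB f g : L2 f -> L2 g -> sqn (fun x => f x - g x) = sqn f - 2 * ip f g + sqn g.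
Proof.
move=> Lf Lg; rewrite sqnD ?sqnN//; last exact: L2N.
have -> : ip f (fun x => - g x) = - ip f g.
  by rewrite /ip -iiN; [apply: eq_ii => x; rewrite mulrN|exact: L2_intgM].
by rewrite mulrN.
Qed.

Lemma sqnD_le f g : L2 f -> L2 g -> sqn (fun x => f x + g x) <= 2 * sqn f + 2 * sqn g.
Proof.
move=> Lf Lg; rewrite sqnD//; have := sqn_ge0 (fun x => f x - g x); rewrite sqnB//; lra.
Qed.

Lemma sqn_le f g C : L2 f -> L2 g -> (forall x, `|f x| <= C * `|g x|) -> sqn f <= C ^+ 2 * sqn g.
Proof.
move=> [mf fi] [mg gi] fg; rewrite /sqn -iiZ//; apply: le_ii => //; first exact: intgZ.
move=> x; rewrite -exprMn -(real_normK (num_real (f x))).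
by rewrite -(real_normK (num_real (C * _))) lerXn2r ?nnegrE// normrM (le_trans (fg x))// ler_wpM2r// ler_norm.
Qed.

Lemma ip_CS f g : L2 f -> L2 g -> ip f g ^+ 2 <= sqn f * sqn g.
Proof.
move=> Lf Lg.
have key t : 0 <= sqn f - 2 * (t * ip f g) + t ^+ 2 * sqn g.
  have -> : t * ip f g = ip f (fun x => t * g x) by rewrite [RHS]ipC ipZl// ipC.
  by rewrite -sqnZ// -sqnB//; [exact: sqn_ge0|exact: L2Z].
have [g0|g0] := eqVneq (sqn g) 0; last first.
  have gp : 0 < sqn g by rewrite lt_def g0 sqn_ge0.
  have := key (ip f g / sqn g); rewrite -(ler_pM2r gp) mul0r.
  have -> : (sqn f - 2 * (ip f g / sqn g * ip f g) + (ip f g / sqn g) ^+ 2 * sqn g) * sqn g =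
    sqn f * sqn g - ip f g ^+ 2 by field.
  by rewrite subr_ge0.
rewrite g0 mulr0; have [->|c0] := eqVneq (ip f g) 0; first by rewrite expr0n.
have := key ((sqn f + 1) / (2 * ip f g)); rewrite g0 mulr0 addr0.
have -> : 2 * ((sqn f + 1) / (2 * ip f g) * ip f g) = sqn f + 1 by field.
lra.
Qed.

Lemma ip_le f g : L2 f -> L2 g -> `|ip f g| <= Num.sqrt (sqn f) * Num.sqrt (sqn g).
Proof.
by move=> Lf Lg; rewrite -sqrtrM ?sqn_ge0// -sqrtr_sqr ler_wsqrtr// ip_CS.
Qed.

Lemma ae_eq_sqn0 f g : L2 f -> L2 g -> sqn (fun x => f x - g x) = 0 -> {ae mu, forall x, f x = g x}.
Proof.
move=> Lf Lg h; have [_ i] := L2B Lf Lg.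
have := ii_eq0_ae (fun x => sqr_ge0 (f x - g x)) i h.
by apply: filterS => x /eqP; rewrite sqrf_eq0 subr_eq0 => /eqP.
Qed.

(** [|d| <= 2^-k + 2^k d^2], and the first terms sum to at most 2. *)
Lemma cvg_of_sqr_sums (a : nat -> R) (S : R) :
  (forall n, \sum_(0 <= k < n) 2 ^+ k * (a k.+1 - a k) ^+ 2 <= S) -> cvgn a.
Proof.
move=> h.
have -> : a = (fun n => a 0%N + series (fun k => a k.+1 - a k) n).
  apply/funext => n; rewrite seriesEnat /= telescope_sumr//; ring.
apply: is_cvgD; first exact: is_cvg_cst.
apply: normed_cvg.
apply: nondecreasing_is_cvgn; first by apply: nondecreasing_series => n _ _ /=.
exists (2 + S) => _ [n _ <-].
change (\sum_(0 <= k < n) `|a k.+1 - a k| <= 2 + S).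
apply: (@le_trans _ _ (\sum_(0 <= k < n) (2^-1 ^+ k + 2 ^+ k * (a k.+1 - a k) ^+ 2))).
  apply: ler_sum => k _; set t := a k.+1 - a k.
  have p : 0 < 2 ^+ k :> R by exact: exprn_gt0.
  rewrite exprVn -(ler_pM2l p) mulrDr mulfV ?gt_eqF// mulrA -expr2 -exprMn.
  rewrite -[2 ^+ k * `|t|]ger0_norm ?mulr_ge0 ?(ltW p)// normrM normr_id -normrM.
  set z := 2 ^+ k * t; rewrite -(real_normK (num_real z)); have := sqr_ge0 (`|z| - 1); have := normr_ge0 z; nra.
rewrite big_split /= lerD//.
have -> : \sum_(0 <= i < n) 2^-1 ^+ i = 2 * (1 - 2^-1 ^+ n) :> R.
  elim: n => [|n ih]; first by rewrite big_nil expr0 subrr mulr0.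
  by rewrite big_nat_recr//= ih exprS; field.
have : 0 <= 2^-1 ^+ n :> R by rewrite exprn_ge0.
lra.
Qed.

(** Riesz's proof: a subsequence with squared increments at most [8^-k] converges almost
    everywhere, and Fatou's lemma identifies the [L^2] limit. *)
Lemma L2_complete (F : nat -> T -> R) : (forall n, L2 (F n)) ->
  (forall e, 0 < e -> exists N : nat, forall m n, (N <= m)%N -> (N <= n)%N ->
     sqn (fun x => F m x - F n x) <= e) ->
  exists f, [/\ L2 f, sqn (fun x => F n x - f x) @[n --> \oo] --> 0 &
   exists s : nat -> nat, (forall k, (k <= s k)%N) /\
     {ae mu, forall x, F (s k) x @[k --> \oo] --> f x}].
Proof.
move=> LF Cau.
have c8 k : 0 < (8 ^+ k)^-1 :> R by rewrite invr_gt0 exprn_gt0.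
pose N k := sval (cid (Cau _ (c8 k))).
have NP k m n : (N k <= m)%N -> (N k <= n)%N -> sqn (fun x => F m x - F n x) <= (8 ^+ k)^-1.
  by rewrite /N; case: cid => /= M hM; exact: hM.
pose s k := (\max_(i < k.+1) N i + k)%N.
have sN k n : (k <= n)%N -> (N k <= s n)%N.
  move=> kn; rewrite /s; apply: leq_trans (leq_addr _ _).
  have kn' : (k < n.+1)%N by [].
  exact: (leq_bigmax (Ordinal kn')).
have sk k : (k <= s k)%N by rewrite leq_addl.
pose D k x := (2 ^+ k * (F (s k.+1) x - F (s k) x) ^+ 2)%:E : \bar R.
have LD k : L2 (fun x => F (s k.+1) x - F (s k) x) by exact: L2B.
have D0 k x : (0 <= D k x)%E by rewrite /D lee_fin; apply: mulr_ge0; [exact: exprn_ge0|exact: sqr_ge0].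
have mD k : measurable_fun setT (D k).
  by apply/measurable_EFinP; case: (LF (s k)) => ? _; case: (LF (s k.+1)) => ? _; meas.
have iD k : (\int[mu]_x D k x <= ((4 ^+ k)^-1)%:E)%E.
  rewrite /D -EFin_ii; last by apply: intgZ; case: (LD k).
  rewrite lee_fin iiZ; last by case: (LD k).
  have /(ler_wpM2l (exprn_ge0 k (ler0n R 2))) := NP k _ _ (sN k k.+1 (leqnSn k)) (sN k k (leqnn k)).
  move=> /le_trans; apply; apply: le_of_eq.
  by rewrite (_ : 8 = 2 * 4 :> R) ?exprMn ?invfM ?mulrA ?mulfV ?mul1r ?expf_neq0//; lra.
have geo n : \sum_(0 <= k < n) (4 ^+ k)^-1 <= 2 :> R.
  have -> : \sum_(0 <= k < n) (4 ^+ k)^-1 = 4 / 3 * (1 - (4 ^+ n)^-1) :> R.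
    elim: n => [|n ih]; first by rewrite big_nil expr0 invr1 subrr mulr0.
    rewrite big_nat_recr//= ih exprS invfM; field.
    by rewrite expf_neq0.
  have : 0 < (4 ^+ n)^-1 :> R by rewrite invr_gt0 exprn_gt0.
  lra.
(* The series of the squared increments, weighted by [2^k], has a finite integral. *)
have aeS : {ae mu, forall x, exists S : R, forall n, \sum_(0 <= k < n) 2 ^+ k * (F (s k.+1) x - F (s k) x) ^+ 2 <= S}.
  pose SS x := (\sum_(k <oo) D k x)%E.
  have mSS : measurable_fun setT SS.
    by apply: (@ge0_emeasurable_sum _ _ _ setT D xpredT) => [k x _ _|k _]; [exact: D0|exact: mD].
  have iSS : mu.-integrable setT SS.
    apply/integrableP; split => //.
    rewrite (eq_integral SS); last by move=> x _; rewrite gee0_abs// nneseries_ge0.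
    rewrite integral_nneseries//.
    apply: (@le_lt_trans _ _ 2%:E); last exact: ltry.
    apply: lime_le; first by apply: is_cvg_nneseries => k _ _; apply: integral_ge0.
    apply: nearW => n; apply: (@le_trans _ _ (\sum_(0 <= k < n) (4 ^+ k)^-1)%:E); last by rewrite lee_fin.
    by rewrite -sumEFin; apply: lee_sum => k _; exact: iD.
  have := integrable_ae measurableT iSS; apply: filterS => x /(_ I) fx.
  exists (fine (SS x)) => n; rewrite -lee_fin fineK// -sumEFin.
  by apply: nneseries_lim_ge => k _ _; exact: D0.
pose f x := fine (limn_esup (fun k => (F (s k) x)%:E)).
have mf : measurable_fun setT f.
  apply: (measurableT_comp (@fine_measurable _ setT measurableT)).
  apply: (@measurable_fun_limn_esup _ _ _ setT (fun k x => (F (s k) x)%:E)) => k.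
  by apply/measurable_EFinP; case: (LF (s k)).
have aef : {ae mu, forall x, F (s k) x @[k --> \oo] --> f x}.
  apply: filterS aeS => x [S hS].
  have /cvg_ex[/= l hl] := @cvg_of_sqr_sums (fun k => F (s k) x) S hS.
  suff -> : f x = l by [].
  rewrite /f is_cvg_limn_esupE; last first.
    by apply/cvg_ex; exists l%:E; apply/fine_cvgP; split; [exact: nearW|exact: hl].
  rewrite (_ : limn _ = l%:E)//; apply/cvg_lim => //.
  by apply/fine_cvgP; split; [exact: nearW|exact: hl].
(* Fatou's lemma along the subsequence bounds the distance to the limit. *)
have fat n e : (exists K : nat, forall k, (K <= k)%N -> sqn (fun x => F n x - F (s k) x) <= e) ->
    intg (fun x => (F n x - f x) ^+ 2) /\ sqn (fun x => F n x - f x) <= e.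
  move=> [K hK].
  apply: (@intg_fatou _ _ _ mu (fun k x => (F n x - F (s (k + K)%N) x) ^+ 2)).
  - by move=> k; case: (L2B (LF n) (LF (s (k + K)%N))).
  - by move=> k x; exact: sqr_ge0.
  - by case: (LF n) => ? _; meas.
  - apply: filterS aef => x hx.
    have hx' : F (s (k + K)%N) x @[k --> \oo] --> f x by move: hx; rewrite -(cvg_shiftn K).
    by rewrite expr2; apply: cvgM; (apply: cvgB; [exact: cvg_cst|exact: hx']).
  - by move=> x; exact: sqr_ge0.
  - by move=> k; apply: hK; rewrite leq_addl.
have fin e : 0 < e -> exists N : nat, forall n, (N <= n)%N ->
    intg (fun x => (F n x - f x) ^+ 2) /\ sqn (fun x => F n x - f x) <= e.
  move=> e0; have [M hM] := Cau e e0; exists M => n Mn; apply: fat; exists M => k Mk.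
  by apply: hM => //; apply: leq_trans Mk _.
exists f; split.
- have [M /(_ M (leqnn M))[iM _]] := fin 1 ltr01.
  have LM : L2 (fun x => F M x - f x) by split => //; case: (LF M) => ? _; meas.
  by apply: eq_L2 (L2B (LF M) LM) => x; ring.
- apply/cvgrPdist_le => e e0; have [M hM] := fin e e0; exists M => // n /= Mn.
  by rewrite sub0r normrN ger0_norm ?sqn_ge0//; case: (hM n Mn).
- by exists s.
Qed.

Lemma L2_complete_cvg (F : nat -> T -> R) (Z : nat -> R) : (forall n, L2 (F n)) -> cvgn Z ->
  (forall M N, (N <= M)%N -> sqn (fun x => F M x - F N x) = Z M - Z N) ->
  exists2 f, L2 f & sqn (fun x => F n x - f x) @[n --> \oo] --> 0.
Proof.
move=> LF cZ nB; have [e e0|f [Lf hf _]] := L2_complete LF; last by exists f.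
have /cvgrPdist_lt/(_ _ (divr_gt0 e0 (ltr0n R 2)))[N _ hN] := cZ; exists N => M L NM NL.
wlog LM : M L NM NL / (L <= M)%N.
  move=> h; have [LM|/ltnW ML] := leqP L M; first exact: h.
  by rewrite -sqnN; have := h L M NL NM ML; congr (_ <= _); apply: eq_sqn => x; rewrite opprB.
by rewrite nB//; have /= := hN M NM; have /= := hN L NL; rewrite !ltr_norml => /andP[? ?] /andP[? ?]; lra.
Qed.

Lemma L2_ae_subseq (F : nat -> T -> R) f : (forall n, L2 (F n)) -> L2 f ->
  sqn (fun x => F n x - f x) @[n --> \oo] --> 0 ->
  exists s : nat -> nat, (forall k, (k <= s k)%N) /\
     {ae mu, forall x, F (s k) x @[k --> \oo] --> f x}.
Proof.
move=> LF Lf Ff.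
have small e : 0 < e -> exists N : nat, forall n, (N <= n)%N -> sqn (fun x => F n x - f x) <= e.
  move=> e0; move/cvgrPdist_le : Ff => /(_ e e0)[N _ hN]; exists N => n Nn.
  by have := hN n Nn; rewrite sub0r normrN ger0_norm ?sqn_ge0.
have Cau e : 0 < e -> exists N : nat, forall m n, (N <= m)%N -> (N <= n)%N ->
     sqn (fun x => F m x - F n x) <= e.
  move=> e0; have [N hN] := small (e / 4) (divr_gt0 e0 (ltr0n R 4)).
  exists N => m n mN nN.
  have -> : sqn (fun x => F m x - F n x) = sqn (fun x => (F m x - f x) + - (F n x - f x)).
    by apply: eq_sqn => x; ring.
  apply: le_trans (sqnD_le (L2B (LF m) Lf) (L2N (L2B (LF n) Lf))) _.
  by rewrite sqnN; have := hN m mN; have := hN n nN; lra.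
have [g [Lg Fg [s [sk sg]]]] := L2_complete LF Cau.
exists s; split => //.
have : {ae mu, forall x, f x = g x}.
  apply: ae_eq_sqn0 => //; apply/eqP; rewrite eq_le sqn_ge0 andbT.
  apply/ler_addgt0Pl => e e0; rewrite addr0.
  have [N hN] := small (e / 4) (divr_gt0 e0 (ltr0n R 4)).
  move/cvgrPdist_le : Fg => /(_ _ (divr_gt0 e0 (ltr0n R 4)))[M _ hM].
  have := hM (maxn N M) (leq_maxr _ _); rewrite sub0r normrN ger0_norm ?sqn_ge0// => h1.
  have h2 := hN (maxn N M) (leq_maxl _ _).
  have -> : sqn (fun x => f x - g x) = sqn (fun x => (F (maxn N M) x - g x) + - (F (maxn N M) x - f x)).
    by apply: eq_sqn => x; ring.
  apply: le_trans (sqnD_le (L2B (LF _) Lg) (L2N (L2B (LF _) Lf))) _.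
  by rewrite sqnN; lra.
by move=> fg; apply: filterS2 fg sg => x ->.
Qed.

End L2theory.

(** * Fubini's theorem for real-valued integrals *)
Section FubiniReal.
Context {R : realType} d1 d2 (T1 : measurableType d1) (T2 : measurableType d2).
Context (m1 : {sigma_finite_measure set T1 -> \bar R}).
Context (m2 : {sigma_finite_measure set T2 -> \bar R}).
Implicit Types f : T1 * T2 -> R.

Lemma measurable_ii2 f : measurable_fun setT f -> intg (m1 \x m2)%E f ->
  measurable_fun setT (fun x => ii m2 (fun y => f (x, y))).
Proof.
move=> mf fi; apply: (measurableT_comp (@fine_measurable _ setT measurableT)).
exact: (measurable_fubini_F fi).
Qed.

Lemma measurable_ii1 f : measurable_fun setT f -> intg (m1 \x m2)%E f ->
  measurable_fun setT (fun y => ii m1 (fun x => f (x, y))).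
Proof.
move=> mf fi; apply: (measurableT_comp (@fine_measurable _ setT measurableT)).
exact: (measurable_fubini_G fi).
Qed.

Lemma fubini12 f : intg (m1 \x m2)%E f ->
  intg m1 (fun x => ii m2 (fun y => f (x, y))) /\
  ii (m1 \x m2)%E f = ii m1 (fun x => ii m2 (fun y => f (x, y))).
Proof.
move=> fi; have mf := intg_meas fi.
have ae : {ae m1, forall x, setT x -> fubini_F m2 (EFin \o f) x = (ii m2 (fun y => f (x, y)))%:E}.
  apply: filterS (ae_integrable1 fi) => x h _.
  by rewrite EFin_ii.
have mF := measurable_fubini_F fi.
have mI : measurable_fun setT (fun x => (ii m2 (fun y => f (x, y)))%:E).
  by apply/measurable_EFinP; exact: measurable_ii2.
have e : (\int[m1]_x fubini_F m2 (EFin \o f) x = \int[m1]_x (ii m2 (fun y => f (x, y)))%:E)%E.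
  exact: ae_eq_integral.
split; last by rewrite /ii {1}/Rintegral -(integral12_prod_meas1 fi) e.
have iF := integrable_fubini_F fi.
apply/integrableP; split => //; case/integrableP: iF => _; apply: le_lt_trans.
apply: le_of_eq; apply: ae_eq_integral => //.
- by apply: measurableT_comp.
- by apply: measurableT_comp.
- by apply: filterS ae => x h /h ->.
Qed.

Lemma fubini21 f : intg (m1 \x m2)%E f ->
  intg m2 (fun y => ii m1 (fun x => f (x, y))) /\
  ii (m1 \x m2)%E f = ii m2 (fun y => ii m1 (fun x => f (x, y))).
Proof.
move=> fi; have mf := intg_meas fi.
have ae : {ae m2, forall y, setT y -> fubini_G m1 (EFin \o f) y = (ii m1 (fun x => f (x, y)))%:E}.
  apply: filterS (ae_integrable2 fi) => x h _.
  by rewrite EFin_ii.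
have mF := measurable_fubini_G fi.
have mI : measurable_fun setT (fun y => (ii m1 (fun x => f (x, y)))%:E).
  by apply/measurable_EFinP; exact: measurable_ii1.
have e : (\int[m2]_y fubini_G m1 (EFin \o f) y = \int[m2]_y (ii m1 (fun x => f (x, y)))%:E)%E.
  exact: ae_eq_integral.
split; last by rewrite /ii {1}/Rintegral -(integral21_prod_meas1 fi) e.
apply/integrableP; split => //.
have hlt := (@integrable21ltyP _ _ _ _ R m1 m2 (EFin \o f) (measurable_int _ fi)).1 fi.
apply: (@le_lt_trans _ _ (\int[m2]_y \int[m1]_x `|(EFin \o f) (x, y)|)%E) => //.
have mabs : measurable_fun setT (fun z => `|f z|%:E).
  by apply/measurable_EFinP; meas.
apply: (@ae_ge0_le_integral _ _ _ m2 setT measurableT) => //.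
- by apply: measurableT_comp.
- by move=> y _; apply: integral_ge0.
- by apply: (measurable_fun_fubini_tonelli_G (fun z => `|f z|%:E)).
- apply: filterS2 ae (ae_integrable2 fi) => y h hi _.
  change (`|(ii m1 (fun x => f (x, y)))%:E| <= \int[m1]_x `|(EFin \o f) (x, y)|)%E; rewrite -(h I).
  exact: (le_trans (le_abse_integral _ _ (measurable_int _ hi))).
Qed.

Lemma tonelli12 f (g : T1 -> R) : measurable_fun setT f ->
  (forall x, intg m2 (fun y => f (x, y))) ->
  (forall x, ii m2 (fun y => `|f (x, y)|) <= g x) -> intg m1 g ->
  intg (m1 \x m2)%E f.
Proof.
move=> mf f2 fg gi; apply/integrable12ltyP; first exact/measurable_EFinP.
have mabs : measurable_fun setT (fun z => `|f z|%:E).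
  by apply/measurable_EFinP; meas.
apply: (@le_lt_trans _ _ (\int[m1]_x (g x)%:E)%E).
  apply: ge0_le_integral => //.
  - by move=> x _; apply: integral_ge0.
  - by apply: (measurable_fun_fubini_tonelli_F (fun z => `|f z|%:E)).
  - by apply/measurable_EFinP; exact: intg_meas gi.
  - move=> x _; rewrite -EFin_ii; last exact: intg_norm.
    by rewrite lee_fin.
by rewrite -EFin_ii// ltry.
Qed.

Lemma fubini_swap f : intg (m1 \x m2)%E f ->
  ii m1 (fun x => ii m2 (fun y => f (x, y))) = ii m2 (fun y => ii m1 (fun x => f (x, y))).
Proof. by move=> fi; rewrite -(fubini12 fi).2 (fubini21 fi).2. Qed.

Lemma intg_prodM (a : T1 -> R) (b : T2 -> R) : intg m1 a -> intg m2 b ->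
  intg (m1 \x m2)%E (fun z => a z.1 * b z.2).
Proof.
move=> ai bi; have ma := intg_meas ai; have mb := intg_meas bi.
apply: (@tonelli12 _ (fun x => `|a x| * ii m2 (fun y => `|b y|))).
- by apply: measurable_funM; [exact: (measurableT_comp ma)|exact: (measurableT_comp mb)].
- by move=> x /=; exact: intgZ.
- move=> x /=; rewrite -iiZ; last exact: intg_norm.
  apply: le_of_eq.
  by apply: eq_ii => y; rewrite normrM.
- by apply: intgZr; exact: intg_norm.
Qed.

End FubiniReal.

(** * Fundamental theorem of calculus on the line *)
Section Line.
Context {R : realType}.
Notation mu := (leb R).
Implicit Types f g F : R -> R.

Lemma cont_meas f : continuous f -> measurable_fun setT f.
Proof. exact: continuous_measurable_fun. Qed.

Lemma cst_cont (c : R) : continuous (fun _ : R => c).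
Proof. by move=> x; exact: cvg_cst. Qed.

Lemma derivable_cont f : (forall x : R, derivable f x (1 : R)) -> continuous f.
Proof. by move=> h x; apply: differentiable_continuous; exact/derivable1_diffP. Qed.

Lemma is_derive_cont f g : (forall x : R, is_derive x (1 : R) f (g x)) -> continuous f.
Proof. by move=> h; apply: derivable_cont => x; apply: ex_derive. Qed.

Lemma ii_indic_itv f (a b : R) : continuous f -> a <= b ->
  intg mu (fun x => f x * ((a <= x <= b)%R)%:R).
Proof.
move=> cf ab.
have : mu.-integrable `[a, b] (EFin \o f).
  apply: continuous_compact_integrable; first exact: segment_compact.
  exact: continuous_subspaceT.
have [h _] := @integrable_mkcond _ _ R mu [set` `[a, b]] (EFin \o f) (measurable_itv _).
move/h.
apply: eq_integrable => // x _; rewrite /= patchE/=.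
rewrite mem_setE in_itv /=; by case: (_ && _); rewrite ?mulr1 ?mulr0.
Qed.

Lemma ii_itv f F (a b : R) : (a < b) -> continuous f -> (forall x : R, is_derive x (1 : R) F (f x)) ->
  ii mu (fun x => f x * ((a <= x <= b)%R)%:R) = F b - F a.
Proof.
move=> ab cf dF.
have cF := is_derive_cont dF.
have h : (\int[mu]_(x in `[a, b]) (f x)%:E = (F b)%:E - (F a)%:E)%E.
  apply: continuous_FTC2 => //.
  - exact: continuous_subspaceT.
  - split.
    + by move=> x _; apply: ex_derive.
    + by apply: cvg_at_right_filter; exact: cF.
    + by apply: cvg_at_left_filter; exact: cF.
  - by move=> x _; rewrite derive1E; apply: derive_val.
rewrite /ii -[RHS]/(fine ((F b)%:E - (F a)%:E)%E) -h /Rintegral; congr fine.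
rewrite [RHS]integral_mkcond; apply: eq_integral => x _.
rewrite patchE mem_setE in_itv /=; by case: (_ && _); rewrite ?mulr1 ?mulr0.
Qed.

Lemma cvg_itv_indic (x : R) : ((- n%:R <= x <= n%:R)%R)%:R @[n --> \oo] --> (1 : R).
Proof.
have [N hN] : exists N : nat, `|x| < N%:R by exists (Num.bound `|x|); exact: archi_boundP.
apply: cvg_near_cst; exists N => // n /= Nn.
have : `|x| <= n%:R by rewrite (le_trans (ltW hN))// ler_nat.
by rewrite ler_norml => ->.
Qed.

(** Exhaust the line by [[-n, n]] and pass to the limit by dominated convergence. *)
Lemma ii_deriv f F (a b : R) : continuous f -> (forall x : R, is_derive x (1 : R) F (f x)) ->
  intg mu f -> F x @[x --> -oo] --> a -> F x @[x --> +oo] --> b -> ii mu f = b - a.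
Proof.
move=> cf dF fi Fa Fb.
have [||||| _ h] := @ii_dct _ _ _ mu (fun n x => f x * ((- n%:R <= x <= n%:R)%R)%:R) f (fun x => `|f x|).
- by move=> n; apply: intg_meas; apply: ii_indic_itv => //; rewrite -subr_ge0 opprK addr_ge0.
- exact: cont_meas.
- apply: aeW => x; rewrite -[X in _ --> X]mulr1; apply: cvgM; first exact: cvg_cst.
  exact: cvg_itv_indic.
- exact: intg_norm.
- by move=> n x; rewrite normrM; case: (_ <= _ <= _); rewrite ?normr1 ?mulr1// normr0 mulr0.
apply: (cvg_unique _ h) => //.
have hb : F n%:R @[n --> \oo] --> b by exact: (cvg_comp _ _ (@cvgr_idn R) Fb).
have ha : F (- n%:R) @[n --> \oo] --> a.
  apply: (@cvg_comp _ _ _ (fun n : nat => - (n%:R : R)) F _ _ _ _ Fa); apply/cvgNrNy; exact: cvgr_idn.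
rewrite /=; apply: (@cvg_trans _ ((fun n : nat => F n%:R - F (- n%:R)) @ \oo)); last exact: cvgB.
apply: near_eq_cvg; exists 1%N => // n /= n0.
by rewrite (ii_itv _ cf dF)// -subr_gt0 opprK -natrD ltr0n addn_gt0 n0.
Qed.

(** A nonnegative function with a bounded primitive: a criterion that spares comparison
    integrals at infinity. *)
Lemma intg_deriv f F C : continuous f -> (forall x, 0 <= f x) ->
  (forall x : R, is_derive x (1 : R) F (f x)) -> (forall x, `|F x| <= C) -> intg mu f.
Proof.
move=> cf f0 dF FC.
have [] // := @intg_monotone _ _ _ mu (fun n x => f x * ((- n.+1%:R <= x <= n.+1%:R)%R)%:R) f (C + C).
- by move=> n; apply: ii_indic_itv => //; rewrite -subr_ge0 opprK addr_ge0.
- by move=> n x; rewrite mulr_ge0.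
- move=> x n m nm; rewrite ler_wpM2l// ler_nat.
  case: (boolP (- n.+1%:R <= x <= n.+1%:R)) => // /andP[h1 h2].
  rewrite (_ : (_ <= _ <= _) = true)//; apply/andP; split.
    by apply: le_trans h1; rewrite lerN2 ler_nat ltnS.
  by apply: (le_trans h2); rewrite ler_nat ltnS.
- move=> x; rewrite -[X in _ --> X]mulr1; apply: cvgM; first exact: cvg_cst.
  by have := cvg_itv_indic x; rewrite -cvg_shiftS.
- move=> n; rewrite (ii_itv _ cf dF); last by rewrite -subr_gt0 opprK addr_gt0.
  by have := FC n.+1%:R; have := FC (- n.+1%:R); rewrite !ler_norml; lra.
Qed.

End Line.

(** * Affine changes of variables *)
Section ChangeOfVariables.
Context {R : realType}.
Notation mu := (leb R).

Lemma ge0_ii_scaled (phi : R -> R) (c : R) (f : R -> \bar R) : 0 < c ->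
  measurable_fun [set: measurableTypeR R] (phi : measurableTypeR R -> measurableTypeR R) ->
  (forall A, measurable A -> mu (phi @^-1` A) = (c%:E * mu A)%E) ->
  measurable_fun setT f -> (forall x, (0 <= f x)%E) ->
  (\int[mu]_x f (phi x) = c%:E * \int[mu]_x f x)%E.
Proof.
move=> c0 mphi hphi mf f0.
have c0' : 0 <= c by exact: ltW.
rewrite -[RHS]/((NngNum c0')%:num%:E * _)%E -(ge0_integral_mscale _ measurableT)//.
rewrite -[LHS](@ge0_integral_pushforward _ _ (measurableTypeR R) (measurableTypeR R) R phi mphi mu setT f)//.
apply: eq_measure_integral => A mA _ /=.
by rewrite /pushforward hphi.
Qed.

Lemma ii_scaled (phi : R -> R) (c : R) (f : R -> R) : 0 < c ->
  measurable_fun [set: measurableTypeR R] (phi : measurableTypeR R -> measurableTypeR R) ->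
  (forall A, measurable A -> mu (phi @^-1` A) = (c%:E * mu A)%E) ->
  intg mu f -> intg mu (fun x => f (phi x)) /\ ii mu (fun x => f (phi x)) = c * ii mu f.
Proof.
move=> c0 mphi hphi fi; have mf := intg_meas fi.
have mfe : measurable_fun setT (EFin \o f) by exact/measurable_EFinP.
have h1 : intg mu (fun x => f (phi x)).
  apply/integrableP; split; first by apply/measurable_EFinP; exact: measurableT_comp.
  rewrite (ge0_ii_scaled (f := fun x => `|f x|%:E) c0 mphi hphi)//; last first.
    by apply/measurable_EFinP; meas.
  rewrite -EFin_ii; last exact: intg_norm.
  by rewrite -EFinM ltry.
split => //.
have fp : measurable_fun setT ((EFin \o f)^\+)%E by exact: measurable_funepos.
have fn : measurable_fun setT ((EFin \o f)^\-)%E by exact: measurable_funeneg.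
rewrite /ii /Rintegral integralE [in RHS]integralE.
rewrite -[(fun x => (f (phi x))%:E)]/((EFin \o f) \o phi) funepos_comp funeneg_comp.
rewrite (ge0_ii_scaled (f := ((EFin \o f)^\+)%E) c0 mphi hphi)//.
rewrite (ge0_ii_scaled (f := ((EFin \o f)^\-)%E) c0 mphi hphi)//.
have ip := integral_funepos_lt_pinfty measurableT fi.
have iN := integral_funeneg_lt_pinfty measurableT fi.
have := integral_ge0 mu (fun x _ => funepos_ge0 (EFin \o f) x) (D := setT).
have := integral_ge0 mu (fun x _ => funeneg_ge0 (EFin \o f) x) (D := setT).
case: (integral _ _ _) iN => // a _ _; case: (integral _ _ _) ip => // b _ _.
by rewrite -!EFinM -!EFinD /= mulrBr.
Qed.

Lemma mu_affine (a b : R) : 0 < a -> forall A, measurable A ->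
  mu ((fun x => a * x + b) @^-1` A) = ((a^-1)%:E * mu A)%E.
Proof.
move=> a0.
have mphi : measurable_fun [set: measurableTypeR R] (fun x : measurableTypeR R => (a * x + b : measurableTypeR R)) by meas.
have a0' : 0 <= a by exact: ltW.
have key : forall A, measurable A -> mu A = mscale (NngNum a0') (pushforward mu (fun x : measurableTypeR R => (a * x + b : measurableTypeR R))) A.
  move=> mm; apply: lebesgue_measure_unique => _ [[x y] /= xy <-].
  rewrite /mscale/= /pushforward /=.
  rewrite (_ : (fun x0 => a * x0 + b) @^-1` `]x, y] = `](x - b) / a, (y - b) / a]%classic); last first.
    apply/seteqP; split => z /=; rewrite !in_itv /= ltr_pdivrMr// ler_pdivlMr// mulrC;
    by rewrite ltrBlDr lerBrDr.
  rewrite !lebesgue_measure_itv /= !lte_fin ltr_pM2r ?invr_gt0// ltrD2r.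
  case: ifP => _; last by rewrite mule0.
  by rewrite -!EFinB -EFinM; congr EFin; field; rewrite gt_eqF.
move=> A mA; rewrite (key mphi A mA) /mscale /= muleA -EFinM mulVf ?mul1e//.
by rewrite gt_eqF.
Qed.

Lemma ii_affine (a b : R) (f : R -> R) : 0 < a -> intg mu f ->
  intg mu (fun x => f (a * x + b)) /\ ii mu (fun x => f (a * x + b)) = a^-1 * ii mu f.
Proof.
move=> a0; apply: (@ii_scaled (fun x => a * x + b)); [by rewrite invr_gt0|by meas|].
exact: mu_affine.
Qed.

Lemma ii_shift (b : R) (f : R -> R) : intg mu f ->
  intg mu (fun x => f (x + b)) /\ ii mu (fun x => f (x + b)) = ii mu f.
Proof.
move=> fi; have [h1 h2] := ii_affine b ltr01 fi; split.
  by apply: eq_intg h1 => x; rewrite mul1r.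
rewrite -[RHS]mul1r -[in X in X * _]invr1 -h2.
by apply: eq_ii => x; rewrite mul1r.
Qed.

Lemma ii_opp (f : R -> R) : intg mu f ->
  intg mu (fun x => f (- x)) /\ ii mu (fun x => f (- x)) = ii mu f.
Proof.
move=> fi; rewrite -[ii mu f]mul1r; apply: ii_scaled => //.
by move=> A mA; rewrite mul1e; exact: (lebesgue_measureN mA).
Qed.

End ChangeOfVariables.

(** * Derivatives and smooth functions *)
Section SmoothCalculus.
Context {R : realType}.
Implicit Types f g : R -> R.

(** The derivative is part of the relation, so that it can be computed by unification rather
    than through [derive1]. *)
Definition dv f f' := forall x : R, is_derive x (1 : R) f (f' x).

Lemma dv_derive1 f f' : dv f f' -> derive1 f = f'.
Proof. by move=> h; apply/funext => x; rewrite derive1E; apply: derive_val. Qed.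

Lemma dv_ext f g f' g' : f =1 g -> f' =1 g' -> dv f f' -> dv g g'.
Proof. by move=> /funext -> /funext ->. Qed.

Lemma dv_cst c : dv (fun=> c) (fun=> 0).
Proof. by move=> x; apply: is_derive_cst. Qed.

Lemma dv_id : dv (fun x => x) (fun=> 1).
Proof. by move=> x; apply: is_derive_id. Qed.

Lemma dvD f g f' g' : dv f f' -> dv g g' -> dv (fun x => f x + g x) (fun x => f' x + g' x).
Proof. by move=> h1 h2 x; have := h1 x; have := h2 x => ? ?; apply: is_deriveD. Qed.

Lemma dvN f f' : dv f f' -> dv (fun x => - f x) (fun x => - f' x).
Proof. by move=> h1 x; have := h1 x => ?; apply: is_deriveN. Qed.

Lemma dvB f g f' g' : dv f f' -> dv g g' -> dv (fun x => f x - g x) (fun x => f' x - g' x).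
Proof. by move=> h1 h2; apply: dvD => //; exact: dvN. Qed.

Lemma dvM f g f' g' : dv f f' -> dv g g' ->
  dv (fun x => f x * g x) (fun x => f' x * g x + f x * g' x).
Proof.
move=> h1 h2 x; have := h1 x; have := h2 x => ? ?.
by apply: is_derive_eq; rewrite addrC /GRing.scale /= [g x * _]mulrC.
Qed.

Lemma dvZ k f f' : dv f f' -> dv (fun x => k * f x) (fun x => k * f' x).
Proof.
move=> h; apply: dv_ext (dvM (dv_cst k) h) => x //=; by rewrite mul0r add0r.
Qed.

Lemma dv_comp f g f' g' : dv f f' -> dv g g' ->
  dv (fun x => f (g x)) (fun x => g' x * f' (g x)).
Proof.
move=> h1 h2 x; have := h1 (g x); have := h2 x => ? ?.
by rewrite mulrC; exact: (@is_derive1_comp R f g x).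
Qed.

Lemma dv_sum I (s : seq I) (P : pred I) (F F' : I -> R -> R) :
  (forall i, dv (F i) (F' i)) ->
  dv (fun x => \sum_(i <- s | P i) F i x) (fun x => \sum_(i <- s | P i) F' i x).
Proof.
move=> h; elim: s => [|i s ih].
  by apply: dv_ext (dv_cst 0) => x; rewrite big_nil.
case: (boolP (P i)) => Pi; last by apply: dv_ext ih => x; rewrite big_cons (negbTE Pi).
by apply: dv_ext (dvD (h i) ih) => x; rewrite big_cons Pi.
Qed.

Lemma dv_cont f f' : dv f f' -> continuous f.
Proof. exact: is_derive_cont. Qed.

Lemma dv_sin : dv (@sin R) (@cos R).
Proof. by move=> x; apply: is_derive_sin. Qed.

Lemma dv_cos : dv (@cos R) (fun x => - sin x).
Proof. by move=> x; apply: is_derive_cos. Qed.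

Lemma meas_cos_comp d (T : measurableType d) (g : T -> R) : measurable_fun setT g ->
  measurable_fun setT (fun z => cos (g z)).
Proof. by apply: (measurableT_comp (f := @cos R : measurableTypeR R -> R)); apply: cont_meas; exact: dv_cont dv_cos. Qed.

Lemma dv_exp : dv (@expR R) (@expR R).
Proof. by move=> x; apply: is_derive_expR. Qed.

Lemma dvV f f' : dv f f' -> (forall x, f x != 0) ->
  dv (fun x => (f x)^-1) (fun x => - f' x / f x ^+ 2).
Proof.
move=> h f0 x; have hx := h x.
by apply: is_derive_eq (@is_deriveV R f x (f' x) 1 (f0 x) hx) _; rewrite /GRing.scale/= mulNr mulNr mulrC.
Qed.

(** Closure under sums and products lets smoothness be proved coinductively: if every generator
    has its derivative in the algebra, every member is smooth. *)
Inductive alg (G : (R -> R) -> Prop) : (R -> R) -> Prop :=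
| alg_gen f of G f : alg G f
| alg_cst c : alg G (fun=> c)
| alg_add f g of alg G f & alg G g : alg G (fun x => f x + g x)
| alg_mul f g of alg G f & alg G g : alg G (fun x => f x * g x).

Lemma alg_smooth (G : (R -> R) -> Prop) :
  (forall f, G f -> exists f', dv f f' /\ alg G f') -> forall f, alg G f -> smooth f.
Proof.
move=> hG.
have H f : alg G f -> exists f', dv f f' /\ alg G f'.
  elim=> [{}f /hG//|c|{}f g _ [f' [df af]] _ [g' [dg ag]]|{}f g fin_energy [f' [df af]] genergy [g' [dg ag]]].
  - by exists (fun=> 0); split; [exact: dv_cst|exact: alg_cst].
  - by exists (fun x => f' x + g' x); split; [exact: dvD|exact: alg_add].
  - exists (fun x => f' x * g x + f x * g' x); split; first exact: dvM.
    by apply: alg_add; apply: alg_mul.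
have Hn f n : alg G f -> alg G (derive1n n f).
  elim: n => // n ih af; rewrite derive1nS.
  by have [g [dg ag]] := H _ (ih af); rewrite (dv_derive1 dg).
move=> f af n x; have [g [dg _]] := H _ (Hn f n af); exact: (@ex_derive _ _ _ _ _ _ _ (dg x)).
Qed.

Lemma smooth_dv f : smooth f -> dv f (derive1 f).
Proof.
move=> sf x; have d := sf 0%N x; rewrite derive1E.
exact: derivableP.
Qed.

Lemma derive1n_shift f n : derive1n n (derive1 f) = derive1n n.+1 f.
Proof. by rewrite /derive1n iterSr. Qed.

Lemma smooth_derive1 f : smooth f -> smooth (derive1 f).
Proof. by move=> sf n x; rewrite derive1n_shift; exact: sf. Qed.

Lemma smooth_derive1n f n : smooth f -> smooth (derive1n n f).
Proof. by move=> sf k x; rewrite /derive1n -iterD; exact: (sf (k + n)%N x). Qed.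

Lemma smooth_cont f : smooth f -> continuous f.
Proof. by move=> /smooth_dv /dv_cont. Qed.

Lemma smooth_gen f : smooth f -> exists f', dv f f' /\ alg smooth f'.
Proof.
by move=> sf; exists (derive1 f); split; [exact: smooth_dv|apply: alg_gen; exact: smooth_derive1].
Qed.

Lemma smooth_cst c : smooth (fun _ : R => c).
Proof. by apply: (alg_smooth smooth_gen); exact: alg_cst. Qed.

Lemma smoothD f g : smooth f -> smooth g -> smooth (fun x => f x + g x).
Proof. by move=> sf sg; apply: (alg_smooth smooth_gen); apply: alg_add; exact: alg_gen. Qed.

Lemma smoothM f g : smooth f -> smooth g -> smooth (fun x => f x * g x).
Proof. by move=> sf sg; apply: (alg_smooth smooth_gen); apply: alg_mul; exact: alg_gen. Qed.

Lemma smoothZ k f : smooth f -> smooth (fun x => k * f x).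
Proof. by move=> sf; exact: (smoothM (f := fun=> k) (@smooth_cst k) sf). Qed.

Lemma smooth_sum I (s : seq I) (P : pred I) (F : I -> R -> R) :
  (forall i, smooth (F i)) -> smooth (fun x => \sum_(i <- s | P i) F i x).
Proof.
move=> h; elim: s => [|i s ih].
  by under eq_fun do rewrite big_nil; exact: (@smooth_cst 0).
case: (boolP (P i)) => Pi; last by under eq_fun do rewrite big_cons (negbTE Pi).
by under eq_fun do rewrite big_cons Pi; exact: (smoothD (h i) ih).
Qed.

Lemma smooth_affine f a b : smooth f -> smooth (fun x => f (a * x + b)).
Proof.
move=> sf; pose G h := exists2 g, smooth g & h = (fun x => g (a * x + b)).
apply: (@alg_smooth G); last by apply: alg_gen; exact: (ex_intro2 _ _ f sf erefl).
move=> _ [g sg ->]; exists (fun x => a * derive1 g (a * x + b)); split.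
  apply: dv_ext (dv_comp (smooth_dv sg) (dvD (dvZ a dv_id) (dv_cst b))) => x //=.
  by rewrite addr0 mulr1.
apply: alg_mul; first exact: alg_cst.
by apply: alg_gen; exact: (ex_intro2 _ _ (derive1 g) (smooth_derive1 sg) erefl).
Qed.

End SmoothCalculus.

(** * Bump functions and the fundamental lemma of the calculus of variations *)
Section Bump.
Context {R : realType}.
Notation mu := (leb R).

Lemma is_derive_quadratic (f : R -> R) (x l C : R) :
  (forall h, `|f (x + h) - f x - l * h| <= C * h ^+ 2) -> is_derive x (1 : R) f l.
Proof.
move=> hf.
have C0 : 0 <= C by have := hf 1; rewrite expr1n !mulr1; exact: (le_trans (normr_ge0 _)).
have lim : h^-1 *: (f (h *: (1 : R) + x) - f x) @[h --> 0^'] --> l.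
  apply/cvgrPdist_le => /= e e0.
  have e1 : 0 < e / (C + 1) by rewrite divr_gt0// ltr_wpDl.
  near=> h.
  have h0 : h != 0 by near: h; exact: nbhs_dnbhs_neq.
  have he : `|h| <= e / (C + 1).
    by near: h; apply: dnbhs0_le.
  rewrite /GRing.scale /= mulr1.
  have -> : l - h^-1 * (f (h + x) - f x) = - (h^-1 * (f (x + h) - f x - l * h)).
    by rewrite [x + h]addrC; field.
  rewrite normrN normrM normfV ler_pdivrMl ?normr_gt0//.
  apply: le_trans (hf h) _; rewrite -real_normK ?num_real// expr2 mulrA [leRHS]mulrC ler_wpM2r//.
  apply: (@le_trans _ _ ((C + 1) * `|h|)); first by rewrite ler_wpM2r// lerDl.
  by rewrite mulrC -ler_pdivlMr// ltr_wpDl.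
apply: DeriveDef; first by apply/cvg_ex; exists l.
by apply/cvg_lim.
Unshelve. all: by end_near. Qed.

Lemma horner_le_expR (P : {poly R}) (a : R) : 0 < a ->
  exists C, 0 <= C /\ forall y, 0 <= y -> `|P.[y]| <= C * expR (a * y).
Proof.
elim/poly_ind: P a => [|P c ih] a a0.
  by exists 0; split => // y _; rewrite horner0 normr0 mul0r.
have a2 : 0 < a / 2 by rewrite divr_gt0.
have [C [C0 hC]] := ih _ a2.
exists (C * (2 / a) + `|c|); split; first by rewrite addr_ge0 ?mulr_ge0// ?invr_ge0 ltW.
move=> y y0; rewrite hornerD hornerM hornerX hornerC mulrDl.
apply: le_trans (ler_normD _ _) _; apply: lerD; last first.
  by rewrite ler_peMr// -expR0 ler_expR mulr_ge0// ltW.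
rewrite normrM (ger0_norm y0).
have -> : expR (a * y) = expR (a / 2 * y) * expR (a / 2 * y) by rewrite -expRD; congr expR; field.
rewrite mulrACA -mulrA [X in _ <= X]mulrCA mulrA.
rewrite [leRHS](_ : _ = (C * expR (a / 2 * y)) * (2 / a * expR (a / 2 * y))); last by ring.
apply: ler_pM => //; first exact: hC.
have e : y = 2 / a * (a / 2 * y) by field; rewrite gt_eqF.
rewrite [leLHS]e ler_wpM2l ?divr_ge0 ?(ltW a0)//.
apply: le_trans (expR_ge1Dx _); lra.
Qed.

(** The functions [P(1/x) e^(-1/x)], extended by 0, are stable under derivation; for [P = 1]
    this is the standard flat function. *)
Definition rhoP (P : {poly R}) (x : R) : R := if 0 < x then P.[x^-1] * expR (- x^-1) else 0.

Lemma dv_rhoP P : dv (rhoP P) (rhoP ('X^2 * (P - P^`()))).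
Proof.
move=> x; case: (ltgtP x 0) => x0.
- rewrite /(rhoP ('X^2 * _)) ltNge (ltW x0)/=.
  apply: (@near_eq_is_derive _ _ _ (fun=> 0)) => //.
    near=> y; rewrite /rhoP ltNge (_ : y <= 0)//; apply: ltW.
    by near: y; exact: lt_nbhsl.
- rewrite /(rhoP ('X^2 * _)) x0/=.
  apply: (@near_eq_is_derive _ _ _ (fun y : R => P.[y^-1] * expR (- y^-1))).
    near=> y; rewrite /rhoP (_ : 0 < y)//.
    by near: y; exact: lt_nbhsr.
  have dVx : is_derive x (1 : R) (fun y => y^-1) (- 1 / x ^+ 2).
    apply: is_derive_eq (@is_deriveV R (fun y => y) x 1 1 (lt0r_neq0 x0) _) _.
    by rewrite /GRing.scale/= mulr1 mulN1r.
  have half_poly : is_derive (x^-1) (1 : R) (fun y => P.[y]) (P^`().[x^-1]).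
    by have := @is_derive_poly R P x^-1.
  have d1 := @is_derive1_comp R (fun y => P.[y]) (fun y => y^-1) x _ _ half_poly dVx.
  have d2 := @is_derive1_comp R expR (fun y => - y^-1) x _ _ (is_derive_expR _) (is_deriveN dVx).
  apply: is_derive_eq (is_deriveM d1 d2) _.
  rewrite /GRing.scale/= hornerM hornerXn hornerD hornerN exprVn; field.
  by rewrite gt_eqF.
- have [C [C0 hC]] := horner_le_expR ('X^2 * P) ltr01.
  rewrite x0; apply: (@is_derive_quadratic _ _ _ C) => h.
  rewrite add0r /rhoP ltxx subr0 mul0r subr0.
  case: ifP => [h0|_]; last by rewrite normr0 mulr_ge0 ?sqr_ge0.
  have hi : 0 <= h^-1 by rewrite invr_ge0 ltW.
  have := hC _ hi; rewrite hornerM hornerXn mul1r !normrM.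
  rewrite [`|expR _|]ger0_norm ?expR_ge0// (ger0_norm hi) expRN ler_pdivrMr ?expR_gt0// => H.
  have -> : `|P.[h^-1]| = h ^+ 2 * (h^-1 * h^-1 * `|P.[h^-1]|) by field; rewrite gt_eqF.
  by apply: le_trans (ler_wpM2l (sqr_ge0 h) H) _; rewrite mulrA [C * _]mulrC.
Unshelve. all: by end_near. Qed.

Lemma rhoP_smooth P : smooth (rhoP P).
Proof.
apply: (@alg_smooth _ (fun f => exists P, f = rhoP P)); last by apply: alg_gen; exists P.
move=> _ [Q ->]; exists (rhoP ('X^2 * (Q - Q^`()))); split; first exact: dv_rhoP.
by apply: alg_gen; eexists.
Qed.

Definition rho := rhoP 1.

Lemma rhoE x : rho x = if 0 < x then expR (- x^-1) else 0.
Proof. by rewrite /rho /rhoP hornerC mul1r. Qed.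

Lemma rho_ge0 x : 0 <= rho x.
Proof. by rewrite rhoE; case: ifP => // _; exact: expR_ge0. Qed.

Lemma rho_le1 x : rho x <= 1.
Proof.
rewrite rhoE; case: ifP => // x0.
by rewrite -[leRHS]expR0 ler_expR oppr_le0 invr_ge0 ltW.
Qed.

(** As [k] grows, the bump tends to the indicator of [(a, b)]. *)
Definition bmp (a b k x : R) := rho (k * (x - a)) * rho (k * (b - x)).

Lemma bmp_smooth a b k : smooth (bmp a b k).
Proof.
have h1 := @smooth_affine R rho k (- (k * a)) (@rhoP_smooth 1).
have h2 := @smooth_affine R rho (- k) (k * b) (@rhoP_smooth 1).
have := smoothM h1 h2; congr smooth; apply/funext => x; rewrite /bmp.
by congr (rho _ * rho _); ring.
Qed.

Lemma bmp_ge0 a b k x : 0 <= bmp a b k x.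
Proof. by rewrite mulr_ge0 ?rho_ge0. Qed.

Lemma bmp_le1 a b k x : bmp a b k x <= 1.
Proof. by rewrite /bmp -[leRHS]mul1r ler_pM ?rho_ge0 ?rho_le1. Qed.

Lemma bmp_out a b k x : 0 < k -> ~~ (a < x < b) -> bmp a b k x = 0.
Proof.
move=> k0; rewrite negb_and -!leNgt => /orP[] h; rewrite /bmp !rhoE.
  by rewrite ltNge pmulr_rle0// subr_le0 h mul0r.
by rewrite [0 < k * (b - x)]ltNge pmulr_rle0// subr_le0 h mulr0.
Qed.

Lemma bmp_test a b k : 0 < k -> test_function (bmp a b k).
Proof.
move=> k0; split; first exact: bmp_smooth.
apply: (@subclosed_compact _ _ `[a, b]%classic); first exact: closed_closure.
  exact: segment_compact.
have -> : `[a, b]%classic = closure `[a, b]%classic :> set R.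
  by apply: (closure_id _).1; exact: itv_closed.
apply: closureS => x /= h; rewrite in_itv/=.
case: (boolP (a < x < b)) => [/andP[h1 h2]|h']; first by rewrite !ltW.
by rewrite bmp_out ?eqxx in h.
Qed.

Lemma cvg_rho x : 0 < x -> rho (n.+1%:R * x) @[n --> \oo] --> (1 : R).
Proof.
move=> x0.
have -> : (fun n : nat => rho (n.+1%:R * x)) = (fun n => expR (- (n.+1%:R^-1 / x))).
  by apply/funext => n; rewrite rhoE mulr_gt0 ?ltr0Sn// invfM.
have h : - (n.+1%:R^-1 / x) @[n --> \oo] --> (0 : R).
  rewrite -oppr0; apply: cvgN; rewrite -(mul0r x^-1); apply: cvgM; last exact: cvg_cst.
  exact: cvg_harmonic.
have := @continuous_cvg _ _ _ _ _ _ (@expR R) _ (@continuous_expR R 0) h.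
by rewrite expR0 => H; exact: H.
Qed.

Lemma cvg_bmp a b x : bmp a b n.+1%:R x @[n --> \oo] --> ((a < x < b)%R%:R : R).
Proof.
case: (boolP (a < x < b)) => [/andP[h1 h2]|h]; last first.
  by apply: cvg_near_cst; apply: nearW => n; rewrite bmp_out.
by rewrite -[X in _ --> X]mulr1; apply: cvgM; apply: cvg_rho; rewrite subr_gt0.
Qed.

(** Bumps increase to indicators, so every integral of [h] over an interval vanishes; Lebesgue
    differentiation concludes. *)
Lemma ae0_of_test (h : R -> R) :
  (forall a b : R, a < b -> intg mu (fun x => h x * (a <= x <= b)%R%:R)) ->
  measurable_fun setT h ->
  (forall phi, test_function phi -> ii mu (fun x => h x * phi x) = 0) ->
  {ae mu, forall x, h x = 0}.
Proof.
move=> hi mh h0.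
have key a b : a < b -> ii mu (fun x => h x * (a < x < b)%R%:R) = 0.
  move=> ab.
  have [|||||_ hc] := @ii_dct _ _ _ mu (fun n x => h x * bmp a b n.+1%:R x)
    (fun x => h x * (a < x < b)%R%:R) (fun x => `|h x * (a <= x <= b)%R%:R|).
  - by move=> n; apply: measurable_funM => //; apply: cont_meas; apply: smooth_cont; exact: bmp_smooth.
  - apply: measurable_funM => //; rewrite (_ : (fun _ => _) = \1_(`]a, b[%classic)); last first.
      by apply/funext => x; rewrite indicE mem_setE in_itv.
    exact: measurable_indic.
  - by apply: aeW => x; apply: cvgM; [exact: cvg_cst|exact: cvg_bmp].
  - by apply: intg_norm; exact: hi.
  - move=> n x; rewrite !normrM; case: (boolP (a < x < b)) => [/andP[h1 h2]|h'].
      rewrite (ltW h1) (ltW h2) normr1 ler_wpM2l// -normrM ger0_norm ?bmp_ge0//.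
      exact: bmp_le1.
    by rewrite -normrM -/(bmp a b n.+1%:R x) bmp_out// normr0 mulr0 mulr_ge0.
  apply/esym; apply: (cvg_unique _ _ hc) => //.
  apply: cvg_near_cst; apply: nearW => n; apply: h0; exact: bmp_test.
have mI (a b : R) : measurable_fun setT (fun x : R => (a < x < b)%R%:R : R).
  rewrite (_ : (fun _ => _) = \1_(`]a, b[%classic)); first exact: measurable_indic.
  by apply/funext => x; rewrite indicE mem_setE in_itv.
have locf : forall N : nat, {ae mu, forall x, - N.+1%:R < x < N.+1%:R -> h x = 0}.
  move=> N; set a : R := - N.+1%:R; set b : R := N.+1%:R.
  have ab : a < b by rewrite -subr_gt0 opprK addr_gt0.
  pose hN x := h x * (a < x < b)%R%:R.
  have mhN : measurable_fun setT hN by apply: measurable_funM.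
  have iN : mu.-integrable setT (EFin \o hN).
    apply: (@intg_le _ _ _ mu hN (fun x => `|h x * (a <= x <= b)%R%:R|)) => //; last exact: intg_norm (hi a b ab).
    move=> x; rewrite !normrM; case: (boolP (a < x < b)) => [/andP[h1 h2]|h'].
      by rewrite (ltW h1) (ltW h2).
    by rewrite normr0 mulr0 mulr_ge0.
  (* A primitive that vanishes identically on the interval. *)
  pose F y := (\int[mu]_(t in [set` `]-oo, y]]) hN t)%R.
  have F0 y : a < y -> y < b -> F y = 0.
    move=> ay yb; rewrite /F -Rintegral_itv_bndo_bndc; last exact: integrableS iN.
    rewrite Rintegral_mkcond -[RHS](key a y ay); apply: eq_ii => t.
    rewrite patchE mem_setE in_itv /= /hN; case: (ltP t y) => ty; last by rewrite andbF mulr0.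
    by rewrite (lt_trans ty yb).
  have /= := @FTC1Ny R hN _ _.
  have H1 : forall y : R, mu.-integrable `]-oo, y] (EFin \o hN).
    by move=> y; apply: (integrableS measurableT _ _ iN).
  have H2 : locally_integrable [set: R] hN by apply: open_integrable_locally => //; exact: openT.
  move=> /(_ H1 H2); apply: (@filterS _ _ (ae_filter_ringOfSetsType mu)) => x [_ hd] /andP[ax xb].
  have : hN x = h x by rewrite /hN ax xb mulr1.
  move=> <-; rewrite -hd -/F derive1E (@near_eq_derive _ _ _ F (fun=> 0)); first exact: derive_cst.
  near=> y; apply: F0.
    by near: y; exact: lt_nbhsr.
  by near: y; exact: lt_nbhsl.
have /ae_foralln := locf; apply: filterS => x hx.
have [N hN] : exists N : nat, `|x| < N%:R by exists (Num.bound `|x|); exact: archi_boundP.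
apply: (hx N); rewrite -ltr_norml; apply: (lt_le_trans hN).
by rewrite ler_nat.
Unshelve. all: by end_near. Qed.

End Bump.

(** * The circle as the compactified line *)
Section Circle.
Context {R : realType}.
Notation mu := (leb R).

(** The angle of the stereographic projection; [2 pi * p] is its derivative and [Cn], [Sn] are
    the harmonics of the circle read on the line. *)
Definition th (x : R) : R := 2 * atan x.
(** The Poisson density: the pullback of the normalised length of the circle. *)
Definition p (x : R) : R := (pi * (1 + x ^+ 2))^-1.
Definition Cn (n : int) (x : R) : R := cos (n%:~R * th x).
Definition Sn (n : int) (x : R) : R := sin (n%:~R * th x).

Lemma sqr1_gt0 (x : R) : 0 < 1 + x ^+ 2.
Proof. by have := sqr_ge0 x; lra. Qed.

Lemma pi_neq0 : (pi : R) != 0.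
Proof. by rewrite gt_eqF ?pi_gt0. Qed.

Lemma p_gt0 x : 0 < p x.
Proof. by rewrite /p invr_gt0 mulr_gt0 ?pi_gt0 ?sqr1_gt0. Qed.

Lemma p_ge0 x : 0 <= p x. Proof. exact: ltW (p_gt0 x). Qed.

Lemma dv_atan : dv (@atan R) (fun x => (1 + x ^+ 2)^-1).
Proof.
move=> x; apply: DeriveDef; first exact: derivable_atan.
by rewrite -derive1E derive1_atan.
Qed.

Lemma dv_th : dv th (fun x => 2 * pi * p x).
Proof.
apply: dv_ext (dvZ 2 dv_atan) => // x; rewrite /p invfM.
have := pi_neq0; move: (pi : R) => P P0; field.
by rewrite (gt_eqF (sqr1_gt0 x)) P0.
Qed.

Lemma th_cont : continuous th.
Proof. exact: dv_cont dv_th. Qed.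

Lemma dv_sqr1 : dv (fun x : R => 1 + x ^+ 2) (fun x => 2 * x).
Proof.
apply: dv_ext (dvD (dv_cst 1) (dvM dv_id dv_id)) => x //=.
by rewrite add0r mul1r mulr1 -mulr2n mulr_natl.
Qed.

Lemma p_cont : continuous p.
Proof.
have h := dvZ pi dv_sqr1.
by apply: (dv_cont (dvV h _)) => x; rewrite mulf_neq0 ?gt_eqF ?pi_gt0 ?sqr1_gt0.
Qed.

Lemma cos_th x : cos (th x) = (1 - x ^+ 2) / (1 + x ^+ 2).
Proof.
rewrite /th mulr_natl cos_mulr2n cos_atan exprVn sqr_sqrtr ?ltW ?sqr1_gt0//.
by rewrite -mulr_natl; field; rewrite (gt_eqF (sqr1_gt0 x)).
Qed.

Lemma sin_th x : sin (th x) = 2 * x / (1 + x ^+ 2).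
Proof.
have h : sin (atan x) = x * cos (atan x).
  have := atanK x; rewrite /tan => e; rewrite -{2}e mulfVK//.
  by rewrite cos_atan invr_neq0// gt_eqF// sqrtr_gt0 sqr1_gt0.
rewrite /th mulr_natl sin_mulr2n h mulrCA -expr2 cos_atan exprVn sqr_sqrtr ?ltW ?sqr1_gt0//.
by rewrite -mulr_natl; ring.
Qed.

(** Conformal invariance: the chord between two points of the circle in terms of their
    projections. *)
Lemma chord x y : 2 - 2 * cos (th x - th y) = 4 * pi ^+ 2 * (p x * p y * (x - y) ^+ 2).
Proof.
rewrite cosB !cos_th !sin_th /p !invfM.
have := pi_neq0; move: (pi : R) => P P0; field.
by rewrite !(gt_eqF (sqr1_gt0 _)) P0.
Qed.

Lemma Cn_cont n : continuous (Cn n).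
Proof. by apply: dv_cont (dv_comp dv_cos (dvZ n%:~R dv_th)). Qed.

Lemma Sn_cont n : continuous (Sn n).
Proof. by apply: dv_cont (dv_comp dv_sin (dvZ n%:~R dv_th)). Qed.

Lemma Cn_le1 n x : `|Cn n x| <= 1.
Proof. by rewrite ler_norml cos_geN1 cos_le1. Qed.

Lemma Sn_le1 n x : `|Sn n x| <= 1.
Proof. by rewrite ler_norml sin_geN1 sin_le1. Qed.

Lemma CnN n x : Cn (- n) x = Cn n x.
Proof. by rewrite /Cn intrN mulNr cosN. Qed.

Lemma SnN n x : Sn (- n) x = - Sn n x.
Proof. by rewrite /Sn intrN mulNr sinN. Qed.

Lemma Cn0 x : Cn 0 x = 1.
Proof. by rewrite /Cn mul0r cos0. Qed.

Lemma Sn0 x : Sn 0 x = 0.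
Proof. by rewrite /Sn mul0r sin0. Qed.

Lemma CnD m n x : Cn (m + n) x = Cn m x * Cn n x - Sn m x * Sn n x.
Proof. by rewrite /Cn /Sn intrD mulrDl cosD. Qed.

Lemma SnD m n x : Sn (m + n) x = Sn m x * Cn n x + Cn m x * Sn n x.
Proof. by rewrite /Cn /Sn intrD mulrDl sinD. Qed.

Lemma CnB m n x : Cn (m - n) x = Cn m x * Cn n x + Sn m x * Sn n x.
Proof. by rewrite CnD CnN SnN mulrN opprK. Qed.

Lemma SnB m n x : Sn (m - n) x = Sn m x * Cn n x - Cn m x * Sn n x.
Proof. by rewrite SnD CnN SnN mulrN. Qed.

Lemma CS1 n x : Cn n x ^+ 2 + Sn n x ^+ 2 = 1.
Proof. exact: cos2Dsin2. Qed.

Lemma cvg_th_y : th x @[x --> +oo] --> (pi : R).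
Proof.
have -> : (pi : R) = 2 * (pi / 2) by field.
by apply: cvgM; [exact: cvg_cst|exact: cvgy_atan].
Qed.

Lemma cvg_th_Ny : th x @[x --> -oo] --> (- pi : R).
Proof.
have h : - th (- x) @[x --> -oo] --> (- pi : R).
  apply: cvgN; apply: (@cvg_comp _ _ _ (fun x => - x) th _ _ _ _ cvg_th_y).
  by apply/cvgNry; exact: cvg_id.
by have -> : th = (fun x => - th (- x)) by apply/funext => x; rewrite /th atanN mulrN opprK.
Qed.

Lemma th_lt x : `|th x| <= pi.
Proof.
rewrite /th ler_norml; have := atan_gtNpi2 x; have := atan_ltpi2 x; lra.
Qed.

Lemma intg_p : intg mu p.
Proof.
apply: (@intg_deriv _ p (fun x => (2 * pi)^-1 * th x) ((2 * pi)^-1 * pi)).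
- exact: p_cont.
- exact: p_ge0.
- apply: dv_ext (dvZ _ dv_th) => // x; rewrite mulrA mulVf ?mul1r// mulf_neq0 ?gt_eqF ?pi_gt0//.
- move=> x; rewrite normrM ger0_norm ?invr_ge0 ?mulr_ge0 ?pi_ge0// ler_wpM2l//.
    by rewrite invr_ge0 mulr_ge0// pi_ge0.
  exact: th_lt.
Qed.

Lemma intg_bp (b : R -> R) C : measurable_fun setT b -> (forall x, `|b x| <= C) ->
  intg mu (fun x => b x * p x).
Proof.
move=> mb bC; apply: (@intg_le _ _ _ mu _ (fun x => C * p x)).
- by apply: measurable_funM => //; apply: cont_meas; exact: p_cont.
- by move=> x; rewrite normrM (ger0_norm (p_ge0 x)) ler_wpM2r ?p_ge0.
- by apply: intgZ; exact: intg_p.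
Qed.

Lemma ii_p : ii mu p = 1.
Proof.
have -> : (1 : R) = (2 * pi)^-1 * pi - (2 * pi)^-1 * (- pi).
  by have := pi_neq0; move: (pi : R) => P P0; field.
apply: (@ii_deriv _ p (fun x => (2 * pi)^-1 * th x)).
- exact: p_cont.
- apply: dv_ext (dvZ _ dv_th) => // x; rewrite mulrA mulVf ?mul1r// mulf_neq0 ?gt_eqF ?pi_gt0//.
- exact: intg_p.
- by apply: cvgM; [exact: cvg_cst|exact: cvg_th_Ny].
- by apply: cvgM; [exact: cvg_cst|exact: cvg_th_y].
Qed.

Lemma sin_npi (n : int) : sin (n%:~R * pi) = 0 :> R.
Proof.
have h (k : nat) : sin (k%:R * pi) = 0 :> R.
  elim: k => [|k ih]; first by rewrite mul0r sin0.
  by rewrite -natr1 mulrDl mul1r sinDpi ih oppr0.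
case: n => k; first exact: h.
by rewrite NegzE intrN mulNr sinN h oppr0.
Qed.

Lemma ii_Cnp n : n != 0 -> ii mu (fun x => Cn n x * p x) = 0.
Proof.
move=> n0; have n0' : n%:~R != 0 :> R by rewrite intr_eq0.
have pi0 : pi != 0 :> R by rewrite gt_eqF ?pi_gt0.
pose k : R := (2 * pi * n%:~R)^-1.
have dF : dv (fun x => k * Sn n x) (fun x => Cn n x * p x).
  apply: dv_ext (dvZ k (dv_comp dv_sin (dvZ n%:~R dv_th))) => // x; rewrite /k /Cn.
  by move: (pi : R) pi0 => P P0; field; rewrite P0 n0'.
rewrite (@ii_deriv _ _ (fun x => k * Sn n x) (k * sin (n%:~R * - pi)) (k * sin (n%:~R * pi)) _ dF).
- by rewrite mulrN sinN sin_npi oppr0 mulr0 subrr.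
- by move=> x; apply: cvgM; [exact: Cn_cont|exact: p_cont].
- by apply: (@intg_bp _ 1); [apply: cont_meas; exact: Cn_cont|exact: Cn_le1].
- apply: cvgM; first exact: cvg_cst.
  apply: continuous_cvg; first exact: continuous_sin.
  by apply: cvgM; [exact: cvg_cst|exact: cvg_th_Ny].
- apply: cvgM; first exact: cvg_cst.
  apply: continuous_cvg; first exact: continuous_sin.
  by apply: cvgM; [exact: cvg_cst|exact: cvg_th_y].
Qed.

Lemma ii_Snp n : ii mu (fun x => Sn n x * p x) = 0.
Proof.
have [->|n0] := eqVneq n 0.
  by rewrite -[RHS](ii0 mu); apply: eq_ii => x; rewrite Sn0 mul0r.
have n0' : n%:~R != 0 :> R by rewrite intr_eq0.
have pi0 : pi != 0 :> R by rewrite gt_eqF ?pi_gt0.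
pose k : R := - (2 * pi * n%:~R)^-1.
have dF : dv (fun x => k * Cn n x) (fun x => Sn n x * p x).
  apply: dv_ext (dvZ k (dv_comp dv_cos (dvZ n%:~R dv_th))) => // x; rewrite /k /Sn.
  by move: (pi : R) pi0 => P P0; field; rewrite P0 n0'.
rewrite (@ii_deriv _ _ (fun x => k * Cn n x) (k * cos (n%:~R * - pi)) (k * cos (n%:~R * pi)) _ dF).
- by rewrite mulrN cosN subrr.
- by move=> x; apply: cvgM; [exact: Sn_cont|exact: p_cont].
- by apply: (@intg_bp _ 1); [apply: cont_meas; exact: Sn_cont|exact: Sn_le1].
- apply: cvgM; first exact: cvg_cst.
  apply: continuous_cvg; first exact: continuous_cos.
  by apply: cvgM; [exact: cvg_cst|exact: cvg_th_Ny].
- apply: cvgM; first exact: cvg_cst.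
  apply: continuous_cvg; first exact: continuous_cos.
  by apply: cvgM; [exact: cvg_cst|exact: cvg_th_y].
Qed.

Lemma ii_Cnp_delta n : ii mu (fun x => Cn n x * p x) = (n == 0)%:R.
Proof.
have [->|n0] := eqVneq n 0; last exact: ii_Cnp.
by rewrite -[RHS]ii_p; apply: eq_ii => x; rewrite Cn0 mul1r.
Qed.

(** [N] times the Fejer kernel, as the square of a geometric sum. *)
Definition K (N : nat) (t : R) : R :=
  (\sum_(0 <= k < N) cos (k%:R * t)) ^+ 2 + (\sum_(0 <= k < N) sin (k%:R * t)) ^+ 2.

Lemma K_ge0 N t : 0 <= K N t.
Proof. by rewrite addr_ge0 ?sqr_ge0. Qed.

(** Telescoping of the geometric sum; it makes [2 - 2 cos] times the kernel bounded. *)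
Lemma K_mul N t : (2 - 2 * cos t) * K N t = 2 - 2 * cos (N%:R * t).
Proof.
rewrite /K; set A := \sum_(_ <= _ < _) _; set B := \sum_(_ <= _ < _) _.
have h1 : (cos t - 1) * A - sin t * B = cos (N%:R * t) - 1.
  rewrite /A /B; elim: N {A B} => [|N ih].
    by rewrite !big_nil mul0r cos0 !mulr0; ring.
  rewrite !big_nat_recr//= -[N.+1%:R]natr1 [(_ + 1) * t]mulrDl mul1r cosD.
  by move: ih; set a := \sum_(_ <= _ < _) _; set b := \sum_(_ <= _ < _) _; lra.
have h2 : sin t * A + (cos t - 1) * B = sin (N%:R * t).
  rewrite /A /B; elim: N {A B h1} => [|N ih].
    by rewrite !big_nil mul0r sin0 !mulr0; ring.
  rewrite !big_nat_recr//= -[N.+1%:R]natr1 [(_ + 1) * t]mulrDl mul1r sinD.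
  by move: ih; set a := \sum_(_ <= _ < _) _; set b := \sum_(_ <= _ < _) _; lra.
have e1 : 2 - 2 * cos t = (cos t - 1) ^+ 2 + sin t ^+ 2.
  transitivity ((cos t ^+ 2 + sin t ^+ 2) - 2 * cos t + 1); last by ring.
  by rewrite cos2Dsin2; ring.
have e2 : 2 - 2 * cos (N%:R * t) = (cos (N%:R * t) - 1) ^+ 2 + sin (N%:R * t) ^+ 2.
  transitivity ((cos (N%:R * t) ^+ 2 + sin (N%:R * t) ^+ 2) - 2 * cos (N%:R * t) + 1); last by ring.
  by rewrite cos2Dsin2; ring.
by rewrite e1 e2 -h1 -h2; ring.
Qed.

Lemma KE N t : K N t = \sum_(0 <= j < N) \sum_(0 <= k < N) cos ((j%:Z - k%:Z)%:~R * t).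
Proof.
rewrite /K !expr2 !big_distrlr /= -big_split /=; apply: eq_bigr => j _.
rewrite -big_split /=; apply: eq_bigr => k _.
by rewrite intrB mulrBl cosB.
Qed.

Lemma sin_mul_le (m : nat) (t : R) : `|sin (m%:R * t)| <= m%:R * `|sin t|.
Proof.
elim: m => [|m ih]; first by rewrite !mul0r sin0 normr0.
rewrite -natr1 !mulrDl !mul1r sinD.
apply: le_trans (ler_normD _ _) _; apply: lerD; rewrite normrM.
  apply: le_trans ih; rewrite -[leRHS]mulr1 ler_wpM2l// ler_norml.
  by rewrite cos_geN1 cos_le1.
rewrite -[leRHS]mul1r ler_wpM2r// ler_norml.
by rewrite cos_geN1 cos_le1.
Qed.

Lemma chord_mul (n : int) (t : R) : 2 - 2 * cos (n%:~R * t) <= n%:~R ^+ 2 * (2 - 2 * cos t).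
Proof.
have dbl (s : R) : 2 - 2 * cos s = 4 * sin (s / 2) ^+ 2.
  have -> : cos s = 1 - 2 * sin (s / 2) ^+ 2.
    rewrite -{1}(_ : (s / 2) *+ 2 = s); last by rewrite -mulr_natl; field.
    by rewrite cos_mulr2n -mulr_natl -[X in _ - X](cos2Dsin2 (s / 2)) -[X in X - _ * sin _ ^+ 2](cos2Dsin2 (s / 2)); ring.
  ring.
have key (m : nat) : 2 - 2 * cos (m%:R * t) <= m%:R ^+ 2 * (2 - 2 * cos t).
  rewrite dbl [in leRHS]dbl [leRHS](_ : _ = 4 * (m%:R ^+ 2 * sin (t / 2) ^+ 2)); last by ring.
  rewrite ler_pM2l// -exprMn -(real_normK (num_real (sin _))).
  rewrite -[leRHS](real_normK (num_real _)) lerXn2r ?nnegrE// normrM (ger0_norm (ler0n _ m)).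
  by rewrite -mulrA; exact: sin_mul_le.
case: n => m; first exact: key.
by rewrite NegzE intrN mulNr cosN sqrrN; exact: key.
Qed.

End Circle.

(** * Fourier coefficients, partial sums and Fejer means *)
Section Coefficients.
Context {R : realType}.
Notation mu := (leb R).
Notation mu2 := (leb R \x leb R)%E.
Implicit Types f g h : R -> R.

Lemma measurable_invr : measurable_fun setT (fun x : R => x^-1).
Proof.
apply: (@measurable_fun_cvg _ _ _ setT (fun (n : nat) (x : R) => n%:R * x / (1 + n%:R * x ^+ 2)) (fun x : R => x^-1)) => [n|x _].
  have n0 (x : R) : 1 + n%:R * x ^+ 2 != 0.
    by rewrite gt_eqF// ltr_wpDr// mulr_ge0// sqr_ge0.
  apply: cont_meas => x; apply: cvgM; first by apply: cvgM; [exact: cvg_cst|exact: cvg_id].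
  apply: cvgV; first exact: n0.
  apply: cvgD; first exact: cvg_cst.
  by apply: cvgM; [exact: cvg_cst|rewrite expr2; apply: cvgM; exact: cvg_id].
have [->|x0] := eqVneq x 0.
  by apply: cvg_near_cst; apply: nearW => n; rewrite mulr0 mul0r invr0.
have x2 : 0 < x ^+ 2 by rewrite exprn_even_gt0.
have -> : x^-1 = x^-1 * (1 - 0) by rewrite subr0 mulr1.
apply: (@cvg_trans _ ((fun n : nat => x^-1 * (1 - (1 + n%:R * x ^+ 2)^-1)) @ \oo)).
  apply: near_eq_cvg; apply: nearW => n; field; rewrite x0 /=.
  by rewrite gt_eqF// ltr_wpDr// mulr_ge0// ltW.
apply: cvgM; first exact: cvg_cst.
apply: cvgB; first exact: cvg_cst.
apply/gtr0_cvgV0; first by near=> n; rewrite ltr_wpDr// mulr_ge0// ltW.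
apply: (@cvg_trans _ ((fun n : nat => n%:R * x ^+ 2 + 1) @ \oo)).
  by apply: near_eq_cvg; apply: nearW => n; rewrite addrC.
apply/cvgryPge => A; near=> n.
have h : A / x ^+ 2 <= n%:R by near: n; exact: nbhs_infty_ger.
by rewrite -lerBlDr (le_trans _ (_ : A <= _))// ?gerBl// -ler_pdivrMr.
Unshelve. all: by end_near. Qed.

(** The factor [q] turns [L^2(p dx)] into an unweighted [L^2]. *)
Definition q (x : R) : R := Num.sqrt (p x).

Lemma q_sqr x : q x ^+ 2 = p x.
Proof. by rewrite sqr_sqrtr// p_ge0. Qed.

Lemma q_gt0 x : 0 < q x.
Proof. by rewrite sqrtr_gt0 p_gt0. Qed.

Lemma q_meas : measurable_fun setT q.
Proof.
apply: (measurableT_comp (f := @Num.sqrt R)); last by apply: cont_meas; exact: p_cont.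
by apply: cont_meas; exact: sqrt_continuous.
Qed.

Lemma p_meas : measurable_fun setT (@p R).
Proof. by apply: cont_meas; exact: p_cont. Qed.

(** Bounded measurable functions: integrable against [p] and stable under products. *)
Definition Bd f := measurable_fun setT f /\ exists M, forall x, `|f x| <= M.
Definition L2p f := L2 mu (fun x => f x * q x).

Lemma Bd_cst c : Bd (fun=> c).
Proof. by split; [meas|exists `|c|]. Qed.

Lemma BdD f g : Bd f -> Bd g -> Bd (fun x => f x + g x).
Proof.
move=> [mf [M hM]] [mg [N hN]]; split; first by meas.
by exists (M + N) => x; rewrite (le_trans (ler_normD _ _))// lerD.
Qed.

Lemma BdM f g : Bd f -> Bd g -> Bd (fun x => f x * g x).
Proof.
move=> [mf [M hM]] [mg [N hN]]; split; first by meas.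
by exists (M * N) => x; rewrite normrM ler_pM.
Qed.

Lemma BdZ k f : Bd f -> Bd (fun x => k * f x).
Proof. exact: BdM (Bd_cst k). Qed.

Lemma BdN f : Bd f -> Bd (fun x => - f x).
Proof. by move=> [mf [M hM]]; split; [meas|exists M => x; rewrite normrN]. Qed.

Lemma BdB f g : Bd f -> Bd g -> Bd (fun x => f x - g x).
Proof. by move=> bf bg; apply: BdD => //; exact: BdN. Qed.

Lemma Bd_sum I (s : seq I) (P : pred I) (F : I -> R -> R) :
  (forall i, Bd (F i)) -> Bd (fun x => \sum_(i <- s | P i) F i x).
Proof.
move=> h; elim: s => [|i s ih].
  by under eq_fun do rewrite big_nil; exact: (Bd_cst 0).
case: (boolP (P i)) => Pi; last by under eq_fun do rewrite big_cons (negbTE Pi).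
by under eq_fun do rewrite big_cons Pi; exact: (BdD (h i) ih).
Qed.

Lemma Bd_Cn n : Bd (Cn n).
Proof. by split; [apply: cont_meas; exact: Cn_cont|exists 1; exact: Cn_le1]. Qed.

Lemma Bd_Sn n : Bd (Sn n).
Proof. by split; [apply: cont_meas; exact: Sn_cont|exists 1; exact: Sn_le1]. Qed.

Lemma Bd_intg f : Bd f -> intg mu (fun x => f x * p x).
Proof. by move=> [mf [M hM]]; exact: (intg_bp mf hM). Qed.

Lemma Bd_L2p f : Bd f -> L2p f.
Proof.
move=> bf; have [mf _] := bf; split; first by apply: measurable_funM => //; exact: q_meas.
by apply: eq_intg (Bd_intg (BdM bf bf)) => x; rewrite exprMn q_sqr expr2.
Qed.

Lemma L2p_bddM b f : Bd b -> L2p f -> L2p (fun x => b x * f x).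
Proof.
by move=> [mb [M hM]] Lf; have := @L2_bddM _ _ _ mu b (fun x => f x * q x) M mb hM Lf; apply: eq_L2 => x; rewrite mulrA.
Qed.

Lemma L2p_meas f : L2p f -> measurable_fun setT f.
Proof.
move=> [mf _]; have -> : f = (fun x => f x * q x * (q x)^-1).
  by apply/funext => x; rewrite mulfK// gt_eqF ?q_gt0.
apply: measurable_funM => //; apply: (measurableT_comp measurable_invr); exact: q_meas.
Qed.

Lemma L2pD f g : L2p f -> L2p g -> L2p (fun x => f x + g x).
Proof. by move=> Lf Lg; apply: eq_L2 (L2D Lf Lg) => x; rewrite mulrDl. Qed.

Lemma L2pZ k f : L2p f -> L2p (fun x => k * f x).
Proof. by move=> Lf; apply: eq_L2 (L2Z k Lf) => x; rewrite mulrA. Qed.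

Lemma L2pB f g : L2p f -> L2p g -> L2p (fun x => f x - g x).
Proof. by move=> Lf Lg; apply: eq_L2 (L2B Lf Lg) => x; rewrite mulrBl. Qed.

Lemma L2p_intgM f g : L2p f -> L2p g -> intg mu (fun x => f x * g x * p x).
Proof.
move=> Lf Lg; apply: eq_intg (L2_intgM Lf Lg) => x.
by rewrite mulrACA -expr2 q_sqr.
Qed.

Definition ipp f g : R := ii mu (fun x => f x * g x * p x).

Lemma ippE f g : ipp f g = ip mu (fun x => f x * q x) (fun x => g x * q x).
Proof. by apply: eq_ii => x; rewrite mulrACA -expr2 q_sqr. Qed.

Lemma ippC f g : ipp f g = ipp g f.
Proof. by apply: eq_ii => x; rewrite [f x * _]mulrC. Qed.

Lemma ippDl f g h : L2p f -> L2p g -> L2p h -> ipp (fun x => f x + g x) h = ipp f h + ipp g h.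
Proof.
move=> Lf Lg Lh; rewrite /ipp -iiD; [|exact: L2p_intgM|exact: L2p_intgM].
by apply: eq_ii => x; ring.
Qed.

Lemma ippZl k f h : L2p f -> L2p h -> ipp (fun x => k * f x) h = k * ipp f h.
Proof.
move=> Lf Lh; rewrite /ipp -iiZ; last exact: L2p_intgM.
by apply: eq_ii => x; ring.
Qed.

Lemma ippBl f g h : L2p f -> L2p g -> L2p h -> ipp (fun x => f x - g x) h = ipp f h - ipp g h.
Proof.
move=> Lf Lg Lh; rewrite /ipp -iiB; [|exact: L2p_intgM|exact: L2p_intgM].
by apply: eq_ii => x; ring.
Qed.

Lemma ipp_suml I (s : seq I) (P : pred I) (F : I -> R -> R) h : (forall i, L2p (F i)) -> L2p h ->
  ipp (fun x => \sum_(i <- s | P i) F i x) h = \sum_(i <- s | P i) ipp (F i) h.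
Proof.
move=> LF Lh; rewrite /ipp -ii_sum; last by move=> i _; exact: L2p_intgM.
by apply: eq_ii => x; rewrite !mulr_suml.
Qed.

(** Cosine and sine coefficients indexed by all integers; the symmetry in [n] replaces complex
    exponentials. *)
Definition al f (n : int) : R := ipp f (Cn n).
Definition be f (n : int) : R := ipp f (Sn n).

Lemma L2p_Cn n : L2p (Cn n). Proof. exact: Bd_L2p (Bd_Cn n). Qed.
Lemma L2p_Sn n : L2p (Sn n). Proof. exact: Bd_L2p (Bd_Sn n). Qed.

Lemma alN f n : al f (- n) = al f n.
Proof. by apply: eq_ii => x; rewrite CnN. Qed.

Lemma beN f n : L2p f -> be f (- n) = - be f n.
Proof.
move=> Lf; rewrite /be /ipp -iiN; last exact: L2p_intgM Lf (L2p_Sn n).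
by apply: eq_ii => x; rewrite SnN mulrN mulNr.
Qed.

Lemma al_Cn m n : al (Cn m) n = ((m == n)%:R + (m == - n)%:R) / 2 :> R.
Proof.
have -> : al (Cn m) n = 2^-1 * (ii mu (fun x => Cn (m - n) x * p x) + ii mu (fun x => Cn (m + n) x * p x)).
  rewrite -iiD; [|exact: Bd_intg (Bd_Cn _)|exact: Bd_intg (Bd_Cn _)].
  rewrite -iiZ; last by apply: intgD; exact: Bd_intg (Bd_Cn _).
  by apply: eq_ii => x; rewrite CnB CnD; field.
by rewrite !ii_Cnp_delta subr_eq0 addr_eq0 mulrC.
Qed.

Lemma be_Cn m n : be (Cn m) n = 0 :> R.
Proof.
have -> : be (Cn m) n = 2^-1 * (ii mu (fun x => Sn (m + n) x * p x) - ii mu (fun x => Sn (m - n) x * p x)).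
  rewrite -iiB; [|exact: Bd_intg (Bd_Sn _)|exact: Bd_intg (Bd_Sn _)].
  rewrite -iiZ; last by apply: intgB; exact: Bd_intg (Bd_Sn _).
  by apply: eq_ii => x; rewrite SnB SnD; field.
by rewrite !ii_Snp subrr mulr0.
Qed.

Lemma al_Sn m n : al (Sn m) n = 0 :> R.
Proof. by rewrite /al ippC; exact: be_Cn. Qed.

Lemma be_Sn m n : be (Sn m) n = ((m == n)%:R - (m == - n)%:R) / 2 :> R.
Proof.
have -> : be (Sn m) n = 2^-1 * (ii mu (fun x => Cn (m - n) x * p x) - ii mu (fun x => Cn (m + n) x * p x)).
  rewrite -iiB; [|exact: Bd_intg (Bd_Cn _)|exact: Bd_intg (Bd_Cn _)].
  rewrite -iiZ; last by apply: intgB; exact: Bd_intg (Bd_Cn _).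
  by apply: eq_ii => x; rewrite CnB CnD; field.
by rewrite !ii_Cnp_delta subr_eq0 addr_eq0 mulrC.
Qed.

Definition zsum (N : nat) (F : int -> R) : R :=
  F 0 + \sum_(0 <= n < N) (F n.+1%:Z + F (- n.+1%:Z)).

Lemma zsumS N F : zsum N.+1 F = zsum N F + (F N.+1%:Z + F (- N.+1%:Z)).
Proof. by rewrite /zsum big_nat_recr//= addrA. Qed.

Lemma eq_zsum N F G : F =1 G -> zsum N F = zsum N G.
Proof. by move=> /funext ->. Qed.

Lemma zsumD N F G : zsum N (fun n => F n + G n) = zsum N F + zsum N G.
Proof. by elim: N => [|N ih]; [rewrite /zsum !big_nil; ring|rewrite !zsumS ih; ring]. Qed.

Lemma zsumZ N k F : zsum N (fun n => k * F n) = k * zsum N F.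
Proof. by elim: N => [|N ih]; [rewrite /zsum !big_nil; ring|rewrite !zsumS ih; ring]. Qed.

Lemma zsumB N F G : zsum N (fun n => F n - G n) = zsum N F - zsum N G.
Proof. by elim: N => [|N ih]; [rewrite /zsum !big_nil; ring|rewrite !zsumS ih; ring]. Qed.

Lemma zsum_le N F G : (forall n, F n <= G n) -> zsum N F <= zsum N G.
Proof.
by move=> h; rewrite /zsum lerD// ler_sum// => i _; rewrite lerD.
Qed.

Lemma zsum_norm N F : `|zsum N F| <= zsum N (fun n => `|F n|).
Proof.
elim: N => [|N ih]; first by rewrite /zsum !big_nil !addr0.
rewrite !zsumS (le_trans (ler_normD _ _))// lerD//; exact: ler_normD.
Qed.

Lemma zsum_ge0 N F : (forall n, 0 <= F n) -> 0 <= zsum N F.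
Proof. by move=> h; rewrite /zsum addr_ge0// sumr_ge0// => i _; rewrite addr_ge0. Qed.

Lemma zsumN N F : zsum N (fun n => F (- n)) = zsum N F.
Proof.
rewrite /zsum oppr0; congr (_ + _); apply: eq_bigr => i _; by rewrite opprK addrC.
Qed.

Lemma zsum_sum N I (s : seq I) (F : I -> int -> R) :
  zsum N (fun n => \sum_(i <- s) F i n) = \sum_(i <- s) zsum N (F i).
Proof.
elim: s => [|i s ih].
  rewrite big_nil /zsum big_nil big1 ?addr0// => i _; by rewrite !big_nil addr0.
by rewrite big_cons -ih -zsumD; apply: eq_zsum => n; rewrite big_cons.
Qed.

(** Counting the pairs with a given difference: the passage from the square of a sum to Cesaro
    means. *)
Lemma dsum_zsum N (y : int -> R) :
  \sum_(0 <= j < N) \sum_(0 <= k < N) y (j%:Z - k%:Z) = \sum_(0 <= M < N) zsum M y.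
Proof.
elim: N => [|N ih]; first by rewrite !big_nil.
rewrite [RHS]big_nat_recr//= -ih big_nat_recr//=.
under eq_bigr do rewrite big_nat_recr//=.
rewrite big_split /= big_nat_recr//= subrr.
have -> : \sum_(0 <= i < N) y (i%:Z - N%:Z) = \sum_(0 <= i < N) y (- i.+1%:Z).
  rewrite big_nat_rev/= add0n; apply: eq_big_nat => i /andP[_ iN]; congr y.
  by rewrite -subzn//; ring.
have -> : \sum_(0 <= i < N) y (N%:Z - i%:Z) = \sum_(0 <= i < N) y i.+1%:Z.
  rewrite big_nat_rev/= add0n; apply: eq_big_nat => i /andP[_ iN]; congr y.
  by rewrite -subzn//; ring.
by rewrite /zsum big_split /=; ring.
Qed.

Lemma zsum_fun_L2p N (F : int -> R -> R) : (forall n, L2p (F n)) -> L2p (fun x => zsum N (F^~ x)).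
Proof.
move=> h; elim: N => [|N ih].
  by apply: eq_L2 (h 0) => x; rewrite /zsum big_nil addr0.
by apply: eq_L2 (L2pD ih (L2pD (h N.+1%:Z) (h (- N.+1%:Z)))) => x; rewrite zsumS.
Qed.

Lemma zsum_fun_Bd N (F : int -> R -> R) : (forall n, Bd (F n)) -> Bd (fun x => zsum N (F^~ x)).
Proof.
move=> h; elim: N => [|N ih].
  by have := h 0; congr Bd; apply/funext => x; rewrite /zsum big_nil addr0.
by have := BdD ih (BdD (h N.+1%:Z) (h (- N.+1%:Z))); congr Bd; apply/funext => x; rewrite zsumS.
Qed.

Lemma ipp_zsum N (F : int -> R -> R) h : (forall n, L2p (F n)) -> L2p h ->
  ipp (fun x => zsum N (F^~ x)) h = zsum N (fun n => ipp (F n) h).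
Proof.
move=> LF Lh; elim: N => [|N ih].
  by rewrite /zsum big_nil addr0; apply: eq_ii => x; rewrite /zsum big_nil addr0.
rewrite zsumS -ih -ippDl// -ippDl//; [|exact: zsum_fun_L2p|exact: L2pD].
by apply: eq_ii => x; rewrite zsumS.
Qed.

(** Partial sums of the Fourier series; [sg] are their Cesaro means. *)
Definition Sm (M : nat) f (x : R) : R := zsum M (fun n => al f n * Cn n x + be f n * Sn n x).
Definition sg (N : nat) f (x : R) : R := N%:R^-1 * \sum_(0 <= M < N) Sm M f x.

Lemma Sm_Bd M f : Bd (Sm M f).
Proof. by apply: zsum_fun_Bd => n; apply: BdD; apply: BdZ; [exact: Bd_Cn|exact: Bd_Sn]. Qed.

Lemma sg_Bd N f : Bd (sg N f).
Proof. by apply: BdZ; apply: Bd_sum => M; exact: Sm_Bd. Qed.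

Lemma ipp_Sm M f h : L2p h -> ipp (Sm M f) h = zsum M (fun n => al f n * al h n + be f n * be h n).
Proof.
move=> Lh; rewrite (ipp_zsum _ (F := fun n x => al f n * Cn n x + be f n * Sn n x))//; last first.
  by move=> n; apply: L2pD; apply: L2pZ; [exact: L2p_Cn|exact: L2p_Sn].
apply: eq_zsum => n; rewrite ippDl//; [|exact: L2pZ (L2p_Cn _)|exact: L2pZ (L2p_Sn _)].
rewrite ippZl; [|exact: L2p_Cn|by []]; rewrite ippZl; [|exact: L2p_Sn|by []].
by rewrite [ipp (Cn n) h]ippC [ipp (Sn n) h]ippC.
Qed.

Lemma K_cont N : continuous (@K R N).
Proof.
have hs (F F' : nat -> R -> R) : (forall k, dv (F k) (F' k)) -> continuous (fun t => \sum_(0 <= k < N) F k t).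
  by move=> h; apply: dv_cont (dv_sum _ _ h).
have hc := hs _ _ (fun k => dv_comp dv_cos (dvZ k%:R dv_id)).
have hn := hs _ _ (fun k => dv_comp dv_sin (dvZ k%:R dv_id)).
move=> t; rewrite /K; apply: cvgD; rewrite expr2; apply: cvgM; (try exact: hc); exact: hn.
Qed.

Lemma K_le N t : K N t <= 2 * N%:R ^+ 2 :> R.
Proof.
have b (F : nat -> R) : (forall k, `|F k| <= 1) -> (\sum_(0 <= k < N) F k) ^+ 2 <= N%:R ^+ 2.
  move=> h; rewrite -(real_normK (num_real (\sum_(0 <= k < N) _))) lerXn2r ?nnegrE//.
  apply: le_trans (ler_norm_sum _ _ _) _.
  apply: le_trans (ler_sum _ (fun i _ => h i)) _.
  by rewrite sumr_const_nat subn0.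
rewrite mulr2n mulrDl mul1r; apply: lerD; apply: b => k; rewrite ler_norml.
  by rewrite cos_geN1 cos_le1.
by rewrite sin_geN1 sin_le1.
Qed.

Lemma Bd_K N x : Bd (fun y => K N (th x - th y)).
Proof.
split; last by exists (2 * N%:R ^+ 2) => y; rewrite ger0_norm ?K_ge0 ?K_le.
apply: cont_meas => y; apply: continuous_cvg; first exact: K_cont.
by apply: cvgB; [exact: cvg_cst|exact: th_cont].
Qed.

(** The Cesaro means are convolutions with the nonnegative Fejer kernel. *)
Lemma sgE N f x : L2p f -> (0 < N)%N ->
  N%:R * sg N f x = ipp f (fun y => K N (th x - th y)).
Proof.
move=> Lf N0; rewrite /sg mulrA mulfV ?mul1r ?pnatr_eq0 -?lt0n//.
have e y : K N (th x - th y) = \sum_(0 <= M < N) zsum M (fun n => Cn n x * Cn n y + Sn n x * Sn n y).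
  rewrite KE -dsum_zsum; apply: eq_bigr => j _; apply: eq_bigr => k _.
  by rewrite /Cn /Sn mulrBr cosB.
rewrite ippC; transitivity (ipp (fun y => \sum_(0 <= M < N) zsum M (fun n => Cn n x * Cn n y + Sn n x * Sn n y)) f);
  last by apply: eq_ii => y; rewrite e.
have Lt n : L2p (fun y => Cn n x * Cn n y + Sn n x * Sn n y).
  by apply: L2pD; apply: L2pZ; [exact: L2p_Cn|exact: L2p_Sn].
rewrite ipp_suml//; last by move=> M; exact: zsum_fun_L2p.
apply: eq_bigr => M _; rewrite ipp_zsum//; apply: eq_zsum => n.
rewrite ippDl//; [|exact: L2pZ (L2p_Cn _)|exact: L2pZ (L2p_Sn _)].
rewrite ippZl; [|exact: L2p_Cn|by []]; rewrite ippZl; [|exact: L2p_Sn|by []].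
rewrite [ipp (Cn n) f]ippC [ipp (Sn n) f]ippC.
by rewrite -/(al f n) -/(be f n); ring.
Qed.

Lemma ii_Kp N x : (0 < N)%N -> ii mu (fun y => K N (th x - th y) * p y) = N%:R :> R.
Proof.
move=> N0; have := @sgE N (fun=> 1) x (Bd_L2p (Bd_cst 1)) N0.
have -> : sg N (fun=> 1) x = 1.
  rewrite /sg (eq_bigr (fun=> 1)); last first.
    move=> M _; rewrite /Sm; transitivity (zsum M (fun n => (n == 0)%:R)).
      apply: eq_zsum => n.
      have -> : al (fun=> 1) n = (n == 0)%:R.
        rewrite -[RHS]ii_Cnp_delta; apply: eq_ii => y; by rewrite mul1r.
      have -> : be (fun=> 1) n = 0.
        rewrite -[RHS](ii_Snp n); apply: eq_ii => y; by rewrite mul1r.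
      by rewrite mul0r addr0; case: eqP => [->|_]; rewrite ?Cn0 ?mulr1 ?mul0r.
    by rewrite /zsum big1 ?addr0// => i _; rewrite oppr_eq0 addr0.
  by rewrite sumr_const_nat subn0 mulVf// pnatr_eq0 -lt0n.
by rewrite mulr1 => ->; apply: eq_ii => y; rewrite mul1r.
Qed.

Lemma sg_bound N f M : L2p f -> (0 < N)%N -> (forall x, `|f x| <= M) -> forall x, `|sg N f x| <= M.
Proof.
move=> Lf N0 fM x; have N0' : 0 < N%:R :> R by rewrite ltr0n.
rewrite -(ler_pM2l N0') -{1}(gtr0_norm N0') -normrM sgE//.
apply: le_trans (ler_norm_ii (L2p_intgM Lf (Bd_L2p (Bd_K N x)))) _.
rewrite mulrC -(ii_Kp x N0) -iiZ; last exact: Bd_intg (Bd_K N x).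
apply: le_ii.
- exact: intg_norm (L2p_intgM Lf (Bd_L2p (Bd_K N x))).
- by apply: intgZ; exact: Bd_intg (Bd_K N x).
move=> y; rewrite !normrM (ger0_norm (K_ge0 _ _)) (ger0_norm (p_ge0 _)) -mulrA.
by rewrite ler_wpM2r// mulr_ge0 ?K_ge0 ?p_ge0.
Qed.

End Coefficients.

(** * The Gagliardo energy *)
Section Gagliardo.
Context {R : realType}.
Notation mu := (leb R).
Notation mu2 := (leb R \x leb R)%E.
Implicit Types f g h phi : R -> R.

Definition sqnp f : R := ipp f f.

Lemma sqnp_ge0 f : 0 <= sqnp f.
Proof. by apply: ii_ge0 => x; rewrite mulr_ge0 ?p_ge0// -expr2 sqr_ge0. Qed.

Lemma sqnpE f : sqnp f = sqn mu (fun x => f x * q x).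
Proof. by rewrite /sqnp ippE ipff. Qed.

Lemma ipp_CS f g : L2p f -> L2p g -> ipp f g ^+ 2 <= sqnp f * sqnp g.
Proof. by move=> Lf Lg; rewrite !sqnpE ippE; exact: ip_CS. Qed.

(** The function whose [L^2] norm over the plane is the Gagliardo seminorm. *)
Definition dquot f (z : R * R) : R := (f z.1 - f z.2) / (z.1 - z.2).
Definition fin_energy f := L2 mu2 (dquot f).
Definition genergy f : R := sqn mu2 (dquot f).
Definition energy_form f g : R := ip mu2 (dquot f) (dquot g).

Lemma meas_fst f : measurable_fun setT f ->
  measurable_fun [set: plane R] (fun z => f z.1).
Proof. by move=> mf; exact: (measurableT_comp (f := f : measurableTypeR R -> R) mf measurable_fst). Qed.

Lemma meas_snd f : measurable_fun setT f ->
  measurable_fun [set: plane R] (fun z => f z.2).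
Proof. by move=> mf; exact: (measurableT_comp (f := f : measurableTypeR R -> R) mf measurable_snd). Qed.

Lemma midR : measurable_fun setT (fun x : R => x). Proof. by meas. Qed.

Lemma dquot_meas f : measurable_fun setT f -> measurable_fun [set: plane R] (dquot f).
Proof.
move=> mf; apply: measurable_funM.
  by apply: measurable_funB; [exact: meas_fst|exact: meas_snd].
apply: (measurableT_comp (f := fun x : R => x^-1) measurable_invr).
by apply: measurable_funB; [exact: (meas_fst midR)|exact: (meas_snd midR)].
Qed.

Lemma dquotD f g z : dquot (fun x => f x + g x) z = dquot f z + dquot g z.
Proof. by rewrite /dquot -mulrDl; congr (_ * _); ring. Qed.

Lemma dquotZ k f z : dquot (fun x => k * f x) z = k * dquot f z.
Proof. by rewrite /dquot mulrA; congr (_ * _); ring. Qed.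

Lemma dquotB f g z : dquot (fun x => f x - g x) z = dquot f z - dquot g z.
Proof. by rewrite /dquot -mulrBl; congr (_ * _); ring. Qed.

Lemma fin_energyD f g : fin_energy f -> fin_energy g -> fin_energy (fun x => f x + g x).
Proof. by move=> Lf Lg; apply: eq_L2 (L2D Lf Lg) => z; rewrite dquotD. Qed.

Lemma fin_energyZ k f : fin_energy f -> fin_energy (fun x => k * f x).
Proof. by move=> Lf; apply: eq_L2 (L2Z k Lf) => z; rewrite dquotZ. Qed.

Lemma fin_energyB f g : fin_energy f -> fin_energy g -> fin_energy (fun x => f x - g x).
Proof. by move=> Lf Lg; apply: eq_L2 (L2B Lf Lg) => z; rewrite dquotB. Qed.

Lemma fin_energy_cst c : fin_energy (fun=> c).
Proof. by apply: eq_L2 (L2_0 mu2) => z; rewrite /dquot subrr mul0r. Qed.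

Lemma fin_energy_sum I (s : seq I) (P : pred I) (F : I -> R -> R) :
  (forall i, fin_energy (F i)) -> fin_energy (fun x => \sum_(i <- s | P i) F i x).
Proof.
move=> h; elim: s => [|i s ih].
  by under eq_fun do rewrite big_nil; exact: (fin_energy_cst 0).
case: (boolP (P i)) => Pi; last by under eq_fun do rewrite big_cons (negbTE Pi).
by under eq_fun do rewrite big_cons Pi; exact: (fin_energyD (h i) ih).
Qed.

Lemma intg_kp : intg mu2 (fun z => p z.1 * p z.2).
Proof. exact: (intg_prodM (intg_p (R := R)) (intg_p (R := R))). Qed.

Lemma intg_bkp (H : R * R -> R) M : measurable_fun [set: plane R] H ->
  (forall z, `|H z| <= M) -> intg mu2 (fun z => H z * (p z.1 * p z.2)).
Proof.
move=> mH hM; apply: (@intg_le _ _ _ mu2 _ (fun z => M * (p z.1 * p z.2))).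
- apply: measurable_funM => //; apply: measurable_funM; [exact: (meas_fst (p_meas (R:=R)))|exact: (meas_snd (p_meas (R:=R)))].
- by move=> z; rewrite normrM ler_pM// ger0_norm// mulr_ge0 ?p_ge0.
- by apply: intgZ; exact: intg_kp.
Qed.

Lemma fin_energy_kp f C : measurable_fun setT f -> (forall z, dquot f z ^+ 2 <= C * (p z.1 * p z.2)) -> fin_energy f.
Proof.
move=> mf h; split; first exact: dquot_meas.
apply: (@intg_le _ _ _ mu2 _ (fun z => C * (p z.1 * p z.2))).
- by apply: measurable_funX; exact: dquot_meas.
- by move=> z; rewrite ger0_norm ?sqr_ge0//; exact: h.
- by apply: intgZ; exact: intg_kp.
Qed.

Lemma KN N t : K N (- t) = K N t :> R.
Proof.
rewrite /K; congr (_ ^+ 2 + _); first by apply: eq_bigr => k _; rewrite mulrN cosN.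
rewrite -[RHS]sqrrN; congr (_ ^+ 2); rewrite -sumrN.
by apply: eq_bigr => k _; rewrite mulrN sinN.
Qed.

Lemma mK2 N : measurable_fun [set: plane R] (fun z => K N (th z.1 - th z.2)).
Proof.
apply: (measurableT_comp (f := @K R N)); first by apply: cont_meas; exact: K_cont.
apply: measurable_funB; [apply: meas_fst|apply: meas_snd]; apply: cont_meas; exact: th_cont.
Qed.

(** By [chord] and [K_mul] the singular kernel [1 / (x - y)^2], damped by [2 - 2 cos (N t)], is
    the Fejer kernel. *)
Lemma dquot_K f N z : dquot f z ^+ 2 * ((2 - 2 * cos (N%:R * (th z.1 - th z.2))) / (4 * pi ^+ 2)) =
  (f z.1 - f z.2) ^+ 2 * K N (th z.1 - th z.2) * (p z.1 * p z.2).
Proof.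
case: z => x y /=; rewrite -K_mul chord /dquot /=.
have [->|xy] := eqVneq x y; first by rewrite !subrr !mul0r expr0n !mul0r.
have xy' : x - y != 0 by rewrite subr_eq0.
have := @pi_neq0 R; move: (pi : R) => P P0; field.
by rewrite P0.
Qed.

(** Expand the square: the kernel has mass [N] in each variable, and the cross term is a Fejer
    mean. *)
Lemma energyN f N : Bd f -> (0 < N)%N ->
  intg mu2 (fun z => (f z.1 - f z.2) ^+ 2 * K N (th z.1 - th z.2) * (p z.1 * p z.2)) /\
  ii mu2 (fun z => (f z.1 - f z.2) ^+ 2 * K N (th z.1 - th z.2) * (p z.1 * p z.2)) =
    2 * (N%:R * sqnp f - ipp f (fun x => N%:R * sg N f x)).
Proof.
move=> bf N0; have [mf [M hM]] := bf; have Lf := Bd_L2p bf.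
have M0 : 0 <= M by exact: le_trans (hM 0).
have kb t : `|K N t| <= 2 * N%:R ^+ 2 :> R by rewrite ger0_norm ?K_ge0 ?K_le.
have m1 := meas_fst mf; have m2 := meas_snd mf; have mK := mK2 N.
have I1 : intg mu2 (fun z => f z.1 ^+ 2 * K N (th z.1 - th z.2) * (p z.1 * p z.2)).
  apply: (@intg_bkp _ (M ^+ 2 * (2 * N%:R ^+ 2))); first by apply: measurable_funM => //; exact: measurable_funX.
  by move=> z; rewrite normrM ler_pM// normrX lerXn2r ?nnegrE.
have I2 : intg mu2 (fun z => f z.2 ^+ 2 * K N (th z.1 - th z.2) * (p z.1 * p z.2)).
  apply: (@intg_bkp _ (M ^+ 2 * (2 * N%:R ^+ 2))); first by apply: measurable_funM => //; exact: measurable_funX.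
  by move=> z; rewrite normrM ler_pM// normrX lerXn2r ?nnegrE.
have I3 : intg mu2 (fun z => f z.1 * f z.2 * K N (th z.1 - th z.2) * (p z.1 * p z.2)).
  apply: (@intg_bkp _ (M * M * (2 * N%:R ^+ 2))); first by apply: measurable_funM => //; exact: measurable_funM.
  by move=> z; rewrite !normrM !ler_pM// mulr_ge0.
have e1 : ii mu2 (fun z => f z.1 ^+ 2 * K N (th z.1 - th z.2) * (p z.1 * p z.2)) = N%:R * sqnp f.
  rewrite (fubini12 I1).2 /sqnp /ipp -iiZ; last exact: L2p_intgM.
  apply: eq_ii => x /=; rewrite -(ii_Kp x N0) -iiZr; last exact: Bd_intg (Bd_K N x).
  by apply: eq_ii => y; ring.
have e2 : ii mu2 (fun z => f z.2 ^+ 2 * K N (th z.1 - th z.2) * (p z.1 * p z.2)) = N%:R * sqnp f.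
  rewrite (fubini21 I2).2 /sqnp /ipp -iiZ; last exact: L2p_intgM.
  apply: eq_ii => x /=; rewrite -(ii_Kp x N0) -iiZr; last exact: Bd_intg (Bd_K N x).
  by apply: eq_ii => y; rewrite -KN opprB; ring.
have e3 : ii mu2 (fun z => f z.1 * f z.2 * K N (th z.1 - th z.2) * (p z.1 * p z.2)) =
    ipp f (fun x => N%:R * sg N f x).
  rewrite (fubini12 I3).2 /ipp; apply: eq_ii => x /=; rewrite sgE// /ipp.
  rewrite -mulrA [ii _ _ * p x]mulrC mulrA -iiZ; last exact: L2p_intgM Lf (Bd_L2p (Bd_K N x)).
  by apply: eq_ii => y; ring.
have I12 := intgB (intgD I1 I2) (intgZ 2 I3).
have E z : (f z.1 ^+ 2 * K N (th z.1 - th z.2) * (p z.1 * p z.2) +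
      f z.2 ^+ 2 * K N (th z.1 - th z.2) * (p z.1 * p z.2)) -
    2 * (f z.1 * f z.2 * K N (th z.1 - th z.2) * (p z.1 * p z.2)) =
  (f z.1 - f z.2) ^+ 2 * K N (th z.1 - th z.2) * (p z.1 * p z.2) by ring.
split; first by apply: eq_intg I12 => z; exact: E.
transitivity (ii mu2 (fun z => (f z.1 ^+ 2 * K N (th z.1 - th z.2) * (p z.1 * p z.2) +
      f z.2 ^+ 2 * K N (th z.1 - th z.2) * (p z.1 * p z.2)) -
    2 * (f z.1 * f z.2 * K N (th z.1 - th z.2) * (p z.1 * p z.2)))).
  by apply: eq_ii => z; exact: esym (E z).
rewrite iiB; [|exact: intgD|exact: intgZ].
by rewrite iiD// iiZ// e1 e2 e3; ring.
Qed.

Definition coef2 f (n : int) : R := al f n ^+ 2 + be f n ^+ 2.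

Lemma coef2_ge0 f n : 0 <= coef2 f n. Proof. by rewrite addr_ge0 ?sqr_ge0. Qed.

Lemma ipp_sg f N : L2p f -> (0 < N)%N ->
  ipp f (fun x => N%:R * sg N f x) = \sum_(0 <= M < N) zsum M (coef2 f).
Proof.
move=> Lf N0; rewrite ippC.
rewrite (_ : (fun x => N%:R * sg N f x) = (fun x => \sum_(0 <= M < N) Sm M f x)); last first.
  by apply/funext => x; rewrite /sg mulrA mulfV ?mul1r// pnatr_eq0 -lt0n.
rewrite ipp_suml//; last by move=> M; exact: Bd_L2p (Sm_Bd M f).
by apply: eq_bigr => M _; rewrite ipp_Sm//; apply: eq_zsum => n; rewrite /coef2 !expr2.
Qed.

(** Cauchy-Schwarz against the probability density [K / N]. *)
Lemma sg_dist f N : Bd f -> (0 < N)%N ->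
  N%:R * sqnp (fun x => sg N f x - f x) <= 2 * (N%:R * sqnp f - ipp f (fun x => N%:R * sg N f x)).
Proof.
move=> bf N0; have [mf [M hM]] := bf; have Lf := Bd_L2p bf.
have N0' : 0 < N%:R :> R by rewrite ltr0n.
have [I <-] := energyN bf N0.
have [Ix ->] := fubini12 I.
have bd : Bd (fun x => sg N f x - f x) by apply: BdB => //; exact: sg_Bd.
have LK x : L2 mu (fun y => Num.sqrt (K N (th x - th y)) * q y).
  have mKx : measurable_fun setT (fun y => K N (th x - th y)) by case: (Bd_K N x).
  have msq : measurable_fun setT (@Num.sqrt R) by apply: cont_meas; exact: sqrt_continuous.
  split; first by apply: measurable_funM; [exact: (measurableT_comp msq mKx)|exact: q_meas].
  apply: eq_intg (Bd_intg (Bd_K N x)) => y.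
  by rewrite exprMn sqr_sqrtr ?K_ge0// q_sqr.
have bfx x : Bd (fun y => f y - f x) by apply: BdB => //; exact: Bd_cst.
have LF x : L2 mu (fun y => (f y - f x) * (Num.sqrt (K N (th x - th y)) * q y)).
  by have [mb [Mx hMx]] := bfx x; exact: (@L2_bddM _ _ _ mu (fun y => f y - f x) _ Mx mb hMx (LK x)).
have key x : N%:R * (sg N f x - f x) ^+ 2 <= ii mu (fun y => (f x - f y) ^+ 2 * K N (th x - th y) * p y).
  have h1 : N%:R * (sg N f x - f x) = ip mu (fun y => (f y - f x) * (Num.sqrt (K N (th x - th y)) * q y))
      (fun y => Num.sqrt (K N (th x - th y)) * q y).
    rewrite mulrBr sgE// -(ii_Kp x N0) -iiZr; last exact: Bd_intg (Bd_K N x).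
    rewrite /ipp -iiB; [|exact: L2p_intgM Lf (Bd_L2p (Bd_K N x))|exact: intgZr (Bd_intg (Bd_K N x))].
    apply: eq_ii => y; rewrite (_ : _ * _ * (_ * _) = (f y - f x) * (Num.sqrt (K N (th x - th y)) ^+ 2 * q y ^+ 2)); last by ring.
    by rewrite sqr_sqrtr ?K_ge0// q_sqr; ring.
  have := ip_CS (LF x) (LK x); rewrite -h1 => h2.
  have e2 : sqn mu (fun y => Num.sqrt (K N (th x - th y)) * q y) = N%:R.
    rewrite -(ii_Kp x N0); apply: eq_ii => y; by rewrite exprMn sqr_sqrtr ?K_ge0// q_sqr.
  have e1 : sqn mu (fun y => (f y - f x) * (Num.sqrt (K N (th x - th y)) * q y)) =
      ii mu (fun y => (f x - f y) ^+ 2 * K N (th x - th y) * p y).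
    apply: eq_ii => y; rewrite !exprMn sqr_sqrtr ?K_ge0// q_sqr mulrA; congr (_ * _ * _).
    by rewrite -sqrrN opprB.
  by rewrite -(ler_pM2l N0') mulrA -expr2 -exprMn -[leRHS]mulrC -{2}e2 -e1.
rewrite /sqnp /ipp -iiZ; last exact: L2p_intgM (Bd_L2p bd) (Bd_L2p bd).
apply: le_ii => //; first by apply: intgZ; exact: L2p_intgM (Bd_L2p bd) (Bd_L2p bd).
move=> x; rewrite -expr2 mulrA.
apply: le_trans (ler_wpM2r (p_ge0 x) (key x)) _.
apply: le_of_eq; rewrite -iiZr; last first.
  have := LF x => -[_]; apply: eq_intg => y.
  by rewrite !exprMn sqr_sqrtr ?K_ge0// q_sqr mulrA -sqrrN opprB.
by apply: eq_ii => y /=; ring.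
Qed.

Lemma two_cos_le4 (t : R) : 0 <= 2 - 2 * cos t <= 4.
Proof. by have := cos_geN1 t; have := cos_le1 t; lra. Qed.

Lemma energyN_le f N : Bd f -> fin_energy f -> (0 < N)%N ->
  2 * (N%:R * sqnp f - ipp f (fun x => N%:R * sg N f x)) <= genergy f / pi ^+ 2.
Proof.
move=> bf [mG iG] N0; have [I <-] := energyN bf N0.
rewrite mulrC -iiZ//; apply: le_ii => //; first exact: intgZ.
move=> z; rewrite -dquot_K mulrC ler_wpM2r ?sqr_ge0//.
rewrite ler_pdivrMr ?mulr_gt0 ?exprn_gt0 ?pi_gt0//.
rewrite (_ : (pi ^+ 2)^-1 * (4 * pi ^+ 2) = 4).
  by have /andP[] := two_cos_le4 (N%:R * (th z.1 - th z.2)).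
have := @pi_neq0 R; move: (pi : R) => P P0; field.
by rewrite P0.
Qed.

(** Finite energy bounds the left side of [energyN] uniformly in [N], so the Fejer means
    converge at the rate [1/N]. *)
Lemma sg_cvg f : Bd f -> fin_energy f -> sqnp (fun x => sg N.+1 f x - f x) @[N --> \oo] --> 0.
Proof.
move=> bf gf.
apply: (@squeeze_cvgr _ _ _ _ (fun=> 0) (fun N : nat => (genergy f / pi ^+ 2) * N.+1%:R^-1)).
- apply: nearW => N; rewrite sqnp_ge0 /= ler_pdivlMr ?ltr0Sn// mulrC.
  exact: le_trans (sg_dist bf (ltn0Sn N)) (energyN_le bf gf (ltn0Sn N)).
- exact: cvg_cst.
- rewrite -(mulr0 (genergy f / pi ^+ 2)); apply: cvgM; [exact: cvg_cst|exact: cvg_harmonic].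
Qed.

(** Near the diagonal use the mean value theorem, away from it the decay of [f]; both bounds are
    dominated by [p x * p y]. *)
Lemma fin_energy_decay f f' M : dv f f' -> (forall x, `|f x| <= M * p x) -> (forall x, `|f' x| <= M * p x) -> fin_energy f.
Proof.
move=> df hf hf'.
have cf := dv_cont df.
have M0 : 0 <= M by have := hf 0; have := p_gt0 (0 : R); have := normr_ge0 (f 0); nra.
have pE (x : R) : p x * (1 + x ^+ 2) = pi^-1.
  by rewrite /p invfM -mulrA mulVf ?mulr1// gt_eqF ?sqr1_gt0.
have pcomp (x y : R) : `|x - y| <= 1 -> p x <= 3 * p y.
  move=> xy; rewrite /p -[3]invrK -invfM lef_pV2 ?posrE ?mulr_gt0 ?pi_gt0 ?sqr1_gt0 ?invr_gt0//.
  rewrite mulrCA ler_pM2l ?pi_gt0// ler_pdivrMl//.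
  have : (x - y) ^+ 2 <= 1 by rewrite -(real_normK (num_real _)) expr_le1.
  have := sqr_ge0 (x + (x - y)); nra.
apply: (@fin_energy_kp _ (18 * M ^+ 2 + 16 * M ^+ 2)); first exact: cont_meas.
case=> x y; rewrite /dquot /=.
have [->|xy] := eqVneq x y; first by rewrite !subrr mul0r expr0n /=; have := p_ge0 y; nra.
have d2 : 0 < (x - y) ^+ 2 by rewrite exprn_even_gt0//= subr_eq0.
rewrite expr_div_n ler_pdivrMr//.
have px := p_gt0 x; have py := p_gt0 y.
have [near|far] := lerP `|x - y| 1.
  have [c hc e] : exists2 c, `|x - c| <= 1 /\ `|y - c| <= 1 & f x - f y = f' c * (x - y).
    have mvt (a b : R) : a < b -> exists2 c, a < c < b & f b - f a = f' c * (b - a).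
      move=> ab; have [c] := @MVT R f f' a b ab (fun x _ => df x) (continuous_subspaceT cf).
      by rewrite in_itv /= => hc e; exists c.
    move: near; rewrite ler_norml => /andP[n1 n2].
    case: (ltgtP x y) xy => // xy _.
      have [c /andP[c1 c2] e] := mvt _ _ xy; exists c; first by rewrite !ler_norml; split; lra.
      by rewrite -opprB e; ring.
    have [c /andP[c1 c2] e] := mvt _ _ xy; exists c => //.
    by rewrite !ler_norml; split; lra.
  rewrite e exprMn ler_wpM2r ?(ltW d2)//.
  have h1 : `|f' c| <= M * (3 * p x).
    apply: le_trans (hf' c) _; rewrite ler_wpM2l//; apply: pcomp; rewrite distrC; by case: hc.
  have h2 : `|f' c| <= M * (3 * p y).
    apply: le_trans (hf' c) _; rewrite ler_wpM2l//; apply: pcomp; rewrite distrC; by case: hc.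
  rewrite -(real_normK (num_real (f' c))) expr2.
  apply: le_trans (ler_pM _ _ h1 h2) _ => //.
  rewrite (_ : M * (3 * p x) * (M * (3 * p y)) = 9 * M ^+ 2 * (p x * p y)); last by ring.
  rewrite ler_wpM2r ?mulr_ge0 ?(ltW px) ?(ltW py)//; have := sqr_ge0 M; lra.
have far2 : 1 <= (x - y) ^+ 2 by rewrite -(real_normK (num_real _)) expr_ge1// ltW.
have pp (a b : R) : 1 <= (a - b) ^+ 2 -> p a <= 4 * p b * (a - b) ^+ 2.
  move=> ab; have pa := p_gt0 a; have pb := p_gt0 b.
  have k : 1 + b ^+ 2 <= 4 * (a - b) ^+ 2 * (1 + a ^+ 2).
    have := sqr_ge0 (a + (a - b)); have := sqr_ge0 a; nra.
  rewrite -(ler_pM2r (sqr1_gt0 a)) pE.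
  rewrite -(ler_pM2r (sqr1_gt0 b)).
  rewrite (_ : 4 * p b * _ * (1 + a ^+ 2) * (1 + b ^+ 2) = (p b * (1 + b ^+ 2)) * (4 * (a - b) ^+ 2 * (1 + a ^+ 2))); last by ring.
  by rewrite pE ler_pM2l// invr_gt0 pi_gt0.
apply: (@le_trans _ _ (2 * (M * p x) ^+ 2 + 2 * (M * p y) ^+ 2)).
  have hx := hf x; have hy := hf y.
  have : f x ^+ 2 <= (M * p x) ^+ 2 by rewrite -(real_normK (num_real (f x))) lerXn2r ?nnegrE// mulr_ge0// ltW.
  have : f y ^+ 2 <= (M * p y) ^+ 2 by rewrite -(real_normK (num_real (f y))) lerXn2r ?nnegrE// mulr_ge0// ltW.
  have := sqr_ge0 (f x + f y); lra.
have h1 : p x ^+ 2 <= 4 * (p x * p y) * (x - y) ^+ 2.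
  by rewrite expr2 (_ : 4 * (p x * p y) * _ = p x * (4 * p y * (x - y) ^+ 2)); [rewrite ler_pM2l// pp|ring].
have h2 : p y ^+ 2 <= 4 * (p x * p y) * (x - y) ^+ 2.
  rewrite expr2 (_ : 4 * (p x * p y) * _ = p y * (4 * p x * (y - x) ^+ 2)); last by ring.
  by rewrite ler_pM2l// pp// -sqrrN opprB.
rewrite !exprMn.
have : M ^+ 2 * p x ^+ 2 <= M ^+ 2 * (4 * (p x * p y) * (x - y) ^+ 2) by rewrite ler_wpM2l ?sqr_ge0.
have : M ^+ 2 * p y ^+ 2 <= M ^+ 2 * (4 * (p x * p y) * (x - y) ^+ 2) by rewrite ler_wpM2l ?sqr_ge0.
have : 0 <= M ^+ 2 * (p x * p y) * (x - y) ^+ 2 by rewrite mulr_ge0 ?sqr_ge0// mulr_ge0 ?sqr_ge0// mulr_ge0// ltW.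
lra.
Qed.

Lemma test_supp phi : test_function phi -> exists2 A : R, 0 < A &
  forall n x, A < `|x| -> derive1n n phi x = 0.
Proof.
move=> [sphi cphi].
have [A [Ar hA]] := compact_bounded cphi.
pose B := `|A| + 1; have B0 : 0 < B by rewrite ltr_wpDl.
have hB x : B < `|x| -> phi x = 0.
  move=> Bx; apply/eqP; apply: contraT => px.
  have := hA B _ x (@subset_closure _ [set x | phi x != 0] x px); rewrite /B => /(_ _)/=.
  have h : A < `|A| + 1 by rewrite (le_lt_trans (ler_norm A))// ltrDl.
  by move=> /(_ h); rewrite leNgt -/B Bx.
exists B => // n; elim: n => [|n ih] x Bx; first exact: hB.
rewrite derive1nS derive1E (@near_eq_derive _ _ _ _ (fun=> 0)); first exact: derive_cst.
near=> y; apply: ih; near: y.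
apply: (@cvgr_gt _ _ _ _ (fun y : R => `|y|) `|x|) => //.
exact: norm_continuous.
Unshelve. all: by end_near. Qed.

Lemma test_bound phi n (g : R -> R) : test_function phi -> continuous g -> (forall x, 0 < g x) ->
  exists M, forall x, `|derive1n n phi x| <= M * g x.
Proof.
move=> tphi cg g0; have [A A0 hA] := test_supp tphi; have [sphi _] := tphi.
pose F x := `|derive1n n phi x| / g x.
have cF : continuous F.
  move=> x; apply: cvgM; last by apply: cvgV; [rewrite gt_eqF|exact: cg].
  have c := @smooth_cont _ _ (@smooth_derive1n _ _ n sphi); exact: (cvg_norm (c x)).
have lapc : - A <= A by lra.
have [c _ hc] := EVT_max lapc (continuous_subspaceT cF).
exists (F c) => x; rewrite -ler_pdivrMr// -/(F x).
have [xA|xA] := lerP `|x| A; first by apply: hc; rewrite in_itv /= -ler_norml.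
by rewrite /F hA// normr0 mul0r divr_ge0// ltW.
Qed.

Lemma test_Bd phi : test_function phi -> Bd phi.
Proof.
move=> tphi; split; first by apply: cont_meas; apply: smooth_cont; case: tphi.
have [M hM] := test_bound 0 tphi (fun x => @cvg_cst _ _ _ _ _) (fun _ => ltr01 (R := R)).
by exists M => x; have := hM x; rewrite mulr1.
Qed.

Lemma test_fin_energy phi : test_function phi -> fin_energy phi.
Proof.
move=> tphi; have [sphi _] := tphi.
have [M hM] := test_bound 0 tphi (@p_cont R) (@p_gt0 R).
have [M' hM'] := test_bound 1 tphi (@p_cont R) (@p_gt0 R).
apply: (@fin_energy_decay phi (derive1 phi) (Num.max M M')).
- exact: smooth_dv.
- by move=> x; apply: le_trans (hM x) _; rewrite ler_wpM2r ?p_ge0// le_max lexx.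
- by move=> x; apply: le_trans (hM' x) _; rewrite ler_wpM2r ?p_ge0// le_max lexx orbT.
Qed.

Lemma test_schwartz phi : test_function phi -> schwartz phi.
Proof.
move=> tphi; split; first by case: tphi.
move=> k n; have [A A0 hA] := test_supp tphi.
have [M hM] := test_bound n tphi (fun x => @cvg_cst _ _ _ _ _) (fun _ => ltr01 (R := R)).
have M0 : 0 <= M by have := hM 0; rewrite mulr1; exact: le_trans.
exists (A ^+ k * M) => x; have [xA|xA] := lerP `|x| A; last first.
  by rewrite hA// mulr0 normr0 mulr_ge0// exprn_ge0// ltW.
rewrite normrM normrX ler_pM ?exprn_ge0// ?lerXn2r ?nnegrE ?(ltW A0)//.
by have := hM x; rewrite mulr1.
Qed.

(** [h] is orthogonal to the Fejer means of test functions, hence to test functions. *)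
Lemma coef_unique h : L2p h -> (forall n, al h n = 0) -> (forall n, be h n = 0) ->
  {ae mu, forall x, h x = 0}.
Proof.
move=> Lh ah bh; have mh := L2p_meas Lh.
have key phi : test_function phi -> ipp h phi = 0.
  move=> tphi; have bphi := test_Bd tphi; have gphi := test_fin_energy tphi.
  have z N : ipp h (sg N phi) = 0.
    rewrite ippC /sg ippZl//; last by apply: Bd_L2p; apply: Bd_sum => M; exact: Sm_Bd.
    rewrite ipp_suml//; last by move=> M; exact: Bd_L2p (Sm_Bd _ _).
    rewrite big1 ?mulr0// => M _; rewrite ipp_Sm// /zsum ah bh !mulr0 addr0 add0r big1// => i _.
    by rewrite !ah !bh !mulr0 !addr0.
  have h1 N : ipp h phi ^+ 2 <= sqnp h * sqnp (fun x => sg N.+1 phi x - phi x).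
    have Ls : L2p (sg N.+1 phi) by exact: Bd_L2p (sg_Bd _ _).
    have Lp := Bd_L2p bphi.
    have := ipp_CS Lh (L2pB Ls Lp); rewrite ippC ippBl// ![ipp _ h]ippC z sub0r sqrrN; exact.
  apply/eqP; rewrite -sqrf_eq0 eq_le sqr_ge0 andbT.
  have : sqnp h * sqnp (fun x => sg N.+1 phi x - phi x) @[N --> \oo] --> sqnp h * 0.
    by apply: cvgM; [exact: cvg_cst|exact: sg_cvg].
  rewrite mulr0 => hc; apply: (@ler_cvg_to _ _ _ _ (fun=> ipp h phi ^+ 2) _ _ _ _ hc).
    exact: cvg_cst.
  by apply: nearW => N; exact: h1.
have : {ae mu, forall x, h x * p x = 0}.
  apply: ae0_of_test.
  - move=> a b ab; apply: (@intg_le _ _ _ mu _ (fun x => `|h x * 1 * p x|)).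
    + apply: measurable_funM; [apply: measurable_funM => //; exact: p_meas|].
      have c1 := @cst_cont R 1.
      have := intg_meas (ii_indic_itv c1 (ltW ab)).
      by congr measurable_fun; apply/funext => x; rewrite mul1r.
    + move=> x; rewrite mulr1 [leLHS]normrM ler_piMr//; by case: (_ <= _ <= _); rewrite ?normr1 ?normr0.
    + by apply: intg_norm; exact: L2p_intgM Lh (Bd_L2p (Bd_cst 1)).
  - by apply: measurable_funM => //; exact: p_meas.
  - move=> phi tphi; rewrite -[RHS](key phi tphi); apply: eq_ii => x; ring.
by apply: (@filterS _ _ (ae_filter_ringOfSetsType mu)) => x /eqP; rewrite mulf_eq0 (gt_eqF (p_gt0 x)) orbF => /eqP.
Qed.

End Gagliardo.

(** * Limits of inner products *)
Section LimitsInL2.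
Context {R : realType} d (T : measurableType d) (mu : {measure set T -> \bar R}).
Implicit Types f g : T -> R.

Lemma cvg_ip (F G : nat -> T -> R) f g : (forall n, L2 mu (F n)) -> (forall n, L2 mu (G n)) -> L2 mu f -> L2 mu g ->
  sqn mu (fun x => F n x - f x) @[n --> \oo] --> 0 -> sqn mu (fun x => G n x - g x) @[n --> \oo] --> 0 ->
  ip mu (F n) (G n) @[n --> \oo] --> ip mu f g.
Proof.
move=> LF LG Lf Lg hF hG.
have e n : ip mu (F n) (G n) - ip mu f g = ip mu (fun x => F n x - f x) (G n) + ip mu f (fun x => G n x - g x).
  by rewrite ipBl// ipBr//; ring.
have hs : Num.sqrt (sqn mu (fun x => F n x - f x)) @[n --> \oo] --> 0.
  have := @continuous_cvg _ _ _ _ _ _ (@Num.sqrt R) _ (@sqrt_continuous R _) hF.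
  by rewrite sqrtr0 => H; exact: H.
have hs' : Num.sqrt (sqn mu (fun x => G n x - g x)) @[n --> \oo] --> 0.
  have := @continuous_cvg _ _ _ _ _ _ (@Num.sqrt R) _ (@sqrt_continuous R _) hG.
  by rewrite sqrtr0 => H; exact: H.
have hb n : Num.sqrt (sqn mu (G n)) <= Num.sqrt (2 * sqn mu (fun x => G n x - g x) + 2 * sqn mu g).
  rewrite ler_wsqrtr//; have := sqnD_le (L2B (LG n) Lg) Lg.
  by rewrite (@eq_sqn _ _ _ mu (fun x => G n x - g x + g x) (G n)) // => x; rewrite subrK.
have hb' : Num.sqrt (2 * sqn mu (fun x => G n x - g x) + 2 * sqn mu g) @[n --> \oo] --> Num.sqrt (2 * 0 + 2 * sqn mu g).
  apply: (@continuous_cvg _ _ _ _ _ _ (@Num.sqrt R) _ (@sqrt_continuous R _)).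
  by apply: cvgD; [apply: cvgM hG; exact: cvg_cst|exact: cvg_cst].
suff h : ip mu (F n) (G n) - ip mu f g @[n --> \oo] --> 0 by exact/subr_cvg0.
apply/norm_cvg0P.
apply: (@squeeze_cvgr _ _ _ _ (fun=> 0) (fun n => Num.sqrt (sqn mu (fun x => F n x - f x)) *
    Num.sqrt (2 * sqn mu (fun x => G n x - g x) + 2 * sqn mu g) + Num.sqrt (sqn mu f) * Num.sqrt (sqn mu (fun x => G n x - g x)))).
- apply: nearW => n; rewrite normr_ge0 /= e (le_trans (ler_normD _ _))// lerD//; last exact: ip_le Lf (L2B (LG n) Lg).
  apply: le_trans (ip_le (L2B (LF n) Lf) (LG n)) _; rewrite ler_wpM2l ?sqrtr_ge0//.
- exact: cvg_cst.
- have := cvgD (cvgM hs hb') (cvgM (cvg_cst (Num.sqrt (sqn mu f))) hs').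
  by rewrite mul0r mulr0 addr0 => H; exact: H.
Qed.

Lemma cvg_sqn (F : nat -> T -> R) f : (forall n, L2 mu (F n)) -> L2 mu f ->
  sqn mu (fun x => F n x - f x) @[n --> \oo] --> 0 -> sqn mu (F n) @[n --> \oo] --> sqn mu f.
Proof. by move=> LF Lf h; have := cvg_ip LF LF Lf Lf h h; rewrite ipff; under eq_fun do rewrite ipff. Qed.

Lemma cvg_ipl (F : nat -> T -> R) f g : (forall n, L2 mu (F n)) -> L2 mu f -> L2 mu g ->
  sqn mu (fun x => F n x - f x) @[n --> \oo] --> 0 -> ip mu (F n) g @[n --> \oo] --> ip mu f g.
Proof.
move=> LF Lf Lg h; apply: (@cvg_ip F (fun=> g)) => //.
rewrite (_ : (fun n => _) = (fun=> 0)); first exact: cvg_cst.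
by apply/funext => n; rewrite -[RHS](ii0 mu); apply: eq_ii => x; rewrite subrr expr0n.
Qed.

End LimitsInL2.

(** * Completeness of the Fourier basis *)
Section FourierSeries.
Context {R : realType}.
Notation mu := (leb R).
Notation mu2 := (leb R \x leb R)%E.
Implicit Types (f g h : R -> R) (a b : int -> R) (M N : nat) (n : int).

Lemma ae_imp (P Q : R -> Prop) : (forall x, P x -> Q x) -> {ae mu, forall x, P x} -> {ae mu, forall x, Q x}.
Proof. by move=> PQ; apply: (@filterS _ _ (ae_filter_ringOfSetsType mu)). Qed.

Lemma cvg_bigsum (F : nat -> nat -> R) (l : nat -> R) N : (forall k, F k L @[L --> \oo] --> l k) ->
  \sum_(0 <= k < N) F k L @[L --> \oo] --> \sum_(0 <= k < N) l k.
Proof.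
move=> h; elim: N => [|N ih].
  rewrite big_nil (_ : (fun _ => _) = (fun=> 0)); first exact: cvg_cst.
  by apply/funext => L; rewrite big_nil.
rewrite big_nat_recr//= (_ : (fun _ => _) = (fun L => \sum_(0 <= k < N) F k L + F N L)).
  exact: cvgD.
by apply/funext => L; rewrite big_nat_recr.
Qed.

Lemma lim_ev (u : nat -> R) (l x : R) (k : nat) : u M @[M --> \oo] --> l -> (forall M, (k <= M)%N -> u M = x) -> l = x.
Proof.
move=> ul h; apply: (cvg_unique _ ul) => //; apply: cvg_near_cst.
by exists k => // M /= kM; exact: h.
Qed.

Lemma zsum_delta M n a : zsum M (fun k => a k * (n == k)%:R) = if (absz n <= M)%N then a n else 0.
Proof.
elim: M => [|M ih].
  rewrite /zsum big_nil addr0 leqn0 absz_eq0; case: eqP => [->|_]; by rewrite ?mulr1 ?mulr0.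
rewrite zsumS ih (leq_eqVlt _ M.+1) ltnS.
have [e|e] := eqVneq n M.+1%:Z.
  have ne : (M.+1%:Z == - M.+1%:Z) = false by [].
  by rewrite e ne absz_nat eqxx ltnn mulr0 addr0 mulr1 add0r.
have [e'|e'] := eqVneq n (- M.+1%:Z).
  by rewrite e' abszN absz_nat eqxx ltnn mulr0 mulr1 !add0r.
rewrite !mulr0 !addr0 (_ : (`|n|%N == M.+1) = false)//.
apply/negP => /eqP; case: n e e' {ih} => k /= h1 h2 e; first by rewrite e eqxx in h1.
by rewrite -e -NegzE eqxx in h2.
Qed.

Definition evenz a := forall n, a (- n) = a n.
Definition oddz b := forall n, b (- n) = - b n.

Lemma al_even f : evenz (al f). Proof. by move=> n; exact: alN. Qed.
Lemma be_odd f : L2p f -> oddz (be f). Proof. by move=> Lf n; exact: beN. Qed.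

Definition tpoly M a b (x : R) : R := zsum M (fun n => a n * Cn n x + b n * Sn n x).

Lemma tpoly_Bd M a b : Bd (tpoly M a b).
Proof. by apply: zsum_fun_Bd => n; apply: BdD; apply: BdZ; [exact: Bd_Cn|exact: Bd_Sn]. Qed.

Lemma tpoly_L2p M a b : L2p (tpoly M a b). Proof. exact: Bd_L2p (tpoly_Bd _ _ _). Qed.

Lemma ipp_tpoly M a b h : L2p h -> ipp (tpoly M a b) h = zsum M (fun n => a n * al h n + b n * be h n).
Proof.
move=> Lh; rewrite (ipp_zsum _ (F := fun n x => a n * Cn n x + b n * Sn n x))//; last first.
  by move=> n; apply: L2pD; apply: L2pZ; [exact: L2p_Cn|exact: L2p_Sn].
apply: eq_zsum => n; rewrite ippDl//; [|exact: L2pZ (L2p_Cn _)|exact: L2pZ (L2p_Sn _)].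
rewrite ippZl; [|exact: L2p_Cn|by []]; rewrite ippZl; [|exact: L2p_Sn|by []].
by rewrite [ipp (Cn n) h]ippC [ipp (Sn n) h]ippC.
Qed.

Lemma al_tpoly M a b n : evenz a -> al (tpoly M a b) n = if (absz n <= M)%N then a n else 0.
Proof.
move=> ea; rewrite /al ipp_tpoly; last exact: L2p_Cn.
rewrite -zsum_delta; transitivity (2^-1 * (zsum M (fun k => a k * (n == k)%:R) + zsum M (fun k => a (- k) * (n == - k)%:R))).
  by rewrite -zsumD -zsumZ; apply: eq_zsum => k; rewrite al_Cn be_Cn ea; field.
have := zsumN M (fun k => a k * (n == k)%:R) => /= ->; by field.
Qed.

Lemma be_tpoly M a b n : oddz b -> be (tpoly M a b) n = if (absz n <= M)%N then b n else 0.
Proof.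
move=> ob; rewrite /be ipp_tpoly; last exact: L2p_Sn.
rewrite -zsum_delta; transitivity (2^-1 * (zsum M (fun k => b k * (n == k)%:R) + zsum M (fun k => b (- k) * (n == - k)%:R))).
  by rewrite -zsumD -zsumZ; apply: eq_zsum => k; rewrite al_Sn be_Sn ob; field.
have := zsumN M (fun k => b k * (n == k)%:R) => /= ->; by field.
Qed.

Lemma eq_zsum_le M (F G : int -> R) : (forall n, (absz n <= M)%N -> F n = G n) -> zsum M F = zsum M G.
Proof.
elim: M => [|M ih] h; first by rewrite /zsum !big_nil h.
by rewrite !zsumS ih => [|n nM]; [rewrite !h ?abszN ?absz_nat|rewrite h// (leq_trans nM)].
Qed.

Lemma zsum_mono M N (F : int -> R) : (forall n, 0 <= F n) -> (M <= N)%N -> zsum M F <= zsum N F.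
Proof.
move=> F0 /subnK <-; elim: (N - M)%N => [|k ih] //.
by rewrite addSn zsumS (le_trans ih)// lerDl addr_ge0.
Qed.

Lemma sqnp_tpolyB M N a b : evenz a -> oddz b -> (N <= M)%N ->
  sqnp (fun x => tpoly M a b x - tpoly N a b x) = zsum M (fun n => a n ^+ 2 + b n ^+ 2) - zsum N (fun n => a n ^+ 2 + b n ^+ 2).
Proof.
move=> ea ob NM; have LM := tpoly_L2p M a b; have LN := tpoly_L2p N a b.
have e K L : (K <= L)%N -> ipp (tpoly K a b) (tpoly L a b) = zsum K (fun n => a n ^+ 2 + b n ^+ 2).
  move=> KL; rewrite ipp_tpoly//; last exact: tpoly_L2p.
  by apply: eq_zsum_le => n nK; rewrite al_tpoly// be_tpoly// (leq_trans nK KL) !expr2.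
rewrite /sqnp ippBl//; [|exact: L2pB].
rewrite ![ipp _ (fun x => _ - _)]ippC !ippBl//.
by rewrite [ipp (tpoly M a b) (tpoly N a b)]ippC !e//; ring.
Qed.

Lemma cvg_ipp (F : nat -> R -> R) f h : (forall k, L2p (F k)) -> L2p f -> L2p h ->
  sqnp (fun x => F k x - f x) @[k --> \oo] --> 0 -> ipp (F k) h @[k --> \oo] --> ipp f h.
Proof.
move=> LF Lf Lh hF; rewrite ippE (_ : (fun k : nat => ipp (F k) h) = (fun k : nat => ip mu (fun x => F k x * q x) (fun x => h x * q x))); last first.
  by apply/funext => n; rewrite ippE.
apply: (@cvg_ipl _ _ _ mu (fun k x => F k x * q x)) => //.
rewrite (_ : (fun k => sqn _ _) = (fun k => sqnp (fun x => F k x - f x)))//.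
by apply/funext => n; rewrite sqnpE; apply: eq_sqn => x; rewrite mulrBl.
Qed.

Lemma sqnp_ae_subseq (F : nat -> R -> R) f : (forall N, L2p (F N)) -> L2p f ->
  sqnp (fun x => F N x - f x) @[N --> \oo] --> 0 ->
  exists2 s : nat -> nat, s k @[k --> \oo] --> \oo & {ae mu, forall x, F (s k) x @[k --> \oo] --> f x}.
Proof.
move=> LF Lf hF.
have [|s [sk hs]] := @L2_ae_subseq _ _ _ mu (fun N x => F N x * q x) (fun x => f x * q x) LF Lf.
  rewrite (_ : (fun N => sqn _ _) = (fun N => sqnp (fun x => F N x - f x)))//.
  by apply/funext => N; rewrite sqnpE; apply: eq_sqn => x; rewrite mulrBl.
exists s; first by move=> P [N _ hN]; exists N => // k /= Nk; apply: hN; exact: leq_trans (sk k).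
apply: ae_imp hs => x hx; have q0 : q x != 0 by rewrite gt_eqF ?q_gt0.
have := cvgM hx (cvg_cst (q x)^-1); rewrite mulfK//.
suff -> : (fun k => F (s k) x) = (fun k => F (s k) x * q x * (q x)^-1) by move=> H; exact: H.
by apply/funext => k; rewrite mulfK.
Qed.

(** Used to produce half derivatives and weighted functions from their coefficients. *)
Lemma riesz_fischer a b C : evenz a -> oddz b -> (forall M, zsum M (fun n => a n ^+ 2 + b n ^+ 2) <= C) ->
  exists v, [/\ L2p v, (forall n, al v n = a n), (forall n, be v n = b n) &
    sqnp (fun x => tpoly M a b x - v x) @[M --> \oo] --> 0].
Proof.
move=> ea ob hC; pose Z M := zsum M (fun n => a n ^+ 2 + b n ^+ 2).
have Z0 n : 0 <= a n ^+ 2 + b n ^+ 2 by rewrite addr_ge0 ?sqr_ge0.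
have Zm : {homo Z : x y / (x <= y)%N >-> x <= y} by move=> M N; exact: zsum_mono.
have cZ : cvgn Z.
  by apply: nondecreasing_is_cvgn => //; exists C => _ [M _ <-]; exact: hC.
have nB M N : (N <= M)%N -> sqn mu (fun x => tpoly M a b x * q x - tpoly N a b x * q x) = Z M - Z N.
  by move=> NM; rewrite -(sqnp_tpolyB ea ob NM) sqnpE; apply: eq_sqn => x; rewrite mulrBl.
have [g Lg hg] := @L2_complete_cvg _ _ _ mu (fun M x => tpoly M a b x * q x) Z (fun M => tpoly_L2p M a b) cZ nB.
pose v x := g x / q x.
have ve x : v x * q x = g x by rewrite divfK// gt_eqF ?q_gt0.
have Lv : L2p v by apply: eq_L2 Lg => x; rewrite ve.
have hv : sqnp (fun x => tpoly M a b x - v x) @[M --> \oo] --> 0.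
  rewrite (_ : (fun M => sqnp _) = (fun M => sqn mu (fun x => tpoly M a b x * q x - g x)))//.
  by apply/funext => M; rewrite sqnpE; apply: eq_sqn => x; rewrite mulrBl ve.
exists v; split => // n.
  apply: (lim_ev (k := absz n) (cvg_ipp (fun k => tpoly_L2p k a b) Lv (L2p_Cn n) hv)) => M nM.
  by have := al_tpoly M b n ea; rewrite nM.
apply: (lim_ev (k := absz n) (cvg_ipp (fun k => tpoly_L2p k a b) Lv (L2p_Sn n) hv)) => M nM.
by have := be_tpoly M a n ob; rewrite nM.
Qed.

Lemma alB f g n : L2p f -> L2p g -> al (fun x => f x - g x) n = al f n - al g n.
Proof. by move=> Lf Lg; rewrite /al ippBl//; exact: L2p_Cn. Qed.
Lemma beB f g n : L2p f -> L2p g -> be (fun x => f x - g x) n = be f n - be g n.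
Proof. by move=> Lf Lg; rewrite /be ippBl//; exact: L2p_Sn. Qed.
Lemma alD f g n : L2p f -> L2p g -> al (fun x => f x + g x) n = al f n + al g n.
Proof. by move=> Lf Lg; rewrite /al ippDl//; exact: L2p_Cn. Qed.
Lemma beD f g n : L2p f -> L2p g -> be (fun x => f x + g x) n = be f n + be g n.
Proof. by move=> Lf Lg; rewrite /be ippDl//; exact: L2p_Sn. Qed.

Lemma sqnp_Sm M f : L2p f -> sqnp (fun x => f x - Sm M f x) = sqnp f - zsum M (coef2 f).
Proof.
move=> Lf; have LS : L2p (Sm M f) by exact: tpoly_L2p.
rewrite /sqnp ippBl//; [|exact: L2pB]; rewrite ![ipp _ (fun x => _ - _)]ippC !ippBl//.
rewrite [ipp f (Sm M f)]ippC.
have e1 : ipp (Sm M f) f = zsum M (coef2 f) by rewrite ipp_Sm//; apply: eq_zsum => n; rewrite /coef2 !expr2.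
have e2 : ipp (Sm M f) (Sm M f) = zsum M (coef2 f).
  rewrite ipp_Sm//; apply: eq_zsum_le => n nM; rewrite (al_tpoly _ _ _ (al_even f)) (be_tpoly _ _ _ (be_odd Lf)) nM.
  by rewrite /coef2 !expr2.
by rewrite e1 e2; ring.
Qed.

Lemma bessel M f : L2p f -> zsum M (coef2 f) <= sqnp f.
Proof. by move=> Lf; have := sqnp_ge0 (fun x => f x - Sm M f x); rewrite sqnp_Sm// subr_ge0. Qed.

Lemma cvg_Sm f : L2p f -> sqnp (fun x => Sm M f x - f x) @[M --> \oo] --> 0.
Proof.
move=> Lf; have [v [Lv av bv hv]] := riesz_fischer (al_even f) (be_odd Lf) (fun M => bessel M Lf).
have /(coef_unique (L2pB Lf Lv)) h : forall n, al (fun x => f x - v x) n = 0.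
  by move=> n; rewrite alB// av subrr.
have ae : {ae mu, forall x, f x - v x = 0} by apply: h => n; rewrite beB// bv subrr.
rewrite (_ : (fun M => sqnp _) = (fun M => sqnp (fun x => tpoly M (al f) (be f) x - v x)))//.
apply/funext => M; have LS : L2p (Sm M f) by exact: tpoly_L2p.
have Lm g : L2p g -> measurable_fun setT (fun x => (Sm M f x - g x) * (Sm M f x - g x) * p x).
  move=> Lg; have mb := L2p_meas (L2pB LS Lg).
  by apply: measurable_funM; [exact: measurable_funM|exact: p_meas].
apply: ae_eq_ii; [exact: Lm|exact: Lm|].
by apply: ae_imp ae => x /eqP; rewrite subr_eq0 => /eqP ->.
Qed.

Lemma parseval f : L2p f -> zsum M (coef2 f) @[M --> \oo] --> sqnp f.
Proof.
move=> Lf; have := cvgB (cvg_cst (sqnp f)) (cvg_Sm Lf); rewrite subr0.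
suff -> : (fun M => zsum M (coef2 f)) = (fun M => sqnp f - sqnp (fun x => Sm M f x - f x)) by move=> H; exact: H.
apply/funext => M /=; have := sqnp_Sm M Lf.
have -> : sqnp (fun x => f x - Sm M f x) = sqnp (fun x => Sm M f x - f x).
  by apply: eq_ii => x; rewrite -!expr2 -sqrrN opprB.
by move=> ->; ring.
Qed.

Definition absr n : R := (absz n)%:R.
(** Equals the damped energy of [energyN] divided by 2, and increases to the sum of [|n| (al^2 +
    be^2)]. *)
Definition tail_sum f N : R := \sum_(0 <= M < N) (sqnp f - zsum M (coef2 f)).
Definition ecoef f n : R := absr n * coef2 f n.

Lemma absr_ge0 n : 0 <= absr n. Proof. by []. Qed.
Lemma ecoef_ge0 f n : 0 <= ecoef f n. Proof. by rewrite mulr_ge0 ?coef2_ge0. Qed.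

(** Abel summation: the frequency [n] is counted [|n|] times. *)
Lemma dsum_ecoef N (y : int -> R) : \sum_(0 <= M < N) (zsum N y - zsum M y) = zsum N (fun n => absr n * y n).
Proof.
elim: N => [|N ih]; first by rewrite big_nil /zsum big_nil mul0r addr0.
rewrite big_nat_recr//= [X in _ = X]zsumS -ih !zsumS.
rewrite (eq_bigr (fun M => (zsum N y - zsum M y) + (y N.+1%:Z + y (- N.+1%:Z)))); last by move=> M _; ring.
by rewrite big_split /= sumr_const_nat subn0 /absr abszN absz_nat -mulr_natl -addn1 natrD; ring.
Qed.

Lemma tail_sum_ge N f : L2p f -> zsum N (ecoef f) <= tail_sum f N.
Proof.
move=> Lf; rewrite -dsum_ecoef; apply: ler_sum => M _; rewrite lerD2r; exact: bessel.
Qed.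

Lemma tail_sum_le f C N : L2p f -> (forall M, zsum M (ecoef f) <= C) -> tail_sum f N <= C.
Proof.
move=> Lf hC.
have h : \sum_(0 <= M < N) (zsum L (coef2 f) - zsum M (coef2 f)) @[L --> \oo] --> tail_sum f N.
  apply: cvg_bigsum => M; apply: cvgB; [exact: parseval|exact: cvg_cst].
apply: (@ler_cvg_to _ _ _ _ _ (fun=> C) _ _ h); first exact: cvg_cst.
exists N => // L /= NL; apply: le_trans (hC L); rewrite -dsum_ecoef.
rewrite (big_cat_nat (n := N) (p := L))//= lerDl; rewrite big_nat sumr_ge0// => M /andP[_ ML].
by rewrite subr_ge0; apply: zsum_mono; [exact: coef2_ge0|exact: ltnW].
Qed.

Lemma tail_sum_mono f : L2p f -> {homo tail_sum f : x y / (x <= y)%N >-> x <= y}.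
Proof.
move=> Lf M N MN; rewrite /tail_sum (big_cat_nat (n := M) (p := N))//= lerDl sumr_ge0// => k _.
by rewrite subr_ge0 bessel.
Qed.

Lemma energyTT f N : Bd f -> (0 < N)%N ->
  intg mu2 (fun z => dquot f z ^+ 2 * ((2 - 2 * cos (N%:R * (th z.1 - th z.2))) / (4 * pi ^+ 2))) /\
  ii mu2 (fun z => dquot f z ^+ 2 * ((2 - 2 * cos (N%:R * (th z.1 - th z.2))) / (4 * pi ^+ 2))) = 2 * tail_sum f N.
Proof.
move=> bf N0; have [I e] := energyN bf N0; split.
  by apply: eq_intg I => z; rewrite dquot_K.
transitivity (ii mu2 (fun z => (f z.1 - f z.2) ^+ 2 * K N (th z.1 - th z.2) * (p z.1 * p z.2))).
  by apply: eq_ii => z; rewrite dquot_K.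
rewrite e ipp_sg//; last exact: Bd_L2p.
by rewrite /tail_sum sumrB sumr_const_nat subn0 [N%:R * _]mulr_natl.
Qed.

End FourierSeries.

(** * The Gagliardo energy as a Fourier series *)
Section EnergySeries.
Context {R : realType}.
Notation mu := (leb R).
Notation mu2 := (leb R \x leb R)%E.
Implicit Types (f g h : R -> R) (M N : nat) (n : int).

Lemma pp4_gt0 : 0 < 4 * pi ^+ 2 :> R.
Proof. by rewrite mulr_gt0// exprn_gt0// pi_gt0. Qed.

(** Averaging the damping factors [2 - 2 cos (N t)] over [N] produces a factor that tends to a
    constant. *)
Definition cosmean M (t : R) : R := M.+1%:R^-1 * \sum_(0 <= k < M.+1) cos (k%:R * t).

Lemma cvg_cosmean (t : R) : 2 - 2 * cos t != 0 -> cosmean M t @[M --> \oo] --> 0.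
Proof.
move=> t0; have t1 : 0 < 2 - 2 * cos t by rewrite lt0r t0; case/andP: (two_cos_le4 t).
apply/norm_cvg0P; pose C := Num.sqrt (4 / (2 - 2 * cos t)).
apply: (@squeeze_cvgr _ _ _ _ (fun=> 0) (fun M : nat => M.+1%:R^-1 * C)).
- apply: nearW => M; rewrite normr_ge0 /= /cosmean normrM ger0_norm ?invr_ge0// ler_wpM2l ?invr_ge0//.
  rewrite -sqrtr_sqr ler_wsqrtr// ler_pdivlMr// mulrC.
  apply: (@le_trans _ _ ((2 - 2 * cos t) * K M.+1 t)).
    by rewrite ler_wpM2l ?(ltW t1)// /K lerDl sqr_ge0.
  by rewrite K_mul; case/andP: (two_cos_le4 (M.+1%:R * t)).
- exact: cvg_cst.
- by rewrite -(mul0r C); apply: cvgM; [exact: cvg_harmonic|exact: cvg_cst].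
Qed.

Lemma cosmean_le1 M t : `|cosmean M t| <= 1.
Proof.
rewrite /cosmean normrM ger0_norm ?invr_ge0// mulrC ler_pdivrMr ?ltr0Sn// mul1r.
apply: le_trans (ler_norm_sum _ _ _) _.
apply: (@le_trans _ _ (\sum_(0 <= k < M.+1) 1)); last by rewrite sumr_const_nat subn0.
by apply: ler_sum => k _; rewrite ler_norml cos_geN1 cos_le1.
Qed.

Definition tapered f M (z : R * R) : R := dquot f z ^+ 2 * (1 - cosmean M (th z.1 - th z.2)).

Lemma tapered_ge0 f M z : 0 <= tapered f M z.
Proof. by rewrite mulr_ge0 ?sqr_ge0// subr_ge0; have := cosmean_le1 M (th z.1 - th z.2); rewrite ler_norml => /andP[]. Qed.

Lemma tapered_le f M z : tapered f M z <= 2 * dquot f z ^+ 2.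
Proof.
rewrite /tapered mulrC ler_wpM2r ?sqr_ge0//.
by have := cosmean_le1 M (th z.1 - th z.2); rewrite ler_norml => /andP[]; lra.
Qed.

Lemma cvg_tapered f z : tapered f M z @[M --> \oo] --> dquot f z ^+ 2.
Proof.
have [e|ne] := eqVneq (dquot f z) 0.
  rewrite /tapered e expr0n /= (_ : (fun _ => _) = (fun=> 0)); first exact: cvg_cst.
  by apply/funext => M; rewrite mul0r.
rewrite -[X in _ --> X]mulr1 -[X in _ * X]subr0.
apply: cvgM; first exact: cvg_cst.
apply: cvgB; first exact: cvg_cst.
apply: cvg_cosmean; rewrite chord; apply: lt0r_neq0; apply: mulr_gt0; first exact: pp4_gt0.
apply: mulr_gt0; first by apply: mulr_gt0; exact: p_gt0.
rewrite exprn_even_gt0//=; apply: contra ne => /eqP.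
by rewrite /dquot => ->; rewrite invr0 mulr0.
Qed.

Lemma ii_tapered f M : Bd f -> intg mu2 (tapered f M) /\
  ii mu2 (tapered f M) = 4 * pi ^+ 2 * (M.+1%:R^-1 * \sum_(0 <= N < M.+1) tail_sum f N).
Proof.
move=> bf.
pose G N (z : R * R) := dquot f z ^+ 2 * ((2 - 2 * cos (N%:R * (th z.1 - th z.2))) / (4 * pi ^+ 2)).
have hG N : intg mu2 (G N) /\ ii mu2 (G N) = 2 * tail_sum f N.
  case: N => [|N]; last exact: energyTT.
  have e z : 0 = G 0%N z by rewrite /G mul0r cos0 mulr1 subrr mul0r mulr0.
  split; first by apply: eq_intg (intg0 mu2) => z; exact: e.
  by rewrite /tail_sum big_nil mulr0 -[RHS](ii0 mu2); apply: eq_ii => z; rewrite -e.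
have E z : 2 * pi ^+ 2 / M.+1%:R * \sum_(0 <= N < M.+1) G N z = tapered f M z.
  have -> : \sum_(0 <= N < M.+1) G N z = dquot f z ^+ 2 * (M.+1%:R - \sum_(0 <= k < M.+1) cos (k%:R * (th z.1 - th z.2))) / (2 * pi ^+ 2).
    rewrite -[M.+1%:R](_ : \sum_(0 <= k < M.+1) 1 = _); last by rewrite sumr_const_nat subn0.
    rewrite -sumrB mulr_sumr mulr_suml; apply: eq_bigr => N _; rewrite /G.
    by have := @pi_neq0 R; move: (pi : R) => P P0; field; rewrite P0.
  rewrite /tapered /cosmean; move: (\sum_(0 <= k < M.+1) _) (dquot f z ^+ 2) => s d.
  have := @pi_neq0 R; move: (pi : R) => P P0.
  have : M.+1%:R != 0 :> R by rewrite pnatr_eq0.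
  by move: (M.+1%:R : R) => m m0; field; rewrite m0 P0.
have I : intg mu2 (fun z => 2 * pi ^+ 2 / M.+1%:R * \sum_(0 <= N < M.+1) G N z).
  by apply: intgZ; apply: intg_sum => N _; case: (hG N).
split; first by apply: eq_intg I => z; exact: E.
transitivity (ii mu2 (fun z => 2 * pi ^+ 2 / M.+1%:R * \sum_(0 <= N < M.+1) G N z)).
  by apply: eq_ii => z; rewrite E.
rewrite iiZ; last by apply: intg_sum => N _; case: (hG N).
rewrite ii_sum; last by move=> N _; case: (hG N).
rewrite (eq_bigr (fun N => 2 * tail_sum f N)); last by move=> N _; case: (hG N).
by rewrite -mulr_sumr; ring.
Qed.

Lemma mean_le (u : nat -> R) C M : (forall k, u k <= C) -> M.+1%:R^-1 * \sum_(0 <= k < M.+1) u k <= C.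
Proof.
move=> h; rewrite mulrC ler_pdivrMr ?ltr0Sn//.
apply: (@le_trans _ _ (\sum_(0 <= k < M.+1) C)); first exact: ler_sum.
by rewrite sumr_const_nat subn0 mulr_natr.
Qed.

Lemma fin_energy_of_series f C : Bd f -> (forall M, zsum M (ecoef f) <= C) -> fin_energy f /\ genergy f <= 4 * pi ^+ 2 * C.
Proof.
move=> bf hC; have Lf := Bd_L2p bf; have [mf _] := bf.
have [||||||I h] := @intg_fatou _ _ _ mu2 (tapered f) (fun z => dquot f z ^+ 2) (4 * pi ^+ 2 * C).
- by move=> M; case: (ii_tapered M bf).
- exact: tapered_ge0.
- by apply: measurable_funX; exact: dquot_meas.
- by apply: aeW => z; exact: cvg_tapered.
- by move=> z; exact: sqr_ge0.
- move=> M; rewrite (ii_tapered M bf).2 ler_wpM2l ?(ltW pp4_gt0)//.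
  by apply: mean_le => k; exact: tail_sum_le.
by split => //; split => //; exact: dquot_meas.
Qed.

(** Averages of a nondecreasing sequence dominate, in the limit, each of its terms. *)
Lemma series_le f M : Bd f -> fin_energy f -> 4 * pi ^+ 2 * zsum M (ecoef f) <= genergy f.
Proof.
move=> bf [mG iG]; have Lf := Bd_L2p bf.
have [|||||_ h] := @ii_dct _ _ _ mu2 (tapered f) (fun z => dquot f z ^+ 2) (fun z => 2 * dquot f z ^+ 2).
- by move=> N; case: (ii_tapered N bf) => /intg_meas.
- exact: measurable_funX.
- by apply: aeW => z; exact: cvg_tapered.
- exact: intgZ.
- by move=> N z; rewrite ger0_norm ?tapered_ge0 ?tapered_le.
apply: (@le_trans _ _ (4 * pi ^+ 2 * tail_sum f M)); first by rewrite ler_wpM2l ?(ltW pp4_gt0) ?tail_sum_ge.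
have l : 4 * pi ^+ 2 * (tail_sum f M * (1 - M%:R * N.+1%:R^-1)) @[N --> \oo] --> 4 * pi ^+ 2 * (tail_sum f M * (1 - M%:R * 0)).
  apply: cvgM; [exact: cvg_cst|apply: cvgM; [exact: cvg_cst|apply: cvgB; [exact: cvg_cst|]]].
  by apply: cvgM; [exact: cvg_cst|exact: cvg_harmonic].
rewrite mulr0 subr0 mulr1 in l.
apply: (@ler_cvg_to _ _ _ _ _ _ _ _ l h).
exists M => // N /= MN; rewrite (ii_tapered N bf).2 ler_wpM2l ?(ltW pp4_gt0)//.
rewrite mulrC [leRHS]mulrC ler_pdivlMr ?ltr0Sn//.
rewrite (_ : _ * _ * _ = (N.+1 - M)%:R * tail_sum f M); last first.
  rewrite natrB ?(leq_trans MN)//; have : N.+1%:R != 0 :> R by rewrite pnatr_eq0.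
  by move: (N.+1%:R : R) => m m0; field.
rewrite (big_cat_nat (n := M))//=; last exact: leq_trans MN _.
rewrite -[leLHS]add0r lerD//.
  apply: sumr_ge0 => k _; apply: le_trans (tail_sum_ge _ Lf); apply: zsum_ge0 => n; exact: ecoef_ge0.
rewrite mulr_natl -sumr_const_nat; apply: ler_sum_nat => k /andP[Mk _].
exact: tail_sum_mono.
Qed.

(** Fatou's lemma gives one inequality, dominated convergence the other. *)
Lemma cvg_ecoef f : Bd f -> fin_energy f -> 4 * pi ^+ 2 * zsum M (ecoef f) @[M --> \oo] --> genergy f.
Proof.
move=> bf gf; have pp : 0 < 4 * pi ^+ 2 :> R by rewrite mulr_gt0 ?exprn_gt0 ?pi_gt0.
have mono : {homo (fun M => 4 * pi ^+ 2 * zsum M (ecoef f)) : x y / (x <= y)%N >-> x <= y}.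
  by move=> M N MN; rewrite ler_pM2l//; apply: zsum_mono => // n; exact: ecoef_ge0.
have c : cvgn (fun M => 4 * pi ^+ 2 * zsum M (ecoef f)).
  by apply: nondecreasing_is_cvgn => //; exists (genergy f) => _ [M _ <-]; exact: series_le.
suff <- : lim ((fun M => 4 * pi ^+ 2 * zsum M (ecoef f)) @ \oo) = genergy f by exact: c.
apply/eqP; rewrite eq_le; apply/andP; split.
  by apply: limr_le => //; apply: nearW => M; exact: series_le.
pose L := lim ((fun M => 4 * pi ^+ 2 * zsum M (ecoef f)) @ \oo).
have [|_] := @fin_energy_of_series f (L / (4 * pi ^+ 2)) bf; last by rewrite mulrC divfK// gt_eqF.
move=> M; rewrite ler_pdivlMr// mulrC; exact: (nondecreasing_cvgn_le mono c M).
Qed.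

Lemma genergyD f g : fin_energy f -> fin_energy g -> genergy (fun x => f x + g x) = genergy f + 2 * energy_form f g + genergy g.
Proof. by move=> Lf Lg; rewrite -[RHS](sqnD Lf Lg); apply: eq_sqn => z; rewrite dquotD. Qed.

Definition eform f g n : R := absr n * (al f n * al g n + be f n * be g n).

Lemma cvg_eform f g : Bd f -> Bd g -> fin_energy f -> fin_energy g -> 4 * pi ^+ 2 * zsum M (eform f g) @[M --> \oo] --> energy_form f g.
Proof.
move=> bf bg gf gg; have Lf := Bd_L2p bf; have Lg := Bd_L2p bg.
have -> : energy_form f g = 2^-1 * ((genergy (fun x => f x + g x) - genergy f) - genergy g) by rewrite genergyD//; field.
suff -> : (fun M => 4 * pi ^+ 2 * zsum M (eform f g)) = (fun M => 2^-1 * ((4 * pi ^+ 2 * zsum M (ecoef (fun x => f x + g x)) -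
    4 * pi ^+ 2 * zsum M (ecoef f)) - 4 * pi ^+ 2 * zsum M (ecoef g))).
  apply: cvgM; first exact: cvg_cst.
  apply: cvgB; [apply: cvgB; apply: cvg_ecoef => //; [exact: BdD|exact: fin_energyD]|exact: cvg_ecoef].
apply/funext => M; rewrite -!mulrBr -!zsumB [RHS]mulrCA -(zsumZ _ 2^-1); congr (_ * _); apply: eq_zsum => n.
by rewrite /eform /ecoef /coef2 alD// beD//; field.
Qed.

Lemma dquot_CS n (z : R * R) : dquot (Cn n) z ^+ 2 + dquot (Sn n) z ^+ 2 <= 4 * pi ^+ 2 * n%:~R ^+ 2 * (p z.1 * p z.2).
Proof.
case: z => x y; rewrite /dquot /=.
have [->|xy] := eqVneq x y.
  rewrite !subrr !mul0r expr0n /= addr0 mulr_ge0//; last by rewrite mulr_ge0// p_ge0.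
  by rewrite mulr_ge0 ?sqr_ge0// ltW// pp4_gt0.
have d2 : 0 < (x - y) ^+ 2 by rewrite exprn_even_gt0//= subr_eq0.
rewrite !expr_div_n -mulrDl ler_pdivrMr//.
have -> : (Cn n x - Cn n y) ^+ 2 + (Sn n x - Sn n y) ^+ 2 = 2 - 2 * cos (n%:~R * (th x - th y)).
  rewrite mulrBr cosB -/(Cn n x) -/(Cn n y) -/(Sn n x) -/(Sn n y).
  by have := CS1 n x; have := CS1 n y; nra.
apply: le_trans (chord_mul _ _) _; rewrite chord le_eqVlt; apply/orP; left; apply/eqP; ring.
Qed.

Lemma fin_energy_Cn n : fin_energy (@Cn R n).
Proof.
apply: (@fin_energy_kp _ _ (4 * pi ^+ 2 * n%:~R ^+ 2)); first by apply: cont_meas; exact: Cn_cont.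
by move=> z; apply: le_trans (dquot_CS n z); rewrite lerDl sqr_ge0.
Qed.

Lemma fin_energy_Sn n : fin_energy (@Sn R n).
Proof.
apply: (@fin_energy_kp _ _ (4 * pi ^+ 2 * n%:~R ^+ 2)); first by apply: cont_meas; exact: Sn_cont.
by move=> z; apply: le_trans (dquot_CS n z); rewrite lerDr sqr_ge0.
Qed.

Lemma fin_energy_tpoly M (a b : int -> R) : fin_energy (tpoly M a b).
Proof.
have h n : fin_energy (fun x => a n * Cn n x + b n * Sn n x) by apply: fin_energyD; apply: fin_energyZ; [exact: fin_energy_Cn|exact: fin_energy_Sn].
rewrite /tpoly; elim: M => [|M ih].
  by have := h 0; congr fin_energy; apply/funext => x; rewrite /zsum big_nil addr0.
have := fin_energyD ih (fin_energyD (h M.+1%:Z) (h (- M.+1%:Z))); congr fin_energy; apply/funext => x; by rewrite zsumS.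
Qed.

Lemma absrN n : absr (- n) = absr n :> R. Proof. by rewrite /absr abszN. Qed.

Lemma cvg_genergy_Sm f : Bd f -> fin_energy f -> genergy (fun x => f x - Sm M f x) @[M --> \oo] --> 0.
Proof.
move=> bf gf; have Lf := Bd_L2p bf.
suff E : (fun M => genergy (fun x => f x - Sm M f x)) = (fun M => genergy f - 4 * pi ^+ 2 * zsum M (ecoef f)).
  by rewrite E -(subrr (genergy f)); apply: cvgB; [exact: cvg_cst|exact: cvg_ecoef].
apply/funext => M.
have bS : Bd (Sm M f) by exact: tpoly_Bd. have gS : fin_energy (Sm M f) by exact: fin_energy_tpoly. have LS := Bd_L2p bS.
have h1 : genergy (Sm M f) = 4 * pi ^+ 2 * zsum M (ecoef f).
  apply: (lim_ev (k := M) (cvg_ecoef bS gS)) => N MN; congr (_ * _).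
  have e n : ecoef (Sm M f) n = if (absz n <= M)%N then ecoef f n else 0.
    rewrite /ecoef /coef2 (al_tpoly _ _ _ (al_even f)) (be_tpoly _ _ _ (be_odd Lf)); case: ifP => //.
    by rewrite !expr0n addr0 mulr0.
  rewrite (eq_zsum _ e) -(subnK MN); elim: (N - M)%N => [|k ih].
    by apply: eq_zsum_le => n ->.
  by rewrite addSn zsumS ih abszN absz_nat ltnNge leq_addl /= !addr0.
have h2 : energy_form f (Sm M f) = 4 * pi ^+ 2 * zsum M (ecoef f).
  apply: (lim_ev (k := M) (cvg_eform bf bS gf gS)) => N MN; congr (_ * _).
  have e n : eform f (Sm M f) n = if (absz n <= M)%N then ecoef f n else 0.
    rewrite /eform /ecoef /coef2 (al_tpoly _ _ _ (al_even f)) (be_tpoly _ _ _ (be_odd Lf)); case: ifP => //.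
    by rewrite !mulr0 addr0 mulr0.
  rewrite (eq_zsum _ e) -(subnK MN); elim: (N - M)%N => [|k ih].
    by apply: eq_zsum_le => n ->.
  by rewrite addSn zsumS ih abszN absz_nat ltnNge leq_addl /= !addr0.
have : genergy (fun x => f x - Sm M f x) = genergy f - 2 * energy_form f (Sm M f) + genergy (Sm M f).
  by rewrite -[RHS](sqnB gf gS); apply: eq_sqn => z; rewrite dquotB.
by rewrite h1 h2 => ->; ring.
Qed.

End EnergySeries.

(** * Taylor bounds and half-line integrals *)
Section TaylorHalfLine.
Context {R : realType}.
Notation mu := (leb R).
Implicit Types f g : R -> R.

Lemma mvt f f' (a b : R) : dv f f' -> exists2 c, `|c - a| <= `|b - a| & f b - f a = f' c * (b - a).
Proof.
move=> df; have cf := dv_cont df.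
case: (ltgtP a b) => [ab|ba|->].
- have [c] := @MVT R f f' a b ab (fun x _ => df x) (continuous_subspaceT cf).
  rewrite in_itv /= => /andP[c1 c2] e; exists c => //.
  by rewrite !gtr0_norm ?subr_gt0// lerD2r ltW.
- have [c] := @MVT R f f' b a ba (fun x _ => df x) (continuous_subspaceT cf).
  rewrite in_itv /= => /andP[c1 c2] e; exists c; last by rewrite -opprB e; ring.
  by rewrite ![`|_ - a|]distrC !gtr0_norm ?subr_gt0// lerD2l lerN2 ltW.
- by exists b; rewrite ?subrr ?mulr0.
Qed.

Lemma taylor1 f f' f'' M (a h : R) : dv f f' -> dv f' f'' ->
  (forall y, `|y - a| <= `|h| -> `|f'' y| <= M) -> `|f (a + h) - f a - h * f' a| <= M * h ^+ 2.
Proof.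
move=> df df' hM.
have [c] := @mvt f f' a (a + h) df; rewrite (_ : a + h - a = h); last by ring.
move=> hc ->; have [e] := @mvt f' f'' a c df' => he h2.
rewrite mulrC -mulrBr h2 !normrM.
have M0 : `|f'' e| <= M by apply: hM; exact: le_trans hc.
rewrite -(real_normK (num_real h)) [leRHS]mulrC expr2 -mulrA ler_wpM2l// mulrC ler_pM//.
Qed.

Lemma sdiff f f' f'' M (a h : R) : dv f f' -> dv f' f'' ->
  (forall y, `|y - a| <= `|h| -> `|f'' y| <= M) -> `|f a - (f (a + h) + f (a - h)) / 2| <= M * h ^+ 2.
Proof.
move=> df df' hM; have h1 := taylor1 df df' hM.
have := @taylor1 f f' f'' M a (- h) df df'; rewrite normrN sqrrN => /(_ hM).
by move: h1; rewrite !ler_norml => /andP[? ?] /andP[? ?]; apply/andP; split; lra.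
Qed.

Lemma trig_taylor (a b : R) : `|cos (a + b) - cos a + b * sin a| <= b ^+ 2 /\ `|sin (a + b) - sin a - b * cos a| <= b ^+ 2.
Proof.
split.
  have := @taylor1 (@cos R) _ _ 1 a b (@dv_cos R) (dvN (@dv_sin R)).
  rewrite mul1r mulrN opprK; apply => y _; by rewrite normrN ler_norml cos_geN1 cos_le1.
have := @taylor1 (@sin R) _ _ 1 a b (@dv_sin R) (@dv_cos R).
by rewrite mul1r; apply => y _; rewrite normrN ler_norml sin_geN1 sin_le1.
Qed.

Definition hl (x : R) : R := (0 <= x)%R%:R.

Lemma cvg_half (x : R) : ((0 <= x <= n%:R)%R)%:R @[n --> \oo] --> hl x.
Proof.
rewrite /hl; case: (lerP 0 x) => x0 /=; last exact: cvg_cst.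
apply: cvg_near_cst; near=> n; suff -> : x <= n%:R by [].
by near: n; exact: nbhs_infty_ger.
Unshelve. all: by end_near. Qed.

Lemma hl_meas : measurable_fun setT hl.
Proof.
rewrite (_ : hl = \1_(`[0, +oo[%classic)); first exact: measurable_indic.
by apply/funext => x; rewrite indicE mem_setE in_itv /= andbT.
Qed.

Lemma half_le f G C : continuous f -> dv G f -> (forall x, 0 <= x -> 0 <= f x) -> (forall x, 0 <= x -> `|G x| <= C) ->
  intg mu (fun x => f x * hl x) /\ ii mu (fun x => f x * hl x) <= 2 * C.
Proof.
move=> cf dG f0 hG.
have F0 n x : 0 <= f x * ((0 <= x <= n%:R)%R)%:R.
  by case: (lerP 0 x) => x0 /=; rewrite ?mulr0// mulr_ge0// f0.
have hl0 x : 0 <= f x * hl x by rewrite /hl; case: (lerP 0 x) => x0; rewrite ?mulr0 ?mulr1// f0.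
apply: (@intg_fatou _ _ _ mu (fun n x => f x * ((0 <= x <= n%:R)%R)%:R)).
- by move=> n; exact: ii_indic_itv.
- exact: F0.
- by apply: measurable_funM; [exact: cont_meas|exact: hl_meas].
- by apply: aeW => x; apply: cvgM; [exact: cvg_cst|exact: cvg_half].
- exact: hl0.
- case=> [|n].
    rewrite (@ae_eq_ii _ _ _ mu _ (fun=> 0)) ?ii0//.
    + by have := hG 0 (lexx _); have := normr_ge0 (G 0); lra.
    + by apply: intg_meas; exact: ii_indic_itv.
    + have : mu [set 0] = 0 by exact: lebesgue_measure_set1.
      move=> m0; exists [set 0 : R]; split => //.
      move=> x /=; apply: contra_notP => x0.
      by rewrite (_ : (0 <= x <= 0%:R) = false) ?mulr0//; apply/negP => /andP[? ?]; apply: x0; apply/eqP; rewrite eq_le; apply/andP.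
  rewrite (ii_itv (ltr0Sn R n) cf dG).
  by have := hG n.+1%:R (ler0n _ _); have := hG 0 (lexx _); rewrite !ler_norml; lra.
Qed.

Lemma half_eq f G : continuous f -> dv G f -> intg mu (fun x => f x * hl x) ->
  G n%:R @[n --> \oo] --> 0 -> ii mu (fun x => f x * hl x) = - G 0.
Proof.
move=> cf dG I hG.
have [||||| _ h] := @ii_dct _ _ _ mu (fun n x => f x * ((0 <= x <= n.+1%:R)%R)%:R) (fun x => f x * hl x) (fun x => `|f x * hl x|).
- by move=> n; apply: intg_meas; exact: ii_indic_itv.
- exact: (intg_meas I).
- apply: aeW => x; apply: cvgM; first exact: cvg_cst.
  by have := @cvg_half (x : R); rewrite -cvg_shiftS.
- exact: intg_norm.
- move=> n x; rewrite !normrM ler_wpM2l// /hl.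
  by case: (0 <= x) => //=; case: (x <= _); rewrite ?normr0 ?normr1.
have h' : G n.+1%:R - G 0 @[n --> \oo] --> 0 - G 0.
  by apply: cvgB; [have := hG; rewrite -cvg_shiftS|exact: cvg_cst].
rewrite -[RHS]add0r; apply: (cvg_unique _ h) => //.
suff -> : (fun n => ii mu (fun x => f x * ((0 <= x <= n.+1%:R)%R)%:R)) = (fun n => G n.+1%:R - G 0) by [].
by apply/funext => n; rewrite (ii_itv (ltr0Sn R n) cf dG).
Qed.

Lemma even_half f : (forall x, f (- x) = f x) -> measurable_fun setT f -> intg mu (fun x => f x * hl x) ->
  intg mu f /\ ii mu f = 2 * ii mu (fun x => f x * hl x).
Proof.
move=> ef mf I; have [I' e'] := ii_opp I.
have ID := intgD I I'.
have ae : {ae mu, forall x, f x * hl x + f (- x) * hl (- x) = f x}.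
  have m0 : mu [set 0] = 0 by exact: lebesgue_measure_set1.
  exists [set 0 : R]; split => // x /=; apply: contra_notP => x0.
  rewrite ef /hl oppr_ge0; case: (ltgtP 0 x) => [_|_|e]; rewrite ?mulr0 ?mulr1 ?addr0 ?add0r//.
  by exfalso; apply: x0.
have If : intg mu f by exact: ae_intg ID.
split => //; rewrite -(ae_eq_ii (intg_meas ID) mf ae) iiD// e'; ring.
Qed.

Lemma p_le_inv (x : R) : 0 < x -> p x <= x^-1.
Proof.
move=> x0; rewrite /p lef_pV2 ?posrE ?mulr_gt0 ?pi_gt0 ?sqr1_gt0//.
have : 1 <= pi :> R by apply: le_trans (pi_ge2 _); lra.
by move=> h; have := sqr_ge0 (x - 1); nra.
Qed.

Lemma cvg_p_y : p x @[x --> +oo] --> (0 : R).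
Proof.
apply/cvgrPdist_le => e e0; near=> x.
have x0 : 0 < x by near: x; exact: nbhs_pinfty_gt.
have xe : e^-1 <= x by near: x; apply: nbhs_pinfty_ge; exact: num_real.
by rewrite sub0r normrN ger0_norm ?p_ge0// (le_trans (p_le_inv x0))// invf_ple ?posrE.
Unshelve. all: by end_near. Qed.

Lemma pN (x : R) : p (- x) = p x. Proof. by rewrite /p sqrrN. Qed.

Lemma cvg_p_Ny : p x @[x --> -oo] --> (0 : R).
Proof.
rewrite (_ : @p R = fun x => p (- x)); last by apply/funext => x; rewrite pN.
by apply: (@cvg_comp _ _ _ (fun x => - x) p _ _ _ _ cvg_p_y); apply/cvgNry; exact: cvg_id.
Qed.

Lemma ii_deriv0 f G C : continuous f -> dv G f -> intg mu f -> (forall x, `|G x| <= C * p x) -> ii mu f = 0.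
Proof.
move=> cf dG I hG.
have hc (F : set_system R) : Filter F -> p x @[x --> F] --> 0 -> G x @[x --> F] --> 0.
  move=> FF hp; apply/norm_cvg0P.
  apply: (@squeeze_cvgr _ _ _ _ (fun=> 0) (fun x => C * p x)).
  - by apply: nearW => x; rewrite normr_ge0 hG.
  - exact: cvg_cst.
  - by rewrite -(mulr0 C); apply: cvgM; [exact: cvg_cst|exact: hp].
rewrite (ii_deriv cf dG I (hc _ _ cvg_p_Ny) (hc _ _ cvg_p_y)); ring.
Qed.

End TaylorHalfLine.

(** * Circle harmonics as Laplace-type integrals *)
Section LaplaceFunctions.
Context {R : realType}.
Notation mu := (leb R).
Implicit Types (n : nat) (x t : R).

(** With [s = t^2], integrals against [|t|^n e^(-t^2) dt] are Laplace-type integrals in [s] with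
    the power [(n - 1) / 2]; integrating over all [t] avoids a boundary at 0. *)
Definition gaussw n t : R := `|t| ^+ n * expR (- t ^+ 2).

Lemma gaussw_ge0 n t : 0 <= gaussw n t. Proof. by rewrite mulr_ge0// expR_ge0. Qed.

Lemma gaussw_cont n : continuous (gaussw n).
Proof.
move=> t; apply: cvgM.
  elim: n => [|n ih]; first exact: cvg_cst.
  rewrite (_ : (fun t : R => `|t| ^+ n.+1) = (fun t => `|t| * `|t| ^+ n)); last by apply/funext => s; rewrite exprS.
  by rewrite exprS; apply: cvgM => //; apply: cvg_norm; exact: cvg_id.
apply: (@dv_cont _ (fun t => expR (- t ^+ 2)) (fun t => - (1 * t + t * 1) * expR (- t ^+ 2))).
exact: dv_comp dv_exp (dvN (dvM dv_id dv_id)).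
Qed.

Lemma gaussw_bound n : exists C, forall t, gaussw n t <= C * p t.
Proof.
have [C [C0 hC]] := @horner_le_expR R ((1 + 'X^n) * (1 + 'X)) 1 ltr01.
exists (C * pi) => t; have t2 := sqr_ge0 t.
have -> : C * pi * p t = C / (1 + t ^+ 2) by rewrite /p invfM mulrA mulfK// pi_neq0.
rewrite ler_pdivlMr ?sqr1_gt0//.
rewrite /gaussw expRN mulrAC ler_pdivrMr ?expR_gt0//.
have := hC _ t2; rewrite mul1r; apply: le_trans.
have -> : ((1 + 'X^n) * (1 + 'X)).[t ^+ 2] = (1 + (t ^+ 2) ^+ n) * (1 + t ^+ 2) by rewrite !hornerE; ring.
rewrite [leRHS]ger0_norm; last by apply: mulr_ge0; apply: addr_ge0 => //; exact: exprn_ge0.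
rewrite ler_wpM2r ?addr_ge0//.
have [t1|t1] := lerP `|t| 1.
  by apply: (@le_trans _ _ 1); [exact: exprn_ile1|rewrite lerDl exprn_ge0].
rewrite -(real_normK (num_real t)) -exprM mulnC exprM expr2.
have h : 1 <= `|t| ^+ n by rewrite exprn_ege1// ltW.
have h0 : 0 <= `|t| ^+ n by rewrite exprn_ge0.
by rewrite -[leLHS]mulr1 (le_trans (ler_wpM2l h0 h))// lerDr.
Qed.

Lemma intg_gausswM n (b : R -> R) : measurable_fun setT b -> (forall t, `|b t| <= 1) -> intg mu (fun t => gaussw n t * b t).
Proof.
move=> mb b1; have [C hC] := gaussw_bound n.
apply: (@intg_le _ _ _ mu _ (fun t => C * p t)); [|move=> t|exact: intgZ (intg_p)].
- by apply: measurable_funM => //; apply: cont_meas; exact: gaussw_cont.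
- by rewrite normrM ger0_norm ?gaussw_ge0// (le_trans _ (hC t))// ler_piMr ?gaussw_ge0.
Qed.

Lemma intg_gaussw n : intg mu (gaussw n).
Proof.
have := @intg_gausswM n (fun=> 1) (measurable_cst _) (fun _ => _).
by move=> /(_ _)/=; rewrite normr1 => /(_ (fun=> lexx _)); apply: eq_intg => t; rewrite mulr1.
Qed.

Lemma cos_meas x : measurable_fun setT (fun t : R => cos (x * t ^+ 2)).
Proof.
apply: cont_meas; apply: (@dv_cont _ _ (fun t => x * (1 * t + t * 1) * - sin (x * t ^+ 2))).
exact: dv_comp dv_cos (dvZ x (dvM dv_id dv_id)).
Qed.

Lemma sin_meas x : measurable_fun setT (fun t : R => sin (x * t ^+ 2)).
Proof.
apply: cont_meas; apply: (@dv_cont _ _ (fun t => x * (1 * t + t * 1) * cos (x * t ^+ 2))).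
exact: dv_comp dv_sin (dvZ x (dvM dv_id dv_id)).
Qed.

Lemma cos_norm1 (s : R) : `|cos s| <= 1. Proof. by rewrite ler_norml cos_geN1 cos_le1. Qed.
Lemma sin_norm1 (s : R) : `|sin s| <= 1. Proof. by rewrite ler_norml sin_geN1 sin_le1. Qed.

(** Real and imaginary parts of a multiple of [(1 - i x)^(-(n + 1) / 2)]. *)
Definition lapc n x : R := ii mu (fun t => gaussw n t * cos (x * t ^+ 2)).
Definition laps n x : R := ii mu (fun t => gaussw n t * sin (x * t ^+ 2)).

Lemma intg_lapc n x : intg mu (fun t => gaussw n t * cos (x * t ^+ 2)).
Proof. by apply: intg_gausswM => [|t]; [exact: cos_meas|exact: cos_norm1]. Qed.
Lemma intg_laps n x : intg mu (fun t => gaussw n t * sin (x * t ^+ 2)).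
Proof. by apply: intg_gausswM => [|t]; [exact: sin_meas|exact: sin_norm1]. Qed.

Lemma gausswD2 n t : gaussw n.+2 t = t ^+ 2 * gaussw n t.
Proof. by rewrite /gaussw 2!exprS mulrA -expr2 real_normK ?num_real// mulrA. Qed.

Lemma dv_lapc n : dv (lapc n) (fun x => - laps n.+2 x).
Proof.
move=> x; apply: (@is_derive_quadratic _ _ _ _ (ii mu (gaussw n.+4))) => h.
rewrite /lapc /laps mulNr opprK.
rewrite -iiB; [|exact: intg_lapc|exact: intg_lapc]; rewrite -(iiZr h (intg_laps _ _)).
rewrite -iiD; [|by apply: intgB; exact: intg_lapc|apply: intgZr; exact: intg_laps].
rewrite -(iiZr (h ^+ 2) (intg_gaussw _)).
apply: norm_ii_le; [|move=> t|apply: intgZr; exact: intg_gaussw].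
  by apply: intg_meas; apply: intgD; [apply: intgB; exact: intg_lapc|apply: intgZr; exact: intg_laps].
rewrite !gausswD2 (_ : _ + _ = gaussw n t * (cos (x * t ^+ 2 + h * t ^+ 2) - cos (x * t ^+ 2) + (h * t ^+ 2) * sin (x * t ^+ 2))); last first.
  by rewrite mulrDl; ring.
rewrite normrM ger0_norm ?gaussw_ge0//.
apply: le_trans (ler_wpM2l (gaussw_ge0 _ _) (trig_taylor _ _).1) _.
by apply: le_of_eq; ring.
Qed.

Lemma dv_laps n : dv (laps n) (lapc n.+2).
Proof.
move=> x; apply: (@is_derive_quadratic _ _ _ _ (ii mu (gaussw n.+4))) => h.
rewrite /lapc /laps.
rewrite -iiB; [|exact: intg_laps|exact: intg_laps]; rewrite -(iiZr h (intg_lapc _ _)).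
rewrite -iiB; [|by apply: intgB; exact: intg_laps|apply: intgZr; exact: intg_lapc].
rewrite -(iiZr (h ^+ 2) (intg_gaussw _)).
apply: norm_ii_le; [|move=> t|apply: intgZr; exact: intg_gaussw].
  by apply: intg_meas; apply: intgB; [apply: intgB; exact: intg_laps|apply: intgZr; exact: intg_lapc].
rewrite !gausswD2 (_ : _ - _ = gaussw n t * (sin (x * t ^+ 2 + h * t ^+ 2) - sin (x * t ^+ 2) - (h * t ^+ 2) * cos (x * t ^+ 2))); last first.
  by rewrite mulrDl; ring.
rewrite normrM ger0_norm ?gaussw_ge0//.
apply: le_trans (ler_wpM2l (gaussw_ge0 _ _) (trig_taylor _ _).2) _.
by apply: le_of_eq; ring.
Qed.

Lemma dv_tabs : dv (fun t : R => t * `|t|) (fun t => 2 * `|t|).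
Proof.
move=> t; apply: (@is_derive_quadratic _ _ _ _ 1) => h; rewrite mul1r ler_norml.
case: (ger0P t) => t0; case: (ger0P (t + h)) => th0; apply/andP; split; nra.
Qed.

Lemma dv_tpow n : (0 < n)%N -> dv (fun t : R => t * `|t| ^+ n) (fun t => n.+1%:R * `|t| ^+ n).
Proof.
elim/ltn_ind: n => -[|[|[|n]]] ih // _.
- by apply: dv_ext dv_tabs => t; rewrite ?expr1.
- have h : dv (fun t : R => t * (t * t)) (fun t => 1 * (t * t) + t * (1 * t + t * 1)) by exact: dvM dv_id (dvM dv_id dv_id).
  apply: dv_ext h => t; rewrite real_normK ?num_real//; ring.
have h := dvM (dvM dv_id dv_id) (ih n.+1 (leqW (leqnn _)) isT).
have e (t : R) : `|t| ^+ n.+3 = t ^+ 2 * `|t| ^+ n.+1.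
  by rewrite 2!exprS mulrA -expr2 real_normK ?num_real.
apply: dv_ext h => t; rewrite e; first by ring.
by rewrite -[n.+4]addn2 natrD; ring.
Qed.

Lemma dv_gaussw n : (0 < n)%N -> dv (fun t => t * gaussw n t) (fun t => n.+1%:R * gaussw n t - 2 * gaussw n.+2 t).
Proof.
move=> n0; have he : dv (fun t : R => expR (- t ^+ 2)) (fun t => - (1 * t + t * 1) * expR (- t ^+ 2)).
  exact: dv_comp dv_exp (dvN (dvM dv_id dv_id)).
apply: dv_ext (dvM (dv_tpow n0) he) => t; first by rewrite /gaussw; ring.
by rewrite gausswD2 /gaussw; ring.
Qed.

Lemma twt n t : `|t * gaussw n t| = gaussw n.+1 t.
Proof. by rewrite normrM (ger0_norm (gaussw_ge0 _ _)) /gaussw [`|t| ^+ n.+1]exprS mulrA. Qed.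

(** Integration by parts in [t]; with its companion for [laps] it expresses index [n + 2]
    through index [n]. *)
Lemma ibp_lapc n x : (0 < n)%N -> n.+1%:R * lapc n x = 2 * (lapc n.+2 x + x * laps n.+2 x).
Proof.
move=> n0.
pose G t := t * gaussw n t * cos (x * t ^+ 2).
pose g t := n.+1%:R * (gaussw n t * cos (x * t ^+ 2)) - (2 * (gaussw n.+2 t * cos (x * t ^+ 2)) + 2 * x * (gaussw n.+2 t * sin (x * t ^+ 2))).
have dG : dv G g.
  apply: dv_ext (dvM (dv_gaussw n0) (dv_comp dv_cos (dvZ x (dvM dv_id dv_id)))) => t //.
  rewrite /g gausswD2; ring.
have [C hC] := gaussw_bound n.+1.
have I1 := intgZ n.+1%:R (intg_lapc n x).
have I2 := intgZ 2 (intg_lapc n.+2 x).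
have I3 := intgZ (2 * x) (intg_laps n.+2 x).
have cg : continuous g.
  have cs : continuous (fun t : R => cos (x * t ^+ 2)) by exact: dv_cont (dv_comp dv_cos (dvZ x (dvM dv_id dv_id))).
  have sn : continuous (fun t : R => sin (x * t ^+ 2)) by exact: dv_cont (dv_comp dv_sin (dvZ x (dvM dv_id dv_id))).
  move=> t; apply: cvgB; [|apply: cvgD]; apply: cvgM; try exact: cvg_cst;
    by apply: cvgM; [exact: gaussw_cont|first [exact: cs|exact: sn]].
have : ii mu g = 0.
  apply: (@ii_deriv0 _ g G C) => //; first by apply: intgB => //; exact: intgD.
  by move=> t; rewrite /G normrM twt (le_trans _ (hC t))// ler_piMr ?gaussw_ge0 ?cos_norm1.
rewrite /g iiB//; last exact: intgD.
rewrite iiD// (iiZ _ (intg_lapc n x)) (iiZ _ (intg_lapc n.+2 x)) (iiZ _ (intg_laps n.+2 x)).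
by rewrite -/(lapc n x) -/(lapc n.+2 x) -/(laps n.+2 x); lra.
Qed.

Lemma ibp_laps n x : (0 < n)%N -> n.+1%:R * laps n x = 2 * (laps n.+2 x - x * lapc n.+2 x).
Proof.
move=> n0.
pose G t := t * gaussw n t * sin (x * t ^+ 2).
pose g t := n.+1%:R * (gaussw n t * sin (x * t ^+ 2)) - (2 * (gaussw n.+2 t * sin (x * t ^+ 2)) - 2 * x * (gaussw n.+2 t * cos (x * t ^+ 2))).
have dG : dv G g.
  apply: dv_ext (dvM (dv_gaussw n0) (dv_comp dv_sin (dvZ x (dvM dv_id dv_id)))) => t //.
  rewrite /g gausswD2; ring.
have [C hC] := gaussw_bound n.+1.
have I1 := intgZ n.+1%:R (intg_laps n x).
have I2 := intgZ 2 (intg_laps n.+2 x).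
have I3 := intgZ (2 * x) (intg_lapc n.+2 x).
have cg : continuous g.
  have cs : continuous (fun t : R => cos (x * t ^+ 2)) by exact: dv_cont (dv_comp dv_cos (dvZ x (dvM dv_id dv_id))).
  have sn : continuous (fun t : R => sin (x * t ^+ 2)) by exact: dv_cont (dv_comp dv_sin (dvZ x (dvM dv_id dv_id))).
  move=> t; apply: cvgB; [|apply: cvgB]; apply: cvgM; try exact: cvg_cst;
    by apply: cvgM; [exact: gaussw_cont|first [exact: cs|exact: sn]].
have : ii mu g = 0.
  apply: (@ii_deriv0 _ g G C) => //; first by apply: intgB => //; exact: intgB.
  by move=> t; rewrite /G normrM twt (le_trans _ (hC t))// ler_piMr ?gaussw_ge0 ?sin_norm1.
rewrite /g iiB//; last exact: intgB.
rewrite iiB// (iiZ _ (intg_laps n x)) (iiZ _ (intg_laps n.+2 x)) (iiZ _ (intg_lapc n.+2 x)).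
by rewrite -/(laps n x) -/(laps n.+2 x) -/(lapc n.+2 x); lra.
Qed.

Lemma lapc2 n x : (0 < n)%N -> lapc n.+2 x = n.+1%:R / 2 * (lapc n x - x * laps n x) / (1 + x ^+ 2).
Proof.
move=> n0; apply: (@mulIf _ (1 + x ^+ 2)); first by rewrite gt_eqF ?sqr1_gt0.
rewrite divfK ?gt_eqF ?sqr1_gt0//.
rewrite (_ : _ / 2 * _ = (n.+1%:R * lapc n x - x * (n.+1%:R * laps n x)) / 2); last by field.
by rewrite ibp_lapc// ibp_laps//; field.
Qed.

Lemma laps2 n x : (0 < n)%N -> laps n.+2 x = n.+1%:R / 2 * (laps n x + x * lapc n x) / (1 + x ^+ 2).
Proof.
move=> n0; apply: (@mulIf _ (1 + x ^+ 2)); first by rewrite gt_eqF ?sqr1_gt0.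
rewrite divfK ?gt_eqF ?sqr1_gt0//.
rewrite (_ : _ / 2 * _ = (n.+1%:R * laps n x + x * (n.+1%:R * lapc n x)) / 2); last by field.
by rewrite ibp_lapc// ibp_laps//; field.
Qed.

Lemma dv0_cst (f : R -> R) : dv f (fun=> 0) -> forall x, f x = f 0.
Proof. by move=> h x; have [c _] := @mvt _ f (fun=> 0) 0 x h; rewrite mul0r => /eqP; rewrite subr_eq0 => /eqP. Qed.

(** The left side has derivative 0 by the recursion, which gives the exact size of the integral. *)
Lemma lapc_size n x : (0 < n)%N -> (lapc n x ^+ 2 + laps n x ^+ 2) ^+ 2 * (1 + x ^+ 2) ^+ n.+1 = lapc n 0 ^+ 4.
Proof.
move=> n0; have dA := dv_lapc n; have dB := dv_laps n.
pose f x := (lapc n x * lapc n x + laps n x * laps n x).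
have df := dvD (dvM dA dA) (dvM dB dB).
have dp (k : nat) : dv (fun x : R => (1 + x ^+ 2) ^+ k.+1) (fun x => 2 * x * k.+1%:R * (1 + x ^+ 2) ^+ k).
  elim: k => [|k ih]; first by apply: dv_ext (@dv_sqr1 R) => y; rewrite ?expr1 ?mulr1.
  apply: dv_ext (dvM (@dv_sqr1 R) ih) => y; first by rewrite [RHS]exprS.
  rewrite [_ ^+ k.+1]exprS -[k.+2]addn1 natrD; ring.
have h : dv (fun x => f x * f x * (1 + x ^+ 2) ^+ n.+1) (fun=> 0).
  apply: dv_ext (dvM (dvM df df) (dp n)) => y //.
  rewrite /f lapc2// laps2// [_ ^+ n.+1]exprS.
  have : 1 + y ^+ 2 != 0 by rewrite gt_eqF ?sqr1_gt0.
  by move: ((1 + y ^+ 2) ^+ n) (lapc n y) (laps n y) (n.+1%:R : R) => c a b k h; field.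
have := dv0_cst h x; rewrite /f expr0n addr0 expr1n mulr1.
have -> : laps n 0 = 0.
  by rewrite -[RHS](ii0 mu); apply: eq_ii => t; rewrite mul0r sin0 mulr0.
by rewrite !expr2 mulr0 addr0 => ->; ring.
Qed.

Lemma ii_gaussw1 : ii mu (gaussw 1) = 1.
Proof.
pose f (t : R) := t * expR (- t ^+ 2); pose G (t : R) := - 2^-1 * expR (- t ^+ 2).
have he : dv (fun t : R => expR (- t ^+ 2)) (fun t => - (1 * t + t * 1) * expR (- t ^+ 2)).
  exact: dv_comp dv_exp (dvN (dvM dv_id dv_id)).
have dG : dv G f by apply: dv_ext (dvZ (- 2^-1) he) => t //; rewrite /f; field.
have cf : continuous f by exact: dv_cont (dvM dv_id he).
have e t : f t * hl t = gaussw 1 t * hl t.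
  by rewrite /hl /f /gaussw; case: (lerP 0 t) => t0; rewrite ?mulr0// expr1 ger0_norm.
have I : intg mu (fun t => gaussw 1 t * hl t).
  apply: intg_gausswM; first exact: hl_meas.
  by move=> t; rewrite /hl; case: (0 <= t); rewrite ?normr0 ?normr1.
have ew t : gaussw 1 (- t) = gaussw 1 t by rewrite /gaussw normrN sqrrN.
have [_ ->] := even_half ew (cont_meas (@gaussw_cont 1%N)) I.
rewrite -(@eq_ii _ _ _ mu (fun t => f t * hl t) _ e) (half_eq cf dG).
- by rewrite /G expr0n oppr0 expR0; field.
- by apply: eq_intg I => t; rewrite e.
have [C hC] := gaussw_bound 0%N.
apply/norm_cvg0P.
apply: (@squeeze_cvgr _ _ _ _ (fun=> 0) (fun k : nat => C * p k%:R)).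
- apply: nearW => k; rewrite normr_ge0 /= (le_trans _ (hC _))// /G /gaussw expr0 mul1r normrM normrN.
  by rewrite !ger0_norm ?expR_ge0 ?invr_ge0// ler_piMl ?expR_ge0// invf_le1// ler1n.
- exact: cvg_cst.
- rewrite -(mulr0 C); apply: cvgM; first exact: cvg_cst.
  apply: (@cvg_comp _ _ _ (fun k : nat => k%:R : R) p _ _ _ _ (@cvg_p_y R)).
  by apply/cvgryPge => a; exact: nbhs_infty_ger.
Qed.

(** Two combinations of these functions have zero derivative. *)
Lemma AB1 x : lapc 1 x = (1 + x ^+ 2)^-1 /\ laps 1 x = x / (1 + x ^+ 2).
Proof.
have dA := dv_lapc 1; have dB := dv_laps 1.
have h1 : dv (fun x => lapc 1 x + x * laps 1 x) (fun=> 0).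
  apply: dv_ext (dvD dA (dvM dv_id dB)) => y //; rewrite lapc2// laps2//.
  have : 1 + y ^+ 2 != 0 by rewrite gt_eqF ?sqr1_gt0.
  by move: (lapc 1 y) (laps 1 y) => a b h; field.
have h2 : dv (fun x => laps 1 x - x * lapc 1 x) (fun=> 0).
  apply: dv_ext (dvB dB (dvM dv_id dA)) => y //; rewrite lapc2// laps2//.
  have : 1 + y ^+ 2 != 0 by rewrite gt_eqF ?sqr1_gt0.
  by move: (lapc 1 y) (laps 1 y) => a b h; field.
have a0 : lapc 1 0 = 1.
  by rewrite -[RHS]ii_gaussw1; apply: eq_ii => t; rewrite mul0r cos0 mulr1.
have b0 : laps 1 0 = 0.
  by rewrite -[RHS](ii0 mu); apply: eq_ii => t; rewrite mul0r sin0 mulr0.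
have := dv0_cst h1 x; have := dv0_cst h2 x; rewrite a0 b0 !mul0r subr0 addr0 => e2 e1.
have hn : 1 + x ^+ 2 != 0 by rewrite gt_eqF ?sqr1_gt0.
have eB : laps 1 x = x * lapc 1 x by lra.
have eA : lapc 1 x = (1 + x ^+ 2)^-1.
  by apply: (mulIf hn); rewrite mulVf//; move: e1; rewrite eB => e1; rewrite -[RHS]e1; ring.
by rewrite eB eA.
Qed.

(** The harmonics are polynomials in [1 / (1 - i x)], that is, combinations of the integrals of
    odd index. *)
Lemma CS_expand n : exists K (a : nat -> R) (c : R), forall x,
  Cn n%:Z x = c + \sum_(0 <= k < K) a k * lapc k.*2.+1 x /\
  Sn n%:Z x = \sum_(0 <= k < K) a k * laps k.*2.+1 x.
Proof.
elim: n => [|n [K [a [c h]]]].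
  by exists 0%N, (fun=> 0), 1 => x; rewrite Cn0 Sn0 !big_nil addr0.
have c1 x : Cn 1 x = -1 + 2 * lapc 1 x.
  rewrite /Cn mul1r cos_th (AB1 x).1; have : 1 + x ^+ 2 != 0 by rewrite gt_eqF ?sqr1_gt0.
  by move=> ?; field.
have s1 x : Sn 1 x = 2 * laps 1 x.
  rewrite /Sn mul1r sin_th (AB1 x).2; ring.
have e2 (k : nat) : k.*2.+2%:R = 2 * k.+1%:R :> R by rewrite -doubleS -muln2 natrM mulrC.
have rA (k : nat) x : lapc 1 x * lapc k.*2.+1 x - laps 1 x * laps k.*2.+1 x = lapc k.*2.+3 x / k.+1%:R.
  rewrite (AB1 x).1 (AB1 x).2 lapc2// (e2 k).
  have : 1 + x ^+ 2 != 0 by rewrite gt_eqF ?sqr1_gt0.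
  have : k.+1%:R != 0 :> R by rewrite pnatr_eq0.
  by move: (k.+1%:R : R) (lapc _ x) (laps _ x) => m A B h1 h2; field; rewrite h1.
have rB (k : nat) x : laps 1 x * lapc k.*2.+1 x + lapc 1 x * laps k.*2.+1 x = laps k.*2.+3 x / k.+1%:R.
  rewrite (AB1 x).1 (AB1 x).2 laps2// (e2 k).
  have : 1 + x ^+ 2 != 0 by rewrite gt_eqF ?sqr1_gt0.
  have : k.+1%:R != 0 :> R by rewrite pnatr_eq0.
  by move: (k.+1%:R : R) (lapc _ x) (laps _ x) => m A B h1 h2; field; rewrite h1.
(* Multiply the expansion at order [n] by [-1 + 2 (A 1 + i B 1)], the harmonic of order one. *)
pose a' k := (if k == 0%N then 2 * c else 2 * a k.-1 / k%:R) - (if (k < K)%N then a k else 0).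
have ea' (F : nat -> R) : \sum_(0 <= k < K.+1) a' k * F k =
    2 * c * F 0%N + 2 * \sum_(0 <= k < K) a k * (F k.+1 / k.+1%:R) - \sum_(0 <= k < K) a k * F k.
  rewrite /a'; under eq_bigr do rewrite mulrBl.
  rewrite sumrB big_nat_recl//= [X in _ - X]big_nat_recr//= ltnn mul0r addr0.
  congr (_ + _ - _).
    by rewrite mulr_sumr; apply: eq_bigr => k _; ring.
  by apply: eq_big_nat => k /andP[_ ->].
exists K.+1, a', (- c) => x; have [hC hS] := h x.
rewrite -[n.+1]addn1 PoszD CnD SnD hC hS c1 s1 !ea'; split.
  under [X in _ = _ + (_ + 2 * X - _)]eq_bigr do rewrite doubleS -rA mulrBr.
  rewrite sumrB.
  under [X in _ = _ + (_ + 2 * (X - _) - _)]eq_bigr do rewrite mulrCA.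
  under [X in _ = _ + (_ + 2 * (_ - X) - _)]eq_bigr do rewrite mulrCA.
  rewrite -!mulr_sumr; ring.
under [X in _ = _ + 2 * X - _]eq_bigr do rewrite doubleS -rB mulrDr.
rewrite big_split /=.
under [X in _ = _ + 2 * (X + _) - _]eq_bigr do rewrite mulrCA.
under [X in _ = _ + 2 * (_ + X) - _]eq_bigr do rewrite mulrCA.
rewrite -!mulr_sumr; ring.
Qed.

End LaplaceFunctions.

(** * The singular-integral half derivative *)
Section HalfDerivative.
Context {R : realType}.
Notation mu := (leb R).
Notation mu2 := (leb R \x leb R)%E.
Implicit Types (f g u phi psi : R -> R) (x t : R).

(** The second difference over [h], with [h = t^2]: [dh / h^(3/2)] becomes [2 dt / t^2]. *)
Definition dl phi x t : R := (phi x - (phi (x + t ^+ 2) + phi (x - t ^+ 2)) / 2) / t ^+ 2.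
(** The normalisation that makes the symbol equal to [|xi|^(1/2)]. *)
Definition c0 : R := ii mu (fun t => (1 - cos (t ^+ 2)) / t ^+ 2).
Definition halfD phi x : R := c0^-1 * ii mu (dl phi x).

Lemma sqr_meas : measurable_fun setT (fun t : R => t ^+ 2).
Proof. by meas. Qed.

Lemma isqr_meas : measurable_fun setT (fun t : R => (t ^+ 2)^-1).
Proof. exact: (measurableT_comp measurable_invr sqr_meas). Qed.

Lemma dl_meas phi x : measurable_fun setT phi -> measurable_fun setT (dl phi x).
Proof.
move=> mphi; have m1 : measurable_fun setT (fun t => phi (x + t ^+ 2)).
  by apply: (measurableT_comp mphi); apply: measurable_funD; [exact: measurable_cst|exact: sqr_meas].
have m2 : measurable_fun setT (fun t => phi (x - t ^+ 2)).
  by apply: (measurableT_comp mphi); apply: measurable_funB; [exact: measurable_cst|exact: sqr_meas].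
apply: measurable_funM; last exact: isqr_meas.
apply: measurable_funB; first exact: measurable_cst.
by apply: measurable_funM; [exact: measurable_funD|exact: measurable_cst].
Qed.

Lemma dl_meas2 phi : measurable_fun setT phi ->
  measurable_fun [set: plane R] (fun z => dl phi z.1 z.2).
Proof.
move=> mphi.
have ms : measurable_fun [set: plane R] (fun z => z.2 ^+ 2).
  by have := meas_snd sqr_meas.
have m0 := meas_fst (@midR R).
have m1 : measurable_fun [set: plane R] (fun z => phi (z.1 + z.2 ^+ 2)).
  apply: (measurableT_comp (f := phi : measurableTypeR R -> R) mphi); exact: measurable_funD.
have m2 : measurable_fun [set: plane R] (fun z => phi (z.1 - z.2 ^+ 2)).
  apply: (measurableT_comp (f := phi : measurableTypeR R -> R) mphi); exact: measurable_funB.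
apply: measurable_funM; last exact: (meas_snd isqr_meas).
apply: measurable_funB; first exact: meas_fst.
by apply: measurable_funM; [exact: measurable_funD|exact: measurable_cst].
Qed.

(** Domination of the singular integrand by an integrable weight, uniformly in the position. *)
Definition kbound phi M := forall x t, `|dl phi x t| <= M * p t.

Lemma min_p (A t : R) : `|A| <= 1 -> `|A| <= t ^+ 4 -> `|A / t ^+ 2| <= 2 * pi * p t.
Proof.
move=> h1 h4; rewrite normrM normfV (ger0_norm (sqr_ge0 t)).
have -> : 2 * pi * p t = 2 / (1 + t ^+ 2) by rewrite /p invfM mulrA mulfK// pi_neq0.
have [->|t0] := eqVneq t 0; first by rewrite expr0n invr0 mulr0 addr0 invr1 mulr1.
have t2 : 0 < t ^+ 2 by rewrite exprn_even_gt0.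
rewrite ler_pdivrMr// mulrAC ler_pdivlMr ?sqr1_gt0//.
have e4 : t ^+ 4 = t ^+ 2 * t ^+ 2 by ring.
rewrite e4 in h4; move: (t ^+ 2) t2 h4 => y y0 h4.
have [y1|y1] := lerP y 1; have := normr_ge0 A; nra.
Qed.

Lemma kbound_C2 u u' u'' M : dv u u' -> dv u' u'' -> (forall x, `|u x| <= M) -> (forall x, `|u'' x| <= M) ->
  kbound u (4 * M * pi).
Proof.
move=> du du' hu hu'' x t.
have M0 : 0 <= M by exact: le_trans (hu 0).
have [M00|M1] := leP M 0.
  have -> : dl u x t = 0; last by rewrite normr0 !mulr_ge0 ?pi_ge0 ?p_ge0.
  have z y : u y = 0 by apply/eqP; rewrite -normr_le0 (le_trans (hu y)).
  by rewrite /dl !z; rewrite addr0 mul0r subrr mul0r.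
rewrite (_ : dl u x t = (2 * M) * (((u x - (u (x + t ^+ 2) + u (x - t ^+ 2)) / 2) / (2 * M)) / t ^+ 2)); last first.
  by rewrite mulrA mulrCA divff ?mulr1// mulf_neq0// gt_eqF.
rewrite normrM (ger0_norm (_ : 0 <= 2 * M)) ?mulr_ge0//.
rewrite (_ : 4 * M * pi * p t = 2 * M * (2 * pi * p t)); last by ring.
have M2 : 0 < 2 * M by rewrite mulr_gt0.
rewrite ler_pM2l//; apply: min_p; rewrite normrM normfV (gtr0_norm M2) ler_pdivrMr//.
  rewrite mul1r; have := hu x; have := hu (x + t ^+ 2); have := hu (x - t ^+ 2).
  by rewrite !ler_norml => /andP[? ?] /andP[? ?] /andP[? ?]; apply/andP; split; lra.
have := @sdiff _ u u' u'' M x (t ^+ 2) du du' (fun y _ => hu'' y).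
move=> h; apply: le_trans h _; rewrite -exprM; have : 0 <= t ^+ 4 by rewrite exprn_even_ge0.
by nra.
Qed.

Lemma kbound_intg u M x : measurable_fun setT u -> kbound u M -> intg mu (dl u x).
Proof.
move=> mu_ h; apply: (@intg_le _ _ _ mu _ (fun t => M * p t)).
- exact: dl_meas.
- exact: h.
- exact: intgZ intg_p.
Qed.

Lemma dlD u psi x t : dl (fun y => u y + psi y) x t = dl u x t + dl psi x t.
Proof. by rewrite /dl -mulrDl; congr (_ / _); field. Qed.

Lemma dlZ k u x t : dl (fun y => k * u y) x t = k * dl u x t.
Proof. by rewrite /dl mulrA; congr (_ / _); field. Qed.

Lemma dl_cst c x t : dl (fun=> c) x t = 0.
Proof. by rewrite /dl; rewrite (_ : _ - _ = 0) ?mul0r//; field. Qed.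

Lemma one_cos_p t : `|(1 - cos (t ^+ 2)) / t ^+ 2| <= 4 * pi * p t.
Proof.
have h : `|(1 - cos (t ^+ 2)) / 2| <= 1 by move: (cos_le1 (t ^+ 2)) (cos_geN1 (t ^+ 2)) => a b; rewrite ger0_norm; lra.
have h4 : `|(1 - cos (t ^+ 2)) / 2| <= t ^+ 4.
  have [+ _] := trig_taylor 0 (t ^+ 2); rewrite add0r cos0 sin0 mulr0 addr0 -exprM.
  rewrite distrC normrM (ger0_norm (_ : 0 <= 2^-1)) ?invr_ge0// => k.
  by rewrite ler_pdivrMr// (le_trans k)// ler_peMr ?exprn_even_ge0// ler1n.
have := min_p h h4.
rewrite mulrAC normrM (ger0_norm (_ : 0 <= 2^-1)) ?invr_ge0// ler_pdivrMr// => k.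
by apply: le_trans k _; apply: le_of_eq; ring.
Qed.

Lemma one_cos_meas s : measurable_fun setT (fun t : R => (1 - cos (s * t ^+ 2)) / t ^+ 2).
Proof.
apply: measurable_funM; last exact: isqr_meas.
by apply: measurable_funB; [exact: measurable_cst|exact: cos_meas].
Qed.

Lemma intg_one_cos : intg mu (fun t : R => (1 - cos (t ^+ 2)) / t ^+ 2).
Proof.
apply: (@intg_le _ _ _ mu _ (fun t => 4 * pi * p t)).
- by have := one_cos_meas 1; congr measurable_fun; apply/funext => t; rewrite mul1r.
- exact: one_cos_p.
- exact: intgZ intg_p.
Qed.

Lemma c0_gt0 : 0 < c0.
Proof.
have g0 t : 0 <= (1 - cos (t ^+ 2)) / t ^+ 2 by rewrite mulr_ge0 ?invr_ge0 ?sqr_ge0// subr_ge0 cos_le1.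
rewrite lt0r ii_ge0// andbT; apply/eqP => e0; have h := @ii_eq0_ae _ _ _ mu _ g0 intg_one_cos e0.
have ae : {ae mu, forall x : R, 1 * ((2^-1 <= x <= 1)%R)%:R = 0 :> R}.
  apply: ae_imp h => t h; rewrite mul1r; case: (boolP (2^-1 <= t <= 1)) => [/andP[t1 t2]|//].
  exfalso; move/eqP: h; rewrite mulf_eq0 invr_eq0 expf_eq0/= subr_eq0 => /orP[/eqP e|/eqP e]; last by lra.
  have s0 : 0 < sin (t ^+ 2) by apply: sin_gt0_pi; have := pi_ge2 R; rewrite exprn_gt0; nra.
  by have := cos2Dsin2 (t ^+ 2); rewrite -e expr1n; nra.
have c1 := @cst_cont R 1.
have hl2 : 2^-1 < 1 :> R by lra.
have := ae_eq_ii (intg_meas (ii_indic_itv c1 (ltW hl2))) (measurable_cst _) ae.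
by rewrite ii0 (ii_itv hl2 c1 dv_id); lra.
Qed.

(** Scaling [t] by [sqrt|s|] extracts the symbol. *)
Lemma one_cos_scale s : intg mu (fun t : R => (1 - cos (s * t ^+ 2)) / t ^+ 2) /\
  ii mu (fun t : R => (1 - cos (s * t ^+ 2)) / t ^+ 2) = Num.sqrt `|s| * c0.
Proof.
have [->|s0] := eqVneq s 0.
  have e (t : R) : 0 = (1 - cos (0 * t ^+ 2)) / t ^+ 2 by rewrite mul0r cos0 subrr mul0r.
  split; first by apply: eq_intg (intg0 mu) => t; exact: e.
  by rewrite normr0 sqrtr0 mul0r -[RHS](ii0 mu); apply: eq_ii => t; rewrite -e.
pose r := Num.sqrt `|s|; have r0 : 0 < r by rewrite sqrtr_gt0 normr_gt0.
have r2 : r ^+ 2 = `|s| by rewrite sqr_sqrtr.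
have [I e] := @ii_affine R r 0 _ r0 intg_one_cos.
have E t : r ^+ 2 * ((1 - cos ((r * t + 0) ^+ 2)) / (r * t + 0) ^+ 2) = (1 - cos (s * t ^+ 2)) / t ^+ 2.
  rewrite addr0 exprMn r2.
  have -> : cos (`|s| * t ^+ 2) = cos (s * t ^+ 2).
    by case: (ger0P s) => // _; rewrite mulNr cosN.
  have [->|t0] := eqVneq t 0; first by rewrite expr0n !mulr0 cos0 subrr !mul0r mulr0.
  by have sn : `|s| != 0 by [rewrite normr_eq0]; field; rewrite t0 sn.
have I2 := intgZ (r ^+ 2) I.
split; first by apply: eq_intg I2 => t; exact: E.
transitivity (ii mu (fun t => r ^+ 2 * ((1 - cos ((r * t + 0) ^+ 2)) / (r * t + 0) ^+ 2))).
  by apply: eq_ii => t; rewrite E.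
by rewrite iiZ// e -/c0 -/r; field; exact: lt0r_neq0.
Qed.

Lemma dl_cos (s x t : R) : dl (fun y => cos (y * s)) x t = cos (x * s) * ((1 - cos (s * t ^+ 2)) / t ^+ 2).
Proof.
rewrite /dl mulrA; congr (_ / _); rewrite (_ : (x + t ^+ 2) * s = x * s + s * t ^+ 2); last by ring.
by rewrite (_ : (x - t ^+ 2) * s = x * s - s * t ^+ 2); [rewrite cosD cosB; field|ring].
Qed.

Lemma dl_sin (s x t : R) : dl (fun y => sin (y * s)) x t = sin (x * s) * ((1 - cos (s * t ^+ 2)) / t ^+ 2).
Proof.
rewrite /dl mulrA; congr (_ / _); rewrite (_ : (x + t ^+ 2) * s = x * s + s * t ^+ 2); last by ring.
by rewrite (_ : (x - t ^+ 2) * s = x * s - s * t ^+ 2); [rewrite sinD sinB; field|ring].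
Qed.

(** The half derivative of a harmonic [T y s] of frequency [s^2] multiplies it by [|s|];
    Fubini's theorem moves this inside the integral and raises the index. *)
Lemma halfD_transform n (T : R -> R -> R) (F : R -> R) x :
  (forall y, intg mu (fun s => gaussw n s * T y s)) -> (forall y, F y = ii mu (fun s => gaussw n s * T y s)) ->
  (forall y s, `|T y s| <= 1) -> measurable_fun setT (T x) ->
  (forall s t, dl (T^~ s) x t = T x s * ((1 - cos (s ^+ 2 * t ^+ 2)) / t ^+ 2)) ->
  halfD F x = ii mu (fun s => gaussw n.+1 s * T x s).
Proof.
move=> IT FE T1 mT hT.
pose H (z : R * R) := gaussw n z.1 * T x z.1 * ((1 - cos (z.1 ^+ 2 * z.2 ^+ 2)) / z.2 ^+ 2).
have e t : dl F x t = ii mu (fun s => H (s, t)).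
  rewrite /H /= -[RHS](@eq_ii _ _ _ mu (fun s => (gaussw n s * T x s - (gaussw n s * T (x + t ^+ 2) s + gaussw n s * T (x - t ^+ 2) s) * 2^-1) * (t ^+ 2)^-1)).
    rewrite iiZr; last by apply: intgB => //; apply: intgZr; exact: intgD.
    rewrite iiB//; last by apply: intgZr; exact: intgD.
    rewrite iiZr; last exact: intgD.
    by rewrite iiD// -!FE.
  by move=> s; rewrite -[RHS]mulrA -hT /dl; move: ((t ^+ 2)^-1) => i; field.
have iH s : intg mu (fun t => H (s, t)).
  rewrite /H /=; apply: intgZ; exact: (one_cos_scale (s ^+ 2)).1.
have mH : measurable_fun [set: plane R] H.
  apply: measurable_funM.
    apply: (@meas_fst _ (fun s => gaussw n s * T x s)); apply: measurable_funM => //.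
    by apply: cont_meas; exact: gaussw_cont.
  apply: measurable_funM; last exact: (meas_snd isqr_meas).
  apply: measurable_funB; first exact: measurable_cst.
  apply: meas_cos_comp.
  by apply: measurable_funM; [exact: (meas_fst sqr_meas)|exact: (meas_snd sqr_meas)].
have sq s : Num.sqrt `|s ^+ 2| = `|s| :> R by rewrite ger0_norm ?sqr_ge0// sqrtr_sqr.
have I : intg mu2 H.
  apply: (@tonelli12 _ _ _ _ _ mu mu H (fun s => c0 * gaussw n.+1 s)) => //; last exact: intgZ (intg_gaussw _).
  move=> s; rewrite /H /=.
  rewrite (@eq_ii _ _ _ mu _ (fun t => `|gaussw n s * T x s| * ((1 - cos (s ^+ 2 * t ^+ 2)) / t ^+ 2))).
    rewrite iiZ ?(one_cos_scale _).2 ?sq; last exact: (one_cos_scale _).1.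
    rewrite mulrA [c0 * _]mulrC ler_wpM2r ?(ltW c0_gt0)// /gaussw [`|s| ^+ n.+1]exprS.
    rewrite !normrM normrX normr_id (ger0_norm (expR_ge0 _)).
    rewrite (_ : _ * _ * _ * _ = (`|s| * `|s| ^+ n * expR (- s ^+ 2)) * `|T x s|); last by ring.
    by rewrite ler_piMr// mulr_ge0 ?expR_ge0// mulr_ge0// exprn_ge0.
  move=> t; rewrite normrM; congr (_ * _); rewrite ger0_norm// mulr_ge0 ?invr_ge0 ?sqr_ge0// subr_ge0; exact: cos_le1.
rewrite /halfD (_ : ii mu (dl F x) = ii mu (fun t => ii mu (fun s => H (s, t)))); last first.
  by apply: eq_ii => t; exact: e.
rewrite -(fubini_swap I).
transitivity (c0^-1 * ii mu (fun s => c0 * (gaussw n.+1 s * T x s))).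
  congr (_ * _); apply: eq_ii => s; rewrite /H /= iiZ ?(one_cos_scale _).2 ?sq; last exact: (one_cos_scale _).1.
  by rewrite /gaussw [`|s| ^+ n.+1]exprS; ring.
rewrite iiZ; first by rewrite mulKf// gt_eqF ?c0_gt0.
by apply: intg_gausswM mT _ => s; exact: T1.
Qed.

Lemma halfD_lapc n x : halfD (lapc n) x = lapc n.+1 x.
Proof.
apply: (@halfD_transform n (fun y s => cos (y * s ^+ 2))) => //.
- by move=> y; exact: intg_lapc.
- by move=> y s; exact: cos_norm1.
- exact: cos_meas.
- by move=> s t; rewrite dl_cos.
Qed.

Lemma halfD_laps n x : halfD (laps n) x = laps n.+1 x.
Proof.
apply: (@halfD_transform n (fun y s => sin (y * s ^+ 2))) => //.
- by move=> y; exact: intg_laps.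
- by move=> y s; exact: sin_norm1.
- exact: sin_meas.
- by move=> s t; rewrite dl_sin.
Qed.

End HalfDerivative.

(** * Decay of the half derivative *)
Section WeightedDecay.
Context {R : realType}.
Notation mu := (leb R).
Notation mu2 := (leb R \x leb R)%E.
Implicit Types (f g u phi psi : R -> R) (x y t : R).

(** [W = (1 + x^2)^(-3/4)] is the decay of half derivatives of Schwartz functions. [fw] is
    comparable to [W] and has the explicit bounded primitive [Fw], which makes every integral of
    the weight elementary. *)
Definition r4 x : R := Num.sqrt (Num.sqrt (1 + x ^+ 2)).
Definition W x : R := (r4 x ^+ 3)^-1.
Definition Fw x : R := x * (2 * (r4 x ^+ 2)^-1 - (r4 x ^+ 3)^-1).
Definition fw x : R := 2^-1 * W x + 2 * (r4 x ^+ 6)^-1 - 3 / 2 * (r4 x ^+ 7)^-1.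

Lemma sqrt1_ge1 (a : R) : 1 <= a -> 1 <= Num.sqrt a.
Proof. by move=> a1; rewrite -[1]sqrtr1 ler_wsqrtr. Qed.

Lemma r4_ge1 x : 1 <= r4 x.
Proof. by apply: sqrt1_ge1; apply: sqrt1_ge1; rewrite lerDl sqr_ge0. Qed.

Lemma r4_gt0 x : 0 < r4 x. Proof. exact: lt_le_trans ltr01 (r4_ge1 x). Qed.

Lemma r4_4 x : r4 x ^+ 4 = 1 + x ^+ 2.
Proof. by rewrite -[4%N]/(2 * 2)%N exprM !sqr_sqrtr ?sqrtr_ge0// ltW// sqr1_gt0. Qed.

Lemma dv_sqrt u u' : dv u u' -> (forall x, 0 < u x) -> dv (fun x => Num.sqrt (u x)) (fun x => u' x * (2 * Num.sqrt (u x))^-1).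
Proof.
move=> du u0 x; have := @is_derive1_sqrt R (u x) (u0 x) => h.
have := @is_derive1_comp R (@Num.sqrt R) u x _ _ h (du x) => H.
by apply: is_derive_eq H _; rewrite mulrC.
Qed.

Lemma dv_r4 : dv r4 (fun x => x / (2 * r4 x ^+ 3)).
Proof.
have h1 := dv_sqrt (@dv_sqr1 R) (@sqr1_gt0 R).
have h2 := dv_sqrt h1 (fun x => (lt_le_trans ltr01 (sqrt1_ge1 (_ : 1 <= 1 + x ^+ 2)))).
apply: dv_ext (h2 _) => // [x|x]; last by rewrite lerDl sqr_ge0.
rewrite -/(r4 x); have e : Num.sqrt (1 + x ^+ 2) = r4 x ^+ 2 by rewrite sqr_sqrtr// sqrtr_ge0.
by rewrite e; have := lt0r_neq0 (r4_gt0 x); move: (r4 x) => r rn; field.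
Qed.

Lemma W_gt0 x : 0 < W x. Proof. by rewrite invr_gt0 exprn_gt0 ?r4_gt0. Qed.
Lemma W_ge0 x : 0 <= W x. Proof. exact: ltW (W_gt0 x). Qed.
Lemma W_le1 x : W x <= 1.
Proof. by rewrite invf_le1 ?exprn_gt0 ?r4_gt0// exprn_ege1// r4_ge1. Qed.

Lemma r4_cont : continuous r4. Proof. exact: dv_cont dv_r4. Qed.

Lemma W_cont : continuous W.
Proof.
move=> x; apply: cvgV; first by rewrite gt_eqF// exprn_gt0 ?r4_gt0.
by apply: cvgM; [exact: r4_cont|apply: cvgM; exact: r4_cont].
Qed.

Lemma dv_Fw : dv Fw fw.
Proof.
have dn (k : nat) : dv (fun x => r4 x ^+ k.+1) (fun x => k.+1%:R * (x / (2 * r4 x ^+ 3)) * r4 x ^+ k).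
  elim: k => [|k ih]; first by apply: dv_ext dv_r4 => x; rewrite ?expr1 ?expr0 ?mulr1 ?mul1r.
  apply: dv_ext (dvM dv_r4 ih) => x; first by rewrite [RHS]exprS.
  by rewrite [r4 x ^+ k.+1]exprS -[k.+2]addn1 natrD; ring.
have nz (k : nat) x : r4 x ^+ k != 0 by rewrite gt_eqF// exprn_gt0 ?r4_gt0.
have h := dvM dv_id (dvB (dvZ 2 (dvV (dn 1%N) (nz 2%N))) (dvV (dn 2%N) (nz 3%N))).
apply: dv_ext h => x //; rewrite /fw /W.
have rn : r4 x != 0 by rewrite gt_eqF ?r4_gt0.
have e : x ^+ 2 = r4 x ^+ 4 - 1 by rewrite r4_4; ring.
move: (r4 x) rn e => r rn e.
have -> : 1 * (2 * (r ^+ 2)^-1 - (r ^+ 3)^-1) + x * (2 * (- (2%:R * (x / (2 * r ^+ 3)) * r ^+ 1) / (r ^+ 2) ^+ 2) -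
   - (3%:R * (x / (2 * r ^+ 3)) * r ^+ 2) / (r ^+ 3) ^+ 2) =
   2 * (r ^+ 2)^-1 - (r ^+ 3)^-1 - x ^+ 2 * (2 / r ^+ 6 - 3 / (2 * r ^+ 7)) by field.
by rewrite e; field.
Qed.

Lemma fw_W x : W x <= 2 * fw x.
Proof.
have r1 := r4_ge1 x; rewrite /fw; suff : (r4 x ^+ 7)^-1 <= (r4 x ^+ 6)^-1.
  by have : 0 <= (r4 x ^+ 6)^-1 by [rewrite invr_ge0 exprn_ge0// ltW// r4_gt0]; lra.
by rewrite lef_pV2 ?posrE ?exprn_gt0 ?r4_gt0// ler_weXn2l.
Qed.

Lemma fw_ge0 x : 0 <= fw x.
Proof. by have := fw_W x; have := W_ge0 x; lra. Qed.

Lemma fw_cont : continuous fw.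
Proof.
have c (k : nat) : continuous (fun x => (r4 x ^+ k)^-1).
  move=> x; apply: cvgV; first by rewrite gt_eqF// exprn_gt0 ?r4_gt0.
  elim: k => [|k ih]; first exact: cvg_cst.
  rewrite (_ : (fun t : R => r4 t ^+ k.+1) = (fun t => r4 t * r4 t ^+ k)); last by apply/funext => s; rewrite exprS.
  by rewrite exprS; apply: cvgM => //; exact: r4_cont.
move=> x; apply: cvgB; [apply: cvgD|]; apply: cvgM; try exact: cvg_cst; [exact: W_cont|exact: c|exact: c].
Qed.

Lemma Fw_le2 x : `|Fw x| <= 2.
Proof.
have r0 := r4_gt0 x; have r1 := r4_ge1 x.
have r2 : 0 < r4 x ^+ 2 by rewrite exprn_gt0.
have xr : `|x| <= r4 x ^+ 2.
  rewrite -(@ler_pXn2r _ 2) ?nnegrE ?(ltW r2)// real_normK ?num_real// -exprM r4_4; lra.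
have h : (r4 x ^+ 3)^-1 <= (r4 x ^+ 2)^-1.
  by rewrite lef_pV2 ?posrE ?exprn_gt0// ler_weXn2l.
have h0 : 0 <= (r4 x ^+ 3)^-1 by rewrite invr_ge0 exprn_ge0// ltW.
rewrite /Fw normrM [X in _ * X]ger0_norm; last by lra.
apply: (@le_trans _ _ (r4 x ^+ 2 * (2 * (r4 x ^+ 2)^-1))).
  by apply: ler_pM => //; lra.
by rewrite mulrCA divff ?mulr1// gt_eqF.
Qed.

Lemma intg_fw : intg mu fw.
Proof. exact: intg_deriv fw_cont fw_ge0 dv_Fw Fw_le2. Qed.

Lemma intg_W : intg mu W.
Proof.
apply: (@intg_le _ _ _ mu _ (fun x => 2 * fw x)).
- by apply: cont_meas; exact: W_cont.
- by move=> x; rewrite ger0_norm ?W_ge0 ?fw_W.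
- by apply: intgZ; exact: intg_fw.
Qed.

Lemma W_cmp x y : 1 + x ^+ 2 <= 16 * (1 + y ^+ 2) -> W y <= 8 * W x.
Proof.
rewrite -!r4_4 (_ : 16 * r4 y ^+ 4 = (2 * r4 y) ^+ 4); last by ring.
rewrite ler_pXn2r ?nnegrE ?mulr_ge0 ?(ltW (r4_gt0 _))// => h.
rewrite /W -ler_pdivrMl// -invfM lef_pV2 ?posrE ?mulr_gt0 ?exprn_gt0 ?r4_gt0//.
by rewrite (_ : 8 * r4 y ^+ 3 = (2 * r4 y) ^+ 3); [rewrite ler_pXn2r ?nnegrE ?mulr_ge0 ?(ltW (r4_gt0 _))|ring].
Qed.

(** The substitution [y = x + e t^2] turns the integrand into the derivative of [Fw]. *)
Lemma fw_tail (e x : R) : e = 1 \/ e = -1 -> intg mu (fun t => `|t| * fw (x + e * t ^+ 2)) /\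
  ii mu (fun t => `|t| * fw (x + e * t ^+ 2)) <= 4.
Proof.
move=> he; have e2 : e * e = 1 by case: he => ->; ring.
pose f t := t * fw (x + e * t ^+ 2); pose G t := e / 2 * Fw (x + e * t ^+ 2).
have dq2 : dv (fun t : R => x + e * t ^+ 2) (fun t => 0 + e * (1 * t + t * 1)).
  exact: dvD (dv_cst x) (dvZ e (dvM dv_id dv_id)).
have dG : dv G f.
  apply: dv_ext (dvZ (e / 2) (dv_comp dv_Fw dq2)) => t //.
  rewrite /f (_ : _ / _ * _ = e * e * (t * fw (x + e * t ^+ 2))); last by field.
  by rewrite e2 mul1r.
have cf2 : continuous (fun t => fw (x + e * t ^+ 2)).
  move=> t; apply: (@continuous_comp _ _ _ (fun t : R => x + e * t ^+ 2) fw); [exact: (dv_cont dq2)|exact: fw_cont].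
have cf : continuous f by move=> t; apply: cvgM; [exact: cvg_id|exact: cf2].
have [|t _|I h] := @half_le R f G 1 cf dG.
- by move=> t t0; rewrite mulr_ge0// fw_ge0.
- rewrite /G normrM; have := Fw_le2 (x + e * t ^+ 2).
  have -> : `|e / 2| = 2^-1 by case: he => ->; rewrite normrM ?normrN normr1 mul1r ger0_norm// invr_ge0.
  lra.
have E t : f t * hl t = `|t| * fw (x + e * t ^+ 2) * hl t.
  by rewrite /f /hl; case: (lerP 0 t) => t0; rewrite ?mulr0// ger0_norm.
have [|||I2 ->] := @even_half R (fun t => `|t| * fw (x + e * t ^+ 2)).
- by move=> t; rewrite normrN sqrrN.
- by apply: cont_meas => t; apply: cvgM; [apply: cvg_norm; exact: cvg_id|exact: cf2].
- by apply: eq_intg I => t; rewrite E.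
split => //; rewrite -(@eq_ii _ _ _ mu _ _ E); lra.
Qed.

(** Majorant of the second-difference quotient at unit weight; its integral is at most [CD],
    independently of [x]. *)
Definition gk x t : R := 40 * pi * p t + 16 * (`|t| * fw (x + 1 * t ^+ 2) + `|t| * fw (x + -1 * t ^+ 2)).
Definition CD : R := 40 * pi + 128.

Lemma intg_gk x : intg mu (gk x) /\ ii mu (gk x) <= CD.
Proof.
have [I1 h1] := fw_tail x (or_introl erefl); have [I2 h2] := fw_tail x (or_intror erefl).
have I := intgZ 16 (intgD I1 I2); have I0 := intgZ (40 * pi) (@intg_p R).
split; first exact: intgD.
rewrite /gk iiD// (iiZ _ (intgD I1 I2)) (iiD I1 I2) (iiZ _ (@intg_p R)) ii_p.
by apply: lerD; [rewrite mulr1|move: h1 h2; move: (ii _ _) (ii _ _) => a b; lra].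
Qed.

(** Twice differentiable with all derivatives bounded by the weight: a class on which the half
    derivative is an absolutely convergent integral with the decay [W]. *)
Definition WC2 A phi := exists phi' phi'', [/\ dv phi phi', dv phi' phi'',
  (forall x, `|phi x| <= A * W x), (forall x, `|phi' x| <= A * W x) & (forall x, `|phi'' x| <= A * W x)].

(** Small [t]: Taylor. Large [t]: the translates either stay at distance comparable to [|x|], or
    [t^2] exceeds [|x| / 2] and the kernel itself supplies the decay. *)
Lemma dl_WC2 A phi x t : WC2 A phi -> `|dl phi x t| <= A * W x * gk x t.
Proof.
move=> [phi' [phi'' [d1 d2 h0 _ h2]]].
have A0 : 0 <= A by have := h0 0; have := W_gt0 0; have := normr_ge0 (phi 0); nra.
have AW : 0 <= A * W x by rewrite mulr_ge0 ?W_ge0.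
have pE : 2 * pi * p t = 2 / (1 + t ^+ 2) by rewrite /p invfM mulrA mulfK// pi_neq0.
have tail e : 0 <= `|t| * fw (x + e * t ^+ 2) by rewrite mulr_ge0 ?fw_ge0.
rewrite /dl normrM normfV (ger0_norm (sqr_ge0 t)).
have [t1|t1] := lerP (t ^+ 2) 1.
  have h : `|phi x - (phi (x + t ^+ 2) + phi (x - t ^+ 2)) / 2| <= 8 * (A * W x) * t ^+ 4.
    rewrite -[4%N]/(2 * 2)%N exprM; apply: (@sdiff _ phi phi' phi'' (8 * (A * W x)) x (t ^+ 2) d1 d2) => y.
    rewrite (ger0_norm (sqr_ge0 t)) => yx; apply: le_trans (h2 y) _.
    rewrite mulrCA ler_wpM2l//; apply: W_cmp.
    have : `|y - x| <= 1 by exact: le_trans t1.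
    rewrite ler_norml => /andP[? ?]; have : (y - x) ^+ 2 <= 1 by nra.
    have := sqr_ge0 (y + (y - x)); nra.
  apply: (@le_trans _ _ (A * W x * (8 * (2 * pi * p t)))); last first.
    rewrite ler_wpM2l// /gk; have := tail 1; have := tail (-1).
    by have : 0 <= pi * p t by [rewrite mulr_ge0 ?pi_ge0 ?p_ge0]; lra.
  have [->|t0] := eqVneq t 0.
    by rewrite expr0n invr0 mulr0 !mulr_ge0 ?pi_ge0 ?p_ge0 ?W_ge0.
  have t2 : 0 < t ^+ 2 by rewrite exprn_even_gt0.
  rewrite ler_pdivrMr//; apply: le_trans h _.
  have k4 : t ^+ 4 <= 2 / (1 + t ^+ 2) * t ^+ 2.
    rewrite mulrAC ler_pdivlMr ?sqr1_gt0// (_ : t ^+ 4 = t ^+ 2 * t ^+ 2); last by ring.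
    by move: (t ^+ 2) t2 t1 => z; nra.
  rewrite pE (_ : A * W x * (8 * (2 / (1 + t ^+ 2))) * t ^+ 2 = 8 * (A * W x) * (2 / (1 + t ^+ 2) * t ^+ 2)); last by ring.
  by rewrite ler_wpM2l// mulr_ge0.
have t0 : 0 < t ^+ 2 by exact: lt_trans t1.
have it : (t ^+ 2)^-1 <= 2 * pi * p t.
  rewrite pE ler_pdivlMr ?sqr1_gt0// mulrC ler_pdivrMr//; lra.
have i0 : 0 <= (t ^+ 2)^-1 by rewrite invr_ge0 ltW.
have key e : e = 1 \/ e = -1 -> `|phi (x + e * t ^+ 2)| * (t ^+ 2)^-1 <= A * W x * (16 * pi * p t + 16 * (`|t| * fw (x + e * t ^+ 2))).
  move=> he; set y := x + _.
  have [ts|ts] := lerP (t ^+ 2) ((1 + `|x|) / 2).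
    apply: (@le_trans _ _ (A * (8 * W x) * (2 * pi * p t))).
      rewrite ler_pM//; apply: le_trans (h0 y) _; rewrite ler_wpM2l//; apply: W_cmp.
      have hy : `|x| - t ^+ 2 <= `|y|.
        have -> : t ^+ 2 = `|e * t ^+ 2| by case: he => ->; rewrite ?mulN1r ?mul1r ?normrN ger0_norm// ltW.
        by have := lerB_dist x (- (e * t ^+ 2)); rewrite normrN opprK.
      have hxy : `|x| <= 2 * `|y| + 1 by lra.
      rewrite -(real_normK (num_real x)) -(real_normK (num_real y)).
      move: (normr_ge0 x) (normr_ge0 y) hxy; move: `|x| `|y| => a b a0 b0 ab.
      have := sqr_ge0 (b - 1); have : a ^+ 2 <= (2 * b + 1) ^+ 2 by nra.
      nra.
    rewrite (_ : A * (8 * W x) * _ = A * W x * (16 * pi * p t)); last by ring.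
    by rewrite ler_wpM2l// lerDl mulr_ge0 ?tail.
  have h1 : `|phi y| <= A * (2 * fw y) by apply: le_trans (h0 y) _; rewrite ler_wpM2l// fw_W.
  have h3 : (t ^+ 2)^-1 <= 8 * W x * `|t|.
    have r2 : r4 x ^+ 2 <= 2 * t ^+ 2.
      apply: (@le_trans _ _ (1 + `|x|)); last by lra.
      rewrite -(@ler_pXn2r _ 2) ?nnegrE ?addr_ge0 ?sqr_ge0// -exprM r4_4 -(real_normK (num_real x)).
      by have := normr_ge0 x; nra.
    have r1 : r4 x <= 2 * `|t|.
      rewrite -(@ler_pXn2r _ 2) ?nnegrE ?mulr_ge0 ?(ltW (r4_gt0 _))// exprMn real_normK ?num_real//; lra.
    have tn : 0 < `|t| by rewrite normr_gt0; apply: contraTneq t0 => ->; rewrite expr0n ltxx.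
    rewrite -(real_normK (num_real t)) -[(`|t| ^+ 2)^-1]mulr1 ler_pdivrMl ?exprn_gt0//.
    rewrite (_ : _ ^+ 2 * (8 * W x * `|t|) = (2 * `|t|) ^+ 3 * W x); last by ring.
    by rewrite /W ler_pdivlMr ?exprn_gt0 ?r4_gt0// mul1r ler_pXn2r ?nnegrE ?mulr_ge0 ?(ltW (r4_gt0 _)).
  apply: le_trans (ler_pM _ i0 h1 h3) _ => //.
  rewrite (_ : A * (2 * fw y) * _ = A * W x * (16 * (`|t| * fw y))); last by ring.
  by rewrite ler_wpM2l// lerDr !mulr_ge0 ?pi_ge0 ?p_ge0.
have k1 := key 1 (or_introl erefl); have k2 := key (-1) (or_intror erefl).
have k0 : `|phi x| * (t ^+ 2)^-1 <= A * W x * (2 * pi * p t) by rewrite ler_pM.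
rewrite mul1r mulN1r in k1 k2.
apply: (@le_trans _ _ (`|phi x| * (t ^+ 2)^-1 + (`|phi (x + t ^+ 2)| * (t ^+ 2)^-1 + `|phi (x - t ^+ 2)| * (t ^+ 2)^-1) / 2)).
  rewrite -mulrDl mulrAC -mulrDl ler_wpM2r// (le_trans (ler_normB _ _))// lerD2l normrM.
  by rewrite (ger0_norm (_ : 0 <= 2^-1)) ?invr_ge0// ler_wpM2r ?invr_ge0// ler_normD.
rewrite /gk mul1r mulN1r.
set T1 := `|t| * fw (x + _) in k1 *; set T2 := `|t| * fw (x - _) in k2 *.
have T10 : 0 <= A * W x * T1 by rewrite mulr_ge0//; have := tail 1; rewrite mul1r.
have T20 : 0 <= A * W x * T2 by rewrite mulr_ge0//; have := tail (-1); rewrite mulN1r.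
have P0 : 0 <= A * W x * (pi * p t) by rewrite mulr_ge0// mulr_ge0 ?pi_ge0 ?p_ge0.
move: k0 k1 k2.
rewrite (_ : A * W x * (2 * pi * p t) = 2 * (A * W x * (pi * p t))); last by ring.
rewrite (_ : A * W x * (16 * pi * p t + 16 * T1) = 16 * (A * W x * (pi * p t)) + 16 * (A * W x * T1)); last by ring.
rewrite (_ : A * W x * (16 * pi * p t + 16 * T2) = 16 * (A * W x * (pi * p t)) + 16 * (A * W x * T2)); last by ring.
rewrite (_ : A * W x * (40 * pi * p t + 16 * (T1 + T2)) = 40 * (A * W x * (pi * p t)) + 16 * (A * W x * T1) + 16 * (A * W x * T2)); last by ring.
move: (A * W x * (pi * p t)) (A * W x * T1) (A * W x * T2) P0 T10 T20 => P X1 X2 P0 T10 T20; lra.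
Qed.

End WeightedDecay.

(** * Symmetry of the half derivative, and its action on harmonics *)
Section HalfDerivativeDecay.
Context {R : realType}.
Notation mu := (leb R).
Notation mu2 := (leb R \x leb R)%E.
Implicit Types (f g u v phi psi : R -> R) (x y t : R).

Lemma WC2_cont A phi : WC2 A phi -> continuous phi.
Proof. by case=> [phi' [phi'' [d _ _ _ _]]]; exact: dv_cont d. Qed.

Lemma WC2_le A phi x : WC2 A phi -> `|phi x| <= A * W x.
Proof. by case=> [phi' [phi'' [_ _ h _ _]]]. Qed.

Lemma WC2_A0 A phi : WC2 A phi -> 0 <= A.
Proof.
move=> h; have := WC2_le 0 h; have := W_gt0 (0 : R); have := normr_ge0 (phi 0); nra.
Qed.

Lemma WC2_meas A phi : WC2 A phi -> measurable_fun setT phi.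
Proof. by move=> h; apply: cont_meas; exact: WC2_cont h. Qed.

Lemma WC2_intg A phi : WC2 A phi -> intg mu phi.
Proof.
move=> h; apply: (@intg_le _ _ _ mu _ (fun x => A * W x)).
- exact: WC2_meas h.
- by move=> x; exact: WC2_le.
- by apply: intgZ; exact: intg_W.
Qed.

Lemma WC2_bd A phi x : WC2 A phi -> `|phi x| <= A.
Proof.
move=> h; apply: le_trans (WC2_le x h) _; rewrite ler_piMr ?W_le1//; exact: WC2_A0 h.
Qed.

Lemma WC2_L2 A phi : WC2 A phi -> L2 mu phi.
Proof.
move=> h; have mphi := WC2_meas h; split => //.
apply: (@intg_le _ _ _ mu _ (fun x => A * `|phi x|)).
- exact: measurable_funX.
- by move=> x; rewrite normrX expr2 ler_wpM2r// (WC2_bd _ h).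
- by apply: intgZ; apply: intg_norm; exact: WC2_intg h.
Qed.

Lemma WC2D A B u v : WC2 A u -> WC2 B v -> WC2 (A + B) (fun x => u x + v x).
Proof.
move=> [u' [u'' [d1 d2 h0 h1 h2]]] [v' [v'' [e1 e2 k0 k1 k2]]].
exists (fun x => u' x + v' x), (fun x => u'' x + v'' x); split; [exact: dvD|exact: dvD|..];
  by move=> x; rewrite mulrDl (le_trans (ler_normD _ _))// lerD.
Qed.

Lemma WC2Z k A u : WC2 A u -> WC2 (`|k| * A) (fun x => k * u x).
Proof.
move=> [u' [u'' [d1 d2 h0 h1 h2]]].
exists (fun x => k * u' x), (fun x => k * u'' x); split; [exact: dvZ|exact: dvZ|..];
  by move=> x; rewrite normrM -mulrA ler_wpM2l.
Qed.

Lemma WC2_0 : WC2 0 (fun=> 0 : R).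
Proof.
by exists (fun=> 0), (fun=> 0); split; [exact: dv_cst|exact: dv_cst|..] => x; rewrite normr0 mul0r.
Qed.

Lemma WC2_sum K (a : nat -> R) (F : nat -> R -> R) : (forall k, exists A, WC2 A (F k)) ->
  exists A, WC2 A (fun x => \sum_(0 <= k < K) a k * F k x).
Proof.
move=> h; elim: K => [|K [A ih]].
  by exists 0; under eq_fun do rewrite big_nil; exact: WC2_0.
have [B hB] := h K; exists (A + `|a K| * B).
by under eq_fun do rewrite big_nat_recr//=; apply: WC2D => //; exact: WC2Z.
Qed.

Lemma intg_dl2 A phi : WC2 A phi -> intg mu2 (fun z => dl phi z.1 z.2).
Proof.
move=> h; have mphi := WC2_meas h; have A0 := WC2_A0 h.
have Ix x : intg mu (dl phi x).
  apply: (@intg_le _ _ _ mu _ (fun t => A * W x * gk x t)); first exact: dl_meas.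
    by move=> t; exact: dl_WC2.
  by apply: intgZ; case: (intg_gk x).
apply: (@tonelli12 _ _ _ _ _ mu mu (fun z => dl phi z.1 z.2) (fun x => A * CD * W x)) => //.
- exact: dl_meas2.
- move=> x /=; apply: (@le_trans _ _ (ii mu (fun t => A * W x * gk x t))).
    apply: le_ii; [exact: intg_norm|by apply: intgZ; case: (intg_gk x)|].
    by move=> t; exact: dl_WC2.
  have [I hI] := intg_gk x; rewrite iiZ// mulrAC ler_wpM2r ?W_ge0// ler_wpM2l//.
- by apply: intgZ; exact: intg_W.
Qed.

Lemma intg_dl A phi x : WC2 A phi -> intg mu (dl phi x).
Proof.
move=> h; apply: (@intg_le _ _ _ mu _ (fun t => A * W x * gk x t)).
- by apply: dl_meas; exact: WC2_meas h.
- by move=> t; exact: dl_WC2.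
- by apply: intgZ; case: (intg_gk x).
Qed.

Lemma halfD_intg A phi : WC2 A phi -> intg mu (halfD phi).
Proof. by move=> h; apply: intgZ; exact: (fubini12 (intg_dl2 h)).1. Qed.

Lemma halfD_meas A phi : WC2 A phi -> measurable_fun setT (halfD phi).
Proof. by move=> /halfD_intg /intg_meas. Qed.

Lemma halfD_le A phi x : WC2 A phi -> `|halfD phi x| <= c0^-1 * CD * A * W x.
Proof.
move=> h; have c0' := c0_gt0 (R := R); have A0 := WC2_A0 h.
rewrite /halfD normrM gtr0_norm ?invr_gt0// -!mulrA ler_wpM2l ?invr_ge0 ?(ltW c0')//.
have [I hI] := intg_gk x.
apply: (@le_trans _ _ (ii mu (fun t => A * W x * gk x t))).
  apply: norm_ii_le; [by apply: dl_meas; exact: WC2_meas h|by move=> t; exact: dl_WC2|exact: intgZ].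
by rewrite iiZ// mulrC ler_wpM2r// mulr_ge0 ?W_ge0.
Qed.

(** For fixed [t] the second difference is symmetric by translation invariance; Fubini's theorem
    exchanges the integrals. *)
Lemma halfD_sym A a M phi : Bd a -> kbound a M -> WC2 A phi -> ii mu (fun x => phi x * halfD a x) = ii mu (fun x => a x * halfD phi x).
Proof.
move=> [ma [Ma ha]] ka h; have mphi := WC2_meas h; have Iphi := WC2_intg h.
have A0 := WC2_A0 h; have Ma0 : 0 <= Ma by exact: le_trans (ha 0).
pose H1 (z : R * R) := phi z.1 * dl a z.1 z.2.
pose H2 (z : R * R) := a z.1 * dl phi z.1 z.2.
have M0 : 0 <= M by have := ka 0 0; have := p_gt0 (0 : R); have := normr_ge0 (dl a 0 0); nra.
have I1 : intg mu2 H1.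
  apply: (@intg_le _ _ _ mu2 _ (fun z => (M * `|phi z.1|) * p z.2)).
  - by apply: measurable_funM; [exact: meas_fst|exact: dl_meas2].
  - by case=> x t /=; rewrite normrM [M * _]mulrC -mulrA ler_wpM2l.
  - by apply: (@intg_prodM _ _ _ _ _ mu mu (fun x => M * `|phi x|) (@p R)); [apply: intgZ; exact: intg_norm|exact: intg_p].
have I2 : intg mu2 H2.
  apply: (@intg_le _ _ _ mu2 _ (fun z => Ma * `|dl phi z.1 z.2|)).
  - by apply: measurable_funM; [exact: meas_fst|exact: dl_meas2].
  - by case=> x t /=; rewrite normrM ler_wpM2r.
  - by apply: intgZ; apply: intg_norm; exact: intg_dl2 h.
have key t : ii mu (fun x => H1 (x, t)) = ii mu (fun x => H2 (x, t)).
  pose s := t ^+ 2.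
  have Is e : intg mu (fun x => phi (x + e)) by exact: (ii_shift e Iphi).1.
  have ba e : intg mu (fun x => a x * phi (x + e)).
    apply: (@intg_le _ _ _ mu _ (fun x => Ma * `|phi (x + e)|)).
    - by apply: measurable_funM => //; exact: intg_meas.
    - by move=> x; rewrite normrM ler_wpM2r.
    - by apply: intgZ; apply: intg_norm.
  have sh e : intg mu (fun x => phi x * a (x + e)) /\ ii mu (fun x => phi x * a (x + e)) = ii mu (fun x => a x * phi (x + - e)).
    have [J E] := ii_shift e (ba (- e)).
    have F x : a (x + e) * phi (x + e + - e) = phi x * a (x + e) by rewrite addrK mulrC.
    by split; [apply: eq_intg J => x; exact: F|rewrite -E; apply: eq_ii => x; rewrite F].
  have sh0 : intg mu (fun x => phi x * a x).
    by have [J _] := sh 0; apply: eq_intg J => x; rewrite addr0.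
  have ba0 : intg mu (fun x => a x * phi x).
    by apply: eq_intg sh0 => x; rewrite mulrC.
  have e1 : ii mu (fun x => H1 (x, t)) = (ii mu (fun x => phi x * a x) - (ii mu (fun x => phi x * a (x + s)) + ii mu (fun x => phi x * a (x + - s))) * 2^-1) * s^-1.
    rewrite -iiD; [|exact: (sh s).1|exact: (sh (- s)).1].
    rewrite -iiZr; last by apply: intgD; [exact: (sh s).1|exact: (sh (- s)).1].
    rewrite -iiB//; last by apply: intgZr; apply: intgD; [exact: (sh s).1|exact: (sh (- s)).1].
    rewrite -iiZr; last by apply: intgB => //; apply: intgZr; apply: intgD; [exact: (sh s).1|exact: (sh (- s)).1].
    by apply: eq_ii => x; rewrite /H1 /= /dl -/s; move: (s^-1) => i; field.
  have e2 : ii mu (fun x => H2 (x, t)) = (ii mu (fun x => a x * phi x) - (ii mu (fun x => a x * phi (x + s)) + ii mu (fun x => a x * phi (x + - s))) * 2^-1) * s^-1.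
    rewrite -iiD; [|exact: ba|exact: ba].
    rewrite -iiZr; last by apply: intgD; exact: ba.
    rewrite -iiB//; last by apply: intgZr; apply: intgD; exact: ba.
    rewrite -iiZr; last by apply: intgB => //; apply: intgZr; apply: intgD; exact: ba.
    by apply: eq_ii => x; rewrite /H2 /= /dl -/s; move: (s^-1) => i; field.
  rewrite e1 e2 (sh s).2 (sh (- s)).2 opprK.
  have -> : ii mu (fun x => phi x * a x) = ii mu (fun x => a x * phi x) by apply: eq_ii => x; rewrite mulrC.
  by congr ((_ - _ * _) * _); rewrite addrC.
transitivity (c0^-1 * ii mu (fun x => ii mu (fun t => H1 (x, t)))).
  rewrite -iiZ; last exact: (fubini12 I1).1.
  apply: eq_ii => x; rewrite /H1 /= iiZ /halfD; first by ring.
  exact: kbound_intg ma ka.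
rewrite (fubini_swap I1) (@eq_ii _ _ _ mu _ _ key) -(fubini_swap I2) -iiZ; last exact: (fubini12 I2).1.
by apply: eq_ii => x; rewrite /H2 /= iiZ /halfD; [ring|exact: intg_dl h].
Qed.

Lemma halfD_cvg M (F : nat -> R -> R) f x : (forall k, measurable_fun setT (F k)) -> measurable_fun setT f -> (forall k, kbound (F k) M) ->
  (forall y, F k y @[k --> \oo] --> f y) -> halfD (F k) x @[k --> \oo] --> halfD f x.
Proof.
move=> mF mf hk hc; apply: cvgM; first exact: cvg_cst.
have [|||||_ H] := @ii_dct _ _ _ mu (fun k => dl (F k) x) (dl f x) (fun t => M * p t).
- by move=> k; exact: dl_meas.
- exact: dl_meas.
- apply: aeW => t; apply: cvgM; last exact: cvg_cst.
  apply: cvgB; first exact: hc.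
  by apply: cvgM; [apply: cvgD; exact: hc|exact: cvg_cst].
- exact: intgZ intg_p.
- by move=> k t; exact: hk.
- exact: H.
Qed.

Lemma WC2_kbound A phi : WC2 A phi -> kbound phi (4 * A * pi).
Proof.
move=> h; have A0 := WC2_A0 h; have := h => -[u' [u'' [d1 d2 h0 h1 h2]]].
apply: kbound_C2 d1 d2 _ _ => x; first exact: WC2_bd h.
by apply: le_trans (h2 x) _; rewrite ler_piMr ?W_le1.
Qed.

Definition kregular u := measurable_fun setT u /\ exists M, kbound u M.

Lemma kregular_intg u x : kregular u -> intg mu (dl u x).
Proof. by move=> [mu_ [M hM]]; exact: kbound_intg mu_ hM. Qed.

Lemma kregularD u v : kregular u -> kregular v -> kregular (fun x => u x + v x).
Proof.
move=> [m1 [M h]] [m2 [N k]]; split; first exact: measurable_funD.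
by exists (M + N) => x t; rewrite dlD mulrDl (le_trans (ler_normD _ _))// lerD.
Qed.

Lemma kregularZ k u : kregular u -> kregular (fun x => k * u x).
Proof.
move=> [m1 [M h]]; split; first by apply: measurable_funM => //; exact: measurable_cst.
by exists (`|k| * M) => x t; rewrite dlZ normrM -mulrA ler_wpM2l.
Qed.

Lemma kregular_cst c : kregular (fun _ : R => c).
Proof. by split; [exact: measurable_cst|exists 0 => x t; rewrite dl_cst normr0 mul0r]. Qed.

Lemma halfD_D u v x : kregular u -> kregular v -> halfD (fun x => u x + v x) x = halfD u x + halfD v x.
Proof.
move=> h k; rewrite /halfD -mulrDr -iiD; [|exact: kregular_intg|exact: kregular_intg].
by congr (_ * _); apply: eq_ii => t; rewrite dlD.
Qed.

Lemma halfD_Z k u x : kregular u -> halfD (fun x => k * u x) x = k * halfD u x.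
Proof.
move=> h; rewrite /halfD [RHS]mulrCA -(iiZ k (kregular_intg x h)).
by congr (_ * _); apply: eq_ii => t; rewrite dlZ.
Qed.

Lemma halfD_cst c x : halfD (fun=> c) x = 0 :> R.
Proof.
rewrite /halfD (_ : ii mu _ = 0) ?mulr0// -[RHS](ii0 mu); apply: eq_ii => t; exact: dl_cst.
Qed.

Lemma halfD_sum K (a : nat -> R) (F : nat -> R -> R) : (forall k, kregular (F k)) ->
  kregular (fun x => \sum_(0 <= k < K) a k * F k x) /\
  forall x, halfD (fun x => \sum_(0 <= k < K) a k * F k x) x = \sum_(0 <= k < K) a k * halfD (F k) x.
Proof.
move=> h; elim: K => [|K [ih1 ih2]].
  rewrite (_ : (fun x => _) = (fun=> 0)); last by apply/funext => x; rewrite big_nil.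
  by split => [|x]; [exact: kregular_cst|rewrite halfD_cst big_nil].
rewrite (_ : (fun x => _) = (fun x => \sum_(0 <= k < K) a k * F k x + a K * F K x)); last first.
  by apply/funext => x; rewrite big_nat_recr.
split; first by apply: kregularD => //; exact: kregularZ.
move=> x; rewrite big_nat_recr//= halfD_D//; last exact: kregularZ.
by rewrite ih2 halfD_Z.
Qed.

Lemma AB_bound n x : (1 < n)%N -> `|lapc n x| <= lapc n 0 * W x /\ `|laps n x| <= lapc n 0 * W x.
Proof.
move=> n1; have n0 : (0 < n)%N by exact: ltnW.
have h := lapc_size x n0.
have a0 : 0 <= lapc n 0 :> R by apply: ii_ge0 => t; rewrite mul0r cos0 mulr1 gaussw_ge0.
have r0 := r4_gt0 x; have r1 := r4_ge1 x.
have key (c : R) : c ^+ 2 <= lapc n x ^+ 2 + laps n x ^+ 2 -> `|c| <= lapc n 0 * W x.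
  move=> hc; rewrite /W ler_pdivlMr ?exprn_gt0//.
  rewrite -(@ler_pXn2r _ 4) ?nnegrE ?mulr_ge0 ?exprn_ge0 ?(ltW r0)// -h exprMn.
  apply: ler_pM; rewrite ?exprn_ge0 ?(ltW r0)//.
    rewrite -[4%N]/(2 * 2)%N exprM real_normK ?num_real// lerXn2r ?nnegrE ?sqr_ge0//.
    by rewrite addr_ge0 ?sqr_ge0.
  by rewrite -r4_4 -!exprM ler_weXn2l// mulnC leq_mul.
by split; apply: key; rewrite ?lerDl ?lerDr sqr_ge0.
Qed.

Lemma WC2_lapc n : (1 < n)%N -> exists A, WC2 A (@lapc R n).
Proof.
move=> n1; exists (lapc n 0 + lapc n.+2 0 + lapc n.+4 0).
have a0 k : 0 <= lapc k 0 :> R by apply: ii_ge0 => t; rewrite mul0r cos0 mulr1 gaussw_ge0.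
exists (fun x => - laps n.+2 x), (fun x => - lapc n.+4 x); split; [exact: dv_lapc|exact: dvN (dv_laps _)|..] => x; rewrite ?normrN.
- by apply: le_trans (AB_bound x n1).1 _; rewrite ler_wpM2r ?W_ge0//; have := a0 n.+2; have := a0 n.+4; lra.
- by apply: le_trans (AB_bound x (leqW (leqW n1))).2 _; rewrite ler_wpM2r ?W_ge0//; have := a0 n; have := a0 n.+4; lra.
- by apply: le_trans (AB_bound x (leqW (leqW (leqW (leqW n1))))).1 _; rewrite ler_wpM2r ?W_ge0//; have := a0 n; have := a0 n.+2; lra.
Qed.

Lemma WC2_laps n : (1 < n)%N -> exists A, WC2 A (@laps R n).
Proof.
move=> n1; exists (lapc n 0 + lapc n.+2 0 + lapc n.+4 0).
have a0 k : 0 <= lapc k 0 :> R by apply: ii_ge0 => t; rewrite mul0r cos0 mulr1 gaussw_ge0.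
exists (lapc n.+2), (fun x => - laps n.+4 x); split; [exact: dv_laps|exact: dv_lapc|..] => x; rewrite ?normrN.
- by apply: le_trans (AB_bound x n1).2 _; rewrite ler_wpM2r ?W_ge0//; have := a0 n.+2; have := a0 n.+4; lra.
- by apply: le_trans (AB_bound x (leqW (leqW n1))).1 _; rewrite ler_wpM2r ?W_ge0//; have := a0 n; have := a0 n.+4; lra.
- by apply: le_trans (AB_bound x (leqW (leqW (leqW (leqW n1))))).2 _; rewrite ler_wpM2r ?W_ge0//; have := a0 n; have := a0 n.+2; lra.
Qed.

Lemma kregular_lapc n : kregular (@lapc R n).
Proof.
split; first by apply: cont_meas; exact: dv_cont (@dv_lapc R n).
have hA k x : `|lapc k x| <= ii mu (gaussw k).
  apply: norm_ii_le; [exact: intg_meas (intg_lapc _ _)|move=> t|exact: intg_gaussw].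
  by rewrite normrM ger0_norm ?gaussw_ge0// ler_piMr ?gaussw_ge0 ?cos_norm1.
have i0 k : 0 <= ii mu (gaussw k) by apply: ii_ge0 => t; exact: gaussw_ge0.
eexists; apply: (kbound_C2 (M := ii mu (gaussw n) + ii mu (gaussw n.+4)) (@dv_lapc R n) (dvN (@dv_laps R n.+2))) => x.
  by apply: le_trans (hA _ _) _; rewrite lerDl.
by rewrite normrN (le_trans (hA _ _))// lerDr.
Qed.

Lemma kregular_laps n : kregular (@laps R n).
Proof.
split; first by apply: cont_meas; exact: dv_cont (@dv_laps R n).
have hA k x : `|laps k x| <= ii mu (gaussw k).
  apply: norm_ii_le; [exact: intg_meas (intg_laps _ _)|move=> t|exact: intg_gaussw].
  by rewrite normrM ger0_norm ?gaussw_ge0// ler_piMr ?gaussw_ge0 ?sin_norm1.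
have i0 k : 0 <= ii mu (gaussw k) by apply: ii_ge0 => t; exact: gaussw_ge0.
eexists; apply: (kbound_C2 (M := ii mu (gaussw n) + ii mu (gaussw n.+4)) (@dv_laps R n) (@dv_lapc R n.+2)) => x.
  by apply: le_trans (hA _ _) _; rewrite lerDl.
by rewrite normrN (le_trans (hA _ _))// lerDr.
Qed.

Lemma AB_smooth n : smooth (@lapc R n) /\ smooth (@laps R n).
Proof.
pose G (f : R -> R) := exists k, f = lapc k \/ f = laps k.
have h f : G f -> exists f', dv f f' /\ alg G f'.
  move=> [k [->|->]].
    exists (fun x => - laps k.+2 x); split; first exact: dv_lapc.
    rewrite (_ : (fun x => _) = (fun x => -1 * laps k.+2 x)); last by apply/funext => x; rewrite mulN1r.
    by apply: alg_mul; [exact: alg_cst|apply: alg_gen; exists k.+2; right].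
  by exists (lapc k.+2); split; [exact: dv_laps|apply: alg_gen; exists k.+2; left].
by split; apply: (alg_smooth h); apply: alg_gen; exists n; [left|right].
Qed.

(** [d] is the half derivative of [e] and [s] that of [d], with the regularity needed to pair
    them with test functions. *)
Definition half_of e d (s : R -> R) := [/\ kregular e, smooth d, exists A, WC2 A d,
  forall x, halfD e x = d x & forall x, halfD d x = s x].

Lemma dvU f f' f'' : dv f f' -> dv f f'' -> f' = f''.
Proof. by move=> /dv_derive1 <- /dv_derive1 <-. Qed.

(** On the expansion of [CS_expand] two index shifts equal one derivative, and the derivative of
    a harmonic is [n * th'] times its conjugate. *)
Lemma half_CS (n : nat) : (exists d, half_of (Cn n%:Z) d (fun x => n%:R * (2 * pi * p x) * Cn n%:Z x)) /\
  (exists d, half_of (Sn n%:Z) d (fun x => n%:R * (2 * pi * p x) * Sn n%:Z x)).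
Proof.
have [K [a [c h]]] := @CS_expand R n.
have eC : Cn n%:Z = (fun x => c + \sum_(0 <= k < K) a k * lapc k.*2.+1 x) by apply/funext => x; exact: (h x).1.
have eS : Sn n%:Z = (fun x => \sum_(0 <= k < K) a k * laps k.*2.+1 x) by apply/funext => x; exact: (h x).2.
have half_cos : dv (@Cn R n%:Z) (fun x => - (n%:R * (2 * pi * p x) * Sn n%:Z x)).
  apply: dv_ext (dv_comp (@dv_cos R) (dvZ n%:~R (@dv_th R))) => x //.
  by rewrite mulrN.
have half_sin : dv (@Sn R n%:Z) (fun x => n%:R * (2 * pi * p x) * Cn n%:Z x).
  by apply: dv_ext (dv_comp (@dv_sin R) (dvZ n%:~R (@dv_th R))) => x.
have dC2 : dv (@Cn R n%:Z) (fun x => \sum_(0 <= k < K) a k * - laps k.*2.+3 x).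
  rewrite eC; apply: dv_ext (dvD (dv_cst c) (dv_sum _ _ (fun k => dvZ (a k) (@dv_lapc R k.*2.+1)))) => x //.
  by rewrite add0r.
have dS2 : dv (@Sn R n%:Z) (fun x => \sum_(0 <= k < K) a k * lapc k.*2.+3 x).
  by rewrite eS; exact: dv_sum (fun k => dvZ (a k) (@dv_laps R k.*2.+1)).
have e1 := dvU half_cos dC2; have e2 := dvU half_sin dS2.
split.
  exists (fun x => \sum_(0 <= k < K) a k * lapc k.*2.+2 x); split.
  - rewrite eC; apply: kregularD; first exact: kregular_cst.
    by apply: (halfD_sum _ _ _).1 => k; exact: kregular_lapc.
  - by apply: smooth_sum => k; apply: smoothZ; exact: (AB_smooth _).1.
  - by apply: WC2_sum => k; exact: WC2_lapc.
  - move=> x; rewrite eC halfD_D; [|exact: kregular_cst|by apply: (halfD_sum _ _ _).1 => k; exact: kregular_lapc].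
    rewrite halfD_cst add0r (halfD_sum _ _ _).2; last by move=> k; exact: kregular_lapc.
    by apply: eq_bigr => k _; rewrite halfD_lapc.
  - move=> x; rewrite (halfD_sum _ _ _).2; last by move=> k; exact: kregular_lapc.
    rewrite [RHS](congr1 (fun f => f x) e2).
    by apply: eq_bigr => k _; rewrite halfD_lapc.
exists (fun x => \sum_(0 <= k < K) a k * laps k.*2.+2 x); split.
- by rewrite eS; apply: (halfD_sum _ _ _).1 => k; exact: kregular_laps.
- by apply: smooth_sum => k; apply: smoothZ; exact: (AB_smooth _).2.
- by apply: WC2_sum => k; exact: WC2_laps.
- move=> x; rewrite eS (halfD_sum _ _ _).2; last by move=> k; exact: kregular_laps.
  by apply: eq_bigr => k _; rewrite halfD_laps.
- move=> x; rewrite (halfD_sum _ _ _).2; last by move=> k; exact: kregular_laps.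
  rewrite -[RHS]opprK [in RHS](congr1 (fun f => f x) e1) -sumrN.
  by apply: eq_bigr => k _; rewrite halfD_laps mulrN opprK.
Qed.

Lemma half_C (n : int) : exists d, half_of (Cn n) d (fun x => absr n * (2 * pi * p x) * Cn n x).
Proof.
case: n => n; first exact: (half_CS n).1.
have [d hd] := (half_CS n.+1).1; exists d.
rewrite (_ : Cn (Negz n) = Cn n.+1%:Z)//.
by apply/funext => x; rewrite NegzE CnN.
Qed.

Lemma half_S (n : int) : exists d, half_of (Sn n) d (fun x => absr n * (2 * pi * p x) * Sn n x).
Proof.
case: n => n; first exact: (half_CS n).2.
have [d [k1 k2 [A k3] k4 k5]] := (half_CS n.+1).2; exists (fun x => -1 * d x).
rewrite (_ : Sn (Negz n) = (fun x => -1 * Sn n.+1%:Z x)); last first.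
  by apply/funext => x; rewrite NegzE SnN mulN1r.
split.
- exact: kregularZ.
- exact: smoothZ.
- by exists (`|-1| * A); exact: WC2Z.
- by move=> x; rewrite halfD_Z// k4.
- move=> x; rewrite halfD_Z ?k5; first by rewrite /absr /=; ring.
  by split; [exact: WC2_meas k3|eexists; exact: WC2_kbound k3].
Qed.

Definition half_cos (n : int) : R -> R := projT1 (cid (half_C n)).
Definition half_sin (n : int) : R -> R := projT1 (cid (half_S n)).
Lemma half_cos_half n : half_of (Cn n) (half_cos n) (fun x => absr n * (2 * pi * p x) * Cn n x).
Proof. exact: projT2 (cid (half_C n)). Qed.
Lemma half_sin_half n : half_of (Sn n) (half_sin n) (fun x => absr n * (2 * pi * p x) * Sn n x).
Proof. exact: projT2 (cid (half_S n)). Qed.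

End HalfDerivativeDecay.

(** * Fourier inversion and the multiplier *)
Section SchwartzFunctions.
Context {R : realType}.
Notation mu := (leb R).
Notation mu2 := (leb R \x leb R)%E.
Implicit Types (f g u v phi psi : R -> R) (x y t s e xi : R).

Lemma schwartz_p phi n : schwartz phi -> exists A, forall x, `|derive1n n phi x| <= A * p x.
Proof.
move=> [_ h]; have [M0 h0] := h 0%N n; have [M2 h2] := h 2%N n.
exists ((M0 + M2) * pi) => x.
have -> : (M0 + M2) * pi * p x = (M0 + M2) / (1 + x ^+ 2) by rewrite /p invfM mulrA mulfK// pi_neq0.
rewrite ler_pdivlMr ?sqr1_gt0// mulrDr mulr1 lerD//.
  by have := h0 x; rewrite expr0 mul1r.
by have := h2 x; rewrite normrM (ger0_norm (sqr_ge0 x)) mulrC.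
Qed.

Lemma schwartz_derive1 phi : schwartz phi -> schwartz (derive1 phi).
Proof.
move=> [s h]; split; first exact: smooth_derive1.
by move=> k n; have [M hM] := h k n.+1; exists M => x; rewrite derive1n_shift.
Qed.

Lemma p_le_W x : p x <= W x :> R.
Proof.
rewrite /p /W lef_pV2 ?posrE ?mulr_gt0 ?pi_gt0 ?sqr1_gt0 ?exprn_gt0 ?r4_gt0//.
rewrite -r4_4; apply: (@le_trans _ _ (1 * r4 x ^+ 4)).
  by rewrite mul1r ler_weXn2l// r4_ge1.
by rewrite ler_wpM2r ?exprn_ge0 ?(ltW (r4_gt0 x))//; have := pi_ge2 R; lra.
Qed.

Lemma schwartz_WC2 phi : schwartz phi -> exists A, WC2 A phi.
Proof.
move=> sp; have [sm _] := sp.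
have [A0 h0] := schwartz_p 0 sp; have [A1 h1] := schwartz_p 1 sp; have [A2 h2] := schwartz_p 2 sp.
have pos (A : R) n : (forall x, `|derive1n n phi x| <= A * p x) -> 0 <= A.
  by move=> h; have := h 0; have := p_gt0 (0 : R); have := normr_ge0 (derive1n n phi 0); nra.
have a0 := pos _ _ h0; have a1 := pos _ _ h1; have a2 := pos _ _ h2.
have le (A : R) x : 0 <= A -> A <= A0 + A1 + A2 -> A * p x <= (A0 + A1 + A2) * W x.
  by move=> a AA'; rewrite ler_pM ?p_ge0// p_le_W.
exists (A0 + A1 + A2); exists (derive1 phi), (derive1 (derive1 phi)); split.
- exact: smooth_dv.
- by apply: smooth_dv; exact: smooth_derive1.
- by move=> x; apply: le_trans (h0 x) _; apply: le; lra.
- by move=> x; apply: le_trans (h1 x) _; apply: le; lra.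
- by move=> x; apply: le_trans (h2 x) _; apply: le; lra.
Qed.

Lemma schwartz_intg phi : schwartz phi -> intg mu phi.
Proof. by move=> /schwartz_WC2[A]; exact: WC2_intg. Qed.

(** The real part of [e^(i x xi)] times the Fourier transform; pairing it with an even symbol
    gives the inverse transform at [x]. *)
Definition cosint phi x xi : R := ii mu (fun y => phi y * cos ((x - y) * xi)).

Lemma cosl_meas x xi : measurable_fun setT (fun y : R => cos ((x - y) * xi)).
Proof.
apply: cont_meas; apply: dv_cont (dv_comp (@dv_cos R) (dvM (dvB (dv_cst x) dv_id) (dv_cst xi))).
Qed.

Lemma sinl_meas x xi : measurable_fun setT (fun y : R => sin ((x - y) * xi)).
Proof.
apply: cont_meas; apply: dv_cont (dv_comp (@dv_sin R) (dvM (dvB (dv_cst x) dv_id) (dv_cst xi))).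
Qed.

Lemma intg_bddM f (b : R -> R) : intg mu f -> measurable_fun setT b -> (forall y, `|b y| <= 1) -> intg mu (fun y => f y * b y).
Proof.
move=> If mb b1; apply: (@intg_le _ _ _ mu _ (fun y => `|f y|)).
- by apply: measurable_funM => //; exact: intg_meas If.
- by move=> y; rewrite normrM ler_piMr.
- exact: intg_norm.
Qed.

Lemma cosint_intg phi x xi : schwartz phi -> intg mu (fun y => phi y * cos ((x - y) * xi)).
Proof. by move=> sp; apply: intg_bddM; [exact: schwartz_intg|exact: cosl_meas|move=> y; exact: cos_norm1]. Qed.

Lemma sinint_intg phi x xi : schwartz phi -> intg mu (fun y => phi y * sin ((x - y) * xi)).
Proof. by move=> sp; apply: intg_bddM; [exact: schwartz_intg|exact: sinl_meas|move=> y; exact: sin_norm1]. Qed.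

Lemma cosint_ibp phi x xi : schwartz phi -> cosint (derive1 (derive1 phi)) x xi = - xi ^+ 2 * cosint phi x xi.
Proof.
move=> sp; have s1 := schwartz_derive1 sp; have s2 := schwartz_derive1 s1.
have d1 := smooth_dv sp.1; have d2 := smooth_dv s1.1.
have da : dv (fun y : R => (x - y) * xi) (fun y => (0 - 1) * xi + (x - y) * 0) := dvM (dvB (dv_cst x) dv_id) (dv_cst xi).
have dc := dv_comp (@dv_cos R) da; have ds := dv_comp (@dv_sin R) da.
have bnd psi n (b : R -> R) : schwartz psi -> (forall y, `|b y| <= 1) -> exists A, forall y, `|derive1n n psi y * b y| <= A * p y.
  move=> spsi b1; have [A hA] := schwartz_p n spsi; exists A => y.
  by rewrite normrM (le_trans _ (hA y))// ler_piMr.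
have cont psi : schwartz psi -> continuous psi by move=> h; exact: smooth_cont h.1.
have cc : continuous (fun y : R => cos ((x - y) * xi)) by exact: dv_cont dc.
have cs : continuous (fun y : R => sin ((x - y) * xi)) by exact: dv_cont ds.
have h1 : ii mu (fun y => derive1 (derive1 phi) y * cos ((x - y) * xi) + xi * (derive1 phi y * sin ((x - y) * xi))) = 0.
  have [A hA] := bnd _ 0%N (fun y => cos ((x - y) * xi)) s1 (fun y => cos_norm1 _).
  apply: (ii_deriv0 (G := fun y => derive1 phi y * cos ((x - y) * xi)) (C := A)).
  - by move=> y; apply: cvgD; [apply: cvgM; [exact: cont|exact: cc]|apply: cvgM; [exact: cvg_cst|apply: cvgM; [exact: cont|exact: cs]]].
  - by apply: dv_ext (dvM d2 dc) => y //; ring.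
  - by apply: intgD; [exact: cosint_intg|apply: intgZ; exact: sinint_intg].
  - exact: hA.
have h2 : ii mu (fun y => derive1 phi y * sin ((x - y) * xi) - xi * (phi y * cos ((x - y) * xi))) = 0.
  have [A hA] := bnd _ 0%N (fun y => sin ((x - y) * xi)) sp (fun y => sin_norm1 _).
  apply: (ii_deriv0 (G := fun y => phi y * sin ((x - y) * xi)) (C := A)).
  - by move=> y; apply: cvgB; [apply: cvgM; [exact: cont|exact: cs]|apply: cvgM; [exact: cvg_cst|apply: cvgM; [exact: cont|exact: cc]]].
  - by apply: dv_ext (dvM d1 ds) => y //; ring.
  - by apply: intgB; [exact: sinint_intg|apply: intgZ; exact: cosint_intg].
  - exact: hA.
move: h1 h2; rewrite iiD; [|exact: cosint_intg|by apply: intgZ; exact: sinint_intg].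
rewrite iiZ; last exact: sinint_intg.
rewrite iiB; [|exact: sinint_intg|by apply: intgZ; exact: cosint_intg].
rewrite iiZ; last exact: cosint_intg.
rewrite -/(cosint phi x xi) -/(cosint (derive1 (derive1 phi)) x xi).
move: (cosint _ _ _) (cosint _ _ _) (ii _ _) => a b c e1 e2.
have ec : c = xi * a by lra.
have -> : b = - (xi * c) by lra.
by rewrite ec; ring.
Qed.

Lemma cosint_decay phi x : schwartz phi -> exists B, 0 <= B /\ forall xi, `|cosint phi x xi| * (1 + xi ^+ 2) ^+ 2 <= B.
Proof.
move=> sp; have s2 := schwartz_derive1 (schwartz_derive1 sp); have s4 := schwartz_derive1 (schwartz_derive1 s2).
have bnd psi : schwartz psi -> exists2 B, 0 <= B & forall xi, `|cosint psi x xi| <= B.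
  move=> spsi; exists (ii mu (fun y => `|psi y|)); first exact: ii_ge0.
  move=> xi; apply: norm_ii_le; [exact: intg_meas (cosint_intg _ _ spsi)|move=> y|exact: intg_norm (schwartz_intg spsi)].
  by rewrite normrM ler_piMr ?cos_norm1.
have [B0 p0 h0] := bnd _ sp; have [B2 p2 h2] := bnd _ s2; have [B4 p4 h4] := bnd _ s4.
exists (B0 + 2 * B2 + B4); split=> [|xi]; first by lra.
have {}h0 := h0 xi; have {}h2 := h2 xi; have {}h4 := h4 xi.
rewrite (cosint_ibp _ _ sp) in h2; rewrite (cosint_ibp _ _ s2) (cosint_ibp _ _ sp) in h4.
rewrite !normrM normrN (ger0_norm (sqr_ge0 xi)) in h2 h4.
rewrite (_ : `|cosint phi x xi| * _ = `|cosint phi x xi| + 2 * (xi ^+ 2 * `|cosint phi x xi|) + xi ^+ 2 * (xi ^+ 2 * `|cosint phi x xi|)); last by ring.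
lra.
Qed.

Lemma cosint_meas phi x : schwartz phi -> measurable_fun setT (cosint phi x).
Proof.
move=> sp; have Ip := schwartz_intg sp.
pose H (z : R * R) := p z.1 * (phi z.2 * cos ((x - z.2) * z.1)).
have I : intg mu2 H.
  apply: (@intg_le _ _ _ mu2 _ (fun z => p z.1 * `|phi z.2|)).
  - apply: measurable_funM; first by apply: meas_fst; exact: p_meas.
    apply: measurable_funM; first by apply: meas_snd; exact: intg_meas Ip.
    apply: meas_cos_comp.
    apply: measurable_funM; last exact: (meas_fst (@midR R)).
    by apply: measurable_funB; [exact: measurable_cst|exact: (meas_snd (@midR R))].
  - move=> z; rewrite !normrM (ger0_norm (p_ge0 _)) ler_wpM2l ?p_ge0// ler_piMr ?cos_norm1//.
  - by apply: (@intg_prodM _ _ _ _ _ mu mu (@p R) (fun y => `|phi y|)); [exact: intg_p|exact: intg_norm].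
have := intg_meas (fubini12 I).1 => m.
have -> : cosint phi x = (fun xi => (ii mu (fun y => H (xi, y))) * (p xi)^-1).
  apply/funext => xi; rewrite /H /= iiZ; last exact: cosint_intg.
  by rewrite mulrAC mulfV ?mul1r// gt_eqF ?p_gt0.
apply: measurable_funM => //; apply: (measurableT_comp (@measurable_invr R)); exact: p_meas.
Qed.

Lemma cosint_sqrt_le phi x : schwartz phi -> exists B, forall xi, Num.sqrt `|xi| * `|cosint phi x xi| <= B * p xi /\ `|cosint phi x xi| <= B * p xi.
Proof.
move=> sp; have [B [B0 hB]] := cosint_decay x sp; exists (B * pi) => xi.
have -> : B * pi * p xi = B / (1 + xi ^+ 2) by rewrite /p invfM mulrA mulfK// pi_neq0.
have s1 : 1 <= 1 + xi ^+ 2 by rewrite lerDl sqr_ge0.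
have sq : Num.sqrt `|xi| <= 1 + xi ^+ 2.
  rewrite -(@ler_pXn2r _ 2) ?nnegrE ?sqrtr_ge0 ?(le_trans ler01)// sqr_sqrtr//.
  rewrite -(real_normK (num_real xi)); have := normr_ge0 xi; move: `|xi| => a a0.
  have := sqr_ge0 (a - 1); have := sqr_ge0 (a ^+ 2); nra.
have c0' := normr_ge0 (cosint phi x xi).
split; rewrite ler_pdivlMr ?sqr1_gt0//; apply: le_trans (hB xi).
  by rewrite mulrAC mulrC ler_wpM2l// expr2 ler_wpM2r// (le_trans ler01).
by rewrite ler_wpM2l// expr2 ler_pMr// ?sqr1_gt0.
Qed.

Lemma cosint_int phi x : schwartz phi -> intg mu (cosint phi x).
Proof.
move=> sp; have [B hB] := cosint_sqrt_le x sp.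
apply: (@intg_le _ _ _ mu _ (fun xi => B * p xi)).
- exact: cosint_meas.
- by move=> xi; case: (hB xi).
- exact: intgZ intg_p.
Qed.

Definition abel e xi : R := expR (- (e * `|xi|)).

Lemma abel_bound e : 0 < e -> exists C, forall xi, abel e xi <= C * p xi.
Proof.
move=> e0; have [C [C0 hC]] := @horner_le_expR R (1 + 'X^2) e e0.
exists (C * pi) => xi.
have -> : C * pi * p xi = C / (1 + xi ^+ 2) by rewrite /p invfM mulrA mulfK// pi_neq0.
rewrite ler_pdivlMr ?sqr1_gt0// /abel expRN mulrC ler_pdivrMr ?expR_gt0//.
have := hC _ (normr_ge0 xi).
have -> : (1 + 'X^2).[`|xi|] = 1 + xi ^+ 2 by rewrite !hornerE real_normK ?num_real.
by rewrite ger0_norm ?(ltW (sqr1_gt0 xi)).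
Qed.

Lemma abel_cont e : continuous (abel e).
Proof.
move=> xi; apply: (@continuous_comp _ _ _ (fun xi : R => - (e * `|xi|)) expR).
  by apply: cvgN; apply: cvgM; [exact: cvg_cst|apply: cvg_norm; exact: cvg_id].
exact: (dv_cont (@dv_exp R)).
Qed.

Lemma abel_meas e : measurable_fun setT (abel e).
Proof. by apply: cont_meas; exact: abel_cont. Qed.

Lemma abel_ge0 e xi : 0 <= abel e xi. Proof. exact: expR_ge0. Qed.

Lemma cosr_meas s : measurable_fun setT (fun xi : R => cos (s * xi)).
Proof. by apply: cont_meas; exact: dv_cont (dv_comp (@dv_cos R) (dvZ s dv_id)). Qed.

Lemma abel_intg e : 0 < e -> intg mu (abel e).
Proof.
move=> e0; have [C hC] := abel_bound e0.
apply: (@intg_le _ _ _ mu _ (fun xi => C * p xi)).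
- exact: abel_meas.
- by move=> xi; rewrite ger0_norm ?abel_ge0.
- exact: intgZ intg_p.
Qed.

Lemma ii_abel e s : 0 < e -> ii mu (fun xi => abel e xi * cos (s * xi)) = 2 * e / (e ^+ 2 + s ^+ 2).
Proof.
move=> e0; have n0 : e ^+ 2 + s ^+ 2 != 0 by rewrite gt_eqF// ltr_pwDl ?exprn_gt0 ?sqr_ge0.
pose f xi := expR (- (e * xi)) * cos (s * xi).
pose G xi := (e ^+ 2 + s ^+ 2)^-1 * (expR (- (e * xi)) * (s * sin (s * xi) - e * cos (s * xi))).
have de : dv (fun xi : R => expR (- (e * xi))) (fun xi => - (e * 1) * expR (- (e * xi))).
  exact: dv_comp dv_exp (dvN (dvZ e dv_id)).
have dc : dv (fun xi : R => cos (s * xi)) (fun xi => s * 1 * - sin (s * xi)) := dv_comp (@dv_cos R) (dvZ s dv_id).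
have ds : dv (fun xi : R => sin (s * xi)) (fun xi => s * 1 * cos (s * xi)) := dv_comp (@dv_sin R) (dvZ s dv_id).
have dG : dv G f.
  apply: dv_ext (dvZ (e ^+ 2 + s ^+ 2)^-1 (dvM de (dvB (dvZ s ds) (dvZ e dc)))) => xi //.
  rewrite /f; have : e * e + s * s != 0 by rewrite -!expr2.
  by move=> h; field.
have cf : continuous f by exact: dv_cont (dvM de dc).
have E xi : f xi * hl xi = abel e xi * cos (s * xi) * hl xi.
  by rewrite /f /abel /hl; case: (lerP 0 xi) => x0; rewrite ?mulr0// ger0_norm.
have I : intg mu (fun xi => abel e xi * cos (s * xi) * hl xi).
  apply: intg_bddM; [|exact: hl_meas|by move=> y; rewrite /hl; case: (0 <= y); rewrite ?normr0 ?normr1].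
  by apply: intg_bddM; [exact: abel_intg|exact: cosr_meas|move=> y; exact: cos_norm1].
have [||_ ->] := @even_half R (fun xi => abel e xi * cos (s * xi)) _ _ I.
- by move=> xi; rewrite /abel normrN mulrN cosN.
- by apply: measurable_funM; [exact: abel_meas|exact: cosr_meas].
rewrite -(@eq_ii _ _ _ mu (fun xi => f xi * hl xi) _ E) (half_eq cf dG).
- by rewrite /G !mulr0 oppr0 expR0 sin0 cos0; field.
- by apply: eq_intg I => xi; rewrite E.
have [C hC] := abel_bound e0.
apply/norm_cvg0P; pose B := (e ^+ 2 + s ^+ 2)^-1 * (`|s| + e) * C.
apply: (@squeeze_cvgr _ _ _ _ (fun=> 0) (fun k : nat => B * p k%:R)).
- apply: nearW => k; rewrite normr_ge0 /= /G normrM normrM.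
  rewrite (ger0_norm (_ : 0 <= (e ^+ 2 + s ^+ 2)^-1)) ?invr_ge0 ?addr_ge0 ?sqr_ge0//.
  rewrite /B -!mulrA ler_wpM2l ?invr_ge0 ?addr_ge0 ?sqr_ge0// mulrC ler_pM//.
    apply: le_trans (ler_normB _ _) _; rewrite !normrM (gtr0_norm e0).
    by apply: lerD; rewrite ler_piMr ?sin_norm1 ?cos_norm1// ltW.
  by have := hC k%:R; rewrite /abel ger0_norm// ger0_norm ?expR_ge0.
- exact: cvg_cst.
- rewrite -(mulr0 B); apply: cvgM; first exact: cvg_cst.
  apply: (@cvg_comp _ _ _ (fun k : nat => k%:R : R) p _ _ _ _ (@cvg_p_y R)).
  by apply/cvgryPge => a; exact: nbhs_infty_ger.
Qed.

(** Regularise by Abel means and exchange the integrals: the inner integral is a Poisson kernel,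
    an approximate identity. *)
Lemma inversion phi x : schwartz phi -> ii mu (cosint phi x) = 2 * pi * phi x.
Proof.
move=> sp; have Ip := schwartz_intg sp; have [A hA] := schwartz_WC2 sp.
have mp := intg_meas Ip; have cp := smooth_cont sp.1.
pose e_ (n : nat) : R := n.+1%:R^-1.
have e0 n : 0 < e_ n by rewrite invr_gt0 ltr0Sn.
have ecv : e_ n @[n --> \oo] --> (0 : R) by exact: cvg_harmonic.
have L1 : ii mu (fun xi => abel (e_ n) xi * cosint phi x xi) @[n --> \oo] --> ii mu (cosint phi x).
  have [|||||_ H] := @ii_dct _ _ _ mu (fun n xi => abel (e_ n) xi * cosint phi x xi) (cosint phi x) (fun xi => `|cosint phi x xi|).
  - by move=> n; apply: measurable_funM; [exact: abel_meas|exact: cosint_meas].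
  - exact: cosint_meas.
  - apply: aeW => xi; rewrite -[X in _ --> X]mul1r; apply: cvgM; last exact: cvg_cst.
    rewrite -[X in _ --> X](_ : expR (- (0 * `|xi|)) = 1); last by rewrite mul0r oppr0 expR0.
    apply: (@continuous_cvg _ _ _ _ _ _ (@expR R)); first exact: (dv_cont (@dv_exp R)).
    by apply: cvgN; apply: cvgM; [exact: ecv|exact: cvg_cst].
  - by apply: intg_norm; exact: cosint_int.
  - move=> n xi; rewrite normrM ger0_norm ?abel_ge0// ler_piMl// /abel expR_le1 ?oppr_le0 mulr_ge0// ltW//.
  - exact: H.
have L2 : 2 * pi * ii mu (fun t => phi (e_ n * t + x) * p t) @[n --> \oo] --> 2 * pi * phi x.
  apply: cvgM; first exact: cvg_cst.
  have [|||||_ H] := @ii_dct _ _ _ mu (fun n t => phi (e_ n * t + x) * p t) (fun t => phi x * p t) (fun t => A * p t).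
  - move=> n; apply: measurable_funM; last exact: p_meas.
    apply: (measurableT_comp mp); apply: measurable_funD => //; apply: measurable_funM => //.
  - by apply: measurable_funM => //; exact: p_meas.
  - apply: aeW => t; apply: cvgM; last exact: cvg_cst.
    rewrite -[X in _ --> phi X]add0r -[X in _ --> phi (X + _)](mul0r t).
    apply: (@continuous_cvg _ _ _ _ _ _ phi); first exact: cp.
    by apply: cvgD; [apply: cvgM; [exact: ecv|exact: cvg_cst]|exact: cvg_cst].
  - exact: intgZ intg_p.
  - by move=> n t; rewrite normrM (ger0_norm (p_ge0 t)) ler_wpM2r ?p_ge0// (WC2_bd _ hA).
  - have -> : phi x = ii mu (fun t => phi x * p t) by rewrite iiZ ?ii_p ?mulr1//; exact: intg_p.
    exact: H.
apply: (cvg_unique _ L1) => //.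
suff -> : (fun n => ii mu (fun xi => abel (e_ n) xi * cosint phi x xi)) = (fun n => 2 * pi * ii mu (fun t => phi (e_ n * t + x) * p t)) by [].
apply/funext => n; pose e := e_ n; have en : 0 < e := e0 n.
pose H (z : R * R) := abel e z.1 * (phi z.2 * cos ((x - z.2) * z.1)).
have I : intg mu2 H.
  apply: (@intg_le _ _ _ mu2 _ (fun z => abel e z.1 * `|phi z.2|)).
  - apply: measurable_funM; first by apply: meas_fst; exact: abel_meas.
    apply: measurable_funM; first by apply: meas_snd; exact: intg_meas Ip.
    apply: meas_cos_comp.
    apply: measurable_funM; last exact: (meas_fst (@midR R)).
    by apply: measurable_funB; [exact: measurable_cst|exact: (meas_snd (@midR R))].
  - by move=> z; rewrite !normrM (ger0_norm (abel_ge0 _ _)) ler_wpM2l ?abel_ge0// ler_piMr ?cos_norm1.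
  - by apply: (@intg_prodM _ _ _ _ _ mu mu (abel e) (fun y => `|phi y|)); [exact: abel_intg|exact: intg_norm].
transitivity (ii mu (fun xi => ii mu (fun y => H (xi, y)))).
  by apply: eq_ii => xi; rewrite /H /= iiZ//; exact: cosint_intg.
rewrite (fubini_swap I).
have k y : ii mu (fun xi => H (xi, y)) = phi y * (2 * e / (e ^+ 2 + (x - y) ^+ 2)).
  rewrite -ii_abel// -iiZ; first by apply: eq_ii => xi; rewrite /H /=; ring.
  by apply: intg_bddM; [exact: abel_intg|exact: cosr_meas|move=> z; exact: cos_norm1].
have Iy := (fubini21 I).1.
have [J E] := ii_affine x en Iy.
have E2 : ii mu (fun y => ii mu (fun xi => H (xi, y))) = e * ii mu (fun t => ii mu (fun xi => H (xi, e * t + x))).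
  by rewrite E mulrA mulfV ?mul1r// gt_eqF.
rewrite E2 -iiZ//.
rewrite -iiZ; last first.
  apply: (@intg_le _ _ _ mu _ (fun t => A * p t)); [|move=> t|exact: intgZ intg_p].
    apply: measurable_funM; last exact: p_meas.
    by apply: (measurableT_comp mp); apply: measurable_funD => //; apply: measurable_funM.
  by rewrite normrM (ger0_norm (p_ge0 t)) ler_wpM2r ?p_ge0// (WC2_bd _ hA).
apply: eq_ii => t; rewrite k -/e /p.
have alg (ph P ee : R) : ee != 0 -> P != 0 ->
    ee * (ph * (2 * ee / (ee ^+ 2 + (x - (ee * t + x)) ^+ 2))) = 2 * P * (ph / (P * (1 + t ^+ 2))).
  move=> ne nP; have n1 : 1 + t ^+ 2 != 0 by rewrite gt_eqF ?sqr1_gt0.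
  have -> : ee ^+ 2 + (x - (ee * t + x)) ^+ 2 = ee ^+ 2 * (1 + t ^+ 2) by ring.
  by field; rewrite nP n1 ne.
by apply: alg; [rewrite gt_eqF|exact: pi_neq0].
Qed.

(** Write the symbol as the integral of [one_cos_scale] and invert the Fourier transform for
    each [t]. *)
Lemma multiplier_halfD phi x : schwartz phi -> quarter_laplacian_schwartz phi x = halfD phi x.
Proof.
move=> sp; have [A hA] := schwartz_WC2 sp.
have e1 : quarter_laplacian_schwartz phi x = (2 * pi)^-1 * ii mu (fun xi => Num.sqrt `|xi| * cosint phi x xi).
  rewrite /quarter_laplacian_schwartz /inv_fourier /=.
  rewrite mul0r subr0; congr (_ * _); apply: eq_ii => xi /=.
  rewrite /fourier /cintegral /= !mul0r !subr0 ?addr0 ?add0r.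
  set a := \int[_]_(_ in _) _; set b := \int[_]_(_ in _) _.
  have -> : a = ii mu (fun y => phi y * cos (y * xi)).
    by apply: eq_ii => y; rewrite mul0r subr0 cosN.
  have -> : b = - ii mu (fun y => phi y * sin (y * xi)).
    rewrite -iiN; last first.
      have := sinint_intg 0 (- xi) sp; apply: eq_intg => y; by rewrite sub0r mulrNN.
    by apply: eq_ii => y; rewrite mul0r addr0 sinN mulrN.
  have Ic : intg mu (fun y => phi y * cos (y * xi)).
    have := cosint_intg 0 (- xi) sp; apply: eq_intg => y; by rewrite sub0r mulrNN.
  have Is : intg mu (fun y => phi y * sin (y * xi)).
    have := sinint_intg 0 (- xi) sp; apply: eq_intg => y; by rewrite sub0r mulrNN.
  have -> : cosint phi x xi = cos (x * xi) * ii mu (fun y => phi y * cos (y * xi)) + sin (x * xi) * ii mu (fun y => phi y * sin (y * xi)).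
    rewrite -!iiZ// -iiD; [|exact: intgZ|exact: intgZ].
    by apply: eq_ii => y; rewrite mulrBl cosB; ring.
  ring.
rewrite e1; have [B hB] := cosint_sqrt_le x sp; have c0' := @c0_gt0 R.
pose H (z : R * R) := cosint phi x z.1 * ((1 - cos (z.1 * z.2 ^+ 2)) / z.2 ^+ 2).
have mH : measurable_fun [set: plane R] H.
  apply: measurable_funM; first by apply: meas_fst; exact: cosint_meas.
  apply: measurable_funM; last exact: (meas_snd (@isqr_meas R)).
  apply: measurable_funB; first exact: measurable_cst.
  apply: meas_cos_comp.
  by apply: measurable_funM; [exact: (meas_fst (@midR R))|exact: (meas_snd (@sqr_meas R))].
have iH xi : ii mu (fun t => `|H (xi, t)|) = c0 * (Num.sqrt `|xi| * `|cosint phi x xi|).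
  transitivity (ii mu (fun t => `|cosint phi x xi| * ((1 - cos (xi * t ^+ 2)) / t ^+ 2))).
    apply: eq_ii => t; rewrite /H /= normrM; congr (_ * _).
    by rewrite ger0_norm// mulr_ge0 ?invr_ge0 ?sqr_ge0// subr_ge0 cos_le1.
  rewrite iiZ ?(one_cos_scale xi).2; first by ring.
  exact: (one_cos_scale xi).1.
have I : intg mu2 H.
  apply: (@tonelli12 _ _ _ _ _ mu mu H (fun xi => c0 * B * p xi)) => //.
  - by move=> xi; rewrite /H /=; apply: intgZ; exact: (one_cos_scale xi).1.
  - by move=> xi; rewrite iH -mulrA ler_wpM2l ?(ltW c0')//; case: (hB xi).
  - exact: intgZ intg_p.
have step : c0 * ii mu (fun xi => Num.sqrt `|xi| * cosint phi x xi) = ii mu (fun t => ii mu (fun xi => H (xi, t))).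
  rewrite -(fubini_swap I) -iiZ; last first.
    apply: (@intg_le _ _ _ mu _ (fun xi => B * p xi)); [|move=> xi|exact: intgZ intg_p].
      apply: measurable_funM; last exact: cosint_meas.
      apply: cont_meas => xi; apply: (@continuous_comp _ _ _ (fun xi : R => `|xi|) (@Num.sqrt R)).
        by apply: cvg_norm; exact: cvg_id.
      exact: sqrt_continuous.
    by rewrite normrM ger0_norm ?sqrtr_ge0//; case: (hB xi).
  apply: eq_ii => xi; rewrite /H /= iiZ ?(one_cos_scale xi).2; first by ring.
  exact: (one_cos_scale xi).1.
have inner t : ii mu (fun xi => H (xi, t)) = 2 * pi * dl phi x t.
  have ci y : intg mu (fun xi => cosint phi y xi) by exact: cosint_int.
  have E xi : (cosint phi x xi - (cosint phi (x + t ^+ 2) xi + cosint phi (x - t ^+ 2) xi) * 2^-1) * (t ^+ 2)^-1 = H (xi, t).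
    have -> : cosint phi (x + t ^+ 2) xi + cosint phi (x - t ^+ 2) xi = 2 * cos (xi * t ^+ 2) * cosint phi x xi.
      rewrite /cosint -iiD; [|exact: cosint_intg|exact: cosint_intg]; rewrite -iiZ; last exact: cosint_intg.
      apply: eq_ii => y.
      have -> : (x + t ^+ 2 - y) * xi = (x - y) * xi + xi * t ^+ 2 by ring.
      have -> : (x - t ^+ 2 - y) * xi = (x - y) * xi - xi * t ^+ 2 by ring.
      by rewrite cosD cosB; ring.
    by rewrite /H /=; move: ((t ^+ 2)^-1) => i; field.
  rewrite -(@eq_ii _ _ _ mu _ _ E) iiZr; last by apply: intgB => //; apply: intgZr; exact: intgD.
  rewrite iiB//; last by apply: intgZr; exact: intgD.
  rewrite iiZr; last exact: intgD.
  by rewrite iiD// !inversion// /dl; move: ((t ^+ 2)^-1) (pi : R) => i P; field.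
have nz : c0 != 0 :> R by rewrite gt_eqF.
have np := @pi_neq0 R.
apply: (mulfI nz); rewrite mulrCA step (@eq_ii _ _ _ mu _ _ inner) iiZ; last exact: intg_dl hA.
rewrite /halfD mulrA mulVf ?mul1r; last by rewrite mulf_neq0.
by rewrite mulrA mulfV// mul1r.
Qed.

End SchwartzFunctions.

(** * The half Laplacian and the Gagliardo energy *)
Section HalfLaplacianEnergy.
Context {R : realType}.
Notation mu := (leb R).
Notation mu2 := (leb R \x leb R)%E.
Implicit Types (f g u v phi psi : R -> R) (x y t : R) (a b : int -> R) (M N : nat).

Lemma Lfun2_L2 g : g \in Lfun mu 2%:E <-> L2 mu g.
Proof.
split.
  move=> h; split; last exact: Lfun2_integrable_sqr h.
  by move: h; rewrite inE => /andP[mf _]; move: mf; rewrite inE.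
move=> [mg ig]; rewrite inE; apply/andP; split; rewrite inE//=.
rewrite /finite_norm unlock poweR_lty//.
case/integrableP: ig => _; apply: le_lt_trans; apply: le_of_eq.
by apply: eq_integral => x _ /=; rewrite (powR_mulrn 2)// normrX.
Qed.

Lemma test_of_supp phi (A : R) : smooth phi -> (forall x, A < `|x| -> phi x = 0) -> test_function phi.
Proof.
move=> sp h; split => //.
apply: (@subclosed_compact _ _ `[- A, A]%classic); first exact: closed_closure.
  exact: segment_compact.
have -> : `[- A, A]%classic = closure `[- A, A]%classic :> set R.
  by apply: (closure_id _).1; exact: itv_closed.
apply: closureS => x /= px; rewrite in_itv /= -ler_norml leNgt; apply: contra px => Ax.
by rewrite h.
Qed.

Definition chi0 : R -> R := fun x => (bmp (-1) 1 1 0)^-1 * bmp (-1) 1 1 x.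
(** Cutoffs at scale [k + 1], whose Gagliardo energy does not depend on [k]. *)
Definition chi (k : nat) x : R := chi0 (k.+1%:R^-1 * x).

Lemma bmp0_gt0 : 0 < bmp (-1) 1 1 0 :> R.
Proof. by rewrite /bmp !rhoE !mulr_gt0 ?expR_gt0//; rewrite ?ltr01// ?mul1r ?sub0r ?opprK ?ltr01 ?subr0 //; apply: mulr_gt0; apply: expR_gt0. Qed.

Lemma chi0_smooth : smooth chi0.
Proof. by apply: smoothZ; exact: bmp_smooth. Qed.

Lemma chi_smooth k : smooth (chi k).
Proof.
have := @smooth_affine R chi0 (k.+1%:R^-1) 0 chi0_smooth.
by congr smooth; apply/funext => x; rewrite /chi addr0.
Qed.

Lemma chi_out k x : k.+1%:R < `|x| -> chi k x = 0.
Proof.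
move=> kx; rewrite /chi /chi0 [X in _ * X]bmp_out ?mulr0//.
rewrite -ltr_norml normrM ger0_norm ?invr_ge0// -leNgt mulrC ler_pdivlMr ?ltr0Sn// mul1r ltW//.
Qed.

Lemma chi_test k d : smooth d -> test_function (fun x => chi k x * d x).
Proof.
move=> sd; apply: (@test_of_supp _ k.+1%:R); first by apply: smoothM => //; exact: chi_smooth.
by move=> x kx; rewrite chi_out// mul0r.
Qed.

Lemma cvg_chi x : chi k x @[k --> \oo] --> (1 : R).
Proof.
have c : continuous chi0 by apply: smooth_cont; exact: chi0_smooth.
rewrite -[X in _ --> X](_ : chi0 (0 * x) = 1); last first.
  by rewrite mul0r /chi0 mulVf// gt_eqF// bmp0_gt0.
apply: (@continuous_cvg _ _ _ _ _ _ chi0); first exact: c.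
by apply: cvgM; [exact: cvg_harmonic|exact: cvg_cst].
Qed.

Lemma chi_bounds : exists2 B : R, 0 <= B & forall k, exists c' c'', [/\ dv (chi k) c', dv c' c'',
  (forall x, `|chi k x| <= B), (forall x, `|c' x| <= B * k.+1%:R^-1) & (forall x, `|c'' x| <= B * k.+1%:R^-1)].
Proof.
have t0 : test_function chi0 by have := chi_test 0 (@smooth_cst R 1); congr test_function; apply/funext => x; rewrite /chi invr1 mul1r mulr1.
have c1 := @cst_cont R 1.
have [B0 h0] := test_bound 0 t0 c1 (fun _ => ltr01 (R := R)).
have [B1 h1] := test_bound 1 t0 c1 (fun _ => ltr01 (R := R)).
have [B2 h2] := test_bound 2 t0 c1 (fun _ => ltr01 (R := R)).
have p0 : 0 <= B0 by have := h0 0; have := normr_ge0 (derive1n 0 chi0 0); lra.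
have p1 : 0 <= B1 by have := h1 0; have := normr_ge0 (derive1n 1 chi0 0); lra.
have p2 : 0 <= B2 by have := h2 0; have := normr_ge0 (derive1n 2 chi0 0); lra.
exists (B0 + B1 + B2) => [|k]; first by lra.
set e := k.+1%:R^-1.
have e0 : 0 <= e by rewrite invr_ge0.
have e1 : e <= 1 by rewrite invf_le1 ?ltr0Sn// ler1n.
have d1 := smooth_dv chi0_smooth; have d2 := smooth_dv (smooth_derive1 chi0_smooth).
have dl_ : dv (fun x : R => e * x) (fun=> e * 1) := dvZ e dv_id.
exists (fun x => e * derive1 chi0 (e * x)), (fun x => e * (e * derive1 (derive1 chi0) (e * x))); split.
- by apply: dv_ext (dv_comp d1 dl_) => x; rewrite ?mulr1.
- by apply: dv_ext (dvZ e (dv_comp d2 dl_)) => x; rewrite ?mulr1.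
- by move=> x; have := h0 (e * x); rewrite mulr1 /chi /= -/e; lra.
- move=> x; rewrite normrM (ger0_norm e0) mulrC ler_wpM2r//.
  by have := h1 (e * x); rewrite mulr1 /=; lra.
- move=> x; rewrite !normrM (ger0_norm e0) mulrC ler_wpM2r//.
  have := h2 (e * x); rewrite mulr1 /= => k2.
  by apply: (@le_trans _ _ `|derive1 (derive1 chi0) (e * x)|); [rewrite ler_piMl|lra].
Qed.

Lemma WC2_cut A d : WC2 A d -> exists B, forall k, WC2 B (fun x => chi k x * d x).
Proof.
move=> h; have A0 := WC2_A0 h; have [B B0 hB] := chi_bounds.
have [d' [d'' [dd1 dd2 k0 k1 k2]]] := h.
exists (4 * (B * A)) => k; have [c' [c'' [e1 e2 b0 b1 b2]]] := hB k.
have e1' : B * k.+1%:R^-1 <= B by rewrite ler_piMr// invf_le1 ?ltr0Sn// ler1n.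
have {}b1 x : `|c' x| <= B by exact: le_trans (b1 x) e1'.
have {}b2 x : `|c'' x| <= B by exact: le_trans (b2 x) e1'.
have W0 x := W_ge0 x.
have BA0 x : 0 <= B * (A * W x) by rewrite !mulr_ge0.
have m c1 c2 x : `|c1| <= B -> `|c2| <= A * W x -> `|c1 * c2| <= B * (A * W x) by move=> ? ?; rewrite normrM ler_pM.
exists (fun x => c' x * d x + chi k x * d' x), (fun x => (c'' x * d x + c' x * d' x) + (c' x * d' x + chi k x * d'' x)); split.
- exact: dvM.
- by apply: dvD; exact: dvM.
- move=> x; have := m _ _ x (b0 x) (k0 x); have := BA0 x; lra.
- move=> x; have := m _ _ x (b1 x) (k0 x); have := m _ _ x (b0 x) (k1 x); have := BA0 x => z h1 h2.
  by apply: le_trans (ler_normD _ _) _; lra.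
- move=> x; have := m _ _ x (b2 x) (k0 x); have := m _ _ x (b1 x) (k1 x); have := m _ _ x (b0 x) (k2 x); have := BA0 x => z h1 h2 h3.
  apply: le_trans (ler_normD _ _) _; have := ler_normD (c'' x * d x) (c' x * d' x); have := ler_normD (c' x * d' x) (chi k x * d'' x); lra.
Qed.

Lemma half_of_add e1 d1 s1 e2 d2 s2 : half_of e1 d1 s1 -> half_of e2 d2 s2 ->
  half_of (fun x => e1 x + e2 x) (fun x => d1 x + d2 x) (fun x => s1 x + s2 x).
Proof.
move=> [k1 m1 [A1 w1] D1 S1] [k2 m2 [A2 w2] D2 S2].
have kw A d : WC2 A d -> kregular d by move=> w; split; [exact: WC2_meas w|eexists; exact: WC2_kbound w].
split; [exact: kregularD|exact: smoothD|by exists (A1 + A2); exact: WC2D|..] => x.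
  by rewrite halfD_D// D1 D2.
by rewrite halfD_D ?S1 ?S2//; [exact: kw w1|exact: kw w2].
Qed.

Lemma half_of_scale k e d s : half_of e d s -> half_of (fun x => k * e x) (fun x => k * d x) (fun x => k * s x).
Proof.
move=> [k1 m1 [A1 w1] D1 S1].
have kw : kregular d by split; [exact: WC2_meas w1|eexists; exact: WC2_kbound w1].
by split; [exact: kregularZ|exact: smoothZ|by exists (`|k| * A1); exact: WC2Z|..] => x; rewrite halfD_Z// ?D1 ?S1.
Qed.

Lemma eq_half_of (e d s e' d' s' : R -> R) : e =1 e' -> d =1 d' -> s =1 s' -> half_of e d s -> half_of e' d' s'.
Proof. by move=> /funext -> /funext -> /funext ->. Qed.

Definition half_poly M a b x : R := zsum M (fun n => a n * half_cos n x + b n * half_sin n x).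
Definition full_poly M a b x : R := zsum M (fun n => a n * (absr n * (2 * pi * p x) * Cn n x) + b n * (absr n * (2 * pi * p x) * Sn n x)).

(** Harmonic by harmonic, from [half_CS]. *)
Lemma tpoly_half M a b : half_of (tpoly M a b) (half_poly M a b) (full_poly M a b).
Proof.
have h n : half_of (fun x => a n * Cn n x + b n * Sn n x) (fun x => a n * half_cos n x + b n * half_sin n x)
    (fun x => a n * (absr n * (2 * pi * p x) * Cn n x) + b n * (absr n * (2 * pi * p x) * Sn n x)).
  exact: half_of_add (half_of_scale _ (half_cos_half n)) (half_of_scale _ (half_sin_half n)).
elim: M => [|M ih].
  by apply: eq_half_of (h 0) => x; rewrite /tpoly /half_poly /full_poly /zsum big_nil addr0.
apply: eq_half_of (half_of_add ih (half_of_add (h M.+1%:Z) (h (- M.+1%:Z)))) => x;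
  by rewrite /tpoly /half_poly /full_poly [RHS]zsumS.
Qed.

Lemma ii_full_poly f M a b : Bd f -> ii mu (fun x => f x * full_poly M a b x) = 2 * pi * zsum M (fun n => absr n * (a n * al f n + b n * be f n)).
Proof.
move=> bf; have Lf := Bd_L2p bf.
have -> : zsum M (fun n => absr n * (a n * al f n + b n * be f n)) = ipp (tpoly M (fun n => absr n * a n) (fun n => absr n * b n)) f.
  by rewrite ipp_tpoly//; apply: eq_zsum => n; ring.
rewrite /ipp -iiZ; last by apply: L2p_intgM => //; exact: tpoly_L2p.
apply: eq_ii => x; rewrite /full_poly (_ : 2 * pi * (tpoly M _ _ x * f x * p x) = f x * (2 * pi * p x * tpoly M (fun n => absr n * a n) (fun n => absr n * b n) x)); last by ring.
congr (_ * _); rewrite /tpoly -zsumZ; apply: eq_zsum => n; ring.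
Qed.

Lemma ip_half_poly f M a b c d N : ip mu (half_poly M a b) (half_poly N c d) = 2 * pi * zsum N (fun n => absr n * (c n * al (tpoly M a b) n + d n * be (tpoly M a b) n)).
Proof.
have [[mT [K kT]] _ _ DT _] := tpoly_half M a b; have [_ _ [A wd] _ Dd] := tpoly_half N c d.
rewrite -ii_full_poly; last exact: tpoly_Bd.
transitivity (ii mu (fun x => half_poly N c d x * halfD (tpoly M a b) x)); first by apply: eq_ii => x; rewrite DT mulrC.
by rewrite (halfD_sym (tpoly_Bd M a b) kT wd); apply: eq_ii => x; rewrite Dd.
Qed.

Lemma sqn_half_poly M a b : evenz a -> oddz b -> sqn mu (half_poly M a b) = 2 * pi * zsum M (fun n => absr n * (a n ^+ 2 + b n ^+ 2)).
Proof.
move=> ea ob; rewrite -ipff (ip_half_poly (fun=> 0)); congr (_ * _); apply: eq_zsum_le => n nM.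
by rewrite al_tpoly// be_tpoly// nM !expr2.
Qed.

Lemma half_poly_L2 M a b : L2 mu (half_poly M a b).
Proof. by have [_ _ [A wd] _ _] := tpoly_half M a b; exact: WC2_L2 wd. Qed.

Lemma cvg_uniq (u : nat -> R) (l l' : R) : u k @[k --> \oo] --> l -> u k @[k --> \oo] --> l' -> l = l'.
Proof. by move=> h h'; apply: (cvg_unique _ h). Qed.

(** Test the distributional identity with cut-off half derivatives of the partial sums of [f];
    Cauchy-Schwarz bounds the energy of the partial sums by the norm of [g]. *)
Lemma quarter_laplacian_energy f g : Bd f -> is_quarter_laplacian f g -> fin_energy f /\ genergy f <= 2 * pi * sqn mu g.
Proof.
move=> bf [_ /Lfun2_L2 Lg hg]; have [mf [Mf hMf]] := bf; have Lf := Bd_L2p bf.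
have Mf0 : 0 <= Mf by exact: le_trans (hMf 0).
have key M : 2 * pi * zsum M (ecoef f) <= sqn mu g.
  have [_ sd [A wd] _ Dd] := tpoly_half M (al f) (be f).
  have [B hB] := WC2_cut wd.
  have mB := fun k => WC2_meas (hB k).
  have mDB k : measurable_fun setT (halfD (fun x => chi k x * half_poly M (al f) (be f) x)) := halfD_meas (hB k).
  have B0 := WC2_A0 (hB 0%N).
  have [C C0 hC] := chi_bounds.
  have chb k x : `|chi k x| <= C by have [c' [c'' [_ _ h _ _]]] := hC k; exact: h.
  have mch k : measurable_fun setT (chi k) by apply: cont_meas; apply: smooth_cont; exact: chi_smooth.
  have e k : ii mu (fun x => g x * (chi k x * half_poly M (al f) (be f) x)) = ii mu (fun x => f x * halfD (fun x => chi k x * half_poly M (al f) (be f) x) x).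
    have ts := test_schwartz (chi_test k sd).
    rewrite [LHS]hg//; apply: eq_ii => x; by rewrite multiplier_halfD.
  have [mg _] := Lg.
  have L1 : ii mu (fun x => g x * (chi k x * half_poly M (al f) (be f) x)) @[k --> \oo] --> ip mu g (half_poly M (al f) (be f)).
    have [|||||_ H] := @ii_dct _ _ _ mu (fun k x => g x * (chi k x * half_poly M (al f) (be f) x)) (fun x => g x * half_poly M (al f) (be f) x) (fun x => C * `|g x * half_poly M (al f) (be f) x|).
    - by move=> k; exact: (measurable_funM mg (mB k)).
    - by apply: measurable_funM; [case: Lg|exact: WC2_meas wd].
    - apply: aeW => x; apply: cvgM; first exact: cvg_cst.
      rewrite -[X in _ --> X]mul1r; apply: cvgM; [exact: cvg_chi|exact: cvg_cst].
    - by apply: intgZ; apply: intg_norm; apply: L2_intgM => //; exact: half_poly_L2.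
    - by move=> k x; rewrite mulrCA normrM ler_wpM2r.
    - exact: H.
  have L2' : ii mu (fun x => f x * halfD (fun x => chi k x * half_poly M (al f) (be f) x) x) @[k --> \oo] --> ii mu (fun x => f x * full_poly M (al f) (be f) x).
    have [|||||_ H] := @ii_dct _ _ _ mu (fun k x => f x * halfD (fun x => chi k x * half_poly M (al f) (be f) x) x) (fun x => f x * halfD (half_poly M (al f) (be f)) x) (fun x => Mf * (c0^-1 * CD * B * W x)).
    - by move=> k; exact: (measurable_funM mf (mDB k)).
    - by apply: measurable_funM => //; exact: halfD_meas wd.
    - apply: aeW => x; apply: cvgM; first exact: cvg_cst.
      apply: (@halfD_cvg _ (4 * B * pi)) => //; first exact: WC2_meas wd.
        by move=> k; exact: WC2_kbound.
      move=> y; rewrite -[X in _ --> X]mul1r; apply: cvgM; [exact: cvg_chi|exact: cvg_cst].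
    - by apply: intgZ; apply: intgZ; exact: intg_W.
    - by move=> k x; rewrite normrM ler_pM// halfD_le.
    - by move: H; rewrite (@eq_ii _ _ _ mu _ (fun x => f x * full_poly M (al f) (be f) x)) => [|x]; rewrite ?Dd.
  have E : ip mu g (half_poly M (al f) (be f)) = 2 * pi * zsum M (ecoef f).
    have := @ii_full_poly f M (al f) (be f) bf; rewrite (@eq_zsum _ _ _ (ecoef f)); last by move=> n; rewrite /ecoef /coef2 !expr2.
    move=> <-; apply: (cvg_uniq L1).
    suff -> : (fun k => ii mu (fun x => g x * (chi k x * half_poly M (al f) (be f) x))) =
      (fun k => ii mu (fun x => f x * halfD (fun x => chi k x * half_poly M (al f) (be f) x) x)) by [].
    by apply/funext => k; exact: e.
  have := ip_CS Lg (half_poly_L2 M (al f) (be f)); rewrite E sqn_half_poly//; [|exact: al_even|exact: be_odd].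
  rewrite (@eq_zsum _ _ _ (ecoef f)) => [|n//].
  set z := 2 * pi * _ => h.
  have z0 : 0 <= z by rewrite mulr_ge0 ?mulr_ge0 ?pi_ge0// zsum_ge0// => n; exact: ecoef_ge0.
  move: z0; rewrite le_eqVlt => /orP[/eqP <-|z1]; first exact: sqn_ge0.
  by rewrite -(ler_pM2r z1) -expr2.
have P0 : 0 < 2 * pi :> R by rewrite mulr_gt0 ?pi_gt0.
have [|gf hgf] := @fin_energy_of_series _ f (sqn mu g / (2 * pi)) bf.
  by move=> M; rewrite ler_pdivlMr// mulrC.
split => //; apply: le_trans hgf _; apply: le_of_eq.
by have := @pi_neq0 R; move: (pi : R) => P nP; field.
Qed.

Lemma weight_le x : (1 + `|x|) `^ (- (3 / 2)) <= W x.
Proof.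
rewrite powRN /W lef_pV2 ?posrE ?powR_gt0 ?exprn_gt0 ?r4_gt0 ?ltr_pwDl//.
have r2 : r4 x ^+ 2 <= 1 + `|x|.
  rewrite -(@ler_pXn2r _ 2) ?nnegrE ?addr_ge0 ?sqr_ge0// -exprM r4_4 -(real_normK (num_real x)).
  by have := normr_ge0 x; nra.
apply: (@le_trans _ _ ((r4 x ^+ 2) `^ (3 / 2))).
  rewrite -(powR_mulrn 2) ?(ltW (r4_gt0 x))// -powRrM (_ : 2 * (3 / 2) = 3%:R); last by field.
  by rewrite powR_mulrn// ltW// r4_gt0.
by apply: ge0_ler_powR => //; rewrite ?nnegrE ?sqr_ge0 ?addr_ge0//; lra.
Qed.

Lemma weight_meas : measurable_fun setT (fun x : R => (1 + `|x|) `^ (- (3 / 2))).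
Proof.
apply: (measurableT_comp (f := @powR R ^~ (- (3 / 2)))); first exact: measurable_powR.
by apply: cont_meas => x; apply: cvgD; [exact: cvg_cst|apply: cvg_norm; exact: cvg_id].
Qed.

Lemma quarter_laplacian_meas f g : is_quarter_laplacian f g -> measurable_fun setT f.
Proof.
move=> [h0 _ _]; have h := @intg_meas _ _ _ mu (fun x => f x * (1 + `|x|) `^ (- (3 / 2))) h0.
have -> : f = (fun x => f x * (1 + `|x|) `^ (- (3 / 2)) * ((1 + `|x|) `^ (- (3 / 2)))^-1).
  by apply/funext => x; rewrite mulfK// gt_eqF// powR_gt0// ltr_pwDl.
apply: measurable_funM => //; apply: (measurableT_comp (@measurable_invr R)); exact: weight_meas.
Qed.

Lemma quarter_laplacian_ae f f' g : measurable_fun setT f' -> {ae mu, forall x, f x = f' x} -> is_quarter_laplacian f g -> is_quarter_laplacian f' g.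
Proof.
move=> mf' ff' h; have mf := quarter_laplacian_meas h; have [h1 h2 h3] := h; split => //.
- apply: (@ae_intg _ _ _ mu (fun x => f x * (1 + `|x|) `^ (- (3 / 2))) (fun x => f' x * (1 + `|x|) `^ (- (3 / 2)))) => //.
    by apply: measurable_funM => //; exact: weight_meas.
  by apply: ae_imp ff' => x ->.
- move=> phi sp; rewrite h3//.
  have mq : measurable_fun setT (quarter_laplacian_schwartz phi).
    rewrite (_ : quarter_laplacian_schwartz phi = halfD phi); last by apply/funext => x; exact: multiplier_halfD.
    by have [A hA] := schwartz_WC2 sp; exact: halfD_meas hA.
  by apply: ae_eq_ii; [exact: measurable_funM|exact: measurable_funM|apply: ae_imp ff' => x ->].
Qed.

Lemma quarter_laplacian_ae_eq f f' : measurable_fun setT f -> measurable_fun setT f' -> {ae mu, forall x, f x = f' x} ->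
  quarter_laplacian f = quarter_laplacian f'.
Proof.
move=> mf mf' ff'; rewrite /quarter_laplacian; congr (get _); apply/seteqP; split=> g /= h.
  exact: quarter_laplacian_ae h.
by apply: quarter_laplacian_ae h => //; apply: ae_imp ff' => x ->.
Qed.

Lemma quarter_laplacian_unique f g1 g2 : is_quarter_laplacian f g1 -> is_quarter_laplacian f g2 -> {ae mu, forall x, g1 x = g2 x}.
Proof.
move=> [_ /Lfun2_L2 L1 h1] [_ /Lfun2_L2 L2' h2].
have LB := L2B L1 L2'.
have LL phi : test_function phi -> L2 mu phi.
  by move=> tp; have [A hA] := schwartz_WC2 (test_schwartz tp); exact: WC2_L2 hA.
have : {ae mu, forall x, g1 x - g2 x = 0}.
  apply: ae0_of_test.
  - move=> a b ab; apply: L2_intgM => //; split.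
      have c1 := @cst_cont R 1.
      have := intg_meas (ii_indic_itv c1 (ltW ab)).
      by congr measurable_fun; apply/funext => x; rewrite mul1r.
    have c1 := @cst_cont R 1.
    apply: eq_intg (ii_indic_itv c1 (ltW ab)) => x.
    by rewrite mul1r; case: (_ <= _ <= _); rewrite ?expr1n ?expr0n.
  - by case: LB.
  - move=> phi tp; have ts := test_schwartz tp.
    transitivity (ii mu (fun x => g1 x * phi x) - ii mu (fun x => g2 x * phi x)).
      rewrite -iiB; [|exact: L2_intgM L1 (LL _ tp)|exact: L2_intgM L2' (LL _ tp)].
      by apply: eq_ii => x; ring.
    by rewrite [X in X - _]h1// [X in _ - X]h2// subrr.
by apply: ae_imp => x /eqP; rewrite subr_eq0 => /eqP.
Qed.

(** The half derivatives of the partial sums are Cauchy in [L^2]; the limit is identified by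
    symmetry of [halfD] and by the almost-everywhere convergence of Fejer means. *)
Lemma quarter_laplacian_exists f : Bd f -> fin_energy f -> exists g, is_quarter_laplacian f g /\ sqn mu g = genergy f / (2 * pi).
Proof.
move=> bf gf; have [mf [Mf hMf]] := bf; have Lf := Bd_L2p bf.
have P0 : 0 < 2 * pi :> R by rewrite mulr_gt0 ?pi_gt0.
pose Z M := 2 * pi * zsum M (ecoef f).
have cZ : Z M @[M --> \oo] --> genergy f / (2 * pi).
  suff -> : Z = (fun M => (2 * pi)^-1 * (4 * pi ^+ 2 * zsum M (ecoef f))).
    by rewrite [genergy f / _]mulrC; apply: cvgM; [exact: cvg_cst|exact: cvg_ecoef].
  by apply/funext => M; rewrite /Z; have := @pi_neq0 R; move: (pi : R) (zsum _ _) => P z nP; field.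
pose D M := half_poly M (al f) (be f).
have nB M N : (N <= M)%N -> sqn mu (fun x => D M x - D N x) = Z M - Z N.
  move=> NM; rewrite sqnB; [|exact: half_poly_L2|exact: half_poly_L2].
  rewrite !sqn_half_poly; [|exact: al_even|exact: be_odd|exact: al_even|exact: be_odd].
  rewrite (ip_half_poly f) /Z.
  have -> : zsum N (fun n => absr n * (al f n * al (tpoly M (al f) (be f)) n + be f n * be (tpoly M (al f) (be f)) n)) = zsum N (ecoef f).
    apply: eq_zsum_le => n nN; rewrite (al_tpoly _ _ _ (al_even f)) (be_tpoly _ _ _ (be_odd Lf)) (leq_trans nN NM).
    by rewrite /ecoef /coef2 !expr2.
  have e K : zsum K (fun n => absr n * (al f n ^+ 2 + be f n ^+ 2)) = zsum K (ecoef f) by [].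
  by rewrite !e; ring.
have [g Lg hg] := @L2_complete_cvg _ _ _ mu D Z (fun M => half_poly_L2 M _ _) (cvgP _ cZ) nB.
exists g; split; last first.
  apply: (cvg_uniq (cvg_sqn (fun M => half_poly_L2 M _ _) Lg hg)).
  suff -> : (fun M => sqn mu (D M)) = Z by exact: cZ.
  by apply/funext => M; rewrite /D sqn_half_poly//; [exact: al_even|exact: be_odd].
split; [|exact/Lfun2_L2|].
- apply: (@intg_le _ _ _ mu (fun x => f x * (1 + `|x|) `^ (- (3 / 2))) (fun x => Mf * W x)).
  + by apply: measurable_funM => //; exact: weight_meas.
  + by move=> x; rewrite normrM ler_pM// ger0_norm ?powR_ge0// weight_le.
  + by apply: intgZ; exact: intg_W.
move=> phi sp; have [A hA] := schwartz_WC2 sp.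
have -> : \int[mu]_(x in setT) (f x * quarter_laplacian_schwartz phi x) = ii mu (fun x => f x * halfD phi x).
  by apply: eq_ii => x; rewrite multiplier_halfD.
pose U M := ii mu (fun x => Sm M f x * halfD phi x).
have hU : U M @[M --> \oo] --> ip mu g phi.
  have := cvg_ipl (fun M => half_poly_L2 M (al f) (be f)) Lg (WC2_L2 hA) hg.
  suff -> : U = (fun M => ip mu (half_poly M (al f) (be f)) phi) by [].
  apply/funext => M; have [[mT [K kT]] _ _ DT _] := tpoly_half M (al f) (be f).
  rewrite /U -(halfD_sym (tpoly_Bd M (al f) (be f)) kT hA); apply: eq_ii => x; by rewrite DT mulrC.
(* Partial sums are not uniformly bounded, so the limit is taken along Cesaro means. *)
have hA' := cesaro hU.
have IS M : intg mu (fun x => Sm M f x * halfD phi x).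
  have [mS [KS hS]] := Sm_Bd M f.
  apply: (@intg_le _ _ _ mu _ (fun x => KS * `|halfD phi x|)).
  - by apply: measurable_funM => //; exact: halfD_meas hA.
  - by move=> x; rewrite normrM ler_wpM2r.
  - by apply: intgZ; apply: intg_norm; exact: halfD_intg hA.
have eA N : arithmetic_mean U N = ii mu (fun x => sg N.+1 f x * halfD phi x).
  rewrite /arithmetic_mean /series /= /U -ii_sum//.
  rewrite -iiZ; last by apply: intg_sum.
  by apply: eq_ii => x; rewrite /sg -mulr_suml mulrA.
have [s sinf hs] := sqnp_ae_subseq (fun N => Bd_L2p (sg_Bd N.+1 f)) Lf (sg_cvg bf gf).
have h1 : arithmetic_mean U (s k) @[k --> \oo] --> ip mu g phi by exact: (cvg_comp _ _ sinf hA').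
have h2 : arithmetic_mean U (s k) @[k --> \oo] --> ii mu (fun x => f x * halfD phi x).
  have [|||||_ H] := @ii_dct _ _ _ mu (fun k x => sg (s k).+1 f x * halfD phi x) (fun x => f x * halfD phi x) (fun x => Mf * `|halfD phi x|).
  - by move=> k; apply: measurable_funM; [case: (sg_Bd (s k).+1 f)|exact: halfD_meas hA].
  - by apply: measurable_funM => //; exact: halfD_meas hA.
  - by apply: ae_imp hs => x hx; apply: cvgM; [exact: hx|exact: cvg_cst].
  - by apply: intgZ; apply: intg_norm; exact: halfD_intg hA.
  - move=> k x; rewrite normrM ler_wpM2r// (sg_bound Lf)//.
  - suff -> : (fun k => arithmetic_mean U (s k)) = (fun k => ii mu (fun x => sg (s k).+1 f x * halfD phi x)) by exact: H.
    by apply/funext => k; exact: eA.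
exact: (cvg_uniq h1 h2).
Qed.

Lemma sqn_quarter_laplacian f : Bd f -> fin_energy f -> L2 mu (quarter_laplacian f) /\ sqn mu (quarter_laplacian f) = genergy f / (2 * pi).
Proof.
move=> bf gf; have [g [hg eg]] := quarter_laplacian_exists bf gf.
have h : is_quarter_laplacian f (quarter_laplacian f) by apply: (@getPex _ [set g | is_quarter_laplacian f g]); exists g.
have [_ /Lfun2_L2 L1 _] := h; have [_ /Lfun2_L2 L2' _] := hg.
split => //; rewrite -eg; apply: ae_eq_ii.
- by apply: measurable_funX; case: L1.
- by apply: measurable_funX; case: L2'.
- by apply: ae_imp (quarter_laplacian_unique h hg) => x ->.
Qed.

End HalfLaplacianEnergy.

(** * First variation of the energy *)
Section FirstVariation.
Context {R : realType}.
Notation mu := (leb R).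
Notation mu2 := (leb R \x leb R)%E.
Implicit Types (f g h : R -> R).

Lemma dquotM f g z : dquot (fun x => f x * g x) z = f z.1 * dquot g z + g z.2 * dquot f z.
Proof. by rewrite /dquot; move: ((z.1 - z.2)^-1) => i; ring. Qed.

Lemma fin_energyM f g Mf Mg : measurable_fun setT f -> measurable_fun setT g -> (forall x, `|f x| <= Mf) -> (forall x, `|g x| <= Mg) ->
  fin_energy f -> fin_energy g -> fin_energy (fun x => f x * g x) /\ genergy (fun x => f x * g x) <= 2 * Mf ^+ 2 * genergy g + 2 * Mg ^+ 2 * genergy f.
Proof.
move=> mf mg hf hg Lf Lg.
have L1 : L2 mu2 (fun z => f z.1 * dquot g z).
  by apply: (@L2_bddM _ _ _ mu2 (fun z => f z.1) (dquot g) Mf) => //; exact: meas_fst.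
have L2' : L2 mu2 (fun z => g z.2 * dquot f z).
  by apply: (@L2_bddM _ _ _ mu2 (fun z => g z.2) (dquot f) Mg) => //; exact: meas_snd.
split; first by apply: eq_L2 (L2D L1 L2') => z; rewrite dquotM.
rewrite /genergy (@eq_sqn _ _ _ mu2 _ (fun z => f z.1 * dquot g z + g z.2 * dquot f z)); last by move=> z; rewrite dquotM.
have n1 : sqn mu2 (fun z => f z.1 * dquot g z) <= Mf ^+ 2 * genergy g.
  by apply: (sqn_le L1 Lg) => z; rewrite normrM ler_wpM2r.
have n2 : sqn mu2 (fun z => g z.2 * dquot f z) <= Mg ^+ 2 * genergy f.
  by apply: (sqn_le L2' Lf) => z; rewrite normrM ler_wpM2r.
by have := sqnD_le L1 L2'; move: n1 n2; rewrite /genergy; move: (sqn _ _) (sqn _ _) (sqn _ _) => a b c; lra.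
Qed.

Lemma Bd_fin_energyM f g : Bd f -> Bd g -> fin_energy f -> fin_energy g -> fin_energy (fun x => f x * g x).
Proof. by move=> [mf [M hM]] [mg [N hN]] gf gg; case: (fin_energyM mf mg hM hN gf gg). Qed.

(** First-order expansion of [1/N] for [N = |w + t eta|], with explicit constants so that it
    holds uniformly in the point. *)
Lemma inv_norm_expand (K t s e N : R) : 1 <= K -> `|t| * K <= 8^-1 -> `|s| <= K -> 0 <= e <= K -> 0 <= N ->
  N ^+ 2 = 1 + 2 * t * s + t ^+ 2 * e -> [/\ 2^-1 <= N, N <= 2 & `|N^-1 - 1 + t * s| <= 40 * (t ^+ 2 * K ^+ 2)].
Proof.
move=> K1 tK sK /andP[e0 eK] N0 hN.
pose a := 2 * t * s + t ^+ 2 * e.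
have hN' : N ^+ 2 = 1 + a by rewrite hN /a; ring.
have ts : `|t * s| <= `|t| * K by rewrite normrM ler_wpM2l.
have tK0 : 0 <= `|t| * K by rewrite mulr_ge0// (le_trans ler01).
have t2 : t ^+ 2 = `|t| ^+ 2 by rewrite real_normK ?num_real.
have t0 := normr_ge0 t.
have te : 0 <= t ^+ 2 * e by rewrite mulr_ge0 ?sqr_ge0.
have te1 : t ^+ 2 * e <= `|t| * K * (`|t| * K).
  rewrite t2 (_ : `|t| * K * (`|t| * K) = `|t| ^+ 2 * (K * K)); last by ring.
  by rewrite ler_wpM2l ?sqr_ge0//; nra.
have a_ : `|a| <= 3 * (`|t| * K).
  by move: ts; rewrite /a !ler_norml => /andP[? ?]; apply/andP; split; nra.
have aq : `|a| <= 3 / 8 by lra.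
have N1 : 2^-1 <= N by move: aq; rewrite ler_norml => /andP[? ?]; nra.
have N2 : N <= 2 by move: aq; rewrite ler_norml => /andP[? ?]; nra.
split => //.
have Np : 0 < N by lra.
pose b := N - 1.
have ba : b * (N + 1) = a by rewrite /b; lra.
have bb : `|b| <= `|a|.
  by rewrite -ba normrM ler_peMr// ger0_norm; lra.
have -> : N^-1 - 1 + t * s = b ^+ 2 * (3 / 2 + b / 2) * N^-1 - t ^+ 2 * e / 2.
  have -> : t * s = a / 2 - t ^+ 2 * e / 2 by rewrite /a; field.
  by rewrite -ba /b; field; rewrite gt_eqF.
have b2 : b ^+ 2 <= 9 * (`|t| * K * (`|t| * K)).
  rewrite -(real_normK (num_real b)) (_ : 9 * _ = (3 * (`|t| * K)) ^+ 2); last by ring.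
  by rewrite ler_sqr ?nnegrE// ?mulr_ge0 ?normr_ge0 ?ler0n ?(le_trans ler01 K1)//; exact: le_trans bb a_.
have iN : N^-1 <= 2 by rewrite invf_ple ?posrE//; lra.
have iN0 : 0 <= N^-1 by rewrite invr_ge0.
have h1 : 0 <= 3 / 2 + b / 2 <= 2 by rewrite /b; apply/andP; split; lra.
have b20 := sqr_ge0 b.
have h2 : 0 <= b ^+ 2 * (3 / 2 + b / 2) * N^-1 <= 4 * b ^+ 2.
  case/andP: h1 => h1 h1'; apply/andP; split; first exact: mulr_ge0 (mulr_ge0 b20 h1) iN0.
  have : b ^+ 2 * (3 / 2 + b / 2) <= 2 * b ^+ 2 by nra.
  have : 0 <= b ^+ 2 * (3 / 2 + b / 2) by rewrite mulr_ge0.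
  by nra.
have -> : t ^+ 2 * K ^+ 2 = `|t| * K * (`|t| * K) by rewrite t2; ring.
by case/andP: h2 => ? ?; rewrite ler_norml; apply/andP; split; lra.
Qed.

Lemma kappa_expand (K t s s' n n' : R) : 1 <= K -> `|t| * K <= 8^-1 -> `|s| <= K -> `|s'| <= K -> 0 <= n' <= 2 ->
  `|n - 1 + t * s| <= 40 * (t ^+ 2 * K ^+ 2) -> `|n' - 1 + t * s'| <= 40 * (t ^+ 2 * K ^+ 2) ->
  `|n * n' - 1 + t * (s + s')| <= 200 * (t ^+ 2 * K ^+ 2).
Proof.
move=> K1 tK sK sK' /andP[n0 n2] h h'.
have -> : n * n' - 1 + t * (s + s') = (n - 1 + t * s) * n' + (1 - t * s) * (n' - 1 + t * s') + t ^+ 2 * (s * s') by ring.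
have ts : `|t * s| <= 8^-1 by rewrite normrM (le_trans _ tK)// ler_wpM2l.
have k1 : `|1 - t * s| <= 2 by move: ts; rewrite !ler_norml => /andP[? ?]; apply/andP; split; lra.
set X := t ^+ 2 * K ^+ 2 in h h' *.
have X0 : 0 <= X by rewrite mulr_ge0 ?sqr_ge0.
have e1 : `|(n - 1 + t * s) * n'| <= 40 * X * 2 by rewrite normrM ler_pM// ger0_norm.
have e2 : `|(1 - t * s) * (n' - 1 + t * s')| <= 2 * (40 * X) by rewrite normrM ler_pM.
have e3 : `|t ^+ 2 * (s * s')| <= X.
  by rewrite normrM (ger0_norm (sqr_ge0 t)) /X ler_wpM2l ?sqr_ge0// expr2 normrM ler_pM.
apply: le_trans (ler_normD _ _) _; have := ler_normD ((n - 1 + t * s) * n') ((1 - t * s) * (n' - 1 + t * s')); lra.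
Qed.

Lemma normM_le (a b : R) : `|a * b| <= a ^+ 2 + b ^+ 2.
Proof.
rewrite normrM -(real_normK (num_real a)) -(real_normK (num_real b)); move: (`|a|) (`|b|) => c d.
by have := sqr_ge0 (c - d); have := sqr_ge0 (c + d); lra.
Qed.

Lemma norm_diff_bound (K t n n' d S E : R) : 1 <= K -> `|t| * K <= 8^-1 -> 2^-1 <= n -> 2^-1 <= n' ->
  d * (n + n') = 2 * t * S + t ^+ 2 * E -> d ^+ 2 <= 8 * t ^+ 2 * (S ^+ 2 + E ^+ 2).
Proof.
move=> K1 tK h h' e; have t0 := normr_ge0 t.
have t1 : `|t| <= 1.
  by apply: (@le_trans _ _ (`|t| * K)); [rewrite ler_peMr|apply: le_trans tK _; rewrite invf_le1// ler1n].
have t2 : t ^+ 2 <= 1 by rewrite -(real_normK (num_real t)) expr_le1.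
have l1 : d ^+ 2 <= (d * (n + n')) ^+ 2.
  by rewrite [leRHS]exprMn ler_peMr ?sqr_ge0// expr_ge1//; lra.
apply: le_trans l1 _; rewrite e (_ : 2 * t * S + t ^+ 2 * E = t * (2 * S + t * E)); last by ring.
rewrite exprMn (_ : 8 * t ^+ 2 * _ = t ^+ 2 * (8 * (S ^+ 2 + E ^+ 2))); last by ring.
rewrite ler_wpM2l ?sqr_ge0//.
have : (t * E) ^+ 2 <= E ^+ 2 by rewrite exprMn ler_piMl ?sqr_ge0.
have := sqr_ge0 (2 * S - t * E); have := sqr_ge0 E; have := sqr_ge0 S; lra.
Qed.

(** Here [A], [H], [S], [E], [D] are squared difference quotients of [w], [eta], [w.eta],
    [|eta|^2] and [N], and [k] is [1 / (N N')]. *)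
Lemma pointwise_bound (K t A H P D S E k q : R) : 1 <= K -> `|t| * K <= 8^-1 ->
  0 <= A -> 0 <= H -> 0 <= S -> 0 <= E -> 0 <= D -> `|P| <= A + H -> D <= 8 * t ^+ 2 * (S + E) ->
  0 <= k <= 4 -> `|q| <= 2 * K -> `|k - 1 + t * q| <= 200 * (t ^+ 2 * K ^+ 2) ->
  `|k * (A + 2 * t * P + t ^+ 2 * H - D) - A - t * (2 * P - A * q)| <= 300 * (t ^+ 2 * K ^+ 2) * (A + H + S + E).
Proof.
move=> K1 tK A0 H0 S0 E0 D0 PAH Dle /andP[k0 k4] q2 kex.
have -> : k * (A + 2 * t * P + t ^+ 2 * H - D) - A - t * (2 * P - A * q) =
  A * (k - 1 + t * q) + 2 * t * P * (k - 1) + t ^+ 2 * (k * H) - k * D by ring.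
have t2 : t ^+ 2 = `|t| ^+ 2 by rewrite real_normK ?num_real.
have t0 := normr_ge0 t; have tK0 : 0 <= `|t| * K by rewrite mulr_ge0// (le_trans ler01).
have X0 : 0 <= t ^+ 2 by exact: sqr_ge0.
have K2 : 1 <= K ^+ 2 by rewrite expr_ge1// (le_trans ler01).
have KK : K <= K ^+ 2 by rewrite expr2 ler_peMr// (le_trans ler01).
have tKK : t ^+ 2 * K ^+ 2 = `|t| * K * (`|t| * K) by rewrite t2; ring.
have k1 : `|k - 1| <= 27 * (`|t| * K).
  have -> : k - 1 = (k - 1 + t * q) - t * q by ring.
  apply: le_trans (ler_normB _ _) _.
  have : `|t * q| <= 2 * (`|t| * K) by rewrite normrM mulrCA ler_wpM2l.
  have : 200 * (t ^+ 2 * K ^+ 2) <= 25 * (`|t| * K).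
    rewrite tKK; have : `|t| * K * (`|t| * K) <= `|t| * K * 8^-1 by rewrite ler_wpM2l.
    lra.
  lra.
have T1 : `|A * (k - 1 + t * q)| <= 200 * (t ^+ 2 * K ^+ 2) * A.
  by rewrite normrM (ger0_norm A0) mulrC ler_wpM2r.
have T2 : `|2 * t * P * (k - 1)| <= 54 * (t ^+ 2 * K ^+ 2) * (A + H).
  rewrite !normrM (ger0_norm (_ : 0 <= 2))//.
  apply: (@le_trans _ _ (2 * `|t| * (A + H) * (27 * (`|t| * K)))).
    by rewrite ler_pM ?mulr_ge0// ler_wpM2l ?mulr_ge0.
  have -> : 2 * `|t| * (A + H) * (27 * (`|t| * K)) = 54 * (t ^+ 2 * K) * (A + H) by rewrite t2; ring.
  by rewrite ler_wpM2r ?addr_ge0// ler_wpM2l// ler_wpM2l.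
have T3 : 0 <= t ^+ 2 * (k * H) <= 4 * (t ^+ 2 * K ^+ 2) * H.
  apply/andP; split; first exact: mulr_ge0 X0 (mulr_ge0 k0 H0).
  have -> : 4 * (t ^+ 2 * K ^+ 2) * H = t ^+ 2 * ((4 * K ^+ 2) * H) by ring.
  rewrite ler_wpM2l// ler_wpM2r//; lra.
have T4 : 0 <= k * D <= 32 * (t ^+ 2 * K ^+ 2) * (S + E).
  apply/andP; split; first exact: mulr_ge0.
  apply: (@le_trans _ _ (4 * (8 * t ^+ 2 * (S + E)))); first by rewrite ler_pM.
  have SE : 0 <= S + E by rewrite addr_ge0.
  rewrite (_ : 4 * _ = 32 * (t ^+ 2 * 1) * (S + E)); last by ring.
  by rewrite ler_wpM2r// ler_wpM2l// ler_wpM2l.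
have QA : 0 <= t ^+ 2 * K ^+ 2 * A := mulr_ge0 (mulr_ge0 X0 (sqr_ge0 K)) A0.
have QH : 0 <= t ^+ 2 * K ^+ 2 * H := mulr_ge0 (mulr_ge0 X0 (sqr_ge0 K)) H0.
have QS : 0 <= t ^+ 2 * K ^+ 2 * S := mulr_ge0 (mulr_ge0 X0 (sqr_ge0 K)) S0.
have QE : 0 <= t ^+ 2 * K ^+ 2 * E := mulr_ge0 (mulr_ge0 X0 (sqr_ge0 K)) E0.
move: QA QH QS QE T1 T2 T3 T4; set X := t ^+ 2 * K ^+ 2; rewrite !ler_norml => ? ? ? ? /andP[? ?] /andP[? ?] /andP[? ?] /andP[? ?].
by apply/andP; split; lra.
Qed.

Context (m : nat).
Implicit Types (w eta v : 'I_m -> R -> R).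

Definition dotf w eta (x : R) : R := \sum_i w i x * eta i x.
Definition nsq w eta (t x : R) : R := \sum_i (w i x + t * eta i x) ^+ 2.
Definition proj_var w eta (t : R) (i : 'I_m) (x : R) : R := (Num.sqrt (nsq w eta t x))^-1 * (w i x + t * eta i x).
Definition edensity w (z : R * R) : R := \sum_i dquot (w i) z ^+ 2.

Definition unit_map w := [/\ forall i, measurable_fun setT (w i), forall x, \sum_i w i x ^+ 2 = 1 & forall i, fin_energy (w i)].

Lemma unit_le1 w i x : unit_map w -> `|w i x| <= 1.
Proof.
move=> [_ h _]; rewrite -(@ler_pXn2r _ 2) ?nnegrE// real_normK ?num_real// expr1n -(h x).
by rewrite (bigD1 i)//= lerDl sumr_ge0// => j _; exact: sqr_ge0.
Qed.

Lemma unit_Bd w i : unit_map w -> Bd (w i).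
Proof. by move=> h; split; [case: h|exists 1 => x; exact: unit_le1]. Qed.

Lemma edensity_intg w : (forall i, fin_energy (w i)) -> intg mu2 (edensity w).
Proof. by move=> h; apply: intg_sum => i _; case: (h i). Qed.

Lemma nsqE w eta t x : unit_map w -> nsq w eta t x = 1 + 2 * t * dotf w eta x + t ^+ 2 * dotf eta eta x.
Proof.
move=> [_ h _]; transitivity (\sum_i w i x ^+ 2 + 2 * t * dotf w eta x + t ^+ 2 * dotf eta eta x); last by rewrite h.
rewrite /dotf !mulr_sumr -!big_split /=; apply: eq_bigr => i _; ring.
Qed.

Lemma Bd_dotf w eta : (forall i, Bd (w i)) -> (forall i, Bd (eta i)) -> Bd (dotf w eta).
Proof. by move=> h k; apply: Bd_sum => i; exact: BdM. Qed.

Lemma fin_energy_dotf w eta : (forall i, Bd (w i)) -> (forall i, Bd (eta i)) -> (forall i, fin_energy (w i)) -> (forall i, fin_energy (eta i)) -> fin_energy (dotf w eta).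
Proof. by move=> h k gh gk_; apply: fin_energy_sum => i; exact: Bd_fin_energyM. Qed.

(** Polarisation; the projection enters only through the norms. *)
Lemma proj_var_dist w eta t (x y n n' : R) : n != 0 -> n' != 0 -> n ^+ 2 = nsq w eta t x -> n' ^+ 2 = nsq w eta t y ->
  \sum_i (n^-1 * (w i x + t * eta i x) - n'^-1 * (w i y + t * eta i y)) ^+ 2 =
  n^-1 * n'^-1 * (\sum_i ((w i x + t * eta i x) - (w i y + t * eta i y)) ^+ 2 - (n - n') ^+ 2).
Proof.
move=> n0 n0' hn hn'; pose Y i := w i x + t * eta i x; pose Y' i := w i y + t * eta i y.
have e1 : \sum_i Y i ^+ 2 = n ^+ 2 by rewrite hn.
have e2 : \sum_i Y' i ^+ 2 = n' ^+ 2 by rewrite hn'.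
have -> : \sum_i (n^-1 * Y i - n'^-1 * Y' i) ^+ 2 =
    n^-1 ^+ 2 * \sum_i Y i ^+ 2 + n'^-1 ^+ 2 * \sum_i Y' i ^+ 2 - 2 * n^-1 * n'^-1 * \sum_i Y i * Y' i.
  by rewrite !mulr_sumr -!big_split /= -sumrB; apply: eq_bigr => i _; ring.
have -> : \sum_i (Y i - Y' i) ^+ 2 = \sum_i Y i ^+ 2 + \sum_i Y' i ^+ 2 - 2 * \sum_i Y i * Y' i.
  by rewrite !mulr_sumr -!big_split /= -sumrB; apply: eq_bigr => i _; ring.
by rewrite e1 e2; field; rewrite n0 n0'.
Qed.

(** Integrating [pointwise_bound]: the coefficient of [t] is the first variation and the
    remainder is bounded by energies. *)
Lemma energy_expand w eta : unit_map w -> (forall i, Bd (eta i)) -> (forall i, fin_energy (eta i)) ->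
  exists t0 C, [/\ 0 < t0, 0 <= C & forall t, `|t| <= t0 ->
   (forall i, Bd (proj_var w eta t i) /\ fin_energy (proj_var w eta t i)) /\
   `|\sum_i genergy (proj_var w eta t i) - \sum_i genergy (w i) -
     t * (2 * \sum_i energy_form (w i) (eta i) - ii mu2 (fun z => edensity w z * (dotf w eta z.1 + dotf w eta z.2)))| <= C * t ^+ 2].
Proof.
move=> uw be ge; have [mw hw gw] := uw; have bw := fun i => unit_Bd i uw.
have bs := Bd_dotf bw be; have bE := Bd_dotf be be.
have gs := fin_energy_dotf bw be gw ge; have gE := fin_energy_dotf be be ge ge.
have [ms [Ks hs]] := bs; have [mE [Ke he]] := bE.
have Ks0 : 0 <= Ks := le_trans (normr_ge0 _) (hs 0).
have Ke0 : 0 <= Ke := le_trans (normr_ge0 _) (he 0).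
pose K := 1 + Ks + Ke; have K1 : 1 <= K by rewrite /K; lra.
have Kp : 0 < K by lra.
have E0 x : 0 <= dotf eta eta x by apply: sumr_ge0 => i _; rewrite -expr2 sqr_ge0.
have sK x : `|dotf w eta x| <= K by apply: le_trans (hs x) _; rewrite /K; lra.
have eK x : 0 <= dotf eta eta x <= K.
  by rewrite E0/=; have := he x; rewrite ger0_norm// /K; lra.
(* For [|t| <= t0] the norm of [w + t eta] stays in [[1/2, 2]]. *)
pose t0 := (8 * K)^-1; have t00 : 0 < t0 by rewrite invr_gt0 mulr_gt0.
pose Gd z := edensity w z + edensity eta z + dquot (dotf w eta) z ^+ 2 + dquot (dotf eta eta) z ^+ 2.
have IA := edensity_intg gw; have IH := edensity_intg ge.
have IG : intg mu2 Gd by apply: intgD; [apply: intgD; [exact: intgD|case: gs]|case: gE].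
have A0 z : 0 <= edensity w z by apply: sumr_ge0 => i _; exact: sqr_ge0.
have H0 z : 0 <= edensity eta z by apply: sumr_ge0 => i _; exact: sqr_ge0.
have G0 z : 0 <= Gd z by rewrite /Gd !addr_ge0 ?sqr_ge0.
have C0 : 0 <= 300 * K ^+ 2 := mulr_ge0 (ler0n R 300) (sqr_ge0 K).
exists t0, (300 * K ^+ 2 * ii mu2 Gd); split; [exact: t00|by rewrite mulr_ge0// ii_ge0|].
move=> t tt0; have tK : `|t| * K <= 8^-1.
  rewrite -ler_pdivlMr//; apply: le_trans tt0 _; by rewrite /t0 invfM.
pose N x := Num.sqrt (nsq w eta t x).
have nsq0 x : 0 <= nsq w eta t x by apply: sumr_ge0 => i _; exact: sqr_ge0.
have N2 x : N x ^+ 2 = nsq w eta t x by rewrite sqr_sqrtr.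
have hN x := inv_norm_expand K1 tK (sK x) (eK x) (sqrtr_ge0 _) (etrans (N2 x) (nsqE eta t x uw)).
have Np x : 0 < N x by case: (hN x) => h _ _; apply: lt_le_trans h; rewrite invr_gt0.
pose Y i x := w i x + t * eta i x.
have bY i : Bd (Y i) by apply: BdD => //; exact: BdZ.
have gY i : fin_energy (Y i) by apply: fin_energyD => //; exact: fin_energyZ.
have iN2 x : 0 <= (N x)^-1 <= 2.
  by rewrite invr_ge0 (ltW (Np x))/= invf_ple ?posrE//; case: (hN x).
have mN : measurable_fun setT N.
  apply: (measurableT_comp (f := @Num.sqrt R)); first by apply: cont_meas; exact: sqrt_continuous.
  have -> : nsq w eta t = (fun x => \sum_i Y i x * Y i x) by apply/funext => x; apply: eq_bigr => i _; rewrite expr2.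
  by case: (Bd_dotf bY bY).
have bN : Bd (fun x => (N x)^-1).
  split; first exact: (measurableT_comp (@measurable_invr R) mN).
  by exists 2 => x; case/andP: (iN2 x) => h1 h2; rewrite ger0_norm.
have bv i : Bd (proj_var w eta t i) by exact: BdM bN (bY i).
have dist z : \sum_i dquot (proj_var w eta t i) z ^+ 2 = (N z.1)^-1 * (N z.2)^-1 * (\sum_i dquot (Y i) z ^+ 2 - dquot N z ^+ 2).
  rewrite /dquot; set i0 := (z.1 - z.2)^-1.
  have := @proj_var_dist w eta t z.1 z.2 (N z.1) (N z.2) (lt0r_neq0 (Np _)) (lt0r_neq0 (Np _)) (N2 _) (N2 _).
  move=> /(congr1 ( *%R (i0 ^+ 2))); rewrite mulr_sumr => h.
  rewrite (eq_bigr (fun i => i0 ^+ 2 * ((N z.1)^-1 * (w i z.1 + t * eta i z.1) - (N z.2)^-1 * (w i z.2 + t * eta i z.2)) ^+ 2)); last first.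
    by move=> i _; rewrite exprMn mulrC.
  rewrite h mulrCA; congr (_ * _); rewrite mulrBr exprMn [i0 ^+ 2 * (N z.1 - _) ^+ 2]mulrC; congr (_ - _).
  by rewrite mulr_sumr; apply: eq_bigr => i _; rewrite exprMn mulrC.
have sq0 (f : R -> R) z : 0 <= dquot f z ^+ 2 := sqr_ge0 _.
have kap z : 0 <= (N z.1)^-1 * (N z.2)^-1 <= 4.
  by case/andP: (iN2 z.1) => ? ?; case/andP: (iN2 z.2) => ? ?; rewrite mulr_ge0//= (_ : 4 = 2 * 2) ?ler_pM//; ring.
have IY : intg mu2 (fun z => \sum_i dquot (Y i) z ^+ 2) := edensity_intg gY.
have gv i : fin_energy (proj_var w eta t i).
  split; first by apply: dquot_meas; case: (bv i).
  apply: (@intg_le _ _ _ mu2 _ (fun z => 4 * \sum_i dquot (Y i) z ^+ 2)); last exact: intgZ.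
    by apply: measurable_funX; apply: dquot_meas; case: (bv i).
  move=> z; rewrite ger0_norm//; apply: (@le_trans _ _ (\sum_i dquot (proj_var w eta t i) z ^+ 2)).
    by rewrite (bigD1 i)//= lerDl sumr_ge0.
  rewrite dist; case/andP: (kap z) => k0 k4.
  have : 0 <= \sum_i dquot (Y i) z ^+ 2 by apply: sumr_ge0.
  have := sq0 N z; nra.
split => //.
have Iv := edensity_intg gv.
have eGv : \sum_i genergy (proj_var w eta t i) = ii mu2 (edensity (proj_var w eta t)) by rewrite /edensity ii_sum// => i _; case: (gv i).
have eGw : \sum_i genergy (w i) = ii mu2 (edensity w) by rewrite /edensity ii_sum// => i _; case: (gw i).
pose P z := \sum_i dquot (w i) z * dquot (eta i) z.
have IP : intg mu2 P by apply: intg_sum => i _; exact: L2_intgM (gw i) (ge i).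
have eP : \sum_i energy_form (w i) (eta i) = ii mu2 P by rewrite /P ii_sum// => i _; exact: L2_intgM (gw i) (ge i).
have m12 : measurable_fun [set: plane R] (fun z => dotf w eta z.1 + dotf w eta z.2).
  by apply: measurable_funD; [exact: meas_fst|exact: meas_snd].
have IAs : intg mu2 (fun z => edensity w z * (dotf w eta z.1 + dotf w eta z.2)).
  apply: (@intg_le _ _ _ mu2 _ (fun z => 2 * K * edensity w z)); last exact: intgZ.
    by apply: measurable_funM => //; exact: intg_meas IA.
  move=> z; rewrite normrM mulrC (ger0_norm (A0 z)) ler_wpM2r//.
  by apply: le_trans (ler_normD _ _) _; have := sK z.1; have := sK z.2; lra.
have IL := intgB (intgZ 2 IP) IAs.
have -> : \sum_i genergy (proj_var w eta t i) - \sum_i genergy (w i) -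
     t * (2 * \sum_i energy_form (w i) (eta i) - ii mu2 (fun z => edensity w z * (dotf w eta z.1 + dotf w eta z.2))) =
   ii mu2 (fun z => edensity (proj_var w eta t) z - edensity w z - t * (2 * P z - edensity w z * (dotf w eta z.1 + dotf w eta z.2))).
  by rewrite (iiB (intgB Iv IA) (intgZ t IL)) (iiB Iv IA) (iiZ t IL) (iiB (intgZ 2 IP) IAs) (iiZ 2 IP) eGv eGw eP.
have -> : 300 * K ^+ 2 * ii mu2 Gd * t ^+ 2 = ii mu2 (fun z => 300 * K ^+ 2 * t ^+ 2 * Gd z).
  by rewrite (iiZ (300 * K ^+ 2 * t ^+ 2) IG); move: (ii mu2 Gd) => q; ring.
have Itot : intg mu2 (fun z => edensity (proj_var w eta t) z - edensity w z - t * (2 * P z - edensity w z * (dotf w eta z.1 + dotf w eta z.2))).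
  by apply: intgB; [exact: intgB|apply: intgZ; apply: intgB => //; exact: intgZ].
apply: norm_ii_le; [exact: intg_meas Itot| |exact: intgZ].
move=> z; have dz : edensity (proj_var w eta t) z = (N z.1)^-1 * (N z.2)^-1 * (\sum_i dquot (Y i) z ^+ 2 - dquot N z ^+ 2) := dist z.
have [_ _ hk1] := hN z.1; have [_ _ hk2] := hN z.2.
have kex := kappa_expand K1 tK (sK z.1) (sK z.2) (iN2 z.2) hk1 hk2.
have eY : \sum_i dquot (Y i) z ^+ 2 = edensity w z + 2 * t * P z + t ^+ 2 * edensity eta z.
  rewrite /edensity /P !mulr_sumr -!big_split /=; apply: eq_bigr => i _.
  by rewrite dquotD dquotZ; ring.
have PAH : `|P z| <= edensity w z + edensity eta z.
  apply: le_trans (ler_norm_sum _ _ _) _; rewrite /edensity -big_split /=.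
  by apply: ler_sum => i _; exact: normM_le.
have Dle : dquot N z ^+ 2 <= 8 * t ^+ 2 * (dquot (dotf w eta) z ^+ 2 + dquot (dotf eta eta) z ^+ 2).
  have [h1 _ _] := hN z.1; have [h2 _ _] := hN z.2.
  apply: (norm_diff_bound K1 tK h1 h2).
  rewrite -/(N z.1) -/(N z.2); transitivity ((N z.1 ^+ 2 - N z.2 ^+ 2) / (z.1 - z.2)); first by rewrite /dquot; ring.
  by rewrite !N2 !nsqE// /dquot; ring.
rewrite dz eY; apply: le_trans (pointwise_bound K1 tK (A0 z) (H0 z) (sq0 _ z) (sq0 _ z) (sq0 _ z) PAH Dle (kap z) _ kex) _.
  by apply: le_trans (ler_normD _ _) _; rewrite mulr_natl mulr2n lerD.
by rewrite /Gd le_eqVlt; apply/orP; left; apply/eqP; ring.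
Qed.

End FirstVariation.

(** * Smooth approximation and scale-invariant cutoffs *)
Section EulerLagrange.
Context {R : realType}.
Notation mu := (leb R).
Notation mu2 := (leb R \x leb R)%E.
Implicit Types (f g h : R -> R).

Lemma dv_p : dv (@p R) (fun x => - (2 * pi) * (x * (p x * p x))).
Proof.
have h := dvV (dvZ pi (@dv_sqr1 R)).
apply: dv_ext (h _) => x.
- by [].
- have := @pi_neq0 R; have := lt0r_neq0 (sqr1_gt0 x); rewrite /p; move: (pi : R) (1 + x ^+ 2) => P Q Q0 P0.
  by field; rewrite P0 Q0.
- by rewrite mulf_neq0 ?pi_neq0// gt_eqF// sqr1_gt0.
Qed.

Lemma dv_Cn n : dv (@Cn R n) (fun x => - (2 * pi * n%:~R) * (p x * Sn n x)).
Proof.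
by apply: dv_ext (dv_comp (@dv_cos R) (dvZ n%:~R (@dv_th R))) => x //; rewrite /Sn; ring.
Qed.

Lemma dv_Sn n : dv (@Sn R n) (fun x => 2 * pi * n%:~R * (p x * Cn n x)).
Proof.
by apply: dv_ext (dv_comp (@dv_sin R) (dvZ n%:~R (@dv_th R))) => x //; rewrite /Cn; ring.
Qed.

Lemma trig_smooth n : smooth (@Cn R n) /\ smooth (@Sn R n).
Proof.
pose G f := [\/ f = (fun x => x), f = @p R, f = @Cn R n | f = @Sn R n].
have H f : G f -> exists f', dv f f' /\ alg G f'.
  have gx : alg G (fun x => x) by apply: alg_gen; exact: Or41.
  have gp : alg G (@p R) by apply: alg_gen; exact: Or42.
  have gC : alg G (@Cn R n) by apply: alg_gen; exact: Or43.
  have gS : alg G (@Sn R n) by apply: alg_gen; exact: Or44.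
  case=> ->.
  - by exists (fun=> 1); split; [exact: dv_id|exact: alg_cst].
  - exists (fun x => - (2 * pi) * (x * (p x * p x))); split; first exact: dv_p.
    exact: alg_mul (alg_cst G (- (2 * pi))) (alg_mul gx (alg_mul gp gp)).
  - exists (fun x => - (2 * pi * n%:~R) * (p x * Sn n x)); split; first exact: dv_Cn.
    exact: alg_mul (alg_cst G (- (2 * pi * n%:~R))) (alg_mul gp gS).
  - exists (fun x => 2 * pi * n%:~R * (p x * Cn n x)); split; first exact: dv_Sn.
    exact: alg_mul (alg_cst G (2 * pi * n%:~R)) (alg_mul gp gC).
by split; apply: (alg_smooth H); apply: alg_gen; [exact: Or43|exact: Or44].
Qed.

Lemma smooth_zsum M (F : int -> R -> R) : (forall n, smooth (F n)) -> smooth (fun x => zsum M (F^~ x)).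
Proof. by move=> h; apply: smoothD => //; apply: smooth_sum => i; exact: smoothD. Qed.

Lemma tpoly_smooth M a b : smooth (@tpoly R M a b).
Proof.
apply: smooth_zsum => n; apply: smoothD; apply: smoothZ; [exact: (trig_smooth n).1|exact: (trig_smooth n).2].
Qed.

Lemma sg_smooth N f : smooth (sg N f).
Proof. by apply: smoothZ; apply: smooth_sum => M; exact: tpoly_smooth. Qed.

(** The kernel [1 / (x - y)^2] scales like the inverse of the area element. *)
Lemma genergy_scale f a : 0 < a -> (forall x, intg mu (fun y => dquot f (x, y) ^+ 2)) -> fin_energy f -> fin_energy (fun x => f (a * x)) ->
  genergy (fun x => f (a * x)) = genergy f.
Proof.
move=> a0 hi [_ gf] [_ gfa].
have [i1 e1] := fubini12 gf; have [_ e2] := fubini12 gfa.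
rewrite /genergy /sqn e1 e2.
pose H x := ii mu (fun y => dquot f (x, y) ^+ 2).
have E x : ii mu (fun y => dquot (fun x => f (a * x)) (x, y) ^+ 2) = a * H (a * x).
  have [j1 j2] := ii_affine 0 a0 (hi (a * x)).
  transitivity (ii mu (fun y => a ^+ 2 * dquot f (a * x, a * y + 0) ^+ 2)).
    apply: eq_ii => y; rewrite /dquot /= addr0 -exprMn; congr (_ ^+ 2).
    by rewrite -mulrBr invfM mulrCA [a * (a^-1 * _)]mulVKf// gt_eqF.
  by rewrite iiZ// j2 /H mulrA expr2 mulfK// gt_eqF.
have [j1 j2] := ii_affine 0 a0 i1.
transitivity (ii mu (fun x => a * H (a * x + 0))); first by apply: eq_ii => x; rewrite E addr0.
have {}j2 : ii mu (fun x => H (a * x + 0)) = a^-1 * ii mu H := j2.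
by rewrite (iiZ a j1) j2 mulVKf// gt_eqF.
Qed.

Lemma genergy_chi_le : exists C, forall k, fin_energy (@chi R k) /\ genergy (@chi R k) <= C.
Proof.
have [B B0 hB] := @chi_bounds R.
have tc k : test_function (@chi R k).
  by have := chi_test k (@smooth_cst R 1); congr test_function; apply/funext => x; rewrite mulr1.
have gc k : fin_energy (@chi R k) by exact: test_fin_energy.
exists (genergy (@chi R 0)) => k; split => //.
have e : @chi R k = (fun x => @chi R 0 (k.+1%:R^-1 * x)) by apply/funext => x; rewrite /chi invr1 mul1r.
have k0 : 0 < k.+1%:R^-1 :> R by rewrite invr_gt0.
rewrite e genergy_scale//; last by rewrite -e.
move=> x; have [c' [c'' [d1 _ hb hc' _]]] := hB 0%N.
have m0 : measurable_fun setT (@chi R 0) by apply: cont_meas; exact: dv_cont d1.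
apply: (@intg_le _ _ _ mu _ (fun y => (5 * B ^+ 2 * pi) * p (1 * y + - x))).
- apply: measurable_funX; apply: measurable_funM.
    by apply: measurable_funB => //=; exact: measurable_fun_cst.
  by apply: (measurableT_comp (@measurable_invr R)); meas.
- move=> y; rewrite ger0_norm ?sqr_ge0// mul1r /p invfM mulrA mulfK ?pi_neq0// ler_pdivlMr ?sqr1_gt0// /dquot /=.
  have hB' z : `|c' z| <= B by have := hc' z; rewrite invr1 mulr1.
  have [->|xy] := eqVneq x y; first by rewrite subrr mul0r expr0n/= mul0r mulr_ge0 ?sqr_ge0.
  have xy0 : x - y != 0 by rewrite subr_eq0.
  have [c _ hc] := mvt y x d1.
  have -> : chi 0 x - chi 0 y = c' c * (x - y) by exact: hc.
  have h1 := hb x; have h2 := hb y; have h3 := hB' c; rewrite mulfK// mulrDr mulr1 (_ : c' c ^+ 2 * (y + - x) ^+ 2 = (chi 0 x - chi 0 y) ^+ 2); last by rewrite hc; ring.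
  have e1 : c' c ^+ 2 <= B ^+ 2 by rewrite -(real_normK (num_real (c' c))) ler_sqr ?nnegrE.
  have e2 : (chi 0 x - chi 0 y) ^+ 2 <= (B + B) ^+ 2.
    by rewrite -(real_normK (num_real (chi 0 x - chi 0 y))) ler_sqr ?nnegrE ?addr_ge0// (le_trans (ler_normB _ _))// lerD.
  lra.
- by apply: intgZ; exact: (ii_affine (- x) ltr01 (@intg_p R)).1.
Qed.

End EulerLagrange.

(** * Weak limits in the energy space *)
Section WeakLimits.
Context {R : realType}.
Notation mu := (leb R).
Notation mu2 := (leb R \x leb R)%E.
Implicit Types (f g h eta : R -> R) (e : nat -> R -> R).

(** Bounded almost-everywhere convergence: the mode in which dominated convergence applies to
    every integrable density. *)
Definition bcvg_ae e eta := exists B, [/\ forall k, measurable_fun setT (e k), forall k x, `|e k x| <= B,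
  Bd eta & {ae mu, forall x, e k x @[k --> \oo] --> eta x}].

Lemma bcvg_ae_Bd e eta k : bcvg_ae e eta -> Bd (e k).
Proof. by move=> [B [m b _ _]]; split => //; exists B => x. Qed.

Lemma bcvg_ae_pair e eta h : bcvg_ae e eta -> intg mu h ->
  ii mu (fun x => e k x * h x) @[k --> \oo] --> ii mu (fun x => eta x * h x).
Proof.
move=> [B [me bB [mt _] c]] ih; have mh := intg_meas ih.
have [|||||_ H] := @ii_dct _ _ _ mu (fun k x => e k x * h x) (fun x => eta x * h x) (fun x => B * `|h x|).
- move=> k; exact: measurable_funM (me k) mh.
- exact: measurable_funM mt mh.
- by apply: ae_imp c => x hx; apply: cvgM; [exact: hx|exact: cvg_cst].
- by apply: intgZ; exact: intg_norm.
- by move=> k x; rewrite normrM ler_wpM2r.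
- exact: H.
Qed.

Lemma bcvg_ae_coef e eta n : bcvg_ae e eta ->
  al (e k) n @[k --> \oo] --> al eta n /\ be (e k) n @[k --> \oo] --> be eta n.
Proof.
move=> h; split.
  have E f : al f n = ii mu (fun x => f x * (Cn n x * p x)) by apply: eq_ii => x; rewrite mulrA.
  rewrite E; under eq_fun do rewrite E.
  by apply: bcvg_ae_pair => //; apply: Bd_intg; exact: Bd_Cn.
have E f : be f n = ii mu (fun x => f x * (Sn n x * p x)) by apply: eq_ii => x; rewrite mulrA.
rewrite E; under eq_fun do rewrite E.
by apply: bcvg_ae_pair => //; apply: Bd_intg; exact: Bd_Sn.
Qed.

Lemma zsum_trunc M N (F : int -> R) : (M <= N)%N ->
  zsum N (fun n => if (absz n <= M)%N then F n else 0) = zsum M F.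
Proof.
move=> /subnK <-; elim: (N - M)%N => [|k ih]; first by apply: eq_zsum_le => n ->.
by rewrite addSn zsumS ih abszN !absz_nat ltnNge leq_addl /= !addr0.
Qed.

Lemma cvg_zsum (F : nat -> int -> R) (l : int -> R) M : (forall n, F k n @[k --> \oo] --> l n) ->
  zsum M (F k) @[k --> \oo] --> zsum M l.
Proof.
move=> h; elim: M => [|M ih].
  have E G : zsum 0 G = G 0 :> R by rewrite /zsum big_nil addr0.
  by rewrite E (_ : (fun k => zsum 0 (F k)) = (F^~ 0)); [exact: h|apply/funext => k].
rewrite zsumS (_ : (fun k => zsum M.+1 (F k)) = (fun k => zsum M (F k) + (F k M.+1%:Z + F k (- M.+1%:Z)))); last by apply/funext => k; rewrite zsumS.
by apply: cvgD; [exact: ih|apply: cvgD; exact: h].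
Qed.

Lemma energy_form_Sm M f h : Bd f -> Bd h -> fin_energy h -> energy_form (Sm M f) h = 4 * pi ^+ 2 * zsum M (eform f h).
Proof.
move=> bf bh gh.
apply: (lim_ev (k := M) (cvg_eform (Sm_Bd M f) bh (fin_energy_tpoly M _ _) gh)) => N MN.
congr (_ * _); rewrite -(zsum_trunc _ MN); apply: eq_zsum => n.
rewrite /eform (al_tpoly _ _ _ (al_even f)) (be_tpoly _ _ _ (be_odd (Bd_L2p bf))).
by case: ifP => _; rewrite ?mul0r ?addr0 ?mulr0.
Qed.

Lemma sqr_lt (a b : R) : 0 <= a -> 0 < b -> a ^+ 2 < b ^+ 2 -> a < b.
Proof. by move=> a0 b0; rewrite ltr_sqr ?nnegrE// ltW. Qed.

(** Split off a partial sum of [f]: its pairing depends on finitely many coefficients, and the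
    rest is small in energy. *)
Lemma energy_form_weak f e eta C : Bd f -> fin_energy f -> bcvg_ae e eta -> (forall k, fin_energy (e k)) -> fin_energy eta -> (forall k, genergy (e k) <= C) ->
  energy_form f (e k) @[k --> \oo] --> energy_form f eta.
Proof.
move=> bf gf he ge gt hC; have bt : Bd eta by case: he => B [].
have bk k := bcvg_ae_Bd k he.
pose D := C + genergy eta + 1.
have C0 : 0 <= C := le_trans (sqn_ge0 mu2 _) (hC 0%N).
have G0 : 0 <= genergy eta := sqn_ge0 mu2 (dquot eta).
have D0 : 0 < D by rewrite ltr_wpDl// addr_ge0.
have De : genergy eta <= D by rewrite /D addrAC lerDr addr_ge0.
have Dk k : genergy (e k) <= D by apply: le_trans (hC k) _; rewrite /D -addrA lerDl addr_ge0.
apply/cvgrPdist_lt => d d0.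
have dd : 0 < (d / 3) ^+ 2 / D by rewrite divr_gt0// exprn_gt0// divr_gt0.
have /cvgrPdist_lt/(_ _ dd)[M _ /(_ M (leqnn M))] := cvg_genergy_Sm bf gf.
rewrite sub0r normrN => hM.
have {hM} hM : genergy (fun x => f x - Sm M f x) < (d / 3) ^+ 2 / D by apply: le_lt_trans hM; exact: ler_norm.
have gS : fin_energy (fun x => f x - Sm M f x) by apply: fin_energyB => //; exact: fin_energy_tpoly.
have tail h : fin_energy h -> genergy h <= D -> `|energy_form f h - energy_form (Sm M f) h| < d / 3.
  move=> gh hD; have -> : energy_form f h - energy_form (Sm M f) h = energy_form (fun x => f x - Sm M f x) h.
    rewrite /energy_form -ipBl//; [|exact: fin_energy_tpoly].
    by apply: eq_ip => z //; rewrite dquotB.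
  apply: sqr_lt; [by []|by rewrite divr_gt0|].
  rewrite real_normK ?num_real//; apply: le_lt_trans (ip_CS gS gh) _.
  have : sqn mu2 (dquot h) <= D := hD.
  have : sqn mu2 (dquot (fun x => f x - Sm M f x)) * D < (d / 3) ^+ 2 by rewrite -ltr_pdivlMr.
  have := sqn_ge0 mu2 (dquot (fun x => f x - Sm M f x)).
  by move: (sqn _ _) (sqn _ _) => a b; nra.
have main : energy_form (Sm M f) (e k) @[k --> \oo] --> energy_form (Sm M f) eta.
  rewrite (energy_form_Sm M bf bt gt).
  suff -> : (fun k => energy_form (Sm M f) (e k)) = (fun k => 4 * pi ^+ 2 * zsum M (eform f (e k))).
    apply: cvgM; first exact: cvg_cst.
    apply: cvg_zsum => n; have [h1 h2] := bcvg_ae_coef n he.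
    by apply: cvgM; [exact: cvg_cst|apply: cvgD; (apply: cvgM; [exact: cvg_cst|])].
  by apply/funext => k; rewrite energy_form_Sm.
have d3 : 0 < d / 3 by rewrite divr_gt0.
have /cvgrPdist_lt/(_ _ d3)[N _ hN] := main.
exists N => // k /= Nk; have /= h3 := hN k Nk.
have h1 := tail _ gt De; have h2 := tail _ (ge k) (Dk k).
move: h1 h2 h3; move: (energy_form _ _) (energy_form _ _) (energy_form _ _) (energy_form _ _) => a1 a2 a3 a4; rewrite !ltr_norml => /andP[? ?] /andP[? ?] /andP[? ?]; apply/andP; split; lra.
Qed.

Lemma sg_coef N f n : L2p f -> exists2 t, 0 <= t <= 1 & al (sg N.+1 f) n = t * al f n /\ be (sg N.+1 f) n = t * be f n.
Proof.
move=> Lf; pose t : R := N.+1%:R^-1 * \sum_(0 <= M < N.+1) ((absz n <= M)%N)%:R.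
have LS M : L2p (Sm M f) := Bd_L2p (Sm_Bd M f).
have LSS : L2p (fun x => \sum_(0 <= M < N.+1) Sm M f x).
  by apply: Bd_L2p; apply: Bd_sum => M; exact: Sm_Bd.
have E h (l : R) : L2p h -> (forall M, ipp (Sm M f) h = ((absz n <= M)%N)%:R * l) -> ipp (sg N.+1 f) h = t * l.
  move=> Lh hl; rewrite /sg ippZl// ipp_suml// /t -mulrA mulr_suml; congr (_ * _).
  by apply: eq_bigr => M _; rewrite hl.
exists t.
  rewrite /t mulr_ge0 ?invr_ge0 ?sumr_ge0//= mulrC ler_pdivrMr ?ltr0Sn// mul1r.
  apply: (@le_trans _ _ (\sum_(0 <= M < N.+1) 1)); last by rewrite sumr_const_nat subn0.
  by apply: ler_sum => M _; case: leqP.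
split; apply: E; [exact: L2p_Cn| |exact: L2p_Sn|]; move=> M.
  by rewrite -/(al _ n) (al_tpoly _ _ _ (al_even f)); case: ifP => _; rewrite ?mul1r ?mul0r.
by rewrite -/(be _ n) (be_tpoly _ _ _ (be_odd Lf)); case: ifP => _; rewrite ?mul1r ?mul0r.
Qed.

Lemma fin_energy_sg N f : Bd f -> fin_energy f -> fin_energy (sg N.+1 f) /\ genergy (sg N.+1 f) <= genergy f.
Proof.
move=> bf gf; have P0 := @pp4_gt0 R.
have [M|h1 h2] := @fin_energy_of_series _ (sg N.+1 f) (genergy f / (4 * pi ^+ 2)) (sg_Bd _ _).
  rewrite ler_pdivlMr// mulrC; apply: le_trans (series_le M bf gf); rewrite ler_pM2l//.
  apply: zsum_le => n; rewrite /ecoef ler_wpM2l ?absr_ge0// /coef2.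
  have [t /andP[t0 t1] [-> ->]] := sg_coef N n (Bd_L2p bf).
  have tt : t ^+ 2 <= 1 by rewrite expr_le1.
  by rewrite !exprMn lerD// ler_piMl ?sqr_ge0.
by split => //; apply: le_trans h2 _; rewrite mulrCA mulfV ?mulr1// gt_eqF.
Qed.

Lemma sg_bcvg_ae f : Bd f -> fin_energy f -> exists s : nat -> nat, bcvg_ae (fun k => sg (s k).+1 f) f.
Proof.
move=> bf gf; have Lf := Bd_L2p bf; have [mf [Mf hMf]] := bf.
have [s _ hs] := sqnp_ae_subseq (fun N => Bd_L2p (sg_Bd N.+1 f)) Lf (sg_cvg bf gf).
exists s, Mf; split => //; first by move=> k; case: (sg_Bd (s k).+1 f).
by move=> k x; apply: sg_bound.
Qed.

Lemma chi_bcvg_ae d : smooth d -> Bd d -> bcvg_ae (fun k x => chi k x * d x) d.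
Proof.
move=> sd [md [M hM]]; have [B B0 hB] := @chi_bounds R.
have M0 : 0 <= M := le_trans (normr_ge0 _) (hM 0).
exists (B * M); split.
- by move=> k; case: (test_Bd (chi_test k sd)).
- by move=> k x; case: (hB k) => c' [c'' [_ _ h _ _]]; rewrite normrM ler_pM.
- by split => //; exists M.
- apply: aeW => x; rewrite -[X in _ --> X]mul1r; apply: cvgM; [exact: cvg_chi|exact: cvg_cst].
Qed.

End WeakLimits.

(** * The weak Euler-Lagrange equation *)
Section HarmonicMaps.
Context {R : realType} (m : nat).
Notation mu := (leb R).
Notation mu2 := (leb R \x leb R)%E.
Implicit Types (f g h eta : R -> R) (w : 'I_m -> R -> R).

(** Integrating out either variable of the energy density produces a single density on the line. *)
Lemma marginals (A : R * R -> R) : intg mu2 A -> exists2 rho, intg mu rho &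
  forall h, Bd h -> ii mu2 (fun z => A z * (h z.1 + h z.2)) = ii mu (fun x => h x * rho x).
Proof.
move=> iA; have mA := intg_meas iA.
have [i1 _] := fubini12 iA; have [i2 _] := fubini21 iA.
exists (fun x => ii mu (fun y => A (x, y)) + ii mu (fun y => A (y, x))).
  exact: intgD i1 i2.
move=> h [mh [M hM]].
have I1 : intg mu2 (fun z => A z * h z.1).
  apply: (@intg_le _ _ _ mu2 _ (fun z => M * `|A z|)); last by apply: intgZ; exact: intg_norm.
    exact: measurable_funM mA (meas_fst mh).
  by move=> z; rewrite normrM mulrC ler_wpM2r.
have I2 : intg mu2 (fun z => A z * h z.2).
  apply: (@intg_le _ _ _ mu2 _ (fun z => M * `|A z|)); last by apply: intgZ; exact: intg_norm.
    exact: measurable_funM mA (meas_snd mh).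
  by move=> z; rewrite normrM mulrC ler_wpM2r.
have [j1 e1] := fubini12 I1; have [j2 e2] := fubini21 I2.
have E1 : ii mu (fun x => ii mu (fun y => A (x, y) * h x)) = ii mu (fun x => h x * ii mu (fun y => A (x, y))).
  apply: ae_eq_ii; [exact: intg_meas j1|exact: measurable_funM mh (intg_meas i1)|].
  by apply: ae_imp (ae_integrable1 iA) => x hx; rewrite mulrC iiZr.
have E2 : ii mu (fun x => ii mu (fun y => A (y, x) * h x)) = ii mu (fun x => h x * ii mu (fun y => A (y, x))).
  apply: ae_eq_ii; [exact: intg_meas j2|exact: measurable_funM mh (intg_meas i2)|].
  by apply: ae_imp (ae_integrable2 iA) => x hx; rewrite mulrC iiZr.
have K f : intg mu f -> intg mu (fun x => h x * f x).
  move=> jf; apply: (@intg_le _ _ _ mu _ (fun z => M * `|f z|)); last by apply: intgZ; exact: intg_norm.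
    exact: measurable_funM mh (intg_meas jf).
  by move=> z; rewrite normrM ler_wpM2r.
transitivity (ii mu2 (fun z => A z * h z.1) + ii mu2 (fun z => A z * h z.2)).
  by rewrite -(iiD I1 I2); apply: eq_ii => z; rewrite mulrDr.
rewrite e1 e2 E1 E2 -(iiD (K _ i1) (K _ i2)); apply: eq_ii => x; by rewrite mulrDr.
Qed.

(** The weak Euler-Lagrange equation for the component [i]. *)
Definition EL w i eta :=
  energy_form (w i) eta = 2^-1 * ii mu2 (fun z => edensity w z * (w i z.1 * eta z.1 + w i z.2 * eta z.2)).

Lemma EL_limit w i (e : nat -> R -> R) eta C : unit_map w -> bcvg_ae e eta -> (forall k, fin_energy (e k)) -> fin_energy eta ->
  (forall k, genergy (e k) <= C) -> (forall k, EL w i (e k)) -> EL w i eta.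
Proof.
move=> uw he ge gt hC hk; have [mw _ gw] := uw; have bw := unit_Bd i uw.
have [rho irho hrho] := marginals (edensity_intg gw).
have bt : Bd eta by case: he => B [].
have bk k := bcvg_ae_Bd k he.
have h1 := energy_form_weak bw (gw i) he ge gt hC.
have iw : intg mu (fun x => w i x * rho x).
  apply: (@intg_le _ _ _ mu _ (fun z => 1 * `|rho z|)); last by apply: intgZ; exact: intg_norm.
    exact: measurable_funM (mw i) (intg_meas irho).
  by move=> z; rewrite normrM ler_wpM2r//; exact: unit_le1.
have E h : Bd h -> ii mu2 (fun z => edensity w z * (w i z.1 * h z.1 + w i z.2 * h z.2)) = ii mu (fun x => h x * (w i x * rho x)).
  move=> bh; rewrite (hrho (fun x => w i x * h x) (BdM bw bh)); apply: eq_ii => x; by rewrite mulrCA mulrA.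
have h2 := bcvg_ae_pair he iw.
rewrite /EL (E _ bt); apply: (cvg_uniq h1).
suff -> : (fun k => energy_form (w i) (e k)) = (fun k => 2^-1 * ii mu (fun x => e k x * (w i x * rho x))).
  by apply: cvgM; [exact: cvg_cst|exact: h2].
by apply/funext => k; rewrite (hk k) (E _ (bk k)).
Qed.

(** Cutoffs extend the equation to smooth functions, since their energy is bounded in [k]; Fejer
    means extend it to all [eta]. *)
Lemma EL_all w : unit_map w -> (forall i eta, test_function eta -> EL w i eta) ->
  forall i eta, Bd eta -> fin_energy eta -> EL w i eta.
Proof.
move=> uw ht i.
(* First the smooth bounded functions of finite energy. *)
have step d : smooth d -> Bd d -> fin_energy d -> EL w i d.
  move=> sd bd gd; have [C hC] := @genergy_chi_le R; have [B B0 hB] := @chi_bounds R.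
  have [md [M hM]] := bd.
  apply: (@EL_limit w i (fun k x => chi k x * d x) d (2 * B ^+ 2 * genergy d + 2 * M ^+ 2 * C)) => //.
  - exact: chi_bcvg_ae.
  - by move=> k; apply: test_fin_energy; exact: chi_test.
  - move=> k; have [c' [c'' [d1 _ h _ _]]] := hB k.
    have cosmean : measurable_fun setT (@chi R k) by apply: cont_meas; exact: dv_cont d1.
    have [_ h2] := fin_energyM cosmean md h hM (hC k).1 gd.
    have M2 : 0 <= 2 * M ^+ 2 := mulr_ge0 (ler0n R 2) (sqr_ge0 M).
    by apply: le_trans h2 _; rewrite lerD2l; apply: ler_wpM2l M2 _ _ _; case: (hC k).
  - by move=> k; apply: ht; exact: chi_test.
move=> eta bt gt; have [s hs] := sg_bcvg_ae bt gt.
apply: (EL_limit (C := genergy eta) uw hs) => //.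
- by move=> k; case: (fin_energy_sg (s k) bt gt).
- by move=> k; case: (fin_energy_sg (s k) bt gt).
- by move=> k; apply: step; [exact: sg_smooth|exact: sg_Bd|case: (fin_energy_sg (s k) bt gt)].
Qed.

(** The right side of the equation tested with [w j * h] is symmetric in [i] and [j]. *)
Lemma EL_comm w : unit_map w -> (forall i eta, Bd eta -> fin_energy eta -> EL w i eta) ->
  forall i j h, Bd h -> fin_energy h -> energy_form (w i) (fun x => w j x * h x) = energy_form (w j) (fun x => w i x * h x).
Proof.
move=> uw hE i j h bh gh; have [_ _ gw] := uw.
have bw k := unit_Bd k uw.
rewrite (hE i (fun x => w j x * h x) (BdM (bw j) bh) (Bd_fin_energyM (bw j) bh (gw j) gh)).
rewrite (hE j (fun x => w i x * h x) (BdM (bw i) bh) (Bd_fin_energyM (bw i) bh (gw i) gh)).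
congr (_ * _); apply: eq_ii => z; congr (_ * _); by rewrite [w i z.1 * _]mulrCA [w i z.2 * _]mulrCA.
Qed.

Lemma EL_of_expansion w i eta : unit_map w ->
  (forall et : 'I_m -> R -> R, (forall j, test_function (et j)) ->
     2 * \sum_j energy_form (w j) (et j) = ii mu2 (fun z => edensity w z * (dotf w et z.1 + dotf w et z.2))) ->
  test_function eta -> EL w i eta.
Proof.
move=> uw H te; pose et (j : 'I_m) : R -> R := if j == i then eta else (fun=> 0).
have t0 : test_function (fun _ : R => 0 : R).
  by apply: (@test_of_supp _ _ 0) => //; exact: smooth_cst.
have tt j : test_function (et j) by rewrite /et; case: ifP.
have := H et tt.
rewrite (bigD1 i)//= big1 ?addr0 => [|j ji]; last first.
  rewrite /et (negbTE ji) /energy_form; transitivity (ip mu2 (dquot (w j)) (fun=> 0)).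
    by apply: eq_ip => z //; rewrite /dquot subrr mul0r.
  by rewrite /ip; transitivity (ii mu2 (fun=> 0 : R)); [apply: eq_ii => z; rewrite mulr0|rewrite ii0].
rewrite {1}/et eqxx => e; apply: (@mulfI _ 2); first by rewrite pnatr_eq0.
rewrite e mulrA mulfV ?pnatr_eq0// mul1r; apply: eq_ii => z; congr (_ * (_ + _)).
all: rewrite /dotf (bigD1 i)//= big1 ?addr0 => [|j ji]; rewrite /et ?eqxx// (negbTE ji) ?mulr0//.
Qed.

End HarmonicMaps.

(** * From half-harmonic maps to the weak equation *)
Section Reduction.
Context {R : realType} (m : nat).
Notation mu := (leb R).
Notation mu2 := (leb R \x leb R)%E.
Implicit Types (u : R -> 'rV[R]_m) (w : 'I_m -> R -> R).

(** The exceptional null set is sent to a fixed unit vector, so that the constraint holds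
    everywhere. *)
Lemma unit_representative u : (0 < m)%N -> Hhalf_sphere u ->
  exists w, unit_map w /\ {ae mu, forall x, forall i, u x 0 i = w i x}.
Proof.
move=> m0 [hu su].
have mu_ i : measurable_fun setT (coord u i) by have [g hg] := hu i; exact: quarter_laplacian_meas hg.
pose i0 := Ordinal m0.
pose S x := \sum_(i < m) coord u i x * coord u i x.
have mS : measurable_fun setT S by apply: measurable_sum => i; exact: measurable_funM.
pose b x : R := (S x == 1)%:R.
have mb : measurable_fun setT b.
  have -> : b = \1_(S @^-1` [set 1]) by apply/funext => x; rewrite /b indicE; congr (nat_of_bool _)%:R; apply/eqP/idP => [e|]; [exact: mem_set|rewrite inE].
  by apply: measurable_indic; rewrite -[_ @^-1` _]setTI; exact: mS.
pose w i x := b x * coord u i x + (1 - b x) * (i == i0)%:R.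
have mw i : measurable_fun setT (w i).
  apply: measurable_funD; first exact: measurable_funM.
  by apply: measurable_funM => //; apply: measurable_funB.
have ae : {ae mu, forall x, forall i, coord u i x = w i x}.
  apply: ae_imp su => x hx i.
  have Sx : S x = 1.
    have S0 : 0 <= S x by apply: sumr_ge0 => j _; rewrite -expr2 sqr_ge0.
    rewrite -[LHS]sqr_sqrtr// (_ : Num.sqrt (S x) = 1) ?expr1n// -[RHS]hx /enorm; congr Num.sqrt.
  by rewrite /w /b Sx eqxx mul1r subrr mul0r addr0.
have w1 x : \sum_i w i x ^+ 2 = 1.
  rewrite /w /b; case: eqP => [e|_].
    rewrite -[RHS]e; apply: eq_bigr => i _; by rewrite mul1r subrr mul0r addr0 expr2.
  rewrite (bigD1 i0)//= big1 ?addr0 => [|i /negbTE ->]; rewrite ?eqxx mul0r add0r subr0 ?mulr1 ?expr1n//.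
  by rewrite mulr0 expr0n.
have bw i : Bd (w i).
  split=> //; exists 1 => x; rewrite -(@ler_pXn2r _ 2) ?nnegrE// real_normK ?num_real// expr1n -(w1 x).
  by rewrite (bigD1 i)//= lerDl sumr_ge0// => j _; exact: sqr_ge0.
exists w; split; last exact: ae.
split => // i; have [g hg] := hu i.
have aei : {ae mu, forall x, coord u i x = w i x} by apply: ae_imp ae => x; exact.
by case: (quarter_laplacian_energy (bw i) (quarter_laplacian_ae (mw i) aei hg)).
Qed.

Lemma energy_variation u w (phi : R -> 'rV[R]_m) t : (forall i, measurable_fun setT (coord u i)) ->
  (forall i, measurable_fun setT (coord phi i)) ->
  {ae mu, forall x, forall i, u x 0 i = w i x} ->
  (forall i, Bd (proj_var w (coord phi) t i) /\ fin_energy (proj_var w (coord phi) t i)) ->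
  energy (fun x => sphere_proj (u x + t *: phi x)) = (2 * pi)^-1 * \sum_i genergy (proj_var w (coord phi) t i).
Proof.
move=> mu_ mphi uw hv.
have E i : quarter_laplacian (coord (fun x => sphere_proj (u x + t *: phi x)) i) = quarter_laplacian (proj_var w (coord phi) t i).
  apply: quarter_laplacian_ae_eq.
  - have -> : coord (fun x => sphere_proj (u x + t *: phi x)) i =
        (fun x => (Num.sqrt (\sum_j (coord u j x + t * coord phi j x) * (coord u j x + t * coord phi j x)))^-1 * (coord u i x + t * coord phi i x)).
      apply/funext => x; rewrite /coord /sphere_proj /enorm !mxE; congr ((Num.sqrt _)^-1 * _).
      by apply: eq_bigr => j _; rewrite !mxE expr2.
    have mY j : measurable_fun setT (fun x => coord u j x + t * coord phi j x).
      by apply: measurable_funD => //; exact: measurable_funM.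
    apply: measurable_funM => //; apply: (measurableT_comp (@measurable_invr R)).
    apply: (measurableT_comp (f := @Num.sqrt R)); first by apply: cont_meas; exact: sqrt_continuous.
    by apply: measurable_sum => j; exact: measurable_funM.
  - by case: (hv i) => [[]].
  - apply: ae_imp uw => x hx; rewrite /coord /sphere_proj /enorm /proj_var /nsq !mxE hx; congr ((Num.sqrt _)^-1 * _).
    by apply: eq_bigr => j _; rewrite !mxE hx.
rewrite /energy; transitivity (ii mu (fun x => \sum_i quarter_laplacian (proj_var w (coord phi) t i) x ^+ 2)).
  by apply: eq_ii => x; apply: eq_bigr => i _; rewrite E.
rewrite ii_sum => [|i _]; last by case: (sqn_quarter_laplacian (hv i).1 (hv i).2) => [[]].
by rewrite mulr_sumr; apply: eq_bigr => i _; transitivity (sqn mu (quarter_laplacian (proj_var w (coord phi) t i))); [by []|rewrite (sqn_quarter_laplacian (hv i).1 (hv i).2).2 mulrC].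
Qed.

Lemma derivative_of_expansion (F : R -> R) (l t0 C : R) : 0 < t0 -> is_derive (0 : R) (1 : R) F 0 ->
  (forall t, `|t| <= t0 -> `|F t - F 0 - t * l| <= C * t ^+ 2) -> l = 0.
Proof.
move=> t00 dF hF.
have C0 : 0 <= C.
  have tt : `|t0| <= t0 by rewrite (ger0_norm (ltW t00)).
  have := le_trans (normr_ge0 _) (hF t0 tt).
  by rewrite pmulr_lge0// exprn_gt0.
pose s (n : nat) := t0 * n.+1%:R^-1.
have [dr dv0] := dF.
have c1 : (fun h => h^-1 *: ((F \o shift 0) (h *: (1 : R)) - F 0)) @ 0^' --> (0 : R).
  by rewrite -[X in _ --> X]dv0 /derive; exact: dr.
have cs : s n @[n --> \oo] --> (0 : R).
  by rewrite -[X in _ --> X](mulr0 t0); apply: cvgM; [exact: cvg_cst|exact: cvg_harmonic].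
have sp n : 0 < s n by rewrite mulr_gt0 ?invr_gt0.
have cs' : s n @[n --> \oo] --> 0^'.
  move=> P hP; have [N _ hN] := cs _ hP; exists N => // n Nn; apply: (hN n Nn); rewrite gt_eqF//; exact: sp.
have c2 : (s n)^-1 * (F (s n) - F 0) @[n --> \oo] --> (0 : R).
  have := cvg_comp _ _ cs' c1.
  suff -> : ((fun h => h^-1 *: ((F \o shift 0) (h *: (1 : R)) - F 0)) \o s) = (fun n => (s n)^-1 * (F (s n) - F 0)) by [].
  by apply/funext => n /=; rewrite /GRing.scale /= mulr1 addr0.
have c3 : (s n)^-1 * (F (s n) - F 0) @[n --> \oo] --> l.
  apply/cvgrPdist_le => e e0.
  have /cvgrPdist_le/(_ e e0)[N _ hN] : C * s n @[n --> \oo] --> (0 : R).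
    by rewrite -[X in _ --> X](mulr0 C); apply: cvgM; [exact: cvg_cst|exact: cs].
  exists N => // n /= Nn; have := hN n Nn; rewrite sub0r normrN ger0_norm; last by rewrite mulr_ge0// ltW.
  apply: le_trans.
  have st : `|s n| <= t0 by rewrite (ger0_norm (ltW (sp n))) /s; apply: ler_piMr; [exact: ltW|rewrite invf_le1// ler1n].
  have -> : l - (s n)^-1 * (F (s n) - F 0) = - ((s n)^-1 * (F (s n) - F 0 - s n * l)).
    by field; rewrite gt_eqF.
  have i0 : 0 <= (s n)^-1 by rewrite invr_ge0 ltW.
  rewrite normrN normrM (ger0_norm i0) ler_pdivrMl//.
  by rewrite [s n * (C * s n)]mulrCA -expr2; exact: hF.
exact: cvg_uniq c3 c2.
Qed.

(** The expansion of the energy identifies its derivative at 0, which vanishes by hypothesis. *)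
Lemma harmonic_EL u : (0 < m)%N -> Hhalf_sphere u -> weak_half_harmonic u ->
  exists w, [/\ unit_map w, {ae mu, forall x, forall i, u x 0 i = w i x} &
    forall i j h, Bd h -> fin_energy h -> energy_form (w i) (fun x => w j x * h x) = energy_form (w j) (fun x => w i x * h x)].
Proof.
move=> m0 hu wh; have [w [uw ae]] := unit_representative m0 hu.
have mu_ i : measurable_fun setT (coord u i) by have [g hg] := hu.1 i; exact: quarter_laplacian_meas hg.
exists w; split => //; apply: EL_comm => //; apply: EL_all => // i0 eta0 te0.
apply: EL_of_expansion => // et tet.
pose phi x : 'rV[R]_m := \row_i et i x.
have cp i : coord phi i = et i by apply/funext => x; rewrite /coord mxE.
have cphi : coord phi = et by apply/funext => i; exact: cp.
have tphi : test_map phi by move=> i; rewrite cp.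
have mphi i : measurable_fun setT (coord phi i) by rewrite cp; case: (test_Bd (tet i)).
have [t0 [C [t00 C0 hE]]] := energy_expand uw (fun i => test_Bd (tet i)) (fun i => test_fin_energy (tet i)).
have P0 : 0 < 2 * pi :> R by rewrite mulr_gt0 ?pi_gt0.
have iP0 : 0 <= (2 * pi)^-1 :> R by rewrite invr_ge0 ltW.
apply/eqP; rewrite -subr_eq0; apply/eqP.
apply: (@mulfI _ (2 * pi)^-1); first by rewrite invr_eq0 gt_eqF.
rewrite mulr0; apply: (derivative_of_expansion (C := (2 * pi)^-1 * C) t00 (wh phi tphi)) => t tt.
have [hv h] := hE t tt; have := hE 0; rewrite normr0 => /(_ (ltW t00)) [hv0 _].
have -> : energy (fun x => sphere_proj (u x + 0 *: phi x)) = (2 * pi)^-1 * \sum_i genergy (w i).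
  rewrite (energy_variation mu_ mphi ae) => [|i]; last by rewrite cphi.
  rewrite cphi; congr (_ * _); apply: eq_bigr => i _; congr genergy; apply/funext => x; have [_ w1 _] := uw.
  rewrite /proj_var /nsq mul0r addr0 (_ : \sum_j _ = 1) ?sqrtr1 ?invr1 ?mul1r// -(w1 x).
  by apply: eq_bigr => j _; rewrite mul0r addr0.
rewrite (energy_variation mu_ mphi ae) => [|i]; last by rewrite cphi.
rewrite cphi -mulrBr [t * _]mulrCA -mulrBr normrM ger0_norm// -mulrA ler_wpM2l//.
Qed.

End Reduction.

(** * A smoothing bilinear form on square-summable sequences *)
Section Sequences.
Context {R : realType}.
Implicit Types (F G x y : int -> R) (M N L : nat) (n k : int).

(** Uniform bounds on symmetric partial sums replace infinite sums. *)
Definition zbound F B := forall N, zsum N F <= B.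

Lemma zsum_le_in N F G : (forall n, (absz n <= N)%N -> F n <= G n) -> zsum N F <= zsum N G.
Proof.
elim: N => [|N ih] h; first by rewrite /zsum !big_nil !addr0 h.
rewrite !zsumS; apply: lerD; first by apply: ih => n nN; apply: h; exact: leq_trans nN _.
by apply: lerD; apply: h; rewrite ?abszN.
Qed.

Lemma zbound_le F G B : (forall n, F n <= G n) -> zbound G B -> zbound F B.
Proof. by move=> h b N; apply: le_trans (b N); exact: zsum_le. Qed.

Lemma zsum_exchange M N (F : int -> int -> R) :
  zsum M (fun k => zsum N (fun n => F k n)) = zsum N (fun n => zsum M (fun k => F k n)).
Proof.
elim: M => [|M ih].
  by rewrite {1}/zsum big_nil addr0; apply: eq_zsum => n; rewrite /zsum big_nil addr0.
by rewrite zsumS ih -!zsumD; apply: eq_zsum => n; rewrite zsumS.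
Qed.

Lemma CS_step (X Y S a b : R) : 0 <= X -> 0 <= Y -> S ^+ 2 <= X * Y -> (S + a * b) ^+ 2 <= (X + a ^+ 2) * (Y + b ^+ 2).
Proof.
move=> X0 Y0 h.
have key : 2 * (S * (a * b)) <= X * b ^+ 2 + Y * a ^+ 2.
  move: X0; rewrite le_eqVlt => /orP[/eqP e|Xp].
    have S0 : S = 0 by apply/eqP; rewrite -sqrf_eq0 eq_le sqr_ge0 andbT; move: h; rewrite -e mul0r.
    by rewrite S0 -e !mul0r mulr0 add0r mulr_ge0 ?sqr_ge0.
  rewrite -subr_ge0 -(pmulr_rge0 _ Xp).
  have -> : X * (X * b ^+ 2 + Y * a ^+ 2 - 2 * (S * (a * b))) = (X * b - S * a) ^+ 2 + (X * Y - S ^+ 2) * a ^+ 2 by ring.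
  by apply: addr_ge0; [exact: sqr_ge0|apply: mulr_ge0; rewrite ?subr_ge0// sqr_ge0].
have -> : (X + a ^+ 2) * (Y + b ^+ 2) = X * Y + (X * b ^+ 2 + Y * a ^+ 2) + a ^+ 2 * b ^+ 2 by ring.
have -> : (S + a * b) ^+ 2 = S ^+ 2 + 2 * (S * (a * b)) + a ^+ 2 * b ^+ 2 by ring.
by rewrite lerD2r lerD.
Qed.

Lemma zsum_CS N F G : zsum N (fun n => F n * G n) ^+ 2 <= zsum N (fun n => F n ^+ 2) * zsum N (fun n => G n ^+ 2).
Proof.
have p0 H K : 0 <= zsum K (fun n => H n ^+ 2) :> R by apply: zsum_ge0 => n; exact: sqr_ge0.
elim: N => [|N ih].
  by rewrite /zsum !big_nil !addr0 exprMn.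
rewrite !zsumS !addrA; apply: CS_step; [by rewrite addr_ge0 ?sqr_ge0|by rewrite addr_ge0 ?sqr_ge0|].
exact: CS_step.
Qed.

Lemma zsum_shift1 N F : zsum N (fun n => F (n + 1)) = zsum N F + F N.+1%:Z - F (- N%:Z).
Proof.
elim: N => [|N ih]; first by rewrite /zsum !big_nil !addr0 add0r oppr0; ring.
rewrite !zsumS ih (_ : - N.+1%:Z + 1 = - N%:Z); last by rewrite -addn1 PoszD opprD addrNK.
by rewrite (_ : N.+1%:Z + 1 = N.+2%:Z); [ring|rewrite -[N.+2]addn1 PoszD].
Qed.

Lemma zsum_shiftN1 N F : zsum N (fun n => F (n - 1)) = zsum N F + F (- N.+1%:Z) - F N%:Z.
Proof.
have := zsum_shift1 N (fun n => F (n - 1)).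
have -> : (fun n => F (n + 1 - 1)) = F by apply/funext => n; rewrite addrK.
move=> ->; rewrite (_ : N.+1%:Z - 1 = N%:Z); last by rewrite -addn1 PoszD addrK.
by rewrite (_ : - N%:Z - 1 = - N.+1%:Z); [ring|rewrite -[N.+1]addn1 PoszD opprD].
Qed.

Lemma zsum_shift_le N F k : (forall n, 0 <= F n) -> zsum N (fun n => F (n + k)) <= zsum (N + absz k) F.
Proof.
have pos (j : nat) : forall G, (forall n, 0 <= G n) -> zsum N (fun n => G (n + j%:Z)) <= zsum (N + j) G.
  elim: j => [|j ih] G G0; first by rewrite addn0 (eq_zsum _ (G := G))// => n; rewrite addr0.
  rewrite (eq_zsum _ (G := fun n => (fun l => G (l + 1)) (n + j%:Z))); last first.
    by move=> n /=; rewrite -addrA -PoszD addn1.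
  apply: le_trans (ih (fun l => G (l + 1)) _) _ => //.
  rewrite zsum_shift1 addnS zsumS -addrA lerD2l lerD2l.
  by apply: (@le_trans _ _ 0) => //; rewrite oppr_le0.
have neg (j : nat) : forall G, (forall n, 0 <= G n) -> zsum N (fun n => G (n - j%:Z)) <= zsum (N + j) G.
  elim: j => [|j ih] G G0; first by rewrite addn0 (eq_zsum _ (G := G))// => n; rewrite subr0.
  rewrite (eq_zsum _ (G := fun n => (fun l => G (l - 1)) (n - j%:Z))); last first.
    by move=> n /=; rewrite -addrA -opprD -PoszD addn1.
  apply: le_trans (ih (fun l => G (l - 1)) _) _ => //.
  rewrite zsum_shiftN1 addnS zsumS -addrA lerD2l [leRHS]addrC lerD2l.
  by apply: (@le_trans _ _ 0) => //; rewrite oppr_le0.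
by case: k => j F0; [exact: pos|exact: neg].
Qed.

Lemma zsum_refl_le N F k : (forall n, 0 <= F n) -> zsum N (fun n => F (k - n)) <= zsum (N + absz k) F.
Proof.
move=> F0; rewrite -zsumN (eq_zsum _ (G := fun n => F (n + k))); last by move=> n; rewrite opprK addrC.
exact: zsum_shift_le.
Qed.

Lemma zsum_one N : zsum N (fun=> 1) = 2 * N%:R + 1 :> R.
Proof.
elim: N => [|N ih]; first by rewrite /zsum big_nil addr0 mulr0 add0r.
by rewrite zsumS ih -[N.+1%:R]natr1; ring.
Qed.

Lemma zsum_low M N F : (forall n, 0 <= F n) -> zsum N (fun n => if (absz n <= M)%N then F n else 0) <= zsum M F.
Proof.
move=> F0; case: (leqP M N) => [MN|/ltnW NM]; first by rewrite zsum_trunc.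
apply: (@le_trans _ _ (zsum N F)); last exact: zsum_mono.
by apply: zsum_le => n; case: ifP.
Qed.

Lemma zsum_diag (F : int -> int -> R) B : (forall k n, 0 <= F k n) ->
  (forall N L, zsum N (fun k => zsum L (F k)) <= B) -> forall N, zbound (fun z => zsum N (fun k => F k (z - k))) B.
Proof.
move=> F0 h N L; rewrite zsum_exchange; apply: le_trans (h N (L + N)%N).
apply: zsum_le_in => k kN; apply: le_trans (zsum_shift_le L (- k) (F0 k)) _.
by rewrite abszN; apply: zsum_mono => //; rewrite leq_add2l.
Qed.

(** Cauchy-Schwarz on each line [k + n = z], then summation over [z]. *)
Lemma zbound_diag_CS (F G : int -> int -> R) B Y N : (forall z, zsum N (fun k => G k (z - k) ^+ 2) <= Y) ->
  (forall M L, zsum M (fun k => zsum L (fun n => F k n ^+ 2)) <= B) -> 0 <= Y ->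
  zbound (fun z => zsum N (fun k => F k (z - k) * G k (z - k)) ^+ 2) (B * Y).
Proof.
move=> hG hF Y0 L; apply: (@le_trans _ _ (zsum L (fun z => zsum N (fun k => F k (z - k) ^+ 2) * Y))).
  apply: zsum_le => z; apply: le_trans (zsum_CS _ _ _) _; rewrite ler_wpM2l//.
  by apply: zsum_ge0 => k; exact: sqr_ge0.
rewrite (eq_zsum _ (G := fun z => Y * zsum N (fun k => F k (z - k) ^+ 2))); last by move=> z; rewrite mulrC.
rewrite zsumZ mulrC ler_wpM2r//; apply: (zsum_diag (F := fun k n => F k n ^+ 2)) => // k n; exact: sqr_ge0.
Qed.

Definition abs1 n : R := (maxn 1 (absz n))%:R.
Definition invsqrt n : R := (Num.sqrt (abs1 n))^-1.
Definition skernel k n : R := Num.min (invsqrt k) (invsqrt n).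
(** The kernel is [1 / sqrt (max (1, |k|, |n|))], cut off symmetrically in [k]. *)
Definition sconv N x y (z : int) : R := zsum N (fun k => skernel k (z - k) * (x k * y (z - k))).

Lemma abs1_gt0 n : 0 < abs1 n. Proof. by rewrite ltr0n leq_max. Qed.
Lemma invsqrt_gt0 n : 0 < invsqrt n. Proof. by rewrite invr_gt0 sqrtr_gt0 abs1_gt0. Qed.
Lemma invsqrt_sqr n : invsqrt n ^+ 2 = (abs1 n)^-1. Proof. by rewrite exprVn sqr_sqrtr// ltW// abs1_gt0. Qed.
Lemma skernel_ge0 k n : 0 <= skernel k n. Proof. by rewrite le_min !ltW ?invsqrt_gt0. Qed.
Lemma skernel_lel k n : skernel k n <= invsqrt k. Proof. by rewrite ge_min lexx. Qed.
Lemma skernel_ler k n : skernel k n <= invsqrt n. Proof. by rewrite ge_min lexx orbT. Qed.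
Lemma skernelC k n : skernel k n = skernel n k. Proof. exact: minC. Qed.

Lemma invsqrt_anti k n : (absz k <= absz n)%N -> invsqrt n <= invsqrt k.
Proof.
move=> kn; rewrite lef_pV2 ?posrE ?sqrtr_gt0 ?abs1_gt0// ler_sqrt ?(ltW (abs1_gt0 _))//.
by rewrite ler_nat geq_max leq_maxl /= leq_max kn orbT.
Qed.

Lemma skernel_max k n : (absz k <= absz n)%N -> skernel k n = invsqrt n.
Proof. by move=> kn; apply/min_idPr; exact: invsqrt_anti. Qed.

Lemma count_le L k : zsum L (fun n => ((absz n <= absz k)%N)%:R) <= 3 * abs1 k.
Proof.
apply: (@le_trans _ _ (zsum L (fun n => if (absz n <= absz k)%N then 1 else 0))); first by apply: zsum_le => n; case: ifP.
apply: le_trans (@zsum_low (absz k) L (fun=> 1) _) _ => //.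
rewrite zsum_one; have : 1 <= abs1 k by rewrite ler1n leq_max.
have : (absz k)%:R <= abs1 k by rewrite ler_nat leq_maxr.
lra.
Qed.

Lemma cut_bound X x N L : (forall n, 0 <= x n) -> zbound (fun n => x n ^+ 2) X ->
  zsum N (fun k => zsum L (fun n => (((absz n <= absz k)%N)%:R * (invsqrt k * x k)) ^+ 2)) <= 3 * X.
Proof.
move=> x0 hX; apply: (@le_trans _ _ (zsum N (fun k => 3 * x k ^+ 2))); last by rewrite zsumZ ler_wpM2l.
apply: zsum_le => k.
rewrite (eq_zsum _ (G := fun n => (invsqrt k ^+ 2 * x k ^+ 2) * ((absz n <= absz k)%N)%:R)); last first.
  by move=> n; case: (_ <= _)%N; rewrite ?mul1r ?mul0r ?mulr1 ?mulr0 ?exprMn// expr0n.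
rewrite zsumZ invsqrt_sqr; apply: (@le_trans _ _ ((abs1 k)^-1 * x k ^+ 2 * (3 * abs1 k))).
  by rewrite ler_wpM2l ?count_le// mulr_ge0 ?sqr_ge0// invr_ge0 ltW// abs1_gt0.
by apply: le_of_eq; field; rewrite gt_eqF// abs1_gt0.
Qed.

Lemma zbound_ge0 F B : (forall n, 0 <= F n) -> zbound F B -> 0 <= B.
Proof. by move=> F0 /(_ 0%N); apply: le_trans; exact: zsum_ge0. Qed.

Lemma sconv_ge0 N x y z : (forall n, 0 <= x n) -> (forall n, 0 <= y n) -> 0 <= sconv N x y z.
Proof. by move=> x0 y0; apply: zsum_ge0 => k; rewrite !mulr_ge0 ?skernel_ge0. Qed.

(** Where [|n| <= |k|], the factor [1/sqrt|k|] compensates the number of such [n], at most [3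
    max (1, |k|)]; the other half is symmetric. *)
Lemma sconv_bound N x y X Y : (forall n, 0 <= x n) -> (forall n, 0 <= y n) -> zbound (fun n => x n ^+ 2) X ->
  zbound (fun n => y n ^+ 2) Y -> zbound (fun z => sconv N x y z ^+ 2) (12 * (X * Y)).
Proof.
move=> x0 y0 hX hY L.
have s0 F n : 0 <= (F n : R) ^+ 2 := sqr_ge0 (F n).
have Y0 := zbound_ge0 (s0 y) hY; have X0 := zbound_ge0 (s0 x) hX.
pose F1 k n := ((absz n <= absz k)%N)%:R * (invsqrt k * x k).
pose F2 k n := ((absz k <= absz n)%N)%:R * (invsqrt n * y n).
have B1 : zbound (fun z => zsum N (fun k => F1 k (z - k) * y (z - k)) ^+ 2) (3 * X * Y).
  apply: (zbound_diag_CS (F := F1) (G := fun _ n => y n)) => // [z|M K]; last exact: cut_bound.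
  by apply: le_trans (hY (N + absz z)%N); exact: (zsum_refl_le N z (s0 y)).
have B2 : zbound (fun z => zsum N (fun k => F2 k (z - k) * x k) ^+ 2) (3 * Y * X).
  apply: (zbound_diag_CS (F := F2) (G := fun k _ => x k)) => // M K.
  by rewrite zsum_exchange; exact: cut_bound.
apply: (@le_trans _ _ (zsum L (fun z => 2 * (zsum N (fun k => F1 k (z - k) * y (z - k)) ^+ 2 + zsum N (fun k => F2 k (z - k) * x k) ^+ 2)))).
  apply: zsum_le => z; set S1 := zsum _ _; set S2 := zsum _ _.
  have QS : sconv N x y z <= S1 + S2.
    rewrite -zsumD; apply: zsum_le => k; rewrite /F1 /F2.
    have b0 (b : bool) (c : R) : 0 <= c -> 0 <= b%:R * c by case: b => c0; rewrite ?mul1r ?mul0r.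
    have h1 : 0 <= invsqrt k * x k by rewrite mulr_ge0// ltW// invsqrt_gt0.
    have h2 : 0 <= invsqrt (z - k) * y (z - k) by rewrite mulr_ge0// ltW// invsqrt_gt0.
    case: (leqP (absz (z - k)) (absz k)) => h.
      rewrite mul1r -[leLHS]addr0; apply: lerD; first by rewrite -mulrA ler_wpM2r ?skernel_lel// mulr_ge0.
      by rewrite mulr_ge0// b0.
    by rewrite mul0r mul0r add0r (ltnW h) mul1r -mulrA [y _ * x _]mulrC ler_wpM2r ?skernel_ler// mulr_ge0.
  have Q0 := sconv_ge0 N z x0 y0.
  apply: (@le_trans _ _ ((S1 + S2) ^+ 2)); first by rewrite ler_sqr ?nnegrE// (le_trans Q0).
  by have := sqr_ge0 (S1 - S2); lra.
rewrite zsumZ zsumD (_ : 12 * (X * Y) = 2 * (3 * X * Y + 3 * Y * X)); last by ring.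
by rewrite ler_pM2l// lerD.
Qed.

(** If [x] lives above [M] and [y] below [K], only [2K + 1] values of [n] occur and the kernel
    is at most [1 / sqrt M]. *)
Lemma sconv_off M K N x y X Y : (forall n, 0 <= x n) -> (forall n, 0 <= y n) -> (0 < M)%N ->
  (forall n, (absz n <= M)%N -> x n = 0) -> (forall n, (K < absz n)%N -> y n = 0) -> zbound (fun n => x n ^+ 2) X ->
  zbound (fun n => y n ^+ 2) Y -> zbound (fun z => sconv N x y z ^+ 2) ((2 * K%:R + 1) / M%:R * X * Y).
Proof.
move=> x0 y0 M0 xM yK hX hY L.
have s0 F n : 0 <= (F n : R) ^+ 2 := sqr_ge0 (F n).
have Y0 := zbound_ge0 (s0 y) hY; have X0 := zbound_ge0 (s0 x) hX.
pose F1 k n := ((absz n <= K)%N)%:R * (invsqrt k * x k).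
have B1 : zbound (fun z => zsum N (fun k => F1 k (z - k) * y (z - k)) ^+ 2) ((2 * K%:R + 1) / M%:R * X * Y).
  apply: (zbound_diag_CS (F := F1) (G := fun _ n => y n)) => // [z|P Q].
    by apply: le_trans (hY (N + absz z)%N); exact: (zsum_refl_le N z (s0 y)).
  apply: (@le_trans _ _ (zsum P (fun k => (2 * K%:R + 1) / M%:R * x k ^+ 2))); last by rewrite zsumZ ler_wpM2l// divr_ge0// addr_ge0// mulr_ge0.
  apply: zsum_le => k.
  rewrite (eq_zsum _ (G := fun n => (invsqrt k ^+ 2 * x k ^+ 2) * (if (absz n <= K)%N then 1 else 0))); last first.
    by move=> n; rewrite /F1; case: (_ <= _)%N; rewrite ?mul1r ?mul0r ?mulr1 ?mulr0 ?exprMn// expr0n.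
  rewrite zsumZ; have : zsum Q (fun n => if (absz n <= K)%N then 1 else 0) <= 2 * K%:R + 1 :> R.
    by rewrite -zsum_one; exact: zsum_low.
  move=> c; apply: (@le_trans _ _ (invsqrt k ^+ 2 * x k ^+ 2 * (2 * K%:R + 1))); first by rewrite ler_wpM2l// mulr_ge0.
  have K0 : 0 <= 2 * K%:R + 1 :> R by rewrite addr_ge0// mulr_ge0.
  rewrite mulrC -mulrA; apply: ler_wpM2l => //.
  case: (leqP (absz k) M) => kM; first by rewrite xM// expr0n /= !mulr0.
  by rewrite ler_wpM2r// invsqrt_sqr lef_pV2 ?posrE ?abs1_gt0 ?ltr0n// ler_nat leq_max (ltnW kM) orbT.
apply: le_trans (B1 L); apply: zsum_le => z.
rewrite ler_sqr ?nnegrE ?sconv_ge0//; last first.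
  by apply: zsum_ge0 => k; rewrite mulr_ge0// /F1 mulr_ge0// mulr_ge0// ltW// invsqrt_gt0.
apply: zsum_le => k; rewrite /F1; case: (leqP (absz (z - k)) K) => h; last by rewrite yK// !mulr0.
by rewrite mul1r -mulrA ler_wpM2r ?skernel_lel// mulr_ge0.
Qed.

Lemma zbound_tail F B (e : R) : (forall n, 0 <= F n) -> zbound F B -> 0 < e ->
  exists K, zbound (fun n => if (absz n <= K)%N then 0 else F n) e.
Proof.
move=> F0 hB e0.
have mono : {homo (fun N => zsum N F) : a b / (a <= b)%N >-> a <= b} by move=> a b ab; exact: zsum_mono.
have cv : cvgn (fun N => zsum N F) by apply: nondecreasing_is_cvgn => //; exists B => _ [N _ <-].
have /cvgrPdist_lt/(_ _ e0)[K _ /(_ K (leqnn K)) hK] := cv.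
exists K => N.
have e1 : zsum N (fun n => if (absz n <= K)%N then 0 else F n) = zsum N F - zsum N (fun n => if (absz n <= K)%N then F n else 0).
  by rewrite -zsumB; apply: eq_zsum => n; case: ifP; rewrite ?subrr ?subr0.
rewrite e1; case: (leqP K N) => [KN|/ltnW NK].
  rewrite zsum_trunc//; have := nondecreasing_cvgn_le mono cv N; move: hK; rewrite ltr_norml /= => /andP[_ ?] ?; lra.
rewrite (eq_zsum_le (G := F)) ?subrr ?ltW// => n nN; by rewrite (leq_trans nN NK).
Qed.

(** Split [y] at a frequency beyond which its norm is small, and [x] at a frequency far above
    that one. *)
Lemma sconv_small y Y (e : R) : (forall n, 0 <= y n) -> zbound (fun n => y n ^+ 2) Y -> 0 < e ->
  exists M C, 0 <= C /\ forall N x X, (forall n, 0 <= x n) -> zbound (fun n => x n ^+ 2) X ->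
    zbound (fun z => sconv N x y z ^+ 2) (e * X + C * zsum M (fun n => x n ^+ 2)).
Proof.
move=> y0 hY e0.
have s0 F n : 0 <= (F n : R) ^+ 2 := sqr_ge0 (F n).
have Y0 := zbound_ge0 (s0 y) hY.
have e1 : 0 < e / 72 by rewrite divr_gt0.
have [K hK] := zbound_tail (s0 y) hY e1.
pose B : R := 6 * (2 * K%:R + 1) * Y / e.
have B0 : 0 <= B by apply: divr_ge0; [rewrite !mulr_ge0// addr_ge0// mulr_ge0|exact: ltW].
pose M := (Num.bound B).+1.
have BM : B <= M%:R.
  apply: (@le_trans _ _ (Num.bound B)%:R); last by rewrite ler_nat.
  by apply: ltW; exact: archi_boundP.
have M0 : 0 < M%:R :> R by rewrite ltr0n.
exists M, (36 * Y); split; first by rewrite mulr_ge0.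
move=> N x X x0 hX L; have X0 := zbound_ge0 (s0 x) hX.
(* Three pieces: [x] low; [x] high against [y] low; [x] high against [y] high. *)
pose xl n := if (absz n <= M)%N then x n else 0; pose xh n := if (absz n <= M)%N then 0 else x n.
pose yl n := if (absz n <= K)%N then y n else 0; pose yh n := if (absz n <= K)%N then 0 else y n.
have xl0 n : 0 <= xl n by rewrite /xl; case: ifP.
have xh0 n : 0 <= xh n by rewrite /xh; case: ifP.
have yl0 n : 0 <= yl n by rewrite /yl; case: ifP.
have yh0 n : 0 <= yh n by rewrite /yh; case: ifP.
have hxl : zbound (fun n => xl n ^+ 2) (zsum M (fun n => x n ^+ 2)).
  move=> P; apply: le_trans (zsum_low M P (s0 x)); apply: zsum_le => n; rewrite /xl; case: ifP => //; by rewrite expr0n.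
have hxh : zbound (fun n => xh n ^+ 2) X.
  by apply: zbound_le hX => n; rewrite /xh; case: ifP => // _; rewrite expr0n.
have hyl : zbound (fun n => yl n ^+ 2) Y.
  by apply: zbound_le hY => n; rewrite /yl; case: ifP => // _; rewrite expr0n.
have hyh : zbound (fun n => yh n ^+ 2) (e / 72).
  by apply: zbound_le hK => n; rewrite /yh; case: ifP => // _; rewrite expr0n.
have b1 := sconv_bound N xl0 y0 hxl hY L.
have b2 : zsum L (fun z => sconv N xh yl z ^+ 2) <= e / 6 * X.
  have xM n : (absz n <= M)%N -> xh n = 0 by rewrite /xh => ->.
  have yK n : (K < absz n)%N -> yl n = 0 by rewrite /yl; case: leqP.
  apply: le_trans (@sconv_off M K N xh yl X Y xh0 yl0 isT xM yK hxh hyl L) _.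
  rewrite mulrAC; apply: ler_wpM2r => //.
  rewrite mulrAC ler_pdivrMr//; move: BM; rewrite /B ler_pdivrMr// -mulrA => h.
  by move: h; move: ((_ + 1) * Y) (M%:R) => W V; lra.
have b3 := sconv_bound N xh0 yh0 hxh hyh L.
apply: (@le_trans _ _ (zsum L (fun z => 3 * (sconv N xl y z ^+ 2 + sconv N xh yl z ^+ 2 + sconv N xh yh z ^+ 2)))).
  apply: zsum_le => z.
  have -> : sconv N x y z = sconv N xl y z + sconv N xh yl z + sconv N xh yh z.
    rewrite -!zsumD; apply: eq_zsum => k; rewrite /xl /xh /yl /yh; case: ifP => _; case: ifP => _;
    by rewrite ?mul0r ?mulr0 ?addr0 ?add0r.
  move: (sconv _ _ _ _) (sconv _ _ _ _) (sconv _ _ _ _) => a b c.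
  by have := sqr_ge0 (a - b); have := sqr_ge0 (a - c); have := sqr_ge0 (b - c); lra.
rewrite zsumZ !zsumD; move: b1 b2 b3.
move: (zsum _ _) (zsum _ _) (zsum _ _) (zsum _ _) => a b c d.
move: (d * Y) (X * e) => u v.
lra.
Qed.

Lemma sconv_sym N x y L B : (forall n, 0 <= x n) -> (forall n, 0 <= y n) -> (forall K, zbound (fun z => sconv K x y z ^+ 2) B) ->
  zsum L (fun z => sconv N y x z ^+ 2) <= B.
Proof.
move=> x0 y0 h; apply: le_trans (h (N + L)%N L); apply: zsum_le_in => z zL.
rewrite ler_sqr ?nnegrE ?sconv_ge0//.
pose F k := skernel k (z - k) * (x k * y (z - k)).
have F0 k : 0 <= F k by rewrite !mulr_ge0 ?skernel_ge0.
rewrite /sconv (eq_zsum _ (G := fun k => F (z - k))); last first.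
  by move=> k; rewrite /F subKr skernelC [y _ * _]mulrC.
by apply: le_trans (zsum_refl_le N z F0) _; apply: zsum_mono => //; rewrite leq_add2l.
Qed.

End Sequences.

(** * Products in Fourier coefficients *)
Section Products.
Context {R : realType}.
Notation mu := (leb R).
Implicit Types (f g h : R -> R) (F G : int -> R) (M N L : nat) (n k z : int) (s : bool).

Definition coef s f n : R := if s then be f n else al f n.
Definition trig s n : R -> R := if s then Sn n else Cn n.
(** The contribution of frequencies [k] and [n] to the coefficient of a product at [k + n]; the
    flag selects sines. *)
Definition cterm s f g k n : R := if s then al f k * be g n + be f k * al g n else al f k * al g n - be f k * be g n.
Definition ampl f n : R := `|al f n| + `|be f n|.

Lemma ampl_ge0 f n : 0 <= ampl f n. Proof. exact: addr_ge0. Qed.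

Lemma ampl_sqr f n : ampl f n ^+ 2 <= 2 * coef2 f n.
Proof.
rewrite /ampl /coef2 -(real_normK (num_real (al f n))) -(real_normK (num_real (be f n))).
by have := sqr_ge0 (`|al f n| - `|be f n|); lra.
Qed.

Lemma cterm_le s f g k n : `|cterm s f g k n| <= ampl f k * ampl g n.
Proof.
have -> : ampl f k * ampl g n = `|al f k| * `|al g n| + `|be f k| * `|be g n| + (`|al f k| * `|be g n| + `|be f k| * `|al g n|).
  by rewrite /ampl; ring.
case: s; rewrite /cterm.
  by apply: le_trans (ler_normD _ _) _; rewrite !normrM -[leLHS]add0r lerD2r addr_ge0.
by apply: le_trans (ler_normB _ _) _; rewrite !normrM lerDl addr_ge0.
Qed.

Lemma ctermC s f g k n : cterm s f g k n = cterm s g f n k.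
Proof. by case: s; rewrite /cterm; ring. Qed.

Lemma trig_Bd s n : Bd (@trig s n). Proof. by case: s; [exact: Bd_Sn|exact: Bd_Cn]. Qed.
Lemma trig_fin_energy s n : fin_energy (@trig s n). Proof. by case: s; [exact: fin_energy_Sn|exact: fin_energy_Cn]. Qed.

Lemma ipp_avg (c : R) f h h1 h2 : L2p f -> L2p h1 -> L2p h2 -> (forall x, h x = 2^-1 * (h1 x + c * h2 x)) ->
  ipp f h = 2^-1 * (ipp f h1 + c * ipp f h2).
Proof.
move=> Lf L1 L2' hh; rewrite ![ipp f _]ippC.
rewrite -(ippZl c L2' Lf) -(ippDl L1 (L2pZ c L2') Lf) -(ippZl 2^-1 (L2pD L1 (L2pZ c L2')) Lf).
by apply: eq_ii => x; rewrite hh.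
Qed.

Lemma coef_mulC g z n : L2p g ->
  al (fun x => g x * Cn z x) n = 2^-1 * (al g (z - n) + 1 * al g (z + n)) /\
  be (fun x => g x * Cn z x) n = 2^-1 * (be g (z + n) + -1 * be g (z - n)).
Proof.
move=> Lg; split.
  rewrite -(ipp_avg (h := fun x => Cn z x * Cn n x) Lg (L2p_Cn _) (L2p_Cn _)) => [|x]; last first.
    by rewrite CnB CnD; lra.
  by apply: eq_ii => x; rewrite mulrA.
rewrite -(ipp_avg (h := fun x => Cn z x * Sn n x) Lg (L2p_Sn _) (L2p_Sn _)) => [|x]; last first.
  by rewrite SnB SnD; lra.
by apply: eq_ii => x; rewrite mulrA.
Qed.

Lemma coef_mulS g z n : L2p g ->
  al (fun x => g x * Sn z x) n = 2^-1 * (be g (z + n) + 1 * be g (z - n)) /\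
  be (fun x => g x * Sn z x) n = 2^-1 * (al g (z - n) + -1 * al g (z + n)).
Proof.
move=> Lg; split.
  rewrite -(ipp_avg (h := fun x => Sn z x * Cn n x) Lg (L2p_Sn _) (L2p_Sn _)) => [|x]; last first.
    by rewrite SnB SnD; lra.
  by apply: eq_ii => x; rewrite mulrA.
rewrite -(ipp_avg (h := fun x => Sn z x * Sn n x) Lg (L2p_Cn _) (L2p_Cn _)) => [|x]; last first.
  by rewrite CnB CnD; lra.
by apply: eq_ii => x; rewrite mulrA.
Qed.

(** Multiplying [g] by a harmonic shifts its coefficients by [z] in both directions; the
    reflection [n -> -n] folds the two shifts into one. *)
Lemma zsum_cterm s f g z N (e : int -> R) : evenz e -> L2p f -> L2p g ->
  zsum N (fun n => e n * (al f n * al (fun x => g x * trig s z x) n + be f n * be (fun x => g x * trig s z x) n)) =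
  zsum N (fun n => e n * cterm s f g n (z - n)).
Proof.
move=> ee Lf Lg.
have half (F1 F2 F : int -> R) : (forall n, F n = 2^-1 * F1 n + 2^-1 * F2 n) -> (forall n, F2 (- n) = F1 n) -> zsum N F = zsum N F1.
  move=> h1 h2; rewrite (eq_zsum _ h1) zsumD !zsumZ -(zsumN N F2) (eq_zsum _ h2); lra.
case: s.
- apply: (half _ (fun n => e n * (al f n * be g (z + n) - be f n * al g (z + n)))) => n.
    by rewrite /trig; have [-> ->] := coef_mulS z n Lg; rewrite /cterm; lra.
  by rewrite ee alN (beN n Lf) /cterm; ring.
- apply: (half _ (fun n => e n * (al f n * al g (z + n) + be f n * be g (z + n)))) => n.
    by rewrite /trig; have [-> ->] := coef_mulC z n Lg; rewrite /cterm; lra.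
  by rewrite ee alN (beN n Lf) /cterm; ring.
Qed.

Lemma parseval2 f h : L2p f -> L2p h -> zsum M (fun n => al f n * al h n + be f n * be h n) @[M --> \oo] --> ipp f h.
Proof.
move=> Lf Lh; have := cvg_ipp (fun M => Bd_L2p (Sm_Bd M f)) Lf Lh (cvg_Sm Lf).
suff -> : (fun M => ipp (Sm M f) h) = (fun M => zsum M (fun n => al f n * al h n + be f n * be h n)) by [].
by apply/funext => M; exact: ipp_Sm.
Qed.

Lemma cvg_product s f g z : L2p f -> L2p g ->
  zsum N (fun n => cterm s f g n (z - n)) @[N --> \oo] --> coef s (fun x => f x * g x) z.
Proof.
move=> Lf Lg.
have LH : L2p (fun x => g x * trig s z x).
  rewrite (_ : (fun x => g x * trig s z x) = (fun x => trig s z x * g x)); last by apply/funext => x; rewrite mulrC.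
  by apply: L2p_bddM => //; exact: trig_Bd.
have -> : coef s (fun x => f x * g x) z = ipp f (fun x => g x * trig s z x).
  by case: s {LH}; apply: eq_ii => x; rewrite /trig mulrA.
have := parseval2 Lf LH.
suff -> : (fun M => zsum M (fun n => al f n * al (fun x => g x * trig s z x) n + be f n * be (fun x => g x * trig s z x) n)) =
   (fun N => zsum N (fun n => cterm s f g n (z - n))) by [].
apply/funext => N; have := zsum_cterm s z N (e := fun=> 1) (fun _ => erefl) Lf Lg.
rewrite (eq_zsum _ (G := fun n => al f n * al (fun x => g x * trig s z x) n + be f n * be (fun x => g x * trig s z x) n)); last by move=> n; rewrite mul1r.
by move=> ->; apply: eq_zsum => n; rewrite mul1r.
Qed.

(** Decay at infinity is what allows a conditionally convergent symmetric sum to be shifted or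
    reflected. *)
Definition vanish F := forall e : R, 0 < e -> exists N, forall n, (N <= absz n)%N -> `|F n| <= e.

Lemma vanish_le F G : (forall n, `|F n| <= `|G n|) -> vanish G -> vanish F.
Proof. by move=> h v e /v[N hN]; exists N => n /hN; exact: le_trans. Qed.

Lemma vanish_bound F G B : vanish F -> (forall n, `|G n| <= B) -> vanish (fun n => F n * G n).
Proof.
move=> v b e e0; have B0 : 0 <= B := le_trans (normr_ge0 _) (b 0).
have [|N hN] := v (e / (B + 1)); first by rewrite divr_gt0// ltr_wpDl.
exists N => n /hN h; rewrite normrM; apply: (@le_trans _ _ (e / (B + 1) * B)); first exact: ler_pM.
rewrite mulrAC ler_pdivrMr ?ltr_wpDl//; apply: ler_wpM2l; [exact: ltW|by rewrite lerDl].
Qed.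

Lemma vanish_shift F k : vanish F -> vanish (fun n => F (n + k)).
Proof.
move=> v e /v[N hN]; exists (N + absz k)%N => n h; apply: hN.
by move: h; lia.
Qed.

Lemma vanish_sqr F B : zbound (fun n => F n ^+ 2) B -> vanish F.
Proof.
move=> hB e e0; have e2 : 0 < e ^+ 2 by rewrite exprn_gt0.
have [K hK] := zbound_tail (fun n => sqr_ge0 (F n)) hB e2.
exists K.+1 => n Kn; rewrite -ler_sqr ?nnegrE ?(ltW e0)// real_normK ?num_real//.
apply: le_trans (hK (absz n)).
have -> : F n ^+ 2 = zsum `|n|%N (fun k => F k ^+ 2 * (n == k)%:R) by rewrite zsum_delta leqnn.
apply: zsum_le => k; case: eqP => [<-|_]; first by rewrite leqNgt Kn mulr1.
by rewrite mulr0; case: ifP => // _; exact: sqr_ge0.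
Qed.

Lemma vanish_cvg F : vanish F -> F k.+1%:Z @[k --> \oo] --> (0 : R) /\ F (- k.+1%:Z) @[k --> \oo] --> (0 : R) /\
  F k%:Z @[k --> \oo] --> (0 : R) /\ F (- k%:Z) @[k --> \oo] --> (0 : R).
Proof.
move=> v; split; [|split; [|split]]; apply/cvgrPdist_le => e /v[N hN]; exists N => // k /= Nk;
by rewrite sub0r normrN; apply: hN; rewrite ?abszN absz_nat// (leq_trans Nk).
Qed.

Lemma zsum_shift_lim F k (l : R) : vanish F -> zsum N F @[N --> \oo] --> l -> zsum N (fun n => F (n + k)) @[N --> \oo] --> l.
Proof.
have pos (j : nat) : forall G, vanish G -> zsum N G @[N --> \oo] --> l -> zsum N (fun n => G (n + j%:Z)) @[N --> \oo] --> l.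
  elim: j => [|j ih] G vG hG.
    by rewrite (_ : (fun n => G (n + 0%:Z)) = G)//; apply/funext => n; rewrite addr0.
  rewrite (_ : (fun n => G (n + j.+1%:Z)) = (fun n => (fun l => G (l + 1)) (n + j%:Z))); last first.
    by apply/funext => n /=; rewrite -addrA -PoszD addn1.
  apply: (ih (fun l => G (l + 1))); first exact: vanish_shift.
  rewrite (_ : (fun N => zsum N (fun l => G (l + 1))) = (fun N => zsum N G + G N.+1%:Z - G (- N%:Z))); last first.
    by apply/funext => N; exact: zsum_shift1.
  have [h1 [_ [_ h4]]] := vanish_cvg vG.
  by rewrite -[X in _ --> X](subr0 l) -[X in _ --> X - _](addr0 l); apply: cvgB; [apply: cvgD|].
have neg (j : nat) : forall G, vanish G -> zsum N G @[N --> \oo] --> l -> zsum N (fun n => G (n - j%:Z)) @[N --> \oo] --> l.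
  elim: j => [|j ih] G vG hG.
    by rewrite (_ : (fun n => G (n - 0%:Z)) = G)//; apply/funext => n; rewrite subr0.
  rewrite (_ : (fun n => G (n - j.+1%:Z)) = (fun n => (fun l => G (l - 1)) (n - j%:Z))); last first.
    by apply/funext => n /=; rewrite -addrA -opprD -PoszD addn1.
  apply: (ih (fun l => G (l - 1))); first exact: vanish_shift.
  rewrite (_ : (fun N => zsum N (fun l => G (l - 1))) = (fun N => zsum N G + G (- N.+1%:Z) - G N%:Z)); last first.
    by apply/funext => N; exact: zsum_shiftN1.
  have [_ [h2 [h3 _]]] := vanish_cvg vG.
  by rewrite -[X in _ --> X](subr0 l) -[X in _ --> X - _](addr0 l); apply: cvgB; [apply: cvgD|].
by case: k => j; [exact: pos|exact: (neg j.+1)].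
Qed.

Lemma zsum_refl_lim F z (l : R) : vanish F -> zsum N F @[N --> \oo] --> l -> zsum N (fun n => F (z - n)) @[N --> \oo] --> l.
Proof.
move=> vF /(zsum_shift_lim z vF).
suff -> : (fun N => zsum N (fun n => F (n + z))) = (fun N => zsum N (fun n => F (z - n))) by [].
apply/funext => N.
by rewrite -zsumN; apply: eq_zsum => n; rewrite addrC.
Qed.

(** The symbol of the half derivative on the circle. *)
Definition nu n : R := Num.sqrt (absr n).

Lemma nu_ge0 n : 0 <= nu n. Proof. exact: sqrtr_ge0. Qed.
Lemma nu2 n : nu n ^+ 2 = absr n. Proof. exact: sqr_sqrtr. Qed.
Lemma nuN n : nu (- n) = nu n. Proof. by rewrite /nu absrN. Qed.
Lemma nu0 : nu 0 = 0. Proof. by rewrite /nu sqrtr0. Qed.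

Lemma nu_mono k n : (absz k <= absz n)%N -> nu k <= nu n.
Proof. by move=> h; rewrite ler_sqrt// ler_nat. Qed.

Lemma nu_tri k n : nu (k + n) <= nu k + nu n.
Proof.
have : absr (k + n) <= absr k + absr n :> R by rewrite /absr -natrD ler_nat; lia.
have : 0 <= nu k * nu n by rewrite mulr_ge0 ?nu_ge0.
move=> h1 h2; rewrite -ler_sqr ?nnegrE ?addr_ge0 ?nu_ge0// sqrrD !nu2.
by rewrite mulr2n; lra.
Qed.

Lemma nu_triB k z : nu k <= nu z + nu (z - k).
Proof.
by rewrite -{1}(subKr z k) (le_trans (nu_tri _ _))// nuN.
Qed.

Lemma invsqrt_nu n : n != 0 -> invsqrt n * nu n = 1.
Proof.
move=> n0; have e : abs1 n = absr n :> R by rewrite /abs1 /absr (maxn_idPr _)// absz_gt0.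
by rewrite /invsqrt e mulVf// gt_eqF// sqrtr_gt0 ltr0n absz_gt0.
Qed.

Lemma nu_invsqrt n : nu n <= (1 + absr n) * invsqrt n.
Proof.
have [->|n0] := eqVneq n 0; first by rewrite nu0 mulr_ge0 ?addr_ge0// ltW// invsqrt_gt0.
have : nu n = absr n * invsqrt n by rewrite -nu2 expr2 -mulrA [nu n * invsqrt n]mulrC invsqrt_nu// mulr1.
by move=> ->; rewrite mulrDl mul1r lerDr ltW// invsqrt_gt0.
Qed.

Lemma nu_min k n : Num.min (nu k) (nu n) <= skernel k n * (nu k * nu n).
Proof.
wlog kn : k n / (absz k <= absz n)%N.
  move=> h; case: (leqP (absz k) (absz n)) => [|/ltnW] kn; first exact: h.
  by rewrite minC skernelC [nu k * _]mulrC; exact: h.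
rewrite skernel_max//; have [n0|n0] := eqVneq n 0.
  have k0 : k = 0 by apply/eqP; move: kn; rewrite n0 absz0 leqn0 absz_eq0.
  by rewrite n0 k0 nu0 minxx !mulr0.
by rewrite mulrCA invsqrt_nu// mulr1 ge_min lexx.
Qed.

(** The excess in the triangle inequality for [sqrt|.|] is at most twice the smaller term. *)
Lemma kernel_U k z : `|nu k + nu (z - k) - nu z| <= 2 * (skernel k (z - k) * (nu k * nu (z - k))).
Proof.
have h1 := nu_tri k (z - k); rewrite addrC subrK in h1.
have h2 := nu_triB k z; have h3 := nu_triB (z - k) z; rewrite subKr in h3.
have h0 : 0 <= nu k + nu (z - k) - nu z by lra.
rewrite ger0_norm//; apply: (@le_trans _ _ (2 * Num.min (nu k) (nu (z - k)))); last by rewrite ler_pM2l// nu_min.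
by case: (leP (nu k) (nu (z - k))) => _; lra.
Qed.

(** The left side is [kernel_U]'s kernel times [(nu k - nu (z - k)) / nu z], of modulus at most
    1. *)
Lemma kernel_W k z :
  `|(nu (z - k) - nu k) - (nu z)^-1 * (absr (z - k) - absr k)| <= 2 * (skernel k (z - k) * (nu k * nu (z - k))).
Proof.
have [->|z0] := eqVneq z 0.
  by rewrite sub0r nuN nu0 invr0 mul0r !subrr normr0 !mulr_ge0 ?skernel_ge0 ?nu_ge0.
have zp : 0 < nu z by rewrite sqrtr_gt0 ltr0n absz_gt0.
apply: le_trans (kernel_U k z).
have -> : nu (z - k) - nu k - (nu z)^-1 * (absr (z - k) - absr k) = ((nu k - nu (z - k)) / nu z) * (nu k + nu (z - k) - nu z).
  by rewrite -!nu2; field; rewrite gt_eqF.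
rewrite normrM ler_piMl// normrM normfV (gtr0_norm zp) ler_pdivrMr// mul1r ler_norml.
have h2 := nu_triB k z; have h3 := nu_triB (z - k) z; rewrite subKr in h3.
by apply/andP; split; lra.
Qed.

End Products.

(** * Compensation by the constraint and the equation *)
Section Compensation.
Context {R : realType} {m : nat}.
Notation mu := (leb R).
Implicit Types (f g h : R -> R) (M N L : nat) (n k z : int) (s : bool) (i j : 'I_m).

Lemma cvg_fsum I (l : seq I) (F : I -> nat -> R) (c : I -> R) : (forall a : I, F a N @[N --> \oo] --> c a) ->
  \sum_(i <- l) F i N @[N --> \oo] --> \sum_(i <- l) c i.
Proof.
move=> h; elim: l => [|a l ih].
  by rewrite big_nil (_ : (fun N => \sum_(i <- [::]) F i N) = (fun=> 0)); [exact: cvg_cst|apply/funext => N; rewrite big_nil].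
rewrite big_cons (_ : (fun N => \sum_(i <- a :: l) F i N) = (fun N => F a N + \sum_(i <- l) F i N)).
  by apply: cvgD.
by apply/funext => N; rewrite big_cons.
Qed.

Lemma coef_ipp s f n : coef s f n = ipp f (trig s n). Proof. by case: s. Qed.

Lemma coef_sum s n I (l : seq I) (F : I -> R -> R) : (forall a : I, L2p (F a)) ->
  coef s (fun x => \sum_(i <- l) F i x) n = \sum_(i <- l) coef s (F i) n.
Proof.
move=> LF; rewrite coef_ipp ipp_suml//; last by apply: Bd_L2p; exact: trig_Bd.
by apply: eq_bigr => i _; rewrite coef_ipp.
Qed.

Lemma coefD s n f g : L2p f -> L2p g -> coef s (fun x => f x + g x) n = coef s f n + coef s g n.
Proof. by move=> Lf Lg; case: s; [exact: beD|exact: alD]. Qed.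

Lemma coefB s n f g : L2p f -> L2p g -> coef s (fun x => f x - g x) n = coef s f n - coef s g n.
Proof. by move=> Lf Lg; case: s; [exact: beB|exact: alB]. Qed.

Lemma L2p_sum I (l : seq I) (F : I -> R -> R) : (forall a : I, L2p (F a)) -> L2p (fun x => \sum_(i <- l) F i x).
Proof.
move=> LF; have := @L2_sum _ _ _ mu I l xpredT (fun a x => F a x * q x) (fun a _ => LF a).
by apply: eq_L2 => x; rewrite mulr_suml.
Qed.

Lemma ampl_bounded f n : L2p f -> ampl f n <= 1 + 2 * sqnp f.
Proof.
move=> Lf; have s0 := ampl_ge0 f n.
have h : ampl f n ^+ 2 <= 2 * sqnp f.
  apply: le_trans (ampl_sqr f n) _; rewrite ler_pM2l//; apply: le_trans (bessel (absz n) Lf).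
  have -> : coef2 f n = zsum `|n|%N (fun k => coef2 f k * (n == k)%:R) by rewrite zsum_delta leqnn.
  by apply: zsum_le => k; case: (n == k); rewrite ?mulr1 ?mulr0 ?coef2_ge0.
by have := sqr_ge0 (ampl f n - 1); lra.
Qed.

Lemma ampl_zbound f : L2p f -> zbound (fun n => ampl f n ^+ 2) (2 * sqnp f).
Proof.
move=> Lf N; apply: (@le_trans _ _ (zsum N (fun n => 2 * coef2 f n))); first by apply: zsum_le => n; exact: ampl_sqr.
by rewrite zsumZ ler_pM2l// bessel.
Qed.

(** On the circle the half derivative multiplies coefficients by [nu]; finite energy says
    precisely that the result is in [L^2]. *)
Lemma half_derivative f : Bd f -> fin_energy f -> exists v, L2p v /\ forall s n, coef s v n = nu n * coef s f n.
Proof.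
move=> bf gf; have Lf := Bd_L2p bf.
have [|n|M|v [Lv a b _]] := @riesz_fischer R (fun n => nu n * al f n) (fun n => nu n * be f n) (genergy f / (4 * pi ^+ 2)).
- by move=> n; rewrite nuN alN.
- by rewrite nuN (beN n Lf) mulrN.
- rewrite ler_pdivlMr ?pp4_gt0// mulrC; apply: le_trans (series_le M bf gf).
  by rewrite ler_pM2l ?pp4_gt0//; apply: zsum_le => n; rewrite !exprMn nu2 -mulrDr.
by exists v; split => // -[] n; rewrite /coef.
Qed.

Context (w : 'I_m -> R -> R) (v : 'I_m -> R -> R).
Context (uw : unit_map w) (Lv : forall i, L2p (v i)) (hv : forall i s n, coef s (v i) n = nu n * coef s (w i) n).
Context (comm : forall i j h, Bd h -> fin_energy h -> energy_form (w i) (fun x => w j x * h x) = energy_form (w j) (fun x => w i x * h x)).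

Definition radial (x : R) : R := \sum_(j <- index_enum 'I_m) w j x * v j x.
Definition angular i j (x : R) : R := w i x * v j x - v i x * w j x.
Definition tot_ampl n : R := \sum_(i <- index_enum 'I_m) ampl (v i) n.

Lemma Lwv i j : L2p (fun x => w i x * v j x).
Proof. by apply: L2p_bddM => //; exact: unit_Bd. Qed.

Lemma Lvw i j : L2p (fun x => v i x * w j x).
Proof. by rewrite (_ : (fun x => v i x * w j x) = (fun x => w j x * v i x)); [exact: Lwv|apply/funext => x; rewrite mulrC]. Qed.

Lemma radial_L2p : L2p radial. Proof. by apply: L2p_sum => j; exact: Lwv. Qed.
Lemma angular_L2p i j : L2p (angular i j). Proof. by apply: L2pB; [exact: Lwv|exact: Lvw]. Qed.

(** The orthogonal splitting of [v] along [w], with [radial] and [angular] playing the roles of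
    [w.v] and [w] wedge [v]. *)
Lemma decomposition i x : v i x = w i x * radial x + \sum_(j <- index_enum 'I_m) w j x * angular j i x.
Proof.
have [_ w1 _] := uw; rewrite /radial /angular mulr_sumr -big_split /=.
transitivity (\sum_(j <- index_enum 'I_m) w j x ^+ 2 * v i x); first by rewrite -mulr_suml w1 mul1r.
by apply: eq_bigr => j _; ring.
Qed.

Lemma ampl_v i n : ampl (v i) n = nu n * ampl (w i) n.
Proof.
have := hv i false n; have := hv i true n; rewrite /coef /ampl => -> ->.
by rewrite !normrM (ger0_norm (nu_ge0 n)) mulrDr.
Qed.

Lemma tot_ampl_ge0 n : 0 <= tot_ampl n. Proof. by apply: sumr_ge0 => i _; exact: ampl_ge0. Qed.

Lemma ampl_tot_ampl i n : ampl (v i) n <= tot_ampl n.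
Proof. by rewrite /tot_ampl (bigD1 i)//= lerDl sumr_ge0// => j _; exact: ampl_ge0. Qed.

Lemma cterm_wv s i j k n : cterm s (w i) (v j) k n = nu n * cterm s (w i) (w j) k n.
Proof.
by have := hv j false n; have := hv j true n; case: s; rewrite /coef /cterm => -> ->; ring.
Qed.

Lemma cterm_vw s i j k n : cterm s (v i) (w j) k n = nu k * cterm s (w i) (w j) k n.
Proof. by rewrite ctermC cterm_wv ctermC. Qed.

Lemma lim_wv s i j z : zsum N (fun k => nu (z - k) * cterm s (w i) (w j) k (z - k)) @[N --> \oo] --> coef s (fun x => w i x * v j x) z.
Proof.
have := @cvg_product _ s _ _ z (Bd_L2p (unit_Bd i uw)) (Lv j).
suff -> : (fun N => zsum N (fun k => nu (z - k) * cterm s (w i) (w j) k (z - k))) = (fun N => zsum N (fun k => cterm s (w i) (v j) k (z - k))) by [].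
by apply/funext => N; apply: eq_zsum => k; rewrite cterm_wv.
Qed.

Lemma lim_vw s i j z : zsum N (fun k => nu k * cterm s (w i) (w j) k (z - k)) @[N --> \oo] --> coef s (fun x => v i x * w j x) z.
Proof.
have := @cvg_product _ s _ _ z (Lv i) (Bd_L2p (unit_Bd j uw)).
suff -> : (fun N => zsum N (fun k => nu k * cterm s (w i) (w j) k (z - k))) = (fun N => zsum N (fun k => cterm s (v i) (w j) k (z - k))) by [].
by apply/funext => N; apply: eq_zsum => k; rewrite cterm_vw.
Qed.

Lemma nu_coef1 s z : nu z * coef s (fun=> 1) z = 0 :> R.
Proof.
have -> : (fun=> 1) = @Cn R 0 by apply/funext => x; rewrite Cn0.
have [->|z0] := eqVneq z 0; first by rewrite nu0 mul0r.
case: s; rewrite /coef; first by rewrite be_Cn mulr0.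
by rewrite al_Cn ![0 == _]eq_sym oppr_eq0 (negbTE z0) addr0 mul0r mulr0.
Qed.

(** The sum of [w j ^2] is 1, whose coefficients times [nu] vanish: half of that vanishing sum
    is subtracted from [U]. *)
Lemma U_bound s z : exists u : nat -> R, u N @[N --> \oo] --> coef s radial z /\ forall N, `|u N| <= sconv N tot_ampl tot_ampl z.
Proof.
pose I := index_enum 'I_m.
pose u N := 2^-1 * (\sum_(j <- I) zsum N (fun k => nu k * cterm s (w j) (w j) k (z - k)) +
  \sum_(j <- I) zsum N (fun k => nu (z - k) * cterm s (w j) (w j) k (z - k)) - nu z * \sum_(j <- I) zsum N (fun k => cterm s (w j) (w j) k (z - k))).
have E : coef s radial z = 2^-1 * (\sum_(j <- I) coef s (fun x => v j x * w j x) z + \sum_(j <- I) coef s (fun x => w j x * v j x) z -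
   nu z * \sum_(j <- I) coef s (fun x => w j x * w j x) z).
  have -> : \sum_(j <- I) coef s (fun x => v j x * w j x) z = coef s radial z.
    rewrite /radial coef_sum => [|j]; last exact: Lwv.
    by apply: eq_bigr => j _; congr (coef s _ z); apply/funext => x; rewrite mulrC.
  rewrite -(coef_sum s z I (F := fun j x => w j x * v j x)) => [|j]; last exact: Lwv.
  rewrite -(coef_sum s z I (F := fun j x => w j x * w j x)) => [|j]; last first.
    by apply: Bd_L2p; apply: BdM; exact: unit_Bd.
  have -> : (fun x => \sum_(j <- I) w j x * w j x) = (fun=> 1).
    by apply/funext => x; have [_ w1 _] := uw; rewrite -(w1 x); apply: eq_bigr => j _; rewrite expr2.
  by rewrite nu_coef1 -/radial; move: (coef s radial z) => c; field.
exists u; split.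
  rewrite E; apply: cvgM; first exact: cvg_cst.
  apply: cvgB; first by apply: cvgD; apply: cvg_fsum => j; [exact: lim_vw|exact: lim_wv].
  apply: cvgM; first exact: cvg_cst.
  by apply: cvg_fsum => j; apply: cvg_product; apply: Bd_L2p; exact: unit_Bd.
move=> N.
have -> : u N = zsum N (fun k => \sum_(j <- I) 2^-1 * ((nu k + nu (z - k) - nu z) * cterm s (w j) (w j) k (z - k))).
  rewrite zsum_sum /u mulr_sumr -big_split /= -sumrB mulr_sumr; apply: eq_bigr => j _.
  rewrite -zsumD -zsumZ -zsumB -zsumZ; apply: eq_zsum => k; ring.
apply: le_trans (zsum_norm _ _) _; apply: zsum_le => k.
apply: (@le_trans _ _ (\sum_(j <- I) skernel k (z - k) * (ampl (v j) k * ampl (v j) (z - k)))).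
  apply: le_trans (ler_norm_sum _ _ _) _; apply: ler_sum => j _; rewrite !ampl_v.
  rewrite normrM ger0_norm// normrM.
  apply: (@le_trans _ _ (2^-1 * ((2 * (skernel k (z - k) * (nu k * nu (z - k)))) * (ampl (w j) k * ampl (w j) (z - k))))).
    by rewrite ler_pM2l// ler_pM// ?kernel_U// cterm_le.
  by apply: le_of_eq; field.
rewrite -mulr_sumr ler_wpM2l ?skernel_ge0//.
apply: (@le_trans _ _ (\sum_(j <- I) ampl (v j) k * tot_ampl (z - k))).
  by apply: ler_sum => j _; rewrite ler_wpM2l ?ampl_ge0// ampl_tot_ampl.
by rewrite -mulr_suml.
Qed.

(** The commuted equation tested with a harmonic. Reflecting one of the two sums needs its terms
    to vanish at infinity. *)
Lemma EL_coefficients s i j z :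
  zsum N (fun k => (absr (z - k) - absr k) * cterm s (w i) (w j) k (z - k)) @[N --> \oo] --> (0 : R).
Proof.
have [_ _ gw] := uw.
have one a b : zsum N (fun k => absr k * cterm s (w a) (w b) k (z - k)) @[N --> \oo] --> energy_form (w a) (fun x => w b x * trig s z x) / (4 * pi ^+ 2).
  have bH := BdM (unit_Bd b uw) (trig_Bd s z).
  have gH := Bd_fin_energyM (unit_Bd b uw) (trig_Bd s z) (gw b) (trig_fin_energy s z).
  have h := cvg_eform (unit_Bd a uw) bH (gw a) gH.
  have -> : (fun N => zsum N (fun k => absr k * cterm s (w a) (w b) k (z - k))) =
      (fun N => (4 * pi ^+ 2)^-1 * (4 * pi ^+ 2 * zsum N (eform (w a) (fun x => w b x * trig s z x)))).
    apply/funext => N; rewrite mulKf ?gt_eqF ?pp4_gt0//.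
    by rewrite -(zsum_cterm s z N absrN (Bd_L2p (unit_Bd a uw)) (Bd_L2p (unit_Bd b uw))).
  by rewrite [energy_form _ _ / _]mulrC; apply: cvgM; [exact: cvg_cst|exact: h].
pose F n := absr n * cterm s (w j) (w i) n (z - n).
have vF : vanish F.
  apply: (@vanish_le _ F (fun n => ampl (v j) n * (nu n * ampl (w i) (z - n)))).
    move=> n; rewrite ampl_v /F -nu2 [X in `|X|]mulrC.
    rewrite [leRHS]ger0_norm; last by rewrite !mulr_ge0 ?nu_ge0 ?ampl_ge0.
    rewrite normrM (ger0_norm (sqr_ge0 _)) (_ : nu n * _ * _ = ampl (w j) n * ampl (w i) (z - n) * nu n ^+ 2); last by ring.
    by rewrite ler_wpM2r ?sqr_ge0// cterm_le.
  apply: (vanish_bound (B := nu z * (1 + 2 * sqnp (w i)) + (1 + 2 * sqnp (v i)))).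
    exact: vanish_sqr (ampl_zbound (Lv j)).
  move=> n; rewrite ger0_norm ?mulr_ge0 ?nu_ge0 ?ampl_ge0//.
  apply: (@le_trans _ _ ((nu z + nu (z - n)) * ampl (w i) (z - n))); first by rewrite ler_wpM2r ?ampl_ge0// nu_triB.
  rewrite mulrDl -ampl_v lerD ?ampl_bounded// ler_wpM2l ?nu_ge0// ampl_bounded//; exact: Bd_L2p (unit_Bd i uw).
(* Exchanging [k] and [z - k] turns the equation for [(j, i)] into one with the weight [|z - k|]. *)
have h2 := zsum_refl_lim z vF (one j i).
have {}h2 : zsum N (fun k => absr (z - k) * cterm s (w i) (w j) k (z - k)) @[N --> \oo] --> energy_form (w j) (fun x => w i x * trig s z x) / (4 * pi ^+ 2).
  suff -> : (fun N => zsum N (fun k => absr (z - k) * cterm s (w i) (w j) k (z - k))) = (fun N => zsum N (fun n => F (z - n))) by [].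
  by apply/funext => N; apply: eq_zsum => k; rewrite /F subKr ctermC.
have -> : 0 = energy_form (w j) (fun x => w i x * trig s z x) / (4 * pi ^+ 2) - energy_form (w i) (fun x => w j x * trig s z x) / (4 * pi ^+ 2).
  by rewrite (comm i j (trig_Bd s z) (trig_fin_energy s z)) subrr.
have -> : (fun N => zsum N (fun k => (absr (z - k) - absr k) * cterm s (w i) (w j) k (z - k))) =
  (fun N => zsum N (fun k => absr (z - k) * cterm s (w i) (w j) k (z - k)) - zsum N (fun k => absr k * cterm s (w i) (w j) k (z - k))).
  by apply/funext => N; rewrite -zsumB; apply: eq_zsum => k; rewrite mulrBl.
by apply: cvgB.
Qed.

(** Subtracting the vanishing sum of [EL_coefficients], divided by [nu z], improves the kernel
    of [W]. *)
Lemma W_bound i j s z : exists u : nat -> R, u N @[N --> \oo] --> coef s (angular i j) z /\ forall N, `|u N| <= 2 * sconv N tot_ampl tot_ampl z.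
Proof.
pose P k := cterm s (w i) (w j) k (z - k).
pose u N := zsum N (fun k => nu (z - k) * P k) - zsum N (fun k => nu k * P k) - (nu z)^-1 * zsum N (fun k => (absr (z - k) - absr k) * P k).
exists u; split.
  rewrite -[X in _ --> X]subr0 -[X in _ --> _ - X](mulr0 (nu z)^-1).
  apply: cvgB; last by apply: cvgM; [exact: cvg_cst|exact: EL_coefficients].
  rewrite /angular coefB; [|exact: Lwv|exact: Lvw].
  by apply: cvgB; [exact: lim_wv|exact: lim_vw].
move=> N.
have -> : u N = zsum N (fun k => (nu (z - k) - nu k - (nu z)^-1 * (absr (z - k) - absr k)) * P k).
  by rewrite /u -zsumB -zsumZ -zsumB; apply: eq_zsum => k; ring.
apply: le_trans (zsum_norm _ _) _; rewrite -zsumZ; apply: zsum_le => k; rewrite normrM.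
apply: (@le_trans _ _ (2 * (skernel k (z - k) * (nu k * nu (z - k))) * (ampl (w i) k * ampl (w j) (z - k)))).
  by rewrite ler_pM// ?kernel_W// cterm_le.
rewrite (_ : 2 * _ * _ = 2 * (skernel k (z - k) * ((nu k * ampl (w i) k) * (nu (z - k) * ampl (w j) (z - k))))); last by ring.
by rewrite -!ampl_v ler_pM2l// ler_wpM2l ?skernel_ge0// ler_pM ?ampl_ge0// ampl_tot_ampl.
Qed.

End Compensation.

(** * Weighted estimates and absorption *)
Section Absorption.
Context {R : realType}.
Notation mu := (leb R).
Implicit Types (f g : R -> R) (Z A y : int -> R) (M N L K : nat) (n z : int) (s : bool).

Lemma power_diff (x y d : R) K : 0 <= x -> 0 <= y -> 0 <= d -> `|x - y| <= d * y -> x <= 2 * y ->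
  `|x ^+ K - y ^+ K| <= 3 ^+ K * (d * y ^+ K).
Proof.
move=> x0 y0 d0 h xy; elim: K => [|K ih]; first by rewrite !expr0 subrr normr0 !mulr1 mul1r.
have -> : x ^+ K.+1 - y ^+ K.+1 = x * (x ^+ K - y ^+ K) + (x - y) * y ^+ K by rewrite !exprS; ring.
apply: le_trans (ler_normD _ _) _; rewrite !normrM (ger0_norm x0) (ger0_norm (exprn_ge0 K y0)).
apply: (@le_trans _ _ (2 * y * (3 ^+ K * (d * y ^+ K)) + d * y * y ^+ K)).
  by apply: lerD; [apply: ler_pM|apply: ler_wpM2r => //; exact: exprn_ge0].
have Y0 := exprn_ge0 K y0; have D0 : 0 <= d * (y * y ^+ K) by rewrite !mulr_ge0.
have K1 : 1 <= 3 ^+ K :> R by rewrite exprn_ege1// ler1n.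
rewrite !exprS (_ : 2 * y * _ + _ = (2 * 3 ^+ K + 1) * (d * (y * y ^+ K))); last by ring.
by rewrite ler_wpM2r//; lra.
Qed.

Lemma power_add (x y : R) K : 0 <= x -> 0 <= y -> (x + y) ^+ K <= 2 ^+ K * (x ^+ K + y ^+ K).
Proof.
move=> x0 y0; wlog xy : x y x0 y0 / x <= y.
  by move=> h; case: (leP x y) => [|/ltW] xy; [exact: h|rewrite addrC [x ^+ K + _]addrC; exact: h].
apply: (@le_trans _ _ ((2 * y) ^+ K)); first by rewrite lerXn2r ?nnegrE ?addr_ge0 ?mulr_ge0//; lra.
by rewrite exprMn ler_wpM2l ?exprn_ge0// lerDr exprn_ge0.
Qed.

Definition atrunc L n : R := (minn (absz n).+1 L)%:R.
(** Truncation keeps all weighted norms finite, so that they can be absorbed; the estimates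
    below do not see [L]. *)
Definition tweight K L n : R := atrunc L n ^+ K.

Lemma atrunc_ge0 L n : 0 <= atrunc L n. Proof. by []. Qed.
Lemma tweight_ge0 K L n : 0 <= tweight K L n. Proof. by rewrite exprn_ge0. Qed.
Lemma tweightN K L n : tweight K L (- n) = tweight K L n. Proof. by rewrite /tweight /atrunc abszN. Qed.

Lemma tweight_mono K L k n : (absz k <= absz n)%N -> tweight K L k <= tweight K L n.
Proof. by move=> h; rewrite lerXn2r ?nnegrE ?atrunc_ge0// ler_nat; lia. Qed.

Lemma tweight_le K L n : tweight K L n <= (absz n).+1%:R ^+ K.
Proof. by rewrite lerXn2r ?nnegrE ?atrunc_ge0// ler_nat geq_minl. Qed.

Lemma tweight_leL K L n : tweight K L n <= L%:R ^+ K.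
Proof. by rewrite lerXn2r ?nnegrE ?atrunc_ge0// ler_nat geq_minr. Qed.

Lemma tweight_sub K L k z : tweight K L z <= 2 ^+ K * (tweight K L k + tweight K L (z - k)).
Proof.
apply: le_trans (power_add K (atrunc_ge0 L k) (atrunc_ge0 L (z - k))).
by rewrite lerXn2r ?nnegrE ?addr_ge0 ?atrunc_ge0// -natrD ler_nat; lia.
Qed.

(** For [|k| <= |n|] the relative variation of the weight is of order [|k| / |n| <= sqrt(|k| /
    |n|)]; otherwise [nu k] times the kernel is 1 and quasi-additivity suffices. *)
Lemma tweight_comm K : exists2 C, 0 <= C & forall L k z (s : R), 0 <= s ->
  `|tweight K L z - tweight K L (z - k)| * s <= C * (skernel k (z - k) * (nu k * s * (tweight K L (z - k) + tweight K L k))).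
Proof.
exists (3 ^+ K + 2 ^+ K * 2 + 1); first by rewrite !addr_ge0 ?mulr_ge0 ?exprn_ge0.
have p3 : 0 <= 3 ^+ K :> R by rewrite exprn_ge0.
have p2 : 0 <= 2 ^+ K :> R by rewrite exprn_ge0.
move=> L k z s s0; have T0 := tweight_ge0 K L; set n := z - k.
have zk : z = k + n by rewrite /n addrC subrK.
have N0 : 0 <= nu k :> R := nu_ge0 k.
case: (leqP (absz k) (absz n)) => kn.
  have b0 : 0 < 1 + absr n :> R by rewrite ltr_wpDr// absr_ge0.
  have h1 : `|tweight K L z - tweight K L n| <= 3 ^+ K * (absr k / (1 + absr n) * tweight K L n).
    apply: power_diff => //; first by rewrite divr_ge0 ?absr_ge0// ltW.
      rewrite mulrAC ler_pdivlMr//.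
      have hL (a b e l : nat) : (a <= b + e)%N -> (b <= a + e)%N ->
          `|(minn a l)%:R - (minn b l)%:R| * b%:R <= e%:R * (minn b l)%:R :> R.
        move=> h h'; have [lb|lb] := leqP l b.
          have [la|la] := leqP l a; first by rewrite subrr normr0 mul0r mulr_ge0.
          rewrite distrC ger0_norm ?subr_ge0 ?ler_nat ?(ltnW la)//.
          rewrite -natrB ?(ltnW la)// -!natrM ler_nat; nia.
        rewrite ler_wpM2r// ler_norml; apply/andP; split; [rewrite lerBrDl lerBlDr|rewrite lerBlDl];
        by rewrite -natrD ler_nat; lia.
      have -> : 1 + absr n = (absz n).+1%:R :> R by rewrite -[(absz n).+1%:R]natr1 addrC.
      apply: hL; lia.
    by rewrite -natrM ler_nat; lia.
  apply: (@le_trans _ _ (3 ^+ K * (absr k / (1 + absr n) * tweight K L n) * s)); first by rewrite ler_wpM2r.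
  rewrite (_ : _ * s = 3 ^+ K * (absr k / (1 + absr n) * (tweight K L n * s))); last by ring.
  have h2 : absr k / (1 + absr n) <= invsqrt n * nu k :> R.
    rewrite ler_pdivrMr// -nu2 expr2 [leRHS]mulrAC ler_wpM2r//.
    by rewrite mulrC; apply: le_trans (nu_invsqrt n); exact: nu_mono.
  rewrite skernel_max//; apply: (@le_trans _ _ (3 ^+ K * (invsqrt n * nu k * (tweight K L n * s)))).
    by rewrite ler_wpM2l// ler_wpM2r// mulr_ge0.
  rewrite (_ : 3 ^+ K * _ = 3 ^+ K * (invsqrt n * (nu k * s * tweight K L n))); last by ring.
  have k0 : 0 <= invsqrt n :> R := ltW (invsqrt_gt0 n).
  have X1 : 0 <= nu k * s * tweight K L n by rewrite !mulr_ge0.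
  apply: ler_pM; [exact: p3|exact: mulr_ge0| |].
    by rewrite -addrA lerDl addr_ge0// mulr_ge0.
  by rewrite ler_wpM2l// ler_wpM2l ?mulr_ge0// lerDl.
have k0 : k != 0 by apply: contraTneq kn => ->; rewrite absz0.
have e : skernel k n * nu k = 1 :> R by rewrite skernelC skernel_max ?(ltnW kn)// invsqrt_nu.
rewrite (_ : skernel k n * _ = skernel k n * nu k * (s * (tweight K L n + tweight K L k))); last by ring.
rewrite e mul1r [leRHS]mulrCA mulrC ler_wpM2l//.
have h1 := tweight_sub K L k z; have h2 := tweight_mono K L (ltnW kn); rewrite -/n in h1.
have h3 : `|tweight K L z - tweight K L n| <= tweight K L z + tweight K L n.
  by apply: le_trans (ler_normB _ _) _; rewrite !ger0_norm.
apply: le_trans h3 _; apply: (@le_trans _ _ (2 ^+ K * (tweight K L k + tweight K L n) + tweight K L n)); first by rewrite lerD2r.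
rewrite [tweight K L k + _]addrC; set Y := tweight K L n + tweight K L k.
have Y1 : tweight K L n <= Y by rewrite lerDl.
have Y0 : 0 <= Y by rewrite addr_ge0.
have a0 : 0 <= 3 ^+ K * Y by rewrite mulr_ge0.
have a1 : 0 <= 2 ^+ K * Y by rewrite mulr_ge0.
by rewrite !mulrDl mul1r -mulrA; lra.
Qed.

Lemma cvg_le_cst (u : nat -> R) (l B : R) : u N @[N --> \oo] --> l -> (forall N, u N <= B) -> l <= B.
Proof.
move=> ul h; rewrite leNgt; apply/negP => Bl.
have e0 : 0 < l - B by rewrite subr_gt0.
have /cvgrPdist_lt/(_ _ e0)[N _ /(_ N (leqnn N))] := ul.
by have := h N; rewrite ltr_norml /= => ? /andP[_ ?]; lra.
Qed.

Lemma zbound_lim (u : nat -> int -> R) (l : int -> R) B : (forall n, u N n @[N --> \oo] --> l n) ->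
  (forall N, zbound (fun n => u N n ^+ 2) B) -> zbound (fun n => l n ^+ 2) B.
Proof.
move=> h hB L; apply: (cvg_le_cst (u := fun N => zsum L (fun n => u N n ^+ 2))) => [|N]; last exact: hB.
by apply: cvg_zsum => n; rewrite !expr2; under eq_fun do rewrite expr2; apply: cvgM; exact: h.
Qed.

Context (K : nat) (A : int -> R) (X0 : R).
Context (A0 : forall n, 0 <= A n) (hA : zbound (fun n => A n ^+ 2) X0).
Notation T := (tweight K).

(** [small Z] says that the weighted norm of [Z] is at most any fraction of that of [A] plus a
    constant, uniformly in [L]; [tame] allows a fixed multiple instead. *)
Definition small Z := forall e : R, 0 < e -> exists2 C, 0 <= C & forall L X, zbound (fun n => (T L n * A n) ^+ 2) X ->
  zbound (fun n => (T L n * Z n) ^+ 2) (e * X + C).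
Definition tame Z := exists c C, [/\ 0 <= c, 0 <= C & forall L X, zbound (fun n => (T L n * A n) ^+ 2) X ->
  zbound (fun n => (T L n * Z n) ^+ 2) (c * X + C)].

Lemma small_tame Z : small Z -> tame Z.
Proof. by move=> /(_ 1 ltr01)[C C0 h]; exists 1, C. Qed.

Lemma tame_A : tame A.
Proof. by exists 1, 0; split => // L X h; rewrite mul1r addr0. Qed.

Lemma TA_ge0 L X : zbound (fun n => (T L n * A n) ^+ 2) X -> 0 <= X.
Proof. by apply: zbound_ge0 => n; exact: sqr_ge0. Qed.

Lemma small_le Z Z' c : (forall n, `|Z n| <= c * `|Z' n|) -> small Z' -> small Z.
Proof.
move=> h s e e0; have c1 : 0 < c ^+ 2 + 1 by rewrite ltr_wpDl ?sqr_ge0.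
have [|C C0 hC] := s (e / (c ^+ 2 + 1)); first by rewrite divr_gt0.
exists ((c ^+ 2 + 1) * C); first by rewrite mulr_ge0// ltW.
move=> L X hX N; apply: (@le_trans _ _ (zsum N (fun n => (c ^+ 2 + 1) * (T L n * Z' n) ^+ 2))).
  apply: zsum_le => n; apply: (@le_trans _ _ (c ^+ 2 * (T L n * Z' n) ^+ 2)); last first.
    by rewrite ler_wpM2r ?sqr_ge0// lerDl.
  rewrite !exprMn [leRHS]mulrCA; apply: ler_wpM2l; first exact: sqr_ge0.
  rewrite -(real_normK (num_real (Z n))) -(real_normK (num_real (Z' n))) -exprMn.
  by rewrite ler_sqr ?nnegrE//; exact: le_trans (h n).
rewrite zsumZ; apply: (@le_trans _ _ ((c ^+ 2 + 1) * (e / (c ^+ 2 + 1) * X + C))); first by rewrite ler_pM2l// hC.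
by rewrite mulrDr mulrA [_ * (e / _)]mulrC mulfVK// gt_eqF.
Qed.

Lemma smallD Z Z' : small Z -> small Z' -> small (fun n => Z n + Z' n).
Proof.
move=> s s' e e0; have e4 : 0 < e / 4 by rewrite divr_gt0.
have [C C0 hC] := s _ e4; have [C' C0' hC'] := s' _ e4.
exists (2 * C + 2 * C'); first by rewrite addr_ge0// mulr_ge0.
move=> L X hX N; have h1 := hC L X hX N; have h2 := hC' L X hX N.
apply: (@le_trans _ _ (zsum N (fun n => 2 * (T L n * Z n) ^+ 2 + 2 * (T L n * Z' n) ^+ 2))).
  apply: zsum_le => n; rewrite mulrDr; move: (T L n * Z n) (T L n * Z' n) => a b.
  by have := sqr_ge0 (a - b); lra.
rewrite zsumD !zsumZ; move: h1 h2; move: (zsum _ _) (zsum _ _) => a b; lra.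
Qed.

Lemma small0 : small (fun=> 0).
Proof.
move=> e e0; exists 0 => // L X hX N; apply: (@le_trans _ _ 0); last by rewrite addr0 mulr_ge0 ?(ltW e0)// (TA_ge0 hX).
by rewrite (eq_zsum _ (G := fun n => 0 * 0)) => [|n]; rewrite ?zsumZ ?mul0r// mulr0 expr0n.
Qed.

Lemma small_sum I (l : seq I) (Z : I -> int -> R) : (forall a : I, small (Z a)) -> small (fun n => \sum_(a <- l) Z a n).
Proof.
move=> h; elim: l => [|a l ih].
  by rewrite (_ : (fun n => _) = (fun=> 0)); [exact: small0|apply/funext => n; rewrite big_nil].
by rewrite (_ : (fun n => _) = (fun n => Z a n + \sum_(b <- l) Z b n)); [exact: smallD|apply/funext => n; rewrite big_cons].
Qed.

Lemma low_freq Z Y M L : zbound (fun n => Z n ^+ 2) Y -> zsum M (fun n => (T L n * Z n) ^+ 2) <= (M.+1%:R ^+ K) ^+ 2 * Y.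
Proof.
move=> hZ; apply: (@le_trans _ _ (zsum M (fun n => (M.+1%:R ^+ K) ^+ 2 * Z n ^+ 2))).
  apply: zsum_le_in => n nM; rewrite exprMn ler_wpM2r ?sqr_ge0//.
  rewrite ler_sqr ?nnegrE ?tweight_ge0 ?exprn_ge0//; apply: le_trans (tweight_le K L n) _.
  by rewrite lerXn2r ?nnegrE// ler_nat.
by rewrite zsumZ ler_wpM2l ?sqr_ge0.
Qed.

(** [sconv_small] applied to a weighted sequence, whose low frequencies cost only a constant. *)
Lemma small_sconv Z y Y Y' : (forall n, 0 <= Z n) -> (forall n, 0 <= y n) -> zbound (fun n => Z n ^+ 2) Y -> zbound (fun n => y n ^+ 2) Y' ->
  tame Z -> forall e : R, 0 < e -> exists2 C, 0 <= C & forall L X, zbound (fun n => (T L n * A n) ^+ 2) X ->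
  forall N, zbound (fun z => sconv N (fun n => T L n * Z n) y z ^+ 2) (e * X + C) /\
            zbound (fun z => sconv N y (fun n => T L n * Z n) z ^+ 2) (e * X + C).
Proof.
move=> Z0 y0 hZ hy [c [C [c0 C0 tZ]]] e e0.
have c1 : 0 < c + 1 by rewrite ltr_wpDl.
have e1 : 0 < e / (c + 1) by rewrite divr_gt0.
have [M [C' [C0' hQ]]] := sconv_small y0 hy e1.
pose D := e / (c + 1) * C + C' * ((M.+1%:R ^+ K) ^+ 2 * Y).
have Y0 : 0 <= Y by apply: zbound_ge0 hZ => n; exact: sqr_ge0.
have D0 : 0 <= D.
  by apply: addr_ge0; [exact: mulr_ge0 (ltW e1) C0|exact: mulr_ge0 C0' (mulr_ge0 (sqr_ge0 _) Y0)].
exists D => // L X hX N; have X00 := TA_ge0 hX.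
have TZ0 n : 0 <= T L n * Z n by rewrite mulr_ge0 ?tweight_ge0.
have main N' : zbound (fun z => sconv N' (fun n => T L n * Z n) y z ^+ 2) (e * X + D).
  move=> P; apply: le_trans (hQ N' _ _ TZ0 (tZ L X hX) P) _.
  rewrite /D mulrDr addrA; apply: lerD; last by rewrite ler_wpM2l// low_freq.
  rewrite lerD2r mulrA ler_wpM2r// mulrAC ler_pdivrMr// ler_wpM2l ?(ltW e0)// lerDl//.
by split=> // P; exact: sconv_sym.
Qed.

(** Quasi-additivity puts the weight on one of the two factors of the quadratic form. *)
Lemma small_of_sconv Z : (forall z, exists u : nat -> R, u N @[N --> \oo] --> Z z /\ forall N, `|u N| <= 2 * sconv N A A z) -> small Z.
Proof.
move=> /choice[u hu] e e0.
pose c : R := 8 * (2 ^+ K) ^+ 2.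
have c0 : 0 < c by rewrite mulr_gt0// !exprn_gt0.
have e2 : 0 < e / (2 * c) by rewrite divr_gt0// mulr_gt0.
have [C C0 hC] := small_sconv A0 A0 hA hA tame_A e2.
exists (2 * c * C); first by rewrite !mulr_ge0// ltW.
move=> L X hX; apply: (zbound_lim (u := fun N z => T L z * u z N)) => [z|N P].
  by apply: cvgM; [exact: cvg_cst|case: (hu z)].
have [h1 h2] := hC L X hX N.
apply: (@le_trans _ _ (zsum P (fun z => c * (sconv N (fun n => T L n * A n) A z ^+ 2 + sconv N A (fun n => T L n * A n) z ^+ 2)))).
  apply: zsum_le => z; set q1 := sconv _ _ _ _; set q2 := sconv _ _ _ _.
  have b : `|T L z * u z N| <= 2 * 2 ^+ K * (q1 + q2).
    rewrite normrM (ger0_norm (tweight_ge0 K L z)); have [_ hb] := hu z.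
    apply: (@le_trans _ _ (T L z * (2 * sconv N A A z))); first by rewrite ler_wpM2l ?tweight_ge0.
    rewrite mulrCA -mulrA ler_pM2l// /q1 /q2 -zsumD -!zsumZ; apply: zsum_le => k.
    apply: (@le_trans _ _ (2 ^+ K * (T L k + T L (z - k)) * (skernel k (z - k) * (A k * A (z - k))))).
      by rewrite ler_wpM2r ?tweight_sub// !mulr_ge0 ?skernel_ge0.
    by apply: le_of_eq; ring.
  rewrite -(real_normK (num_real (T L z * _))).
  apply: (@le_trans _ _ ((2 * 2 ^+ K * (q1 + q2)) ^+ 2)); first by rewrite ler_sqr ?nnegrE// (le_trans _ b).
  rewrite !exprMn /c; have := sqr_ge0 (q1 - q2); have : 0 <= (2 ^+ K) ^+ 2 :> R by exact: sqr_ge0.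
  move: ((2 ^+ K) ^+ 2) => p p0 h; have : 0 <= 4 * p * (q1 - q2) ^+ 2 by apply: mulr_ge0 => //; exact: mulr_ge0.
  by move=> {}h; rewrite -subr_ge0; move: h; congr (0 <= _); ring.
rewrite zsumZ zsumD; apply: (@le_trans _ _ (c * (e / (2 * c) * X + C + (e / (2 * c) * X + C)))).
  by rewrite ler_pM2l// lerD// ?h1 ?h2.
by apply: le_of_eq; field; rewrite gt_eqF.
Qed.

Lemma sqnp_mul_le w g : Bd w -> (forall x, `|w x| <= 1) -> L2p g -> sqnp (fun x => w x * g x) <= sqnp g.
Proof.
move=> bw w1 Lg; rewrite !sqnpE.
have := @sqn_le _ _ _ mu (fun x => w x * g x * q x) (fun x => g x * q x) 1 (L2p_bddM bw Lg) Lg.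
rewrite expr1n mul1r; apply => x; rewrite mul1r -mulrA normrM; exact: ler_piMl.
Qed.

(** [T (w g)] differs from [w (T g)] by a commutator that the smoothing form controls, and
    multiplication by [w] does not increase the norm. *)
Lemma small_mul w g : Bd w -> (forall x, `|w x| <= 1) -> L2p g -> (forall n, nu n * ampl w n <= A n) -> small (ampl g) ->
  small (ampl (fun x => w x * g x)).
Proof.
move=> bw w1 Lg hw sg_ e e0; have Lw := Bd_L2p bw; have Lwg := L2p_bddM bw Lg.
have [Ck Ck0 hk] := tweight_comm K.
pose c : R := 64 * (Ck ^+ 2 + 1).
have c0 : 0 < c by rewrite mulr_gt0// ltr_wpDl ?sqr_ge0.
have e1 : 0 < e / 8 by rewrite divr_gt0.
have e2 : 0 < e / (4 * c) by rewrite divr_gt0// mulr_gt0.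
have [C1 C10 h1] := sg_ _ e1.
have [C2 C20 h2] := small_sconv (ampl_ge0 g) A0 (ampl_zbound Lg) hA (small_tame sg_) e2.
have [C3 C30 h3] := small_sconv A0 (ampl_ge0 g) hA (ampl_zbound Lg) tame_A e2.
exists (4 * C1 + c * (C2 + C3)); first by apply: addr_ge0; [exact: mulr_ge0|exact: mulr_ge0 (ltW c0) (addr_ge0 C20 C30)].
move=> L X hX; have X00 := TA_ge0 hX.
have hY := h1 L X hX; set Y := e / 8 * X + C1 in hY.
have TT_ n : T L n ^+ 2 * coef2 g n <= (T L n * ampl g n) ^+ 2.
  rewrite exprMn ler_wpM2l ?sqr_ge0// /coef2 /ampl -(real_normK (num_real (al g n))) -(real_normK (num_real (be g n))).
  by rewrite sqrrD lerD2r lerDl mulrn_wge0// mulr_ge0.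
have [|n|M|G [LG aG bG _]] := @riesz_fischer R (fun n => T L n * al g n) (fun n => T L n * be g n) Y.
- by move=> n; rewrite tweightN alN.
- by rewrite tweightN (beN n Lg) mulrN.
- by apply: le_trans (hY M); apply: zsum_le => n; apply: le_trans (TT_ n); rewrite /coef2 mulrDr !exprMn.
have GY : sqnp G <= Y.
  apply: (cvg_le_cst (parseval LG)) => M; apply: le_trans (hY M); apply: zsum_le => n.
  by apply: le_trans (TT_ n); rewrite /coef2 aG bG mulrDr !exprMn.
have cG s n : coef s G n = T L n * coef s g n by case: s; [exact: bG|exact: aG].
(* The commutator, cut off at [N]. *)
pose r s N z := zsum N (fun k => (T L z - T L (z - k)) * cterm s w g k (z - k)).
have cr s z : r s N z @[N --> \oo] --> T L z * coef s (fun x => w x * g x) z - coef s (fun x => w x * G x) z.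
  have -> : r s ^~ z = (fun N => T L z * zsum N (fun k => cterm s w g k (z - k)) - zsum N (fun k => cterm s w G k (z - k))).
    apply/funext => N; rewrite -zsumZ -zsumB; apply: eq_zsum => k; rewrite mulrBl; congr (_ - _).
    by have := cG false (z - k); have := cG true (z - k); rewrite /cterm /coef; case: s => -> ->; ring.
  by apply: cvgB; [apply: cvgM; [exact: cvg_cst|exact: cvg_product]|exact: cvg_product].
pose B := e / (4 * c) * X + C2 + (e / (4 * c) * X + C3).
have rb s N : zbound (fun z => r s N z ^+ 2) (2 * (Ck ^+ 2 + 1) * B).
  move=> P; have [_ q2] := h2 L X hX N; have [q3 _] := h3 L X hX N.
  apply: (@le_trans _ _ (zsum P (fun z => 2 * (Ck ^+ 2 + 1) * (sconv N A (fun n => T L n * ampl g n) z ^+ 2 + sconv N (fun n => T L n * A n) (ampl g) z ^+ 2)))).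
    apply: zsum_le => z; set q1 := sconv _ _ _ _; set q4 := sconv _ _ _ _.
    have b : `|r s N z| <= Ck * (q1 + q4).
      apply: le_trans (zsum_norm _ _) _; rewrite /q1 /q4 -zsumD -zsumZ; apply: zsum_le => k.
      rewrite normrM; apply: (@le_trans _ _ (`|T L z - T L (z - k)| * (ampl w k * ampl g (z - k)))); first by rewrite ler_wpM2l// cterm_le.
      rewrite [leLHS]mulrA; apply: (@le_trans _ _ (Ck * (skernel k (z - k) * (nu k * ampl w k * (T L (z - k) + T L k))) * ampl g (z - k))).
        by rewrite ler_wpM2r ?ampl_ge0// hk// ampl_ge0.
      rewrite (_ : Ck * _ * _ = Ck * (skernel k (z - k) * (nu k * ampl w k * (T L (z - k) + T L k) * ampl g (z - k)))); last by ring.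
      rewrite ler_wpM2l// -mulrDr ler_wpM2l ?skernel_ge0//.
      apply: (@le_trans _ _ (A k * (T L (z - k) + T L k) * ampl g (z - k))).
        by rewrite ler_wpM2r ?ampl_ge0// ler_wpM2r ?addr_ge0 ?tweight_ge0.
      by apply: le_of_eq; ring.
    rewrite -(real_normK (num_real (r s N z))).
    apply: (@le_trans _ _ ((Ck * (q1 + q4)) ^+ 2)); first by rewrite ler_sqr ?nnegrE// (le_trans _ b).
    rewrite exprMn -mulrA [leRHS]mulrCA; apply: ler_pM; rewrite ?sqr_ge0//; first by rewrite lerDl.
    by have := sqr_ge0 (q1 - q4); lra.
  rewrite zsumZ zsumD ler_wpM2l ?mulr_ge0 ?addr_ge0 ?sqr_ge0//.
  by rewrite lerD ?q2 ?q3.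
have rl s : zbound (fun z => (T L z * coef s (fun x => w x * g x) z - coef s (fun x => w x * G x) z) ^+ 2) (2 * (Ck ^+ 2 + 1) * B).
  exact: zbound_lim (cr s) (rb s).
move=> P.
have hm : zsum P (coef2 (fun x => w x * G x)) <= Y.
  by apply: le_trans (bessel P (L2p_bddM bw LG)) _; apply: le_trans GY; exact: sqnp_mul_le.
apply: (@le_trans _ _ (zsum P (fun z => 4 * coef2 (fun x => w x * G x) z +
   (4 * (T L z * coef false (fun x => w x * g x) z - coef false (fun x => w x * G x) z) ^+ 2 +
    4 * (T L z * coef true (fun x => w x * g x) z - coef true (fun x => w x * G x) z) ^+ 2)))).
  apply: zsum_le => z; rewrite exprMn; apply: (@le_trans _ _ (T L z ^+ 2 * (2 * coef2 (fun x => w x * g x) z))).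
    by rewrite ler_wpM2l ?sqr_ge0// ampl_sqr.
  rewrite /coef2 /coef mulrCA mulrDr -!exprMn.
  move: (al _ _) (be _ _) (T L z * _) (T L z * _) => a1 b1 a2 b2.
  by have := sqr_ge0 (a1 - (b2 - a1)); have := sqr_ge0 (b1 - (a2 - b1)); lra.
pose D s z := (T L z * coef s (fun x => w x * g x) z - coef s (fun x => w x * G x) z) ^+ 2.
rewrite (zsumD P (fun z => 4 * coef2 (fun x => w x * G x) z) (fun z => 4 * D false z + 4 * D true z)).
rewrite (zsumD P (fun z => 4 * D false z) (fun z => 4 * D true z)) !zsumZ.
have k1 := rl false P; have k2 := rl true P.
apply: (@le_trans _ _ (4 * Y + (4 * (2 * (Ck ^+ 2 + 1) * B) + 4 * (2 * (Ck ^+ 2 + 1) * B)))).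
  by rewrite lerD ?ler_pM2l// lerD ?ler_pM2l.
have d0 : Ck ^+ 2 + 1 != 0 by rewrite gt_eqF// ltr_wpDl ?sqr_ge0.
rewrite (_ : 4 * (2 * (Ck ^+ 2 + 1) * B) + 4 * (2 * (Ck ^+ 2 + 1) * B) = 4^-1 * (c * B)); last by rewrite /c; field.
have -> : c * B = e / 2 * X + c * (C2 + C3) by rewrite /B; field; rewrite gt_eqF.
rewrite /Y; have : 0 <= c * (C2 + C3) by rewrite mulr_ge0 ?addr_ge0// ltW.
have : 0 <= e * X by rewrite mulr_ge0// ltW.
by rewrite ![e / _ * X]mulrAC; move: (c * _) (e * X) => u v; lra.
Qed.

(** With the fraction 1/2 the finite quantity [|T A|^2] is absorbed; the bound is uniform in the
    truncation height. *)
Lemma absorb : small A -> exists C, zbound (fun n => ((absz n).+1%:R ^+ K * A n) ^+ 2) C.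
Proof.
have h2 : 0 < 2^-1 :> R by rewrite invr_gt0.
move=> /(_ _ h2)[C C0 hC]; exists (2 * C) => M.
pose F n := (T M.+1 n * A n) ^+ 2.
have F0 n : 0 <= F n by exact: sqr_ge0.
have mono : {homo (fun N => zsum N F) : a b / (a <= b)%N >-> a <= b} by move=> a b ab; exact: zsum_mono.
have bF : zbound F ((M.+1%:R ^+ K) ^+ 2 * X0).
  move=> N; apply: (@le_trans _ _ (zsum N (fun n => (M.+1%:R ^+ K) ^+ 2 * A n ^+ 2))).
    by apply: zsum_le => n; rewrite /F exprMn ler_wpM2r ?sqr_ge0// ler_sqr ?nnegrE ?tweight_ge0 ?exprn_ge0// tweight_leL.
  by rewrite zsumZ ler_wpM2l ?sqr_ge0.
have cv : cvgn (fun N => zsum N F) by apply: nondecreasing_is_cvgn => //; eexists => _ [N _ <-]; exact: bF.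
have [l hl] : exists l : R, zsum N F @[N --> \oo] --> l by apply/cvg_ex.
have Fl N : zsum N F <= l by have := nondecreasing_cvgn_le mono cv N; rewrite (cvg_lim _ hl).
have : l <= 2^-1 * l + C by apply: (cvg_le_cst hl); exact: hC.
move=> ll; apply: (@le_trans _ _ (zsum M F)); last by apply: le_trans (Fl M) _; lra.
by apply: zsum_le_in => n nM; rewrite /F /tweight /atrunc (minn_idPl _)// ltnS.
Qed.

End Absorption.

(** * Rapid decay of the Fourier coefficients *)
Section RapidDecay.
Context {R : realType} {m : nat}.
Implicit Types (w : 'I_m -> R -> R) (K : nat) (n : int).

(** All the products in [decomposition] are small relative to their own sum [A], which is thus
    small relative to itself. *)
Lemma rapid_decay w : unit_map w ->
  (forall i j h, Bd h -> fin_energy h -> energy_form (w i) (fun x => w j x * h x) = energy_form (w j) (fun x => w i x * h x)) ->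
  forall i K, exists C, forall n, (absz n).+1%:R ^+ K * ampl (w i) n <= C.
Proof.
move=> uw comm i K; have [_ _ gw] := uw.
have [v hv] := choice (fun i => half_derivative (unit_Bd i uw) (gw i)).
have Lv j : L2p (v j) by case: (hv j).
have cv j s n : coef s (v j) n = nu n * coef s (w j) n by case: (hv j).
pose A := tot_ampl v.
have A0 n : 0 <= A n := tot_ampl_ge0 v n.
have szvE j n : ampl (v j) n = nu n * ampl (w j) n := ampl_v cv j n.
have hA : exists X0, zbound (fun n => A n ^+ 2) X0.
  pose P (Z : int -> R) := exists X, zbound (fun n => Z n ^+ 2) X.
  have PS (l : seq 'I_m) : P (fun n => \sum_(j <- l) ampl (v j) n).
    elim: l => [|a l [X ih]].
      exists 0 => N; rewrite (eq_zsum _ (G := fun n => 0 * 0)) ?zsumZ ?mul0r// => n.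
      by rewrite big_nil expr0n.
    exists (2 * (2 * sqnp (v a)) + 2 * X) => N.
    apply: (@le_trans _ _ (zsum N (fun n => 2 * ampl (v a) n ^+ 2 + 2 * (\sum_(j <- l) ampl (v j) n) ^+ 2))).
      apply: zsum_le => n; rewrite big_cons; set b := bigop _ _ _.
      by have := sqr_ge0 (ampl (v a) n - b); lra.
    by rewrite zsumD !zsumZ lerD// ler_pM2l//; exact: (ampl_zbound (Lv a)).
  exact: PS.
have [X0 {}hA] := hA.
have sm_cf (g : R -> R) : (forall s z, exists u : nat -> R, u N @[N --> \oo] --> coef s g z /\ forall N, `|u N| <= 2 * sconv N A A z) -> small K A (ampl g).
  move=> h; have sc s : small K A (fun n => `|coef s g n|).
    apply: (small_le (Z' := coef s g) (c := 1)); first by move=> n; rewrite normr_id mul1r.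
    exact: small_of_sconv A0 hA _ (h s).
  by apply: (small_le (Z' := fun n => `|coef false g n| + `|coef true g n|) (c := 1)); [move=> n; rewrite mul1r|exact: smallD].
have sU : small K A (ampl (radial w v)).
  apply: sm_cf => s z; have [u [h1 h2]] := U_bound uw Lv cv s z; exists u; split => // N.
  by apply: le_trans (h2 N) _; rewrite ler_peMl ?sconv_ge0// ler1n.
have sW a b : small K A (ampl (angular w v a b)).
  by apply: sm_cf => s z; exact: W_bound.
have wA a n : nu n * ampl (w a) n <= A n by rewrite -szvE; exact: ampl_tot_ampl.
have w1 a x : `|w a x| <= 1 by exact: unit_le1.
have sv a : small K A (ampl (v a)).
  apply: (small_le (Z' := fun n => ampl (fun x => w a x * radial w v x) n + \sum_(j <- index_enum 'I_m) ampl (fun x => w j x * angular w v j a x) n) (c := 1)).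
    move=> n; rewrite mul1r !ger0_norm ?addr_ge0 ?sumr_ge0 ?ampl_ge0// => [|j _]; last exact: ampl_ge0.
    have LU := L2p_bddM (unit_Bd a uw) (radial_L2p uw Lv).
    have LW j : L2p (fun x => w j x * angular w v j a x) := L2p_bddM (unit_Bd j uw) (angular_L2p uw Lv j a).
    have e s : coef s (v a) n = coef s (fun x => w a x * radial w v x) n + \sum_(j <- index_enum 'I_m) coef s (fun x => w j x * angular w v j a x) n.
      rewrite -coef_sum// -coefD//; last exact: L2p_sum.
      by congr (coef s _ n); apply/funext => x; exact: decomposition.
    rewrite /ampl; have := e false; have := e true; rewrite /coef => -> ->.
    rewrite big_split /= addrACA; apply: lerD.
      by apply: le_trans (ler_normD _ _) _; rewrite lerD2l; exact: ler_norm_sum.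
    by apply: le_trans (ler_normD _ _) _; rewrite lerD2l; exact: ler_norm_sum.
  apply: smallD; first exact: (small_mul A0 hA (unit_Bd a uw) (w1 a) (radial_L2p uw Lv) (wA a) sU).
  apply: small_sum => j; exact: (small_mul A0 hA (unit_Bd j uw) (w1 j) (angular_L2p uw Lv j a) (wA j) (sW j a)).
(* [A] is a finite sum of the amplitudes of the [v j]. *)
have sA : small K A A by apply: small_sum => j; exact: sv.
have [C hC] := absorb hA sA.
exists (1 + C + (1 + 2 * sqnp (w i))) => n.
have Lw := Bd_L2p (unit_Bd i uw).
have C0 : 0 <= C by apply: zbound_ge0 hC => k; exact: sqr_ge0.
have p0 : 0 <= sqnp (w i) := sqnp_ge0 _.
have [->|n0] := eqVneq n 0.
  by rewrite absz0 expr1n mul1r; apply: le_trans (ampl_bounded 0 Lw) _; lra.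
have nu1 : 1 <= nu n :> R by rewrite -sqrtr1 ler_sqrt// ler1n absz_gt0.
have h : (absz n).+1%:R ^+ K * ampl (w i) n <= (absz n).+1%:R ^+ K * A n.
  rewrite ler_wpM2l ?exprn_ge0//; apply: le_trans (wA i n); by rewrite ler_peMl ?ampl_ge0.
have h2 : ((absz n).+1%:R ^+ K * A n) ^+ 2 <= C.
  apply: le_trans (hC (absz n)).
  have -> : ((absz n).+1%:R ^+ K * A n) ^+ 2 = zsum `|n|%N (fun k => ((absz k).+1%:R ^+ K * A k) ^+ 2 * (n == k)%:R) by rewrite zsum_delta leqnn.
  by apply: zsum_le => k; case: (n == k); rewrite ?mulr1 ?mulr0 ?sqr_ge0.
move: h h2; move: (_ * A n) => y h h2; have := sqr_ge0 (y - 1); lra.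
Qed.

End RapidDecay.

(** * Smoothness of rapidly converging series *)
Section SmoothSeries.
Context {R : realType}.
Notation mu := (leb R).
Implicit Types (a b : int -> R) (N M K : nat) (n : int) (x t : R).

Definition rapid a := forall K, exists C, forall n, (absz n).+1%:R ^+ K * `|a n| <= C.

Lemma rapidN a : rapid a -> rapid (fun n => - a n).
Proof. by move=> h K; have [C hC] := h K; exists C => n; rewrite normrN. Qed.

Lemma rapid_mul a : rapid a -> rapid (fun n => n%:~R * a n).
Proof.
move=> h K; have [C hC] := h K.+1; exists C => n; apply: le_trans (hC n).
rewrite normrM exprSr -mulrA ler_wpM2l ?exprn_ge0// ler_wpM2r//.
by rewrite -intr_norm -natr_absz ler_nat.
Qed.

Lemma zsum_inv_sqr N : zsum N (fun n => ((absz n).+1%:R ^+ 2)^-1) <= 3 - 2 / N.+1%:R :> R.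
Proof.
elim: N => [|N ih]; first by rewrite /zsum big_nil addr0 absz0 expr1n invr1; lra.
rewrite zsumS abszN absz_nat.
have h : (N.+2%:R ^+ 2)^-1 <= N.+1%:R^-1 - N.+2%:R^-1 :> R.
  have a0 : 0 < N.+1%:R :> R by []. have e : N.+2%:R = N.+1%:R + 1 :> R by rewrite -[N.+2%:R]natr1.
  rewrite e; move: (N.+1%:R : R) a0 => y y0.
  have -> : y^-1 - (y + 1)^-1 = (y * (y + 1))^-1 by field; rewrite !gt_eqF// addr_gt0.
  rewrite lef_pV2 ?posrE ?exprn_gt0 ?mulr_gt0 ?addr_gt0//; nra.
move: ih h; move: (_ ^-1) (N.+1%:R^-1) (N.+2%:R^-1) (zsum _ _) => p q r s; lra.
Qed.

Lemma summable_le a C : (forall n, (absz n).+1%:R ^+ 2 * `|a n| <= C) -> forall N, zsum N (fun n => `|a n|) <= 3 * C.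
Proof.
move=> h N; have C0 : 0 <= C := le_trans (mulr_ge0 (exprn_ge0 _ (ler0n _ _)) (normr_ge0 _)) (h 0).
apply: (@le_trans _ _ (zsum N (fun n => C * ((absz n).+1%:R ^+ 2)^-1))).
  by apply: zsum_le => n; rewrite ler_pdivlMr ?exprn_gt0// mulrC.
rewrite zsumZ mulrC ler_wpM2r//; apply: le_trans (zsum_inv_sqr N) _.
by rewrite lerBlDr lerDl divr_ge0.
Qed.

Lemma zsum_cvg a B : (forall N, zsum N (fun n => `|a n|) <= B) -> cvgn (fun N => zsum N a).
Proof.
move=> h; have pos (F : int -> R) : (forall n, 0 <= F n) -> (forall N, zsum N F <= 2 * B) -> cvgn (fun N => zsum N F).
  move=> F0 hF; apply: nondecreasing_is_cvgn; first by move=> M N MN; exact: zsum_mono.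
  by exists (2 * B) => _ [N _ <-].
have n0 (n : int) := normr_ge0 (a n).
have B0 : 0 <= B by apply: le_trans (h 0%N); exact: zsum_ge0.
have c1 : cvgn (fun N => zsum N (fun n => a n + `|a n|)).
  apply: pos => [n|N]; first by have := ler_norm (- a n); rewrite normrN; lra.
  rewrite zsumD; have := h N; have : zsum N a <= zsum N (fun n => `|a n|) by apply: zsum_le => n; exact: ler_norm.
  lra.
have c2 : cvgn (fun N => zsum N (fun n => `|a n|)) by apply: pos => // N; have := h N; lra.
have -> : (fun N => zsum N a) = (fun N => zsum N (fun n => a n + `|a n|) - zsum N (fun n => `|a n|)).
  by apply/funext => N; rewrite zsumD addrK.
exact: is_cvgB.
Qed.

Definition trig_term a b (t : R) n : R := a n * cos (n%:~R * t) + b n * sin (n%:~R * t).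
Definition trig_series a b (t : R) : R := limn (fun N => zsum N (trig_term a b t)).

Lemma trig_term_le a b t n : `|trig_term a b t n| <= `|a n| + `|b n|.
Proof.
by apply: le_trans (ler_normD _ _) _; rewrite !normrM lerD// ler_piMr// ?cos_norm1 ?sin_norm1.
Qed.

Lemma rapid_bound a b K : rapid a -> rapid b -> exists C, forall n, (absz n).+1%:R ^+ K * (`|a n| + `|b n|) <= C.
Proof.
by move=> /(_ K)[C hC] /(_ K)[D hD]; exists (C + D) => n; rewrite mulrDr lerD.
Qed.

Lemma trig_series_cvg a b t : rapid a -> rapid b -> zsum N (trig_term a b t) @[N --> \oo] --> trig_series a b t.
Proof.
move=> ra rb; have [C hC] := rapid_bound 2 ra rb.
apply: (@zsum_cvg _ (3 * C)); apply: summable_le => n; apply: le_trans (hC n).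
by rewrite ler_wpM2l ?exprn_ge0// trig_term_le.
Qed.

(** Termwise derivation with a quadratic remainder, summable because [n^2 (|a n| + |b n|)] is. *)
Lemma dv_trig_series a b : rapid a -> rapid b -> dv (trig_series a b) (trig_series (fun n => n%:~R * b n) (fun n => - (n%:~R * a n))).
Proof.
move=> ra rb t; have ra' := rapidN (rapid_mul ra); have rb' := rapid_mul rb.
have [C hC] := rapid_bound 4 ra rb.
have [E hE] : exists E, forall N, zsum N (fun n => n%:~R ^+ 2 * (`|a n| + `|b n|)) <= E.
  exists (3 * C) => N; pose F n : R := n%:~R ^+ 2 * (`|a n| + `|b n|).
  have F0 n : `|F n| = F n by rewrite ger0_norm// mulr_ge0 ?sqr_ge0 ?addr_ge0.
  rewrite -(eq_zsum N (F := fun n => `|F n|) F0); apply: summable_le => n.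
  rewrite F0 /F; apply: le_trans (hC n).
  rewrite mulrA ler_wpM2r ?addr_ge0// (exprD _ 2 2) ler_wpM2l ?exprn_ge0//.
  by rewrite -(real_normK (num_real n%:~R)) lerXn2r ?nnegrE// -intr_norm -natr_absz ler_nat.
apply: (is_derive_quadratic (C := E)) => h.
apply: (cvg_le_cst (u := fun N => `|zsum N (trig_term a b (t + h)) - zsum N (trig_term a b t) -
    zsum N (trig_term (fun n => n%:~R * b n) (fun n => - (n%:~R * a n)) t) * h|)).
  by apply: cvg_norm; apply: cvgB; [apply: cvgB; exact: trig_series_cvg|apply: cvgM; [exact: trig_series_cvg|exact: cvg_cst]].
move=> N; rewrite [leRHS]mulrC [zsum _ _ * h]mulrC -zsumZ -!zsumB; apply: le_trans (zsum_norm _ _) _.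
apply: le_trans (ler_wpM2l (sqr_ge0 h) (hE N)); rewrite -zsumZ; apply: zsum_le => n.
have [h1 h2] := trig_taylor (n%:~R * t) (n%:~R * h).
have -> : trig_term a b (t + h) n - trig_term a b t n - h * trig_term (fun n => n%:~R * b n) (fun n => - (n%:~R * a n)) t n =
  a n * (cos (n%:~R * t + n%:~R * h) - cos (n%:~R * t) + n%:~R * h * sin (n%:~R * t)) +
  b n * (sin (n%:~R * t + n%:~R * h) - sin (n%:~R * t) - n%:~R * h * cos (n%:~R * t)).
  by rewrite /trig_term mulrDr; ring.
apply: le_trans (ler_normD _ _) _; rewrite !normrM.
have -> : h ^+ 2 * (n%:~R ^+ 2 * (`|a n| + `|b n|)) = `|a n| * (n%:~R * h) ^+ 2 + `|b n| * (n%:~R * h) ^+ 2 by ring.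
by rewrite lerD// ler_wpM2l.
Qed.

(** The derivatives stay in the algebra generated by [x], [p] and such series. *)
Lemma trig_series_smooth a b : rapid a -> rapid b -> smooth (fun x => trig_series a b (th x)).
Proof.
move=> ra rb.
pose G f := [\/ f = (fun x => x), f = @p R | exists a b, [/\ rapid a, rapid b & f = (fun x => trig_series a b (th x))]].
apply: (@alg_smooth _ G); last by apply: alg_gen; apply: Or33; exists a, b.
have gx : alg G (fun x => x) by apply: alg_gen; exact: Or31.
have gp : alg G (@p R) by apply: alg_gen; exact: Or32.
move=> f [->|->|[c [d [rc rd ->]]]].
- by exists (fun=> 1); split; [exact: dv_id|exact: alg_cst].
- exists (fun x => - (2 * pi) * (x * (p x * p x))); split; first exact: dv_p.
  exact: alg_mul (alg_cst G (- (2 * pi))) (alg_mul gx (alg_mul gp gp)).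
- exists (fun x => 2 * pi * p x * trig_series (fun n => n%:~R * d n) (fun n => - (n%:~R * c n)) (th x)); split.
    exact: dv_comp (dv_trig_series rc rd) (@dv_th R).
  apply: alg_mul; first exact: alg_mul (alg_cst G (2 * pi)) gp.
  by apply: alg_gen; apply: Or33; exists (fun n => n%:~R * d n), (fun n => - (n%:~R * c n)); split; [exact: rapid_mul|exact/rapidN/rapid_mul|].
Qed.

(** A subsequence of the partial sums converges to [f] almost everywhere, while the whole series
    converges to a smooth function. *)
Lemma smooth_representative (f : R -> R) : L2p f -> (forall K, exists C, forall n, (absz n).+1%:R ^+ K * ampl f n <= C) ->
  exists2 v, smooth v & {ae mu, forall x, f x = v x}.
Proof.
move=> Lf h.
have ra : rapid (al f).
  by move=> K; have [C hC] := h K; exists C => n; apply: le_trans (hC n); rewrite ler_wpM2l ?exprn_ge0// lerDl.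
have rb : rapid (be f).
  by move=> K; have [C hC] := h K; exists C => n; apply: le_trans (hC n); rewrite ler_wpM2l ?exprn_ge0// lerDr.
exists (fun x => trig_series (al f) (be f) (th x)); first exact: trig_series_smooth.
have [s sinf hs] := sqnp_ae_subseq (fun N => Bd_L2p (Sm_Bd N f)) Lf (cvg_Sm Lf).
apply: ae_imp hs => x hx; apply: (cvg_uniq hx).
have H : Sm N f x @[N --> \oo] --> trig_series (al f) (be f) (th x) := trig_series_cvg ra rb.
exact: (cvg_comp _ _ sinf H).
Qed.

End SmoothSeries.

(** * Local Sobolev regularity of smooth functions *)
Section LocalSobolev.
Context {R : realType}.
Notation mu := (leb R).
Implicit Types (phi f : R -> R) (K : nat) (xi : R).

Definition sinint phi xi : R := ii mu (fun y => phi y * sin ((0 - y) * xi)).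

(** The sine transform reduces to a cosine transform of the derivative, whose decay is already
    known. *)
Lemma sinint_cosint phi xi : schwartz phi -> sinint phi xi = - cosint (derive1 phi) 0 xi * xi^-1.
Proof.
move=> sp; have s1 := schwartz_derive1 sp.
have [->|x0] := eqVneq xi 0.
  by rewrite invr0 mulr0 /sinint -[RHS](ii0 mu); apply: eq_ii => y; rewrite mulr0 sin0 mulr0.
have d1 := smooth_dv sp.1.
have da : dv (fun y : R => (0 - y) * xi) (fun y => (0 - 1) * xi + (0 - y) * 0) := dvM (dvB (dv_cst 0) dv_id) (dv_cst xi).
have dc := dv_comp (@dv_cos R) da; have ds := dv_comp (@dv_sin R) da.
have h : ii mu (fun y => derive1 phi y * cos ((0 - y) * xi) + xi * (phi y * sin ((0 - y) * xi))) = 0.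
  have [A hA] := schwartz_p 0 sp.
  apply: (ii_deriv0 (G := fun y => phi y * cos ((0 - y) * xi)) (C := A)).
  - move=> y; apply: cvgD; first by apply: cvgM; [exact: smooth_cont s1.1 y|exact: dv_cont dc y].
    by apply: cvgM; [exact: cvg_cst|apply: cvgM; [exact: smooth_cont sp.1 y|exact: dv_cont ds y]].
  - by apply: dv_ext (dvM d1 dc) => y //; ring.
  - by apply: intgD; [exact: cosint_intg|apply: intgZ; exact: sinint_intg].
  - by move=> y; rewrite normrM (le_trans _ (hA y))// ler_piMr ?cos_norm1.
move: h; rewrite iiD; [|exact: cosint_intg|by apply: intgZ; exact: sinint_intg].
rewrite iiZ; last exact: sinint_intg.
rewrite -/(cosint (derive1 phi) 0 xi) -/(sinint phi xi) => h.
apply: (mulIf x0); rewrite mulfVK//; move: h; move: (cosint _ _ _) (sinint _ _) => c d; lra.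
Qed.

(** Each pair of integrations by parts gains a power of [1 + xi^2]. *)
Lemma C_decay K : forall phi, schwartz phi -> exists B, forall xi, `|cosint phi 0 xi| * (1 + xi ^+ 2) ^+ K <= B.
Proof.
elim: K => [|K ih] phi sp.
  exists (ii mu (fun y => `|phi y|)) => xi; rewrite expr0 mulr1.
  apply: norm_ii_le; [exact: intg_meas (cosint_intg 0 xi sp)|move=> y|exact: intg_norm (schwartz_intg sp)].
  by rewrite normrM ler_piMr ?cos_norm1.
have [B hB] := ih _ sp; have [B' hB'] := ih _ (schwartz_derive1 (schwartz_derive1 sp)).
exists (B + B') => xi; have {}hB := hB xi; have {}hB' := hB' xi; rewrite (cosint_ibp _ _ sp) normrM normrN (ger0_norm (sqr_ge0 xi)) in hB'.
rewrite exprS (_ : _ * _ = `|cosint phi 0 xi| * (1 + xi ^+ 2) ^+ K + xi ^+ 2 * `|cosint phi 0 xi| * (1 + xi ^+ 2) ^+ K); last by ring.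
exact: lerD.
Qed.

(** For [|xi| < 1], where [sinint_cosint] is of no use, the trivial bound suffices. *)
Lemma S_decay K phi : schwartz phi -> exists B, forall xi, `|sinint phi xi| * (1 + xi ^+ 2) ^+ K <= B.
Proof.
move=> sp; have [B hB] := C_decay K (schwartz_derive1 sp).
pose M := ii mu (fun y => `|phi y|).
have M0 : 0 <= M by apply: ii_ge0.
have B0 : 0 <= B.
  by apply: le_trans (hB 0); rewrite mulr_ge0// exprn_ge0// addr_ge0 ?sqr_ge0.
have p0 xi : 0 <= (1 + xi ^+ 2) ^+ K by rewrite exprn_ge0// addr_ge0 ?sqr_ge0.
exists (B + M * 2 ^+ K) => xi; have [x1|x1] := leP 1 `|xi|.
  apply: (@le_trans _ _ B); last by rewrite lerDl mulr_ge0// exprn_ge0.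
  apply: le_trans (hB xi); rewrite ler_wpM2r// (sinint_cosint _ sp) normrM normrN normfV ler_piMr// invf_le1//.
  exact: lt_le_trans x1.
apply: (@le_trans _ _ (M * 2 ^+ K)); last by rewrite lerDr.
apply: ler_pM => //.
  apply: norm_ii_le; [exact: intg_meas (sinint_intg 0 xi sp)|move=> y|exact: intg_norm (schwartz_intg sp)].
  by rewrite normrM ler_piMr ?sin_norm1.
rewrite lerXn2r ?nnegrE ?addr_ge0 ?sqr_ge0//.
have : `|xi| ^+ 2 <= 1 by rewrite expr_le1// ltW.
rewrite real_normK ?num_real//; lra.
Qed.

Lemma sinint_meas phi : schwartz phi -> measurable_fun setT (sinint phi).
Proof.
move=> sp; rewrite (_ : sinint phi = (fun xi => (-1 * cosint (derive1 phi) 0 xi) * xi^-1)); last first.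
  by apply/funext => xi; rewrite sinint_cosint// mulN1r.
apply: measurable_funM; last exact: measurable_invr.
apply: measurable_funM => //; exact: cosint_meas (schwartz_derive1 sp).
Qed.

Lemma fourier_ae f phi xi : schwartz phi -> measurable_fun setT f -> {ae mu, forall x, f x = phi x} ->
  fourier f xi = (cosint phi 0 xi +i* sinint phi xi)%C.
Proof.
move=> sp mf ae; rewrite /fourier /cintegral; congr (_ +i* _)%C.
- transitivity (ii mu (fun x => f x * cos ((0 - x) * xi))).
    by apply: eq_ii => x /=; rewrite mul0r subr0 sub0r mulNr.
  apply: ae_eq_ii; [exact: measurable_funM mf (cosl_meas 0 xi)|exact: intg_meas (cosint_intg 0 xi sp)|].
  by apply: ae_imp ae => x ->.
- transitivity (ii mu (fun x => f x * sin ((0 - x) * xi))).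
    by apply: eq_ii => x /=; rewrite mul0r addr0 sub0r mulNr.
  apply: ae_eq_ii; [exact: measurable_funM mf (sinl_meas 0 xi)|exact: intg_meas (sinint_intg 0 xi sp)|].
  by apply: ae_imp ae => x ->.
Qed.

Lemma sobolev_finite s f phi : schwartz phi -> measurable_fun setT f -> {ae mu, forall x, f x = phi x} ->
  (\int[mu]_(xi in setT) ((1 + xi ^+ 2) `^ s * ComplexField.Normc.normc (fourier f xi) ^+ 2)%:E < +oo)%E.
Proof.
move=> sp mf ae; pose K := (Num.bound s).+1.
have sK : s <= K%:R.
  apply: (@le_trans _ _ (Num.bound s)%:R); last by rewrite ler_nat.
  have [s0|s0] := leP 0 s; first by apply: ltW; exact: archi_boundP.
  by apply: (@le_trans _ _ 0) => //; exact: ltW.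
pose h xi := (1 + xi ^+ 2) `^ s * (cosint phi 0 xi ^+ 2 + sinint phi xi ^+ 2).
have E xi : (1 + xi ^+ 2) `^ s * ComplexField.Normc.normc (fourier f xi) ^+ 2 = h xi.
  by rewrite (fourier_ae xi sp mf ae) /= sqr_sqrtr// addr_ge0 ?sqr_ge0.
have [B hB] := C_decay K sp; have [B' hB'] := S_decay K sp.
have h0 xi : 0 <= h xi by rewrite mulr_ge0 ?powR_ge0// addr_ge0 ?sqr_ge0.
have I : intg mu h.
  apply: (@intg_le _ _ _ mu _ (fun xi => ((B ^+ 2 + B' ^+ 2) * pi) * p xi)).
  - apply: measurable_funM.
      apply: (measurableT_comp (f := @powR R ^~ s)); first exact: measurable_powR.
      by apply: cont_meas; exact: dv_cont (@dv_sqr1 R).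
    apply: measurable_funD; apply: measurable_funX; [exact: cosint_meas|exact: sinint_meas].
  - move=> xi; rewrite ger0_norm//.
    have x1 : 1 <= 1 + xi ^+ 2 by rewrite lerDl sqr_ge0.
    have x0 := sqr1_gt0 xi.
    rewrite /p invfM mulrA mulfK ?pi_neq0// ler_pdivlMr//.
    have hs : (1 + xi ^+ 2) `^ s <= (1 + xi ^+ 2) ^+ K by have := ler_powR x1 sK; rewrite [X in _ <= X]powR_mulrn// ltW.
    have K1 : (1 + xi ^+ 2) ^+ K * (1 + xi ^+ 2) <= ((1 + xi ^+ 2) ^+ K) ^+ 2.
      rewrite [leRHS]expr2; apply: ler_wpM2l; first exact/exprn_ge0/ltW.
      by rewrite [leRHS]exprS; apply: ler_peMr; [exact: ltW|exact: exprn_ege1].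
    apply: (@le_trans _ _ (((1 + xi ^+ 2) ^+ K) ^+ 2 * (cosint phi 0 xi ^+ 2 + sinint phi xi ^+ 2))).
      rewrite /h mulrAC ler_wpM2r ?addr_ge0 ?sqr_ge0//; apply: le_trans K1.
      by rewrite ler_wpM2r// ltW.
    have sq (c b : R) : `|c| * (1 + xi ^+ 2) ^+ K <= b -> ((1 + xi ^+ 2) ^+ K) ^+ 2 * c ^+ 2 <= b ^+ 2.
      have : 0 <= (1 + xi ^+ 2) ^+ K by exact/exprn_ge0/ltW.
      move: (_ ^+ K) => y y0 cb; have cy : 0 <= `|c| * y by rewrite mulr_ge0.
      by rewrite -(real_normK (num_real c)) mulrC -exprMn ler_sqr ?nnegrE// (le_trans cy).
    by rewrite mulrDr lerD ?sq.
  - by apply: intgZ; exact: intg_p.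
case/integrableP: I => _; apply: le_lt_trans; apply: le_of_eq.
by apply: eq_integral => xi _ /=; rewrite E ger0_norm.
Qed.

Lemma Hs_loc_smooth s f v : measurable_fun setT f -> (exists2 w, {ae mu, forall x, f x = w x} & Bd w) ->
  smooth v -> {ae mu, forall x, f x = v x} -> Hs_loc_scalar s f.
Proof.
move=> mf [w fw [mw [B hB]]] sv ae; split.
  split => //; first exact: openT.
  move=> D _ cD; have mD := compact_measurable cD.
  have e : (\int[mu]_(x in D) `|f x|%:E = \int[mu]_(x in D) `|w x|%:E)%E.
    apply: ae_eq_integral => //.
    - by apply/measurable_EFinP; apply: measurableT_comp => //; exact: measurable_funS mf.
    - by apply/measurable_EFinP; apply: measurableT_comp => //; exact: measurable_funS mw.
    - by apply: ae_imp fw => x -> _.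
  rewrite e; apply: (@le_lt_trans _ _ (\int[mu]_(x in D) B%:E)%E).
    apply: ge0_le_integral => //.
    - by apply/measurable_EFinP; apply: measurableT_comp => //; exact: measurable_funS mw.
    - by move=> x _; rewrite lee_fin (le_trans _ (hB x)).
  rewrite integral_cst//; apply: lte_mul_pinfty => //; first by rewrite lee_fin (le_trans _ (hB 0)).
  exact: compact_finite_measure.
move=> chi tc; have [sc _] := tc; have [A A0 hA] := test_supp tc.
have tcv : test_function (fun x => chi x * v x).
  apply: (@test_of_supp _ _ A); first exact: smoothM.
  by move=> x Ax; rewrite (hA 0%N x Ax : chi x = 0) mul0r.
apply: (sobolev_finite s (test_schwartz tcv)).
- by apply: measurable_funM => //; case: (test_Bd tc).
- by apply: ae_imp ae => x; rewrite /= => ->.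
Qed.

End LocalSobolev.

(** * Regularity of half-harmonic maps *)
Section AlmostEverywhere.
Context {R : realType}.
Notation mu := (leb R).

Lemma ae_imp2 (P Q S : R -> Prop) : (forall x, P x -> Q x -> S x) ->
  {ae mu, forall x, P x} -> {ae mu, forall x, Q x} -> {ae mu, forall x, S x}.
Proof. by move=> h p q; apply: (@filterS2 _ _ (ae_filter_ringOfSetsType mu) _ _ _ h p q). Qed.

Lemma ae_all_fin m (P : 'I_m -> R -> Prop) :
  (forall i, {ae mu, forall x, P i x}) -> {ae mu, forall x, forall i, P i x}.
Proof.
move=> h; have H (l : seq 'I_m) : {ae mu, forall x, forall i, i \in l -> P i x}.
  elim: l => [|a l ih]; first by apply: aeW.
  apply: ae_imp2 (h a) ih => x pa ih i; rewrite inE => /orP[/eqP ->//|]; exact: ih.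
by apply: ae_imp (H (index_enum 'I_m)) => x hx i; apply: hx; rewrite mem_index_enum.
Qed.

End AlmostEverywhere.

Theorem theorem1p6 (R : realType) (m : nat) (u : R -> 'rV[R]_m) :
  (1 <= m)%N -> Hhalf_sphere u -> weak_half_harmonic u ->
  (forall s : R, Hs_loc_sphere s u) /\ ae_smooth u.
Proof.
move=> m1 hu wu; have [w [uw uw_ae comm]] := harmonic_EL m1 hu wu.
have bw i := unit_Bd i uw.
have mu_ i : measurable_fun setT (coord u i) by have [g hg] := hu.1 i; exact: quarter_laplacian_meas hg.
have ex i : exists vi : R -> R, smooth vi /\ {ae lebesgue_measure, forall x, w i x = vi x}.
  by have [vi sv ae] := smooth_representative (Bd_L2p (bw i)) (rapid_decay uw comm i); exists vi.
have [v hv] := choice ex.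
have uwi i : {ae lebesgue_measure, forall x, coord u i x = w i x}.
  by apply: ae_imp uw_ae => x; exact.
have uv i : {ae lebesgue_measure, forall x, coord u i x = v i x}.
  by apply: ae_imp2 (uwi i) (hv i).2 => x -> ->.
split.
  move=> s; split; last by case: hu.
  by move=> i; apply: (Hs_loc_smooth s (mu_ i) _ (hv i).1 (uv i)); exists (w i).
exists (fun x => \row_i v i x); split.
  move=> i; rewrite (_ : coord _ i = v i); first exact: (hv i).1.
  by apply/funext => x; rewrite /coord mxE.
apply: ae_imp (ae_all_fin uv) => x hx.
by apply/rowP => i; rewrite mxE -hx.
Qed.
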